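(* Let $k$ be a positive integer. Let $Z=(Z^+,Z^-)$, $Z^{\pm}=(X^{\pm},Y^{\pm})$, be a planar Filippov system with switching line $\Sigma=\{y=0\}$ and $Z^{\pm}$ analytic near the origin. Assume that $Z$ has a $(2k,2k)$-monodromic tangential singularity at the origin with non-vanishing second Lyapunov coefficient $V_2$, and let $\delta=\mathrm{sign}(X^+(0,0))$. Then, given $\lambda>0$ and a neighborhood $U\subset\mathbb{R}^2$ of $(0,0)$, there exist polynomials $P^+$ and $P^-$ in one variable, with degree $2k-2$ and norm less than $\lambda$, and a neighborhood $I\subset\mathbb{R}$ of $0$ such that, for every $b\in I$ satisfying $\mathrm{sign}(b)=-\mathrm{sign}(\delta V_2)$, the Filippov system $$\widetilde Z_b(x,y)=\begin{cases}\widetilde Z^+(x-b,y), & y>0,\\ \widetilde Z^-(x,y), & y<0,\end{cases}\qquad \widetilde Z^{\pm}(x,y)=\begin{pmatrix}X^{\pm}(x,y)\\ Y^{\pm}(x,y)+X^{\pm}(x,y)P^{\pm}(x)\end{pmatrix},$$ has $k$ hyperbolic limit cycles inside $U$ such that each one of these limit cycles surrounds a single sliding segment. In addition, these hyperbolic limit cycles are stable if $V_2<0$ and unstable if $V_2>0$.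
   Context: **Filippov system.** A planar piecewise smooth vector field $Z(x,y)=Z^+(x,y)=(X^+(x,y),Y^+(x,y))$ for $y>0$ and $Z(x,y)=Z^-(x,y)=(X^-(x,y),Y^-(x,y))$ for $y<0$, with $Z^{\pm}$ analytic on an open neighborhood of the origin in $\mathbb{R}^2$, and trajectories defined by Filippov's convention. The switching line is $\Sigma=\{(x,y)\in\mathbb{R}^2: y=0\}$. At points of $\Sigma$ where $Y^+Y^->0$ (crossing region) trajectories of $Z^+$ and $Z^-$ are concatenated. Points of $\Sigma$ where $Y^+Y^-<0$ form the sliding region (attracting or repelling); a sliding segment is a maximal open interval of $\Sigma$ contained in the sliding region. **Monodromic tangential singularity.** For positive integers $k^+,k^-$, $Z$ has a $(2k^+,2k^-)$-monodromic tangential singularity at the origin if: (C1) $X^{\pm}(0,0)\neq 0$, $Y^{\pm}(0,0)=0$, $\frac{\partial^i Y^{\pm}}{\partial x^i}(0,0)=0$ for $i\in\{1,\ldots,2k^{\pm}-2\}$, and $\frac{\partial^{2k^{\pm}-1}Y^{\pm}}{\partial x^{2k^{\pm}-1}}(0,0)\neq 0$; (C2) $X^+(0,0)\frac{\partial^{2k^+-1}Y^+}{\partial x^{2k^+-1}}(0,0)<0$ and $X^-(0,0)\frac{\partial^{2k^--1}Y^-}{\partial x^{2k^--1}}(0,0)>0$; (C3) $X^+(0,0)X^-(0,0)<0$. **Lyapunov coefficients.** Under (C1)-(C3), for $x\ne0$ near $0$ the trajectory of $Z^{+}$ (resp. $Z^-$) through $(x,0)$, followed in $\{y\ge 0\}$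 (resp. $\{y\le 0\}$) forward or backward in time as appropriate, returns to $\Sigma$ at a nearby point $(\varphi^{+}(x),0)$ (resp. $(\varphi^-(x),0)$) on the other side of the origin. With $\varphi^{\pm}(0)=0$, the half-return maps $\varphi^{\pm}$ are analytic involutions near $0$. With $\delta=\mathrm{sign}(X^+(0,0))=-\mathrm{sign}(X^-(0,0))$, the displacement function is $\Delta(x)=\delta(\varphi^+(x)-\varphi^-(x))$ and the Lyapunov coefficients $V_i$ are defined by $\Delta(x)=\sum_{i\ge1}V_ix^i$. **Limit cycles.** A limit cycle here is an isolated periodic orbit of the Filippov system crossing $\Sigma$ in the crossing region. It is hyperbolic if the derivative of the first-return map on $\Sigma$ at the corresponding fixed point is different from $1$ in absolute value (equivalently, it corresponds to a simple zero of the displacement function). ''Stable'' means asymptotically stable, and ''unstable'' means repelling. **Polynomials.** The norm of a polynomial is the norm of the vector of its coefficients. ''Degree $2k-2$'' means of the form $\sum_{j\le 2k-2}c_jx^j$ (some coefficients may vanish). *)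

(* Defs.v *)
(* Stdlib reals with Coquelicot. *)
From Stdlib Require Import Reals List.
From Coquelicot Require Import Coquelicot.
Open Scope R_scope.

(** * Analytic planar vector fields *)

(* Real-analyticity at (x0, y0): near (x0, y0), [F] is the sum of an absolutely
   convergent double power series, whose terms are grouped by total degree. *)
Definition analytic2_at (F : R -> R -> R) (x0 y0 : R) : Prop :=
  exists (a : nat -> nat -> R) (r : R), 0 < r /\
    forall h l : R, Rabs h < r -> Rabs l < r ->
      ex_series (fun n => sum_f_R0 (fun i => Rabs (a i (n - i)%nat * h ^ i * l ^ (n - i))) n) /\
      is_series (fun n => sum_f_R0 (fun i => a i (n - i)%nat * h ^ i * l ^ (n - i)) n)
                (F (x0 + h) (y0 + l)).

(* A vector field on [vdom]; the values of the components outside [vdom] are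
   irrelevant. *)
Record vector_field : Type := VectorField {
  vdom : R * R -> Prop;
  vX : R -> R -> R;
  vY : R -> R -> R }.

Definition veval (W : vector_field) (p : R * R) : R * R :=
  (vX W (fst p) (snd p), vY W (fst p) (snd p)).

Definition analytic_field (W : vector_field) : Prop :=
  open (vdom W) /\ vdom W (0, 0) /\
  forall x y : R, vdom W (x, y) -> analytic2_at (vX W) x y /\ analytic2_at (vY W) x y.

Definition integral_curve (W : vector_field) (a b : R) (g : R -> R * R) : Prop :=
  forall t : R, a <= t <= b -> vdom W (g t) /\ is_derive g t (veval W (g t)).

(** * Filippov systems with switching line y = 0 *)

Record filippov_system : Type := FilippovSystem {
  Zp : vector_field;   (* governs y > 0 *)
  Zm : vector_field }. (* governs y < 0 *)

Definition analytic_system (Z : filippov_system) : Prop :=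
  analytic_field (Zp Z) /\ analytic_field (Zm Z).

Definition sys_dom (Z : filippov_system) (p : R * R) : Prop :=
  (0 <= snd p -> vdom (Zp Z) p) /\ (snd p <= 0 -> vdom (Zm Z) p).

(* Filippov's convention: on the switching line the admissible velocities are
   the convex combinations of the two fields. *)
Definition filippov_velocity (Z : filippov_system) (p v : R * R) : Prop :=
  (0 < snd p /\ v = veval (Zp Z) p) \/
  (snd p < 0 /\ v = veval (Zm Z) p) \/
  (snd p = 0 /\ exists s : R, 0 <= s <= 1 /\
     v = plus (scal s (veval (Zp Z) p)) (scal (1 - s) (veval (Zm Z) p))).

(* Trajectories on the time interval [a, b]: continuous curves satisfying
   Filippov's differential inclusion except at finitely many times, such as the
   times at which the switching line is crossed. *)
Definition filippov_trajectory (Z : filippov_system) (a b : R) (g : R -> R * R) : Prop :=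
  continuous_on (fun t => a <= t <= b) g /\
  (forall t : R, a <= t <= b -> sys_dom Z (g t)) /\
  exists L : list R, forall t : R, a < t < b -> ~ In t L ->
    exists v : R * R, filippov_velocity Z (g t) v /\ is_derive g t v.

Definition crossing_point (Z : filippov_system) (x : R) : Prop :=
  sys_dom Z (x, 0) /\ 0 < vY (Zp Z) x 0 * vY (Zm Z) x 0.

Definition sliding_point (Z : filippov_system) (x : R) : Prop :=
  sys_dom Z (x, 0) /\ vY (Zp Z) x 0 * vY (Zm Z) x 0 < 0.

(* The segment is {(x, 0) | c < x < d}. *)
Definition sliding_segment (Z : filippov_system) (c d : R) : Prop :=
  c < d /\
  (forall x : R, c < x < d -> sliding_point Z x) /\
  (forall c' d' : R, c' <= c -> d <= d' ->
     (forall x : R, c' < x < d' -> sliding_point Z x) -> c' = c /\ d' = d).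

(** * Monodromic tangential singularities and Lyapunov coefficients *)

Definition dxY (W : vector_field) (i : nat) : R := Derive_n (fun x => vY W x 0) i 0.

Definition tangency_order (W : vector_field) (k : nat) : Prop :=
  vX W 0 0 <> 0 /\ vY W 0 0 = 0 /\
  (forall i : nat, (1 <= i <= 2 * k - 2)%nat -> dxY W i = 0) /\
  dxY W (2 * k - 1) <> 0.

Definition monodromic_tangential (Z : filippov_system) (kp km : nat) : Prop :=
  (1 <= kp)%nat /\ (1 <= km)%nat /\
  (tangency_order (Zp Z) kp /\ tangency_order (Zm Z) km) /\
  (vX (Zp Z) 0 0 * dxY (Zp Z) (2 * kp - 1) < 0 /\
   0 < vX (Zm Z) 0 0 * dxY (Zm Z) (2 * km - 1)) /\
  vX (Zp Z) 0 0 * vX (Zm Z) 0 0 < 0.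

(* The half-return map in {s y >= 0}, s = 1 or -1. The return time [T] is
   negative when the trajectory has to be followed backward. *)
Definition half_return_map (W : vector_field) (s : R) (phi : R -> R) : Prop :=
  phi 0 = 0 /\
  locally' 0 (fun x : R =>
    x * phi x < 0 /\
    exists (T : R) (g : R -> R * R),
      T <> 0 /\ g 0 = (x, 0) /\ g T = (phi x, 0) /\
      integral_curve W (Rmin 0 T) (Rmax 0 T) g /\
      forall t : R, Rmin 0 T < t < Rmax 0 T -> 0 < s * snd (g t)).

Definition delta_sign (Z : filippov_system) : R := sign (vX (Zp Z) 0 0).

(* [V] is the sequence of Lyapunov coefficients V_1, V_2, ... of [Z]; the
   expansion of the displacement function has no constant term. *)
Definition lyapunov_coefficients (Z : filippov_system) (V : nat -> R) : Prop :=
  exists phip phim : R -> R,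
    half_return_map (Zp Z) 1 phip /\ half_return_map (Zm Z) (-1) phim /\
    V 0%nat = 0 /\
    locally 0 (fun x : R => is_pseries V x (delta_sign Z * (phip x - phim x))).

(** * Limit cycles *)

Definition periodic_orbit (Z : filippov_system) (G : R * R -> Prop) : Prop :=
  exists (g : R -> R * R) (T : R),
    0 < T /\ filippov_trajectory Z 0 T g /\ g 0 = g T /\
    (exists t : R, 0 <= t <= T /\ g t <> g 0) /\
    forall p : R * R, G p <-> exists t : R, 0 <= t <= T /\ g t = p.

Definition same_set (A B : R * R -> Prop) : Prop := forall p : R * R, A p <-> B p.

Definition near_set (G : R * R -> Prop) (eps : R) (p : R * R) : Prop :=
  exists q : R * R, G q /\ ball q eps p.

Definition limit_cycle (Z : filippov_system) (G : R * R -> Prop) : Prop :=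
  periodic_orbit Z G /\
  (exists x : R, G (x, 0)) /\
  (forall x : R, G (x, 0) -> crossing_point Z x) /\
  exists eps : R, 0 < eps /\
    forall G' : R * R -> Prop, periodic_orbit Z G' ->
      (forall p : R * R, G' p -> near_set G eps p) -> same_set G' G.

(* [rho x] is the first point at which the trajectory from (x, 0) is back in
   the transversal section {(z, 0) | |z - x0| < eps}. *)
Definition first_return_map (Z : filippov_system) (x0 : R) (rho : R -> R) : Prop :=
  exists eps : R, 0 < eps /\
    locally x0 (fun x : R =>
      exists (T : R) (g : R -> R * R),
        0 < T /\ filippov_trajectory Z 0 T g /\
        g 0 = (x, 0) /\ g T = (rho x, 0) /\ Rabs (rho x - x0) < eps /\
        forall t z : R, 0 < t < T -> Rabs (z - x0) < eps -> g t <> (z, 0)).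

Definition hyperbolic (Z : filippov_system) (G : R * R -> Prop) : Prop :=
  exists (x0 : R) (rho : R -> R) (l : R),
    G (x0, 0) /\ first_return_map Z x0 rho /\ rho x0 = x0 /\
    is_derive rho x0 l /\ Rabs l <> 1.

Definition asymptotically_stable (Z : filippov_system) (G : R * R -> Prop) : Prop :=
  (forall eps : R, 0 < eps -> exists eta : R, 0 < eta /\
     forall (T : R) (g : R -> R * R), 0 < T -> filippov_trajectory Z 0 T g ->
       near_set G eta (g 0) ->
       forall t : R, 0 <= t <= T -> near_set G eps (g t)) /\
  (exists eta : R, 0 < eta /\
     forall p : R * R, near_set G eta p ->
       (exists g : R -> R * R, g 0 = p /\ forall T : R, 0 < T -> filippov_trajectory Z 0 T g) /\
       (forall g : R -> R * R, g 0 = p ->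
          (forall T : R, 0 < T -> filippov_trajectory Z 0 T g) ->
          forall eps : R, 0 < eps -> exists T0 : R,
            forall t : R, 0 <= t -> T0 <= t -> near_set G eps (g t))).

Definition reverse_field (W : vector_field) : vector_field :=
  VectorField (vdom W) (fun x y => - vX W x y) (fun x y => - vY W x y).

Definition reverse_system (Z : filippov_system) : filippov_system :=
  FilippovSystem (reverse_field (Zp Z)) (reverse_field (Zm Z)).

Definition repelling (Z : filippov_system) (G : R * R -> Prop) : Prop :=
  asymptotically_stable (reverse_system Z) G.

(* [p] lies in a bounded (path) component of the complement of [G]. *)
Definition encloses (G : R * R -> Prop) (p : R * R) : Prop :=
  ~ G p /\
  exists M : R, forall c : R -> R * R,
    continuous_on (fun t => 0 <= t <= 1) c -> c 0 = p ->
    (forall t : R, 0 <= t <= 1 -> ~ G (c t)) -> norm (c 1) <= M.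

Definition surrounds_segment (G : R * R -> Prop) (c d : R) : Prop :=
  forall x : R, c < x < d -> encloses G (x, 0).

Definition surrounds_single_sliding_segment (Z : filippov_system) (G : R * R -> Prop) : Prop :=
  exists c d : R,
    (sliding_segment Z c d /\ surrounds_segment G c d) /\
    forall c' d' : R, sliding_segment Z c' d' -> surrounds_segment G c' d' ->
      c' = c /\ d' = d.

(** * The perturbed family *)

(* The polynomial sum_(j <= n) c_j x^j and the norm of its coefficient vector;
   the entries of [c] of index > n play no role. *)
Definition poly_eval (n : nat) (c : nat -> R) (x : R) : R :=
  sum_f_R0 (fun j => c j * x ^ j) n.

Definition poly_norm (n : nat) (c : nat -> R) : R :=
  sqrt (sum_f_R0 (fun j => c j ^ 2) n).

Definition perturb_field (W : vector_field) (P : R -> R) : vector_field :=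
  VectorField (vdom W) (vX W) (fun x y => vY W x y + vX W x y * P x).

Definition shift_field (W : vector_field) (b : R) : vector_field :=
  VectorField (fun p => vdom W (fst p - b, snd p))
    (fun x y => vX W (x - b) y) (fun x y => vY W (x - b) y).

Definition perturbed_system (Z : filippov_system) (Pp Pm : R -> R) (b : R) : filippov_system :=
  FilippovSystem (shift_field (perturb_field (Zp Z) Pp) b) (perturb_field (Zm Z) Pm).

(* Main.v *)
(* Away from the zeros of X only the slope Y / X matters, and adding X P(x) to Y adds P(x)
   to the slope. A suitable small P of degree 2k - 2 splits the zero of order 2k - 1 of the
   slope on the axis into simple zeros e, 2e, ..., (2k - 1) e, the same ones for both
   fields; the odd multiples of e are invisible tangencies for both. Near a tangency p a
   first integral of dy/dx = Y / X identifies the half-return map with the involution of a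
   function having a minimum at p, so that phi(p + x) = p - x + al x^2 + o(x^2), where al is
   a logarithmic derivative. The difference of the two values of al at each invisible
   tangency tends, as e -> 0, to a positive multiple of delta V_2. Shifting one field by b of
   the opposite sign opens a sliding segment surrounded by a crossing cycle of size
   sqrt |b|. The cycle is an oval made of two level arcs of the first integrals; these
   integrals, weighted by exponentials of the abscissa, form a Lyapunov function. *)

Require Import Defs.
From Stdlib Require Import Reals List Bool Lra Lia Psatz Classical.
From Stdlib Require Import IndefiniteDescription FunctionalExtensionality.
From Coquelicot Require Import Coquelicot.
Open Scope R_scope.

(** The splitting creates a new difficulty: at each invisible tangency the other 2k - 2 zeros
    contribute to [al] the logarithmic derivative of a product of factors x - j e, a term that may
    blow up like 1/e. It is harmless only because both fields receive exactly the same zeros: it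
    cancels in the difference, and what remains depends on the two analytic germs and converges.
    This is why both polynomials are taken for one common [e], fixed before b.

    The second obstacle is the notion of trajectory. Stability and isolation quantify over all
    solutions of a differential inclusion, so a return map alone proves neither. Every needed bound
    is therefore an inequality along an arbitrary trajectory, and the return map only serves
    hyperbolicity and the existence of trajectories for all times.

    Regularity is kept minimal: the slope needs Lipschitz bounds and a quadratic Taylor bound in y,
    the first integral is merely Lipschitz off the axis, and a restricted first integral has a
    derivative x^n w with w differentiable at the single point 0. A second order expansion of the
    involution follows from this. The unstable case is the stable one for the reversed system. *)

Ltac rmin :=
  let rec go := first
    [exact (Rle_refl _) | apply Rle_trans with (1 := Rmin_l _ _); go | apply Rle_trans with (1 := Rmin_r _ _); go] in
  multimatch goal with
  (* A strict goal first passes through a hypothesis [x < y]; [multimatch] backtracks over these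
     hypotheses until [y] is an iterated minimum having the target among its leaves. *)
  | |- _ <= _ => idtac
  | H : ?x < ?y |- ?x < ?z => apply (Rlt_le_trans x y z H)
  end;
  try match goal with |- ?v <= _ => is_var v; unfold v end; go.

(** * Calculus of one variable *)

Lemma is_derive_eps (f : R -> R) (x l : R) :
  is_derive f x l <->
  forall eps, 0 < eps -> exists d, 0 < d /\
    forall y, Rabs (y - x) < d -> Rabs (f y - f x - l * (y - x)) <= eps * Rabs (y - x).
Proof.
  split.
  - intros [_ H] eps He.
    destruct (H x (fun P HP => HP) (mkposreal eps He)) as [d Hd].
    exists d; split; [apply cond_pos|]. intros y Hy.
    specialize (Hd y Hy). unfold norm, minus, plus, opp, scal in Hd; simpl in Hd.
    unfold mult, abs in Hd; simpl in Hd.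
    replace (f y - f x - l * (y - x)) with (f y + - f x + - ((y + - x) * l)) by ring.
    exact Hd.
  - intros H. split.
    + apply is_linear_scal_l.
    + intros z Hz eps.
      assert (E : x = z) by (apply (is_filter_lim_locally_unique (K := R_AbsRing) (V := R_NormedModule)); exact Hz).
      rewrite <- E.
      destruct (H eps (cond_pos eps)) as [d [Hd0 Hd]].
      exists (mkposreal d Hd0). intros y Hy. specialize (Hd y Hy).
      unfold norm, minus, plus, opp, scal; simpl. unfold mult, abs; simpl.
      replace (f y + - f x + - ((y + - x) * l)) with (f y - f x - l * (y - x)) by ring.
      exact Hd.
Qed.

Lemma continuous_eps (f : R -> R) (x : R) :
  continuous f x <->
  forall eps, 0 < eps -> exists d, 0 < d /\
    forall y, Rabs (y - x) < d -> Rabs (f y - f x) < eps.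
Proof.
  split.
  - intros H eps He.
    destruct (proj1 (filterlim_locally f (f x)) H (mkposreal eps He)) as [d Hd].
    exists d; split; [apply cond_pos|]. intros y Hy. exact (Hd y Hy).
  - intros H. apply (filterlim_locally f (f x)). intros eps.
    destruct (H eps (cond_pos eps)) as [d [Hd0 Hd]].
    exists (mkposreal d Hd0). intros y Hy. exact (Hd y Hy).
Qed.

Lemma is_derive_continuous (f : R -> R) (x l : R) : is_derive f x l -> continuous f x.
Proof. intros H. apply (ex_derive_continuous f). exists l; exact H. Qed.

Lemma is_derive_pair (g : R -> R * R) (x : R) (v : R * R) :
  is_derive g x v <->
  is_derive (fun t => fst (g t)) x (fst v) /\ is_derive (fun t => snd (g t)) x (snd v).
Proof.
  split.
  - intros H. split.
    + apply (filterdiff_comp' g (fun p : R * R => fst p) x (fun y => scal y v) (fun p => fst p)).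
      * exact H.
      * apply filterdiff_linear, is_linear_fst.
    + apply (filterdiff_comp' g (fun p : R * R => snd p) x (fun y => scal y v) (fun p => snd p)).
      * exact H.
      * apply filterdiff_linear, is_linear_snd.
  - intros [H1 H2].
    assert (H : filterdiff (fun t => (fst (g t), snd (g t))) (locally x)
                  (fun y => (scal y (fst v), scal y (snd v)))).
    { apply (filterdiff_comp'_2 (fun t => fst (g t)) (fun t => snd (g t)) (fun a b => (a, b)) x
               (fun y => scal y (fst v)) (fun y => scal y (snd v)) (fun a b => (a, b)) H1 H2).
      apply (filterdiff_ext_lin _ (fun t => t)).
      - apply (filterdiff_ext (fun t => t)); [intros [a b]; reflexivity|].
        apply filterdiff_id.
      - intros [a b]; reflexivity. }
    apply (filterdiff_ext (fun t => (fst (g t), snd (g t)))).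
    + intros t; destruct (g t); reflexivity.
    + exact H.
Qed.

Lemma continuous_prod_iff (g : R -> R * R) (x : R) :
  continuous g x <-> continuous (fun t => fst (g t)) x /\ continuous (fun t => snd (g t)) x.
Proof.
  split.
  - intros H. split.
    + apply (continuous_comp g (fun p => fst p)); [exact H | apply continuous_fst].
    + apply (continuous_comp g (fun p => snd p)); [exact H | apply continuous_snd].
  - intros [H1 H2]. apply (filterlim_locally g (g x)). intros eps.
    generalize (filter_and _ _ (proj1 (filterlim_locally _ _) H1 eps)
                  (proj1 (filterlim_locally _ _) H2 eps)). apply filter_imp. intros y [A B]. split; assumption.
Qed.

Lemma mean_value (f df : R -> R) (a b : R) :
  a <= b -> (forall x, a <= x <= b -> is_derive f x (df x)) ->
  exists c, a <= c <= b /\ f b - f a = df c * (b - a).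
Proof.
  intros Hab H.
  destruct (MVT_gen f a b df) as [c Hc].
  - intros x. rewrite Rmin_left, Rmax_right by lra. intros Hx. apply H; lra.
  - intros x. rewrite Rmin_left, Rmax_right by lra. intros Hx.
    apply continuity_pt_filterlim. apply (is_derive_continuous f x (df x)). apply H; lra.
  - rewrite Rmin_left, Rmax_right in Hc by lra. exists c; exact Hc.
Qed.

Lemma increasing_of_derive (f : R -> R) (a b : R) :
  a <= b -> (forall t, a <= t <= b -> continuous f t) ->
  (forall t, a < t < b -> exists l, is_derive f t l /\ 0 <= l) -> f a <= f b.
Proof.
  intros Hab Hc Hd.
  (* The mean value theorem expects a derivative as a function; choice provides one, with the
     harmless value 0 outside the open interval. *)
  destruct (functional_choice (fun t l => (a < t < b -> is_derive f t l) /\ 0 <= l)) as [df Hdf].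
  { intros t. destruct (classic (a < t < b)) as [H|H].
    - destruct (Hd t H) as [l Hl]. exists l; intuition.
    - exists 0. split; [intros H'; contradiction|lra]. }
  destruct (MVT_gen f a b df) as [c [_ E]].
  - intros x. rewrite Rmin_left, Rmax_right by lra. intros Hx. apply Hdf; lra.
  - intros x. rewrite Rmin_left, Rmax_right by lra. intros Hx.
    apply continuity_pt_filterlim. apply Hc; lra.
  - destruct (Hdf c) as [_ Hp]. nra.
Qed.

(** Trajectories obey the inclusion off a finite list of times only. Continuity bridges the gaps:
    the interval is cut at the exceptional times. *)
Lemma increasing_except (L : list R) : forall (f : R -> R) (a b : R),
  a <= b -> (forall t, a <= t <= b -> continuous f t) ->
  (forall t, a < t < b -> ~ In t L -> exists l, is_derive f t l /\ 0 <= l) -> f a <= f b.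
Proof.
  induction L as [|c L IH]; intros f a b Hab Hc Hd.
  - apply increasing_of_derive; auto.
  - destruct (classic (a < c < b)) as [Hcc|Hcc].
    + apply Rle_trans with (f c); apply IH; try lra; intros t Ht; try (apply Hc; lra);
        intros Hn; apply Hd; try lra; simpl; intros [->|Hi]; lra || contradiction.
    + apply IH; auto. intros t Ht Hn. apply Hd; auto. simpl. intros [->|Hi]; contradiction.
Qed.

Lemma constant_except (L : list R) (f : R -> R) (a b : R) :
  a <= b -> (forall t, a <= t <= b -> continuous f t) ->
  (forall t, a < t < b -> ~ In t L -> is_derive f t 0) -> f a = f b.
Proof.
  intros Hab Hc Hd. apply Rle_antisym.
  - apply (increasing_except L); auto. intros t Ht Hn. exists 0. split; [auto|lra].
  - apply Ropp_le_cancel. apply (increasing_except L (fun t => - f t)); auto.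
    + intros t Ht. apply (continuous_opp (V := R_NormedModule)). auto.
    + intros t Ht Hn. exists 0. split; [|lra].
      replace 0 with (- 0) by ring. apply (is_derive_opp f). auto.
Qed.

(** Tailored to functions that jump: the Lyapunov value is discontinuous whenever the axis is
    crossed, so no derivative test applies. Comparison with nearby times on both sides of each
    instant suffices, by a supremum argument on [0, T]. *)
Lemma local_decreasing (psi : R -> R) (T : R) :
  0 <= T ->
  (forall t, 0 <= t <= T -> exists d, 0 < d /\
     forall s, 0 <= s <= T -> (t - d < s <= t -> psi t <= psi s) /\ (t <= s < t + d -> psi s <= psi t)) ->
  psi T <= psi 0.
Proof.
  intros HT H.
  set (E := fun t => 0 <= t <= T /\ forall s, 0 <= s <= t -> psi s <= psi 0).
  destruct (completeness E) as [m [Hub Hlub]].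
  { exists T. intros t [Ht _]; lra. }
  { exists 0. split; [lra|]. intros s Hs. replace s with 0 by lra. lra. }
  assert (Hm0 : 0 <= m).
  { apply Hub. split; [lra|]. intros s Hs. replace s with 0 by lra. lra. }
  assert (HmT : m <= T) by (apply Hlub; intros t [Ht _]; lra).
  destruct (H m) as [d [Hd0 Hd]]; [lra|].
  assert (Hlt : forall s, 0 <= s < m -> psi s <= psi 0).
  { intros s Hs. destruct (classic (exists t, E t /\ s < t)) as [[t [[Ht1 Ht2] Ht3]]|Hn].
    - apply Ht2; lra.
    - exfalso. assert (m <= s); [|lra]. apply Hlub. intros t Ht.
      apply Rnot_lt_le. intros Hlt. apply Hn. exists t; auto. }
  assert (Hm : psi m <= psi 0).
  { destruct (Req_dec m 0) as [->|Hn0]; [lra|].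
    pose (s := Rmax 0 (m - d / 2)).
    assert (Hs : 0 <= s < m /\ m - d < s) by (unfold s, Rmax; destruct Rle_dec; lra).
    apply Rle_trans with (psi s); [|apply Hlt; lra].
    apply (Hd s); lra. }
  destruct (Rle_lt_or_eq_dec m T HmT) as [Hl|<-]; [|exact Hm].
  exfalso.
  pose (t := Rmin T (m + d / 2)).
  assert (Ht : m < t <= T /\ t < m + d) by (unfold t, Rmin; destruct Rle_dec; lra).
  assert (E t).
  { split; [lra|]. intros s Hs. destruct (Rlt_le_dec s m).
    - apply Hlt; lra.
    - apply Rle_trans with (psi m); [|exact Hm]. apply (Hd s); lra. }
  specialize (Hub t H0). lra.
Qed.

(** The 1-Lipschitz retraction onto [a, b]. Composition with it extends a function controlled on
    [a, b] to the whole line, where the library theorems ask for continuity. *)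
Definition clamp (a b x : R) : R := Rmax a (Rmin x b).

Lemma clamp_in (a b x : R) : a <= b -> a <= clamp a b x <= b.
Proof. intros H. unfold clamp, Rmax, Rmin. repeat destruct Rle_dec; lra. Qed.

Lemma clamp_id (a b x : R) : a <= x <= b -> clamp a b x = x.
Proof. intros H. unfold clamp, Rmax, Rmin. repeat destruct Rle_dec; lra. Qed.

Lemma clamp_lip (a b x y : R) : a <= b -> Rabs (clamp a b x - clamp a b y) <= Rabs (x - y).
Proof.
  intros H. unfold clamp, Rmax, Rmin, Rabs. repeat destruct Rle_dec; repeat destruct Rcase_abs; lra.
Qed.

Lemma clamp_continuous (a b x : R) : a <= b -> continuous (clamp a b) x.
Proof.
  intros Hab. apply continuous_eps. intros eps He. exists eps. split; auto.
  intros y Hy. apply Rle_lt_trans with (2 := Hy). apply clamp_lip; auto.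
Qed.

Lemma ivt (f : R -> R) (a b y : R) :
  a <= b -> (forall t, a <= t <= b -> continuous f t) ->
  Rmin (f a) (f b) <= y <= Rmax (f a) (f b) -> exists c, a <= c <= b /\ f c = y.
Proof.
  intros Hab Hc Hy.
  destruct (IVT_gen (fun t => f (clamp a b t)) a b y) as [c [Hc1 Hc2]].
  - intros t. apply continuity_pt_filterlim.
    apply (continuous_comp (clamp a b) f); [apply clamp_continuous; auto|].
    apply Hc, clamp_in; auto.
  - rewrite !clamp_id by lra. exact Hy.
  - exists (clamp a b c). split; [apply clamp_in; auto|exact Hc2].
Qed.

Lemma strictly_increasing_of_derive (u du : R -> R) (a b : R) :
  (forall x, a <= x <= b -> is_derive u x (du x)) -> (forall x, a <= x <= b -> 0 < du x) ->
  forall x y, a <= x -> x < y -> y <= b -> u x < u y.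
Proof.
  intros Hd Hp x y Hx Hxy Hy.
  destruct (mean_value u du x y) as [c [Hc E]]; [lra| |].
  - intros z Hz; apply Hd; lra.
  - specialize (Hp c). nra.
Qed.

Lemma inverse_function (u du : R -> R) (a b : R) :
  a < b -> (forall x, a <= x <= b -> is_derive u x (du x)) -> (forall x, a <= x <= b -> 0 < du x) ->
  exists v : R -> R,
    (forall x, a <= x <= b -> v (u x) = x) /\
    (forall y, u a <= y <= u b -> a <= v y <= b /\ u (v y) = y) /\
    (forall y, u a < y < u b -> is_derive v y (/ du (v y))).
Proof.
  intros Hab Hd Hp.
  assert (Hinc := strictly_increasing_of_derive u du a b Hd Hp).
  assert (Hab' : u a < u b) by (apply Hinc; lra).
  destruct (functional_choice (fun y x => u a <= y <= u b -> a <= x <= b /\ u x = y)) as [v Hv].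
  { intros y. destruct (classic (u a <= y <= u b)) as [H|H].
    - destruct (ivt u a b y) as [c Hc].
      + lra.
      + intros t Ht. apply (is_derive_continuous u t (du t)). auto.
      + rewrite Rmin_left, Rmax_right; lra.
      + exists c; auto.
    - exists 0. intros H'; contradiction. }
  assert (Hmono : forall x y, a <= x <= b -> a <= y <= b -> u x < u y -> x < y).
  { intros x y Hx Hy Hu. apply Rnot_le_lt. intros Hle.
    destruct (Req_dec x y) as [->|Hn]; [lra|]. assert (u y < u x) by (apply Hinc; lra). lra. }
  exists v. split; [|split].
  - intros x Hx.
    assert (Hr : u a <= u x <= u b).
    { destruct (Req_dec x a) as [->|]; [lra|]. destruct (Req_dec x b) as [->|]; [lra|].
      assert (u a < u x) by (apply Hinc; lra). assert (u x < u b) by (apply Hinc; lra). lra. }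
    destruct (Hv _ Hr) as [H1 H2].
    destruct (Rtotal_order (v (u x)) x) as [Hlt|[E|Hgt]]; auto.
    + assert (u (v (u x)) < u x) by (apply Hinc; lra). lra.
    + assert (u x < u (v (u x))) by (apply Hinc; lra). lra.
  - exact Hv.
  - intros y Hy. apply is_derive_eps. intros eps He.
    destruct (Hv y) as [Hx E]; [lra|]. set (x := v y) in *.
    assert (Hxi : a < x < b) by (split; apply Hmono; lra).
    assert (Hdx : 0 < du x) by (apply Hp; lra).
    (* The accuracy [du x / 2] bounds the increment of x by 2 / [du x] times that of y; the other
       one then gives the error [eps] after division by [du x]. *)
    destruct (proj1 (is_derive_eps u x (du x)) (Hd x Hx) (Rmin (du x / 2) (eps * du x * du x / 2)))
      as [d [Hd0 Hdd]].
    { apply Rmin_pos; [lra|]. apply Rdiv_lt_0_compat; [|lra].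
      apply Rmult_lt_0_compat; auto. apply Rmult_lt_0_compat; auto. }
    set (e := Rmin (d / 2) (Rmin ((x - a) / 2) ((b - x) / 2))).
    assert (He1 : 0 < e) by (unfold e; repeat apply Rmin_pos; lra).
    assert (e <= d / 2) by apply Rmin_l.
    assert (e <= (x - a) / 2) by rmin.
    assert (e <= (b - x) / 2) by rmin.
    assert (Hl : u (x - e) < y) by (rewrite <- E; apply Hinc; lra).
    assert (Hr : y < u (x + e)) by (rewrite <- E; apply Hinc; lra).
    assert (u a < u (x - e)) by (apply Hinc; lra).
    assert (u (x + e) < u b) by (apply Hinc; lra).
    exists (Rmin (y - u (x - e)) (u (x + e) - y)). split; [apply Rmin_pos; lra|].
    intros y' Hy'.
    assert (Hy1 : u (x - e) < y' < u (x + e)).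
    { apply Rabs_def2 in Hy'. pose proof (Rmin_l (y - u (x - e)) (u (x + e) - y)).
      pose proof (Rmin_r (y - u (x - e)) (u (x + e) - y)). lra. }
    destruct (Hv y') as [Hx' E']; [lra|]. set (x' := v y') in *.
    assert (x - e < x') by (apply Hmono; lra).
    assert (x' < x + e) by (apply Hmono; lra).
    assert (Hxx : Rabs (x' - x) < d) by (apply Rabs_def1; lra).
    specialize (Hdd x' Hxx). rewrite E, E' in Hdd.
    set (A := Rabs (x' - x)) in *. assert (0 <= A) by apply Rabs_pos.
    assert (Hb1 : Rabs (y' - y - du x * (x' - x)) <= du x / 2 * A).
    { apply Rle_trans with (1 := Hdd). apply Rmult_le_compat_r; auto. apply Rmin_l. }
    assert (Hb2 : Rabs (y' - y - du x * (x' - x)) <= eps * du x * du x / 2 * A).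
    { apply Rle_trans with (1 := Hdd). apply Rmult_le_compat_r; auto. apply Rmin_r. }
    assert (HA : du x * A <= 2 * Rabs (y' - y)).
    { assert (HB : Rabs (du x * (x' - x)) <= Rabs (y' - y) + du x / 2 * A).
      { replace (du x * (x' - x)) with ((y' - y) - (y' - y - du x * (x' - x))) by ring.
        eapply Rle_trans; [apply Rabs_triang|]. rewrite Rabs_Ropp. lra. }
      rewrite Rabs_mult, (Rabs_right (du x)) in HB by lra. fold A in HB. lra. }
    replace (x' - x - / du x * (y' - y)) with (- / du x * (y' - y - du x * (x' - x))) by (field; lra).
    rewrite Rabs_mult, Rabs_Ropp, Rabs_right by (apply Rle_ge, Rlt_le, Rinv_0_lt_compat; lra).
    apply Rle_trans with (/ du x * (eps * du x * du x / 2 * A)).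
    + apply Rmult_le_compat_l; auto. apply Rlt_le, Rinv_0_lt_compat; lra.
    + replace (/ du x * (eps * du x * du x / 2 * A)) with (eps / 2 * (du x * A)) by (field; lra).
      nra.
Qed.

(** * Analytic vector fields near a regular point *)

Lemma pow_abs_le (rho x : R) (j : nat) : Rabs x <= rho -> Rabs (x ^ j) <= rho ^ j.
Proof. intros H. rewrite <- RPow_abs. apply pow_incr. split; [apply Rabs_pos|exact H]. Qed.

(** Multiplying by [rho], here and in the next bounds, replaces the exponent j - 1 by j and spares
    the case j = 0. *)
Lemma pow_lipschitz (rho x y : R) (j : nat) :
  Rabs x <= rho -> Rabs y <= rho -> Rabs (x ^ j - y ^ j) * rho <= INR j * rho ^ j * Rabs (x - y).
Proof.
  intros Hx Hy. assert (Hr : 0 <= rho) by (pose proof (Rabs_pos x); lra).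
  induction j as [|j IH].
  - simpl. rewrite Rminus_diag, Rabs_R0. lra.
  - rewrite S_INR. replace (x ^ S j - y ^ S j) with (x * (x ^ j - y ^ j) + (x - y) * y ^ j) by (simpl; ring).
    assert (H1 := Rabs_triang (x * (x ^ j - y ^ j)) ((x - y) * y ^ j)).
    rewrite !Rabs_mult in H1. assert (H2 := pow_abs_le rho y j Hy).
    assert (0 <= Rabs (x ^ j - y ^ j)) by apply Rabs_pos.
    assert (0 <= Rabs (x - y)) by apply Rabs_pos.
    assert (Rabs x * Rabs (x ^ j - y ^ j) <= rho * Rabs (x ^ j - y ^ j)) by (apply Rmult_le_compat_r; auto).
    assert (Rabs (x - y) * Rabs (y ^ j) <= Rabs (x - y) * rho ^ j) by (apply Rmult_le_compat_l; auto).
    simpl. nra.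
Qed.

Definition dpow (j : nat) (x : R) : R := INR j * x ^ (j - 1).

Lemma dpow_S (j : nat) (x : R) : dpow (S j) x = (INR j + 1) * x ^ j.
Proof. unfold dpow. rewrite S_INR. replace (S j - 1)%nat with j by lia. reflexivity. Qed.

Lemma dpow_mul (j : nat) (x : R) : x * dpow j x = INR j * x ^ j.
Proof. destruct j; [unfold dpow; simpl; ring|]. rewrite dpow_S, S_INR. simpl; ring. Qed.

Lemma dpow_bound (rho x : R) (j : nat) : Rabs x <= rho -> Rabs (dpow j x) * rho <= INR j * rho ^ j.
Proof.
  intros Hx. destruct j as [|j].
  - unfold dpow; simpl. rewrite Rmult_0_l, Rabs_R0. lra.
  - rewrite dpow_S, Rabs_mult, S_INR. pose proof (pos_INR j).
    rewrite (Rabs_right (INR j + 1)) by lra. pose proof (pow_abs_le rho x j Hx).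
    pose proof (Rabs_pos x). simpl.
    assert ((INR j + 1) * Rabs (x ^ j) * rho <= (INR j + 1) * rho ^ j * rho); [|lra].
    apply Rmult_le_compat_r; [lra|]. apply Rmult_le_compat_l; lra.
Qed.

Lemma dpow_lipschitz (rho x y : R) (j : nat) :
  Rabs x <= rho -> Rabs y <= rho ->
  Rabs (dpow j x - dpow j y) * rho ^ 2 <= INR j ^ 2 * rho ^ j * Rabs (x - y).
Proof.
  intros Hx Hy. assert (Hr : 0 <= rho) by (pose proof (Rabs_pos x); lra).
  destruct j as [|j].
  - unfold dpow; simpl. rewrite !Rmult_0_l, Rminus_diag, Rabs_R0. lra.
  - rewrite !dpow_S, S_INR, <- Rmult_minus_distr_l, Rabs_mult. pose proof (pos_INR j).
    rewrite (Rabs_right (INR j + 1)) by lra.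
    assert (H1 := pow_lipschitz rho x y j Hx Hy).
    assert (0 <= rho ^ j) by (apply pow_le; auto). pose proof (Rabs_pos (x - y)).
    assert (0 <= rho * (rho ^ j * Rabs (x - y))) by (repeat apply Rmult_le_pos; auto).
    replace ((INR j + 1) * Rabs (x ^ j - y ^ j) * rho ^ 2)
      with ((INR j + 1) * rho * (Rabs (x ^ j - y ^ j) * rho)) by ring.
    apply Rle_trans with ((INR j + 1) * rho * (INR j * rho ^ j * Rabs (x - y))).
    + apply Rmult_le_compat_l; auto. apply Rmult_le_pos; lra.
    + replace ((INR j + 1) ^ 2 * rho ^ S j * Rabs (x - y))
        with ((INR j + 1) * rho * (INR j * rho ^ j * Rabs (x - y))
              + (INR j + 1) * (rho * (rho ^ j * Rabs (x - y)))) by (simpl; ring).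
      assert (0 <= (INR j + 1) * (rho * (rho ^ j * Rabs (x - y)))) by (apply Rmult_le_pos; auto; lra).
      lra.
Qed.

(** Induction on j: the remainder of order j + 1 is y times the remainder of order j plus (y - x)^2
    times the derivative of x^j. *)
Lemma pow_taylor (rho x y : R) (j : nat) :
  Rabs x <= rho -> Rabs y <= rho ->
  Rabs (y ^ j - x ^ j - (y - x) * dpow j x) * rho ^ 2 <= INR j ^ 2 * rho ^ j * (y - x) ^ 2.
Proof.
  intros Hx Hy. assert (Hr : 0 <= rho) by (pose proof (Rabs_pos x); lra).
  induction j as [|j IH].
  - unfold dpow; simpl. replace (1 - 1 - (y - x) * (0 * 1)) with 0 by ring. rewrite Rabs_R0. lra.
  - rewrite dpow_S, S_INR.
    replace (y ^ S j - x ^ S j - (y - x) * ((INR j + 1) * x ^ j))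
      with (y * (y ^ j - x ^ j - (y - x) * dpow j x) + (y - x) ^ 2 * dpow j x).
    2:{ transitivity (y ^ S j - y * x ^ j - (y - x) * (x * dpow j x)); [simpl; ring|]. rewrite dpow_mul. simpl; ring. }
    assert (H1 := Rabs_triang (y * (y ^ j - x ^ j - (y - x) * dpow j x)) ((y - x) ^ 2 * dpow j x)).
    rewrite !Rabs_mult, (Rabs_right ((y - x) ^ 2)) in H1 by (apply Rle_ge, pow2_ge_0).
    assert (H2 := dpow_bound rho x j Hx).
    set (A := Rabs (y ^ j - x ^ j - (y - x) * dpow j x)) in *. assert (0 <= A) by apply Rabs_pos.
    assert (0 <= (y - x) ^ 2) by apply pow2_ge_0. set (d := (y - x) ^ 2) in *. clearbody d.
    assert (H3 : Rabs y * A * rho ^ 2 <= rho * (INR j ^ 2 * rho ^ j * d)).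
    { rewrite Rmult_assoc. apply Rmult_le_compat; auto. apply Rabs_pos.
      apply Rmult_le_pos; auto. apply pow2_ge_0. }
    assert (H4 : d * Rabs (dpow j x) * rho ^ 2 <= d * rho * (INR j * rho ^ j)).
    { replace (d * Rabs (dpow j x) * rho ^ 2) with (d * rho * (Rabs (dpow j x) * rho)) by ring.
      apply Rmult_le_compat_l; auto. apply Rmult_le_pos; auto. }
    assert (0 <= rho ^ 2) by apply pow2_ge_0.
    apply Rle_trans with ((Rabs y * A + d * Rabs (dpow j x)) * rho ^ 2).
    { apply Rmult_le_compat_r; auto. }
    rewrite Rmult_plus_distr_r.
    assert (0 <= INR j) by apply pos_INR.
    assert (0 <= rho * rho ^ j * d).
    { assert (0 <= rho ^ j) by (apply pow_le; auto). repeat apply Rmult_le_pos; auto. }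
    replace ((INR j + 1) ^ 2 * rho ^ S j * d)
      with (rho * (INR j ^ 2 * rho ^ j * d) + d * rho * (INR j * rho ^ j)
            + (INR j + 1) * (rho * rho ^ j * d)) by (simpl; ring).
    assert (0 <= (INR j + 1) * (rho * rho ^ j * d)) by (apply Rmult_le_pos; lra).
    lra.
Qed.

Lemma sqr_le_pow8 (n : nat) : INR n ^ 2 <= 8 ^ n.
Proof.
  induction n as [|n IH]; [simpl; lra|].
  rewrite S_INR. destruct n as [|n]; [simpl; lra|].
  rewrite S_INR in *. pose proof (pos_INR n). change (8 ^ S (S n)) with (8 * 8 ^ S n). nra.
Qed.

Lemma sum_abs_le (c t : nat -> R) (B : R) (n : nat) :
  (forall i, (i <= n)%nat -> Rabs (t i) <= B) ->
  Rabs (sum_f_R0 (fun i => c i * t i) n) <= sum_f_R0 (fun i => Rabs (c i)) n * B.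
Proof.
  intros H. apply Rle_trans with (1 := Rsum_abs _ _).
  rewrite Rmult_comm, scal_sum. apply sum_Rle. intros i Hi.
  rewrite Rabs_mult. apply Rmult_le_compat_l; [apply Rabs_pos|auto].
Qed.

Lemma series_geom_bound (T : nat -> R) (B : R) :
  (forall n, Rabs (T n) <= B * (1 / 2) ^ n) -> ex_series T /\ Rabs (Series T) <= 2 * B.
Proof.
  intros H.
  assert (Hg : is_series (fun n => B * (1 / 2) ^ n) (2 * B)).
  { replace (2 * B) with (scal B (/ (1 - 1 / 2))) by (unfold scal; simpl; unfold mult; simpl; field).
    apply (is_series_scal B (fun n => (1 / 2) ^ n)). apply is_series_geom.
    rewrite Rabs_right; lra. }
  assert (Hx : ex_series (fun n => Rabs (T n))).
  { apply (ex_series_le (K := R_AbsRing) (V := R_CompleteNormedModule) _ (fun n => B * (1 / 2) ^ n)).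
    - intros n. unfold norm; simpl. unfold abs; simpl. rewrite Rabs_Rabsolu. apply H.
    - exists (2 * B); exact Hg. }
  split; [apply ex_series_Rabs; auto|].
  apply Rle_trans with (1 := Series_Rabs _ Hx).
  rewrite <- (is_series_unique _ _ Hg). apply Series_le.
  - intros n. split; [apply Rabs_pos|apply H].
  - exists (2 * B); exact Hg.
Qed.

(** * Lipschitz and Taylor estimates on squares *)

Definition box (r x y : R) : Prop := Rabs x <= r /\ Rabs y <= r.

Definition lipschitz_box (F : R -> R -> R) (r C : R) : Prop :=
  forall x y x' y', box r x y -> box r x' y' ->
    Rabs (F x y - F x' y') <= C * (Rabs (x - x') + Rabs (y - y')).

(** Exactly what the linearized equation along solutions of dy/dx = F needs. No derivative in x is
    requested, so that the class is stable under products and inverses by elementary estimates and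
    under the addition of a Lipschitz function of x. *)
Definition smooth_y (F Fy : R -> R -> R) (r C : R) : Prop :=
  lipschitz_box F r C /\ lipschitz_box Fy r C /\
  forall x y y', box r x y -> box r x y' ->
    Rabs (F x y' - F x y - (y' - y) * Fy x y) <= C * (y' - y) ^ 2.

Lemma partial_sum_bounded (a : nat -> R) :
  (forall n, 0 <= a n) -> ex_series a -> exists M, 0 <= M /\ forall n, a n <= M.
Proof.
  intros Hp [l Hl].
  assert (Hn : forall n, sum_n a n <= l).
  { intros n. apply (is_lim_seq_incr_compare (sum_n a) l).
    - exact Hl.
    - intros m. rewrite sum_Sn. unfold plus; simpl. specialize (Hp (S m)). lra. }
  assert (Hs : forall n, 0 <= sum_n a n).
  { induction n; [rewrite sum_O; auto|]. rewrite sum_Sn. unfold plus; simpl. specialize (Hp (S n)). lra. }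
  exists l. split; [specialize (Hs 0%nat); specialize (Hn 0%nat); lra|].
  intros n. apply Rle_trans with (2 := Hn n). destruct n; [rewrite sum_O; lra|].
  rewrite sum_Sn. unfold plus; simpl. specialize (Hs n). lra.
Qed.

Lemma sum_last_only (f : nat -> R) (n : nat) :
  (forall i, (i < n)%nat -> f i = 0) -> sum_f_R0 f n = f n.
Proof.
  intros H. destruct n; [reflexivity|]. simpl.
  rewrite (sum_eq f (fun _ => 0)) by (intros i Hi; apply H; lia).
  rewrite sum_eq_R0 by auto. ring.
Qed.

Lemma monomial_lipschitz (rho h l h' l' : R) (i j : nat) :
  0 < rho -> box rho h l -> box rho h' l' ->
  Rabs (h ^ i * l ^ j - h' ^ i * l' ^ j) <=
    INR (i + j) ^ 2 * rho ^ (i + j) * ((Rabs (h - h') + Rabs (l - l')) / rho).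
Proof.
  intros Hr [Hh Hl] [Hh' Hl'].
  assert (H1 := pow_lipschitz rho h h' i Hh Hh').
  assert (H2 := pow_lipschitz rho l l' j Hl Hl').
  assert (H3 := pow_abs_le rho l j Hl). assert (H4 := pow_abs_le rho h' i Hh').
  assert (Pi : 0 <= rho ^ i) by (apply pow_le; lra). assert (Pj : 0 <= rho ^ j) by (apply pow_le; lra).
  pose proof (pos_INR i). pose proof (pos_INR j).
  pose proof (Rabs_pos (h - h')). pose proof (Rabs_pos (l - l')).
  apply Rmult_le_reg_r with rho; auto.
  apply Rle_trans with (Rabs (h ^ i - h' ^ i) * rho * Rabs (l ^ j) + Rabs (h' ^ i) * (Rabs (l ^ j - l' ^ j) * rho)).
  { replace (h ^ i * l ^ j - h' ^ i * l' ^ j) with ((h ^ i - h' ^ i) * l ^ j + h' ^ i * (l ^ j - l' ^ j)) by ring.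
    assert (HT := Rabs_triang ((h ^ i - h' ^ i) * l ^ j) (h' ^ i * (l ^ j - l' ^ j))).
    rewrite !Rabs_mult in HT. nra. }
  apply Rle_trans with (INR i * rho ^ i * Rabs (h - h') * rho ^ j + rho ^ i * (INR j * rho ^ j * Rabs (l - l'))).
  { apply Rplus_le_compat; apply Rmult_le_compat; auto; try apply Rabs_pos;
      apply Rmult_le_pos; try apply Rabs_pos; lra. }
  rewrite pow_add, plus_INR.
  replace ((INR i + INR j) ^ 2 * (rho ^ i * rho ^ j) * ((Rabs (h - h') + Rabs (l - l')) / rho) * rho)
    with ((INR i + INR j) ^ 2 * (rho ^ i * rho ^ j * (Rabs (h - h') + Rabs (l - l')))) by (field; lra).
  assert (Hi : INR i <= (INR i + INR j) ^ 2).
  { destruct i; [simpl; nra|]. rewrite S_INR in *. pose proof (pos_INR i). nra. }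
  assert (Hj : INR j <= (INR i + INR j) ^ 2).
  { destruct j; [simpl; nra|]. rewrite S_INR in *. pose proof (pos_INR j). nra. }
  assert (0 <= rho ^ i * rho ^ j) by (apply Rmult_le_pos; auto).
  set (q := rho ^ i * rho ^ j) in *.
  replace (INR i * rho ^ i * Rabs (h - h') * rho ^ j + rho ^ i * (INR j * rho ^ j * Rabs (l - l')))
    with (INR i * (q * Rabs (h - h')) + INR j * (q * Rabs (l - l'))) by (unfold q; ring).
  rewrite Rmult_plus_distr_l, Rmult_plus_distr_l.
  apply Rplus_le_compat; apply Rmult_le_compat_r; auto; apply Rmult_le_pos; auto.
Qed.

Lemma monomial_dy_lipschitz (rho h l h' l' : R) (i j : nat) :
  0 < rho -> box rho h l -> box rho h' l' ->
  Rabs (h ^ i * dpow j l - h' ^ i * dpow j l') <=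
    INR (i + j) ^ 2 * rho ^ (i + j) * ((Rabs (h - h') + Rabs (l - l')) / rho ^ 2).
Proof.
  intros Hr [Hh Hl] [Hh' Hl'].
  assert (H1 := pow_lipschitz rho h h' i Hh Hh').
  assert (H2 := dpow_lipschitz rho l l' j Hl Hl').
  assert (H3 := dpow_bound rho l j Hl). assert (H4 := pow_abs_le rho h' i Hh').
  assert (Pi : 0 <= rho ^ i) by (apply pow_le; lra). assert (Pj : 0 <= rho ^ j) by (apply pow_le; lra).
  pose proof (pos_INR i). pose proof (pos_INR j).
  pose proof (Rabs_pos (h - h')). pose proof (Rabs_pos (l - l')).
  assert (Hr2 : 0 < rho ^ 2) by (apply pow_lt; auto).
  apply Rmult_le_reg_r with (rho ^ 2); auto.
  apply Rle_trans with (Rabs (h ^ i - h' ^ i) * rho * (Rabs (dpow j l) * rho)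
                        + Rabs (h' ^ i) * (Rabs (dpow j l - dpow j l') * rho ^ 2)).
  { replace (h ^ i * dpow j l - h' ^ i * dpow j l') with ((h ^ i - h' ^ i) * dpow j l + h' ^ i * (dpow j l - dpow j l')) by ring.
    assert (HT := Rabs_triang ((h ^ i - h' ^ i) * dpow j l) (h' ^ i * (dpow j l - dpow j l'))).
    rewrite !Rabs_mult in HT. nra. }
  apply Rle_trans with (INR i * rho ^ i * Rabs (h - h') * (INR j * rho ^ j) + rho ^ i * (INR j ^ 2 * rho ^ j * Rabs (l - l'))).
  { apply Rplus_le_compat; apply Rmult_le_compat; auto; try apply Rabs_pos;
      apply Rmult_le_pos; try apply Rabs_pos; lra. }
  rewrite pow_add, plus_INR.
  replace ((INR i + INR j) ^ 2 * (rho ^ i * rho ^ j) * ((Rabs (h - h') + Rabs (l - l')) / rho ^ 2) * rho ^ 2)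
    with ((INR i + INR j) ^ 2 * (rho ^ i * rho ^ j * (Rabs (h - h') + Rabs (l - l')))) by (field; lra).
  assert (0 <= rho ^ i * rho ^ j) by (apply Rmult_le_pos; auto).
  set (q := rho ^ i * rho ^ j) in *.
  replace (INR i * rho ^ i * Rabs (h - h') * (INR j * rho ^ j) + rho ^ i * (INR j ^ 2 * rho ^ j * Rabs (l - l')))
    with (INR i * INR j * (q * Rabs (h - h')) + INR j ^ 2 * (q * Rabs (l - l'))) by (unfold q; ring).
  rewrite Rmult_plus_distr_l, Rmult_plus_distr_l.
  apply Rplus_le_compat; apply Rmult_le_compat_r; try nra; apply Rmult_le_pos; auto.
Qed.

Lemma monomial_taylor (rho h l l' : R) (i j : nat) :
  0 < rho -> box rho h l -> box rho h l' ->
  Rabs (h ^ i * l' ^ j - h ^ i * l ^ j - (l' - l) * (h ^ i * dpow j l)) <=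
    INR (i + j) ^ 2 * rho ^ (i + j) * ((l' - l) ^ 2 / rho ^ 2).
Proof.
  intros Hr [Hh Hl] [_ Hl'].
  assert (H1 := pow_taylor rho l l' j Hl Hl').
  assert (H4 := pow_abs_le rho h i Hh).
  assert (Pi : 0 <= rho ^ i) by (apply pow_le; lra). assert (Pj : 0 <= rho ^ j) by (apply pow_le; lra).
  pose proof (pos_INR i). pose proof (pos_INR j).
  assert (Hr2 : 0 < rho ^ 2) by (apply pow_lt; auto).
  apply Rmult_le_reg_r with (rho ^ 2); auto.
  replace (h ^ i * l' ^ j - h ^ i * l ^ j - (l' - l) * (h ^ i * dpow j l))
    with (h ^ i * (l' ^ j - l ^ j - (l' - l) * dpow j l)) by ring.
  rewrite Rabs_mult, Rmult_assoc.
  apply Rle_trans with (rho ^ i * (INR j ^ 2 * rho ^ j * (l' - l) ^ 2)).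
  { apply Rmult_le_compat; auto; try apply Rabs_pos. apply Rmult_le_pos; [apply Rabs_pos|lra]. }
  rewrite pow_add, plus_INR.
  replace ((INR i + INR j) ^ 2 * (rho ^ i * rho ^ j) * ((l' - l) ^ 2 / rho ^ 2) * rho ^ 2)
    with ((INR i + INR j) ^ 2 * (rho ^ i * rho ^ j * (l' - l) ^ 2)) by (field; lra).
  replace (rho ^ i * (INR j ^ 2 * rho ^ j * (l' - l) ^ 2)) with (INR j ^ 2 * (rho ^ i * rho ^ j * (l' - l) ^ 2)) by ring.
  apply Rmult_le_compat_r; [|nra]. apply Rmult_le_pos; [apply Rmult_le_pos; auto|apply pow2_ge_0].
Qed.

(** Absolute convergence at the single point (r1, r1) bounds the weighted coefficient sums of each
    degree. All other estimates are termwise on a smaller square, and the column of coefficients of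
    y^0 gives the expansion on the axis. *)
Lemma analytic_smooth (F : R -> R -> R) :
  analytic2_at F 0 0 ->
  exists (Fy : R -> R -> R) (a : nat -> R) (r r1 C M : R),
    0 < r /\ 0 < r1 /\ smooth_y F Fy r C /\ (forall n, Rabs (a n) * r1 ^ n <= M) /\
    forall x, Rabs x < r1 -> is_pseries a x (F x 0).
Proof.
  intros (a & r0 & Hr0 & Ha).
  set (r1 := r0 / 2). assert (Hr1 : 0 < r1) by (unfold r1; lra).
  destruct (partial_sum_bounded (fun n => sum_f_R0 (fun i => Rabs (a i (n - i)%nat)) n * r1 ^ n))
    as [M [HM0 HM]].
  { intros n. apply Rmult_le_pos; [|apply pow_le; lra]. apply cond_pos_sum. intros; apply Rabs_pos. }
  { destruct (Ha r1 r1) as [He _]; try (rewrite Rabs_right; unfold r1; lra).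
    revert He. apply ex_series_ext. intros n.
    rewrite Rmult_comm, scal_sum. apply sum_eq. intros i Hi.
    rewrite !Rabs_mult, Rmult_assoc, <- Rabs_mult, <- pow_add.
    replace (i + (n - i))%nat with n by lia.
    f_equal. apply Rabs_right, Rle_ge, pow_le; lra. }
  (* The monomial estimates of degree n cost n^2, which is at most 8^n; since 8 / 16 = 1 / 2, a
     geometric series of ratio 1 / 2 remains. *)
  set (rho := r1 / 16). assert (Hrho : 0 < rho) by (unfold rho; lra).
  (* One summation lemma for the increments of F, those of its y-derivative and the Taylor
     remainder: only the termwise factor [t] changes. *)
  assert (Hterm : forall (t : nat -> nat -> R) (B : R),
    (forall n i, (i <= n)%nat -> Rabs (t n i) <= INR n ^ 2 * rho ^ n * B) -> 0 <= B ->
    ex_series (fun n => sum_f_R0 (fun i => a i (n - i)%nat * t n i) n) /\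
    Rabs (Series (fun n => sum_f_R0 (fun i => a i (n - i)%nat * t n i) n)) <= 2 * (M * B)).
  { intros t B Ht HB. apply series_geom_bound. intros n.
    apply Rle_trans with (1 := sum_abs_le _ _ _ _ (fun i Hi => Ht n i Hi)).
    set (S := sum_f_R0 (fun i => Rabs (a i (n - i)%nat)) n). specialize (HM n). fold S in HM.
    assert (HS : 0 <= S) by (apply cond_pos_sum; intros; apply Rabs_pos).
    assert (Hpow : INR n ^ 2 * rho ^ n <= r1 ^ n * (1 / 2) ^ n).
    { replace (r1 ^ n * (1 / 2) ^ n) with (8 ^ n * rho ^ n).
      - apply Rmult_le_compat_r; [apply pow_le; lra|apply sqr_le_pow8].
      - rewrite <- !Rpow_mult_distr. f_equal. unfold rho; field. }
    assert (0 <= (1 / 2) ^ n) by (apply pow_le; lra).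
    apply Rle_trans with (S * (r1 ^ n * (1 / 2) ^ n * B)).
    - apply Rmult_le_compat_l; auto. apply Rmult_le_compat_r; auto.
    - replace (S * (r1 ^ n * (1 / 2) ^ n * B)) with (S * r1 ^ n * B * (1 / 2) ^ n) by ring.
      apply Rmult_le_compat_r; auto. apply Rmult_le_compat_r; auto. }
  set (P := fun h l n => sum_f_R0 (fun i => a i (n - i)%nat * (h ^ i * l ^ (n - i))) n).
  set (Q := fun h l n => sum_f_R0 (fun i => a i (n - i)%nat * (h ^ i * dpow (n - i) l)) n).
  assert (HF : forall h l, box rho h l -> is_series (P h l) (F h l)).
  { intros h l [Hh Hl]. destruct (Ha h l) as [_ H]; try (unfold rho, r1 in *; lra).
    rewrite !Rplus_0_l in H. revert H. apply is_series_ext. intros n. apply sum_eq. intros i _. ring. }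
  assert (HQ : forall h l, box rho h l -> ex_series (Q h l)).
  { intros h l [Hh Hl]. apply (Hterm (fun n i => h ^ i * dpow (n - i) l) (/ rho)).
    - intros n i Hi. rewrite Rabs_mult.
      assert (H1 := pow_abs_le rho h i Hh). assert (H2 := dpow_bound rho l (n - i) Hl).
      apply Rmult_le_reg_r with rho; auto.
      rewrite !Rmult_assoc, Rinv_l by lra. rewrite Rmult_1_r.
      apply Rle_trans with (rho ^ i * (INR (n - i) * rho ^ (n - i))).
      + apply Rmult_le_compat; auto; try apply Rabs_pos. apply Rmult_le_pos; [apply Rabs_pos|lra].
      + replace (rho ^ n) with (rho ^ i * rho ^ (n - i)) by (rewrite <- pow_add; f_equal; lia).
        assert (0 <= rho ^ i * rho ^ (n - i)) by (apply Rmult_le_pos; apply pow_le; lra).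
        assert (INR (n - i) <= INR n ^ 2).
        { assert (INR (n - i) <= INR n) by (apply le_INR; lia).
          destruct n; [simpl in *; lra|]. rewrite S_INR in *. pose proof (pos_INR n). nra. }
        nra.
    - apply Rlt_le, Rinv_0_lt_compat; auto. }
  set (Fy := fun h l => Series (Q h l)).
  set (C := 2 * (M * / rho) + 2 * (M * / rho ^ 2)).
  assert (Hr2 : 0 < rho ^ 2) by (apply pow_lt; auto).
  assert (Hi1 : 0 < / rho) by (apply Rinv_0_lt_compat; auto).
  assert (Hi2 : 0 < / rho ^ 2) by (apply Rinv_0_lt_compat; auto).
  assert (Hm1 : 0 <= M * / rho) by (apply Rmult_le_pos; lra).
  assert (Hm2 : 0 <= M * / rho ^ 2) by (apply Rmult_le_pos; lra).
  exists Fy, (fun n => a n 0%nat), rho, r1, C, M.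
  split; [auto|]. split; [auto|]. split; [split; [|split]|split].
  - intros x y x' y' Hb Hb'.
    set (d := Rabs (x - x') + Rabs (y - y')).
    assert (Hd : 0 <= d) by (unfold d; pose proof (Rabs_pos (x - x')); pose proof (Rabs_pos (y - y')); lra).
    destruct (Hterm (fun n i => x ^ i * y ^ (n - i) - x' ^ i * y' ^ (n - i)) (d / rho)) as [_ Hs].
    { intros n i Hi. assert (H := monomial_lipschitz rho x y x' y' i (n - i) Hrho Hb Hb').
      replace (i + (n - i))%nat with n in H by lia. exact H. }
    { apply Rmult_le_pos; lra. }
    rewrite (is_series_unique _ (F x y - F x' y')) in Hs.
    + apply Rle_trans with (1 := Hs). unfold C, Rdiv. nra.
    + apply (is_series_ext (fun n => minus (P x y n) (P x' y' n))).
      * intros n. unfold P, minus, plus, opp; simpl. rewrite <- Rminus_def, <- minus_sum.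
        apply sum_eq. intros i _. ring.
      * apply (is_series_minus (P x y) (P x' y')); auto.
  - intros x y x' y' Hb Hb'.
    set (d := Rabs (x - x') + Rabs (y - y')).
    assert (Hd : 0 <= d) by (unfold d; pose proof (Rabs_pos (x - x')); pose proof (Rabs_pos (y - y')); lra).
    destruct (Hterm (fun n i => x ^ i * dpow (n - i) y - x' ^ i * dpow (n - i) y') (d / rho ^ 2)) as [_ Hs].
    { intros n i Hi. assert (H := monomial_dy_lipschitz rho x y x' y' i (n - i) Hrho Hb Hb').
      replace (i + (n - i))%nat with n in H by lia. exact H. }
    { apply Rmult_le_pos; lra. }
    rewrite (is_series_unique _ (Fy x y - Fy x' y')) in Hs.
    + apply Rle_trans with (1 := Hs). unfold C, Rdiv. nra.
    + apply (is_series_ext (fun n => minus (Q x y n) (Q x' y' n))).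
      * intros n. unfold Q, minus, plus, opp; simpl. rewrite <- Rminus_def, <- minus_sum.
        apply sum_eq. intros i _. ring.
      * apply (is_series_minus (Q x y) (Q x' y')); apply Series_correct; auto.
  - intros x y y' Hb Hb'.
    destruct (Hterm (fun n i => x ^ i * y' ^ (n - i) - x ^ i * y ^ (n - i) - (y' - y) * (x ^ i * dpow (n - i) y))
                ((y' - y) ^ 2 / rho ^ 2)) as [_ Hs].
    { intros n i Hi. assert (H := monomial_taylor rho x y y' i (n - i) Hrho Hb Hb').
      replace (i + (n - i))%nat with n in H by lia. exact H. }
    { apply Rmult_le_pos; [apply pow2_ge_0|lra]. }
    rewrite (is_series_unique _ (F x y' - F x y - (y' - y) * Fy x y)) in Hs.
    + apply Rle_trans with (1 := Hs). unfold C, Rdiv. pose proof (pow2_ge_0 (y' - y)). nra.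
    + apply (is_series_ext (fun n => minus (minus (P x y' n) (P x y n)) (scal (y' - y) (Q x y n)))).
      * intros n. unfold P, Q, minus, plus, opp, scal; simpl. unfold mult; simpl.
        rewrite scal_sum, <- !Rminus_def, <- !minus_sum.
        apply sum_eq. intros i _. ring.
      * apply (is_series_minus (fun n => minus (P x y' n) (P x y n)) (fun n => scal (y' - y) (Q x y n))).
        -- apply (is_series_minus (P x y') (P x y)); auto.
        -- apply (is_series_scal (y' - y) (Q x y)). apply Series_correct; auto.
  - intros n. specialize (HM n). apply Rle_trans with (2 := HM).
    apply Rmult_le_compat_r; [apply pow_le; lra|].
    replace (Rabs (a n 0%nat)) with (Rabs (a n (n - n)%nat)) by (rewrite Nat.sub_diag; reflexivity).
    destruct n; [simpl; lra|]. rewrite tech5.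
    assert (0 <= sum_f_R0 (fun i => Rabs (a i (S n - i)%nat)) n) by (apply cond_pos_sum; intros; apply Rabs_pos).
    lra.
  - intros x Hx. destruct (Ha x 0) as [_ H].
    + unfold r1 in Hx; lra.
    + rewrite Rabs_R0; auto.
    + rewrite !Rplus_0_l in H. apply is_pseries_R. revert H. apply is_series_ext. intros n.
      rewrite sum_last_only.
      * rewrite Nat.sub_diag. simpl. ring.
      * intros i Hi. rewrite (pow_i (n - i)) by lia. ring.
Qed.

Lemma lipschitz_box_mono (F : R -> R -> R) (r C r' C' : R) :
  lipschitz_box F r C -> r' <= r -> C <= C' -> lipschitz_box F r' C'.
Proof.
  intros H Hr HC x y x' y' [H1 H2] [H3 H4].
  apply Rle_trans with (C * (Rabs (x - x') + Rabs (y - y'))).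
  - apply H; split; lra.
  - apply Rmult_le_compat_r; auto. pose proof (Rabs_pos (x - x')). pose proof (Rabs_pos (y - y')). lra.
Qed.

Lemma smooth_y_mono (F Fy : R -> R -> R) (r C r' C' : R) :
  smooth_y F Fy r C -> r' <= r -> C <= C' -> smooth_y F Fy r' C'.
Proof.
  intros [H1 [H2 H3]] Hr HC. split; [|split].
  - apply lipschitz_box_mono with r C; auto.
  - apply lipschitz_box_mono with r C; auto.
  - intros x y y' [Hx Hy] [_ Hy']. apply Rle_trans with (C * (y' - y) ^ 2).
    + apply H3; split; lra.
    + apply Rmult_le_compat_r; auto. apply pow2_ge_0.
Qed.

Lemma lipschitz_box_bounded (F : R -> R -> R) (r C : R) :
  0 <= r -> lipschitz_box F r C -> exists B, 0 <= B /\ forall x y, box r x y -> Rabs (F x y) <= B.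
Proof.
  intros Hr H. exists (Rabs (F 0 0) + Rabs C * (r + r)).
  pose proof (Rabs_pos (F 0 0)). pose proof (Rabs_pos C).
  split; [assert (0 <= Rabs C * (r + r)) by (apply Rmult_le_pos; lra); lra|].
  intros x y [Hx Hy].
  assert (HL0 := H x y 0 0 (conj Hx Hy)). rewrite !Rminus_0_r in HL0.
  assert (Hb0 : box r 0 0) by (split; rewrite Rabs_R0; auto).
  specialize (HL0 Hb0).
  replace (F x y) with ((F x y - F 0 0) + F 0 0) by ring.
  apply Rle_trans with (1 := Rabs_triang _ _).
  assert (C * (Rabs x + Rabs y) <= Rabs C * (r + r)); [|lra].
  pose proof (Rabs_pos x). pose proof (Rabs_pos y).
  apply Rle_trans with (Rabs C * (Rabs x + Rabs y)).
  - apply Rmult_le_compat_r; [lra|apply Rle_abs].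
  - apply Rmult_le_compat_l; lra.
Qed.

Lemma lipschitz_box_mult (F G : R -> R -> R) (r C D A B : R) :
  lipschitz_box F r C -> lipschitz_box G r D ->
  (forall x y, box r x y -> Rabs (F x y) <= A) -> (forall x y, box r x y -> Rabs (G x y) <= B) ->
  lipschitz_box (fun x y => F x y * G x y) r (C * B + A * D).
Proof.
  intros HF HG HA HB x y x' y' H H'.
  replace (F x y * G x y - F x' y' * G x' y')
    with ((F x y - F x' y') * G x y + F x' y' * (G x y - G x' y')) by ring.
  apply Rle_trans with (1 := Rabs_triang _ _). rewrite !Rabs_mult.
  specialize (HF _ _ _ _ H H'). specialize (HG _ _ _ _ H H').
  specialize (HA _ _ H'). specialize (HB _ _ H).
  set (d := Rabs (x - x') + Rabs (y - y')) in *.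
  replace ((C * B + A * D) * d) with (C * d * B + A * (D * d)) by ring.
  apply Rplus_le_compat; apply Rmult_le_compat; auto; apply Rabs_pos.
Qed.

Lemma lipschitz_box_const (F : R -> R -> R) (r C : R) : lipschitz_box F r C -> forall c,
  lipschitz_box (fun x y => c * F x y) r (Rabs c * C).
Proof.
  intros H c x y x' y' Hb Hb'. rewrite <- Rmult_minus_distr_l, Rabs_mult, Rmult_assoc.
  apply Rmult_le_compat_l; [apply Rabs_pos|auto].
Qed.

Lemma lipschitz_box_plus (F G : R -> R -> R) (r C D : R) :
  lipschitz_box F r C -> lipschitz_box G r D -> lipschitz_box (fun x y => F x y + G x y) r (C + D).
Proof.
  intros HF HG x y x' y' Hb Hb'. specialize (HF _ _ _ _ Hb Hb'). specialize (HG _ _ _ _ Hb Hb').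
  replace (F x y + G x y - (F x' y' + G x' y')) with ((F x y - F x' y') + (G x y - G x' y')) by ring.
  apply Rle_trans with (1 := Rabs_triang _ _). lra.
Qed.

Lemma smooth_y_mult (F Fy G Gy : R -> R -> R) (r C D : R) :
  0 <= r -> smooth_y F Fy r C -> smooth_y G Gy r D ->
  exists E, smooth_y (fun x y => F x y * G x y) (fun x y => Fy x y * G x y + F x y * Gy x y) r E.
Proof.
  intros Hr [HF [HFy HF2]] [HG [HGy HG2]].
  destruct (lipschitz_box_bounded F r C Hr HF) as [A [HA0 HA]].
  destruct (lipschitz_box_bounded Fy r C Hr HFy) as [A' [HA'0 HA']].
  destruct (lipschitz_box_bounded G r D Hr HG) as [B [HB0 HB]].
  destruct (lipschitz_box_bounded Gy r D Hr HGy) as [B' [HB'0 HB']].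
  assert (H1 := lipschitz_box_mult F G r C D A B HF HG HA HB).
  assert (H2 := lipschitz_box_plus _ _ _ _ _ (lipschitz_box_mult Fy G r C D A' B HFy HG HA' HB)
                  (lipschitz_box_mult F Gy r C D A B' HF HGy HA HB')).
  set (E1 := C * B + A * D) in *. set (E2 := C * B + A' * D + (C * B' + A * D)) in *.
  set (E3 := C * B + A' * D + A * D).
  exists (Rmax E1 (Rmax E2 E3)). split; [|split].
  - apply lipschitz_box_mono with r E1; auto; [lra|apply Rmax_l].
  - apply lipschitz_box_mono with r E2; auto; [lra|].
    apply Rle_trans with (2 := Rmax_r _ _). apply Rmax_l.
  - intros x y y' Hb Hb'.
    apply Rle_trans with (E3 * (y' - y) ^ 2).
    2:{ apply Rmult_le_compat_r; [apply pow2_ge_0|]. apply Rle_trans with (2 := Rmax_r _ _). apply Rmax_r. }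
    assert (HG' := HG x y' x y Hb' Hb). rewrite Rminus_diag, Rabs_R0, Rplus_0_l in HG'.
    specialize (HF2 x y y' Hb Hb'). specialize (HG2 x y y' Hb Hb').
    specialize (HA x y Hb). specialize (HA' x y Hb). specialize (HB x y' Hb').
    set (e := F x y' - F x y - (y' - y) * Fy x y) in *.
    set (f := G x y' - G x y - (y' - y) * Gy x y) in *.
    replace (F x y' * G x y' - F x y * G x y - (y' - y) * (Fy x y * G x y + F x y * Gy x y))
      with (e * G x y' + (y' - y) * Fy x y * (G x y' - G x y) + F x y * f) by (unfold e, f; ring).
    apply Rle_trans with (1 := Rabs_triang _ _).
    assert (T := Rabs_triang (e * G x y') ((y' - y) * Fy x y * (G x y' - G x y))).
    rewrite !Rabs_mult in *.
    assert (S1 : Rabs e * Rabs (G x y') <= C * (y' - y) ^ 2 * B) by (apply Rmult_le_compat; auto; apply Rabs_pos).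
    assert (S3 : Rabs (F x y) * Rabs f <= A * (D * (y' - y) ^ 2)) by (apply Rmult_le_compat; auto; apply Rabs_pos).
    assert (S2 : Rabs (y' - y) * Rabs (Fy x y) * Rabs (G x y' - G x y) <= Rabs (y' - y) * A' * (D * Rabs (y' - y))).
    { apply Rmult_le_compat; auto; try apply Rabs_pos.
      - apply Rmult_le_pos; apply Rabs_pos.
      - apply Rmult_le_compat_l; auto; apply Rabs_pos. }
    replace (Rabs (y' - y) * A' * (D * Rabs (y' - y))) with (A' * D * (Rabs (y' - y) ^ 2)) in S2 by ring.
    rewrite pow2_abs in S2. unfold E3. lra.
Qed.

Lemma smooth_y_inv (F Fy : R -> R -> R) (r C m : R) :
  0 <= r -> 0 < m -> smooth_y F Fy r C -> (forall x y, box r x y -> m <= Rabs (F x y)) ->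
  exists E, smooth_y (fun x y => / F x y) (fun x y => - Fy x y * (/ F x y * / F x y)) r E.
Proof.
  intros Hr Hm [HF [HFy HF2]] HFm.
  destruct (lipschitz_box_bounded Fy r C Hr HFy) as [A' [HA'0 HA']].
  assert (Hn : forall x y, box r x y -> F x y <> 0).
  { intros x y Hb E. specialize (HFm x y Hb). rewrite E, Rabs_R0 in HFm. lra. }
  assert (HI : forall x y, box r x y -> Rabs (/ F x y) <= / m).
  { intros x y Hb. rewrite Rabs_inv. apply Rinv_le_contravar; auto. }
  assert (Him : 0 < / m) by (apply Rinv_0_lt_compat; auto).
  set (E1 := C * (/ m * / m)).
  assert (H1 : lipschitz_box (fun x y => / F x y) r E1).
  { intros x y x' y' Hb Hb'.
    replace (/ F x y - / F x' y') with (- ((F x y - F x' y') * (/ F x y * / F x' y'))) by (field; auto).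
    rewrite Rabs_Ropp, !Rabs_mult. unfold E1.
    replace (C * (/ m * / m) * (Rabs (x - x') + Rabs (y - y')))
      with (C * (Rabs (x - x') + Rabs (y - y')) * (/ m * / m)) by ring.
    apply Rmult_le_compat; auto; try apply Rabs_pos.
    - apply Rmult_le_pos; apply Rabs_pos.
    - apply Rmult_le_compat; auto; apply Rabs_pos. }
  assert (HI2 : forall x y, box r x y -> Rabs (/ F x y * / F x y) <= / m * / m).
  { intros x y Hb. rewrite Rabs_mult. apply Rmult_le_compat; auto; apply Rabs_pos. }
  assert (H2 := lipschitz_box_mult _ _ r E1 E1 (/ m) (/ m) H1 H1 HI HI). cbv beta in H2.
  assert (H3 := lipschitz_box_const _ _ _ HFy (-1)).
  assert (HA'' : forall x y, box r x y -> Rabs (-1 * Fy x y) <= A').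
  { intros x y Hb. replace (-1 * Fy x y) with (- Fy x y) by ring. rewrite Rabs_Ropp; auto. }
  assert (H4 := lipschitz_box_mult _ _ r _ _ A' (/ m * / m) H3 H2 HA'' HI2). cbv beta in H4.
  set (E2 := Rabs (-1) * C * (/ m * / m) + A' * (E1 * / m + / m * E1)) in *.
  set (E3 := C * (/ m * / m) + A' * C * (/ m * / m * / m)).
  exists (Rmax E1 (Rmax E2 E3)). split; [|split].
  - apply lipschitz_box_mono with r E1; auto; [lra|apply Rmax_l].
  - apply lipschitz_box_mono with r E2; auto; [|lra|].
    + intros x y x' y' Hb Hb'. specialize (H4 _ _ _ _ Hb Hb').
      replace (- Fy x y * (/ F x y * / F x y) - - Fy x' y' * (/ F x' y' * / F x' y'))
        with (-1 * Fy x y * (/ F x y * / F x y) - -1 * Fy x' y' * (/ F x' y' * / F x' y')) by ring.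
      exact H4.
    + apply Rle_trans with (2 := Rmax_r _ _). apply Rmax_l.
  - intros x y y' Hb Hb'.
    apply Rle_trans with (E3 * (y' - y) ^ 2).
    2:{ apply Rmult_le_compat_r; [apply pow2_ge_0|]. apply Rle_trans with (2 := Rmax_r _ _). apply Rmax_r. }
    assert (HG' := HF x y' x y Hb' Hb). rewrite Rminus_diag, Rabs_R0, Rplus_0_l in HG'.
    specialize (HF2 x y y' Hb Hb'). specialize (HA' x y Hb).
    assert (I1 := HI x y Hb). assert (I2 := HI x y' Hb').
    assert (N1 := Hn x y Hb). assert (N2 := Hn x y' Hb').
    set (e := F x y' - F x y - (y' - y) * Fy x y) in *.
    replace (/ F x y' - / F x y - (y' - y) * (- Fy x y * (/ F x y * / F x y)))
      with (- (e * (/ F x y * / F x y')) + (y' - y) * Fy x y * ((F x y' - F x y) * (/ F x y * / F x y * / F x y')))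
      by (unfold e; field; auto).
    apply Rle_trans with (1 := Rabs_triang _ _).
    rewrite Rabs_Ropp, !Rabs_mult.
    assert (I3 : Rabs (/ F x y) * Rabs (/ F x y') <= / m * / m) by (apply Rmult_le_compat; auto; apply Rabs_pos).
    assert (I4 : Rabs (/ F x y) * Rabs (/ F x y) * Rabs (/ F x y') <= / m * / m * / m).
    { apply Rmult_le_compat; auto; try apply Rabs_pos.
      - apply Rmult_le_pos; apply Rabs_pos.
      - apply Rmult_le_compat; auto; apply Rabs_pos. }
    assert (S1 : Rabs e * (Rabs (/ F x y) * Rabs (/ F x y')) <= C * (y' - y) ^ 2 * (/ m * / m)).
    { apply Rmult_le_compat; auto; try apply Rabs_pos. apply Rmult_le_pos; apply Rabs_pos. }
    assert (S2 : Rabs (y' - y) * Rabs (Fy x y) * (Rabs (F x y' - F x y) * (Rabs (/ F x y) * Rabs (/ F x y) * Rabs (/ F x y')))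
       <= Rabs (y' - y) * A' * (C * Rabs (y' - y) * (/ m * / m * / m))).
    { apply Rmult_le_compat.
      - apply Rmult_le_pos; apply Rabs_pos.
      - repeat apply Rmult_le_pos; apply Rabs_pos.
      - apply Rmult_le_compat_l; auto; apply Rabs_pos.
      - apply Rmult_le_compat; auto; try apply Rabs_pos. repeat apply Rmult_le_pos; apply Rabs_pos. }
    replace (Rabs (y' - y) * A' * (C * Rabs (y' - y) * (/ m * / m * / m)))
      with (A' * C * (/ m * / m * / m) * Rabs (y' - y) ^ 2) in S2 by ring.
    rewrite pow2_abs in S2. unfold E3. lra.
Qed.

Definition slope (W : vector_field) (x y : R) : R := vY W x y * / vX W x y.

Definition regular_field (W : vector_field) (Fy : R -> R -> R) (r C m : R) : Prop :=
  0 < r /\ 0 < m /\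
  (forall x y, box r x y -> vdom W (x, y)) /\
  (forall x y, box r x y -> m <= vX W x y * sign (vX W 0 0)) /\
  lipschitz_box (vX W) r C /\ lipschitz_box (vY W) r C /\ smooth_y (slope W) Fy r C.

Definition power_series_bound (a : nat -> R) (r M : R) : Prop :=
  forall n, Rabs (a n) * r ^ n <= M.

Lemma analytic_field_regular (W : vector_field) :
  analytic_field W -> vX W 0 0 <> 0 ->
  exists (Fy : R -> R -> R) (r C m : R) (a b : nat -> R) (rho M : R),
    regular_field W Fy r C m /\ 0 < rho /\
    power_series_bound a rho M /\ power_series_bound b rho M /\
    forall x, Rabs x < rho -> is_pseries a x (vX W x 0) /\ is_pseries b x (vY W x 0).
Proof.
  intros (Ho & Hd & Ha) HX. destruct (Ha 0 0 Hd) as [HaX HaY].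
  destruct (analytic_smooth _ HaX) as (Xy & a & r1 & rho1 & C1 & M1 & Hr1 & Hrho1 & HsX & HMa & Hpa).
  destruct (analytic_smooth _ HaY) as (Yy & b & r2 & rho2 & C2 & M2 & Hr2 & Hrho2 & HsY & HMb & Hpb).
  destruct (Ho (0, 0) Hd) as [r3 Hr3].
  set (x0 := Rabs (vX W 0 0)). assert (Hx0 : 0 < x0) by (apply Rabs_pos_lt; auto).
  set (D := Rmax 0 (Rmax C1 C2)).
  assert (HD0 : 0 <= D) by apply Rmax_l.
  assert (HD1 : C1 <= D) by (apply Rle_trans with (2 := Rmax_r _ _); apply Rmax_l).
  assert (HD2 : C2 <= D) by (apply Rle_trans with (2 := Rmax_r _ _); apply Rmax_r).
  (* The last radius keeps the variation of X on the square below half of |X(0, 0)|, so X keeps its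
     sign and the slope Y / X is as smooth as X and Y. *)
  set (r := Rmin (Rmin r1 r2) (Rmin (r3 / 2) (x0 / (4 * (D + 1))))).
  assert (Hr4 : 0 < x0 / (4 * (D + 1))) by (apply Rdiv_lt_0_compat; lra).
  assert (Hr : 0 < r) by (unfold r; pose proof (cond_pos r3); repeat apply Rmin_pos; lra).
  assert (L1 : r <= r1) by rmin.
  assert (L2 : r <= r2) by rmin.
  assert (L3 : r <= r3 / 2) by rmin.
  assert (L4 : r <= x0 / (4 * (D + 1))) by rmin.
  assert (SX : smooth_y (vX W) Xy r D) by (apply smooth_y_mono with r1 C1; auto).
  assert (SY : smooth_y (vY W) Yy r D) by (apply smooth_y_mono with r2 C2; auto).
  assert (Hm : forall x y, box r x y -> x0 / 2 <= vX W x y * sign (vX W 0 0)).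
  { intros x y [Hx Hy]. destruct SX as [HL _].
    assert (Hb0 : box r 0 0) by (split; rewrite Rabs_R0; lra).
    specialize (HL x y 0 0 (conj Hx Hy) Hb0). rewrite !Rminus_0_r in HL.
    assert (HB : D * (Rabs x + Rabs y) <= x0 / 2).
    { apply Rle_trans with (D * (2 * (x0 / (4 * (D + 1))))).
      - apply Rmult_le_compat_l; auto; lra.
      - assert (D / (D + 1) <= 1) by (apply (Rdiv_le_1 D (D + 1)); lra).
        replace (D * (2 * (x0 / (4 * (D + 1))))) with (D / (D + 1) * (x0 / 2)) by (field; lra). nra. }
    assert (E : x0 = vX W 0 0 * sign (vX W 0 0)).
    { unfold x0. destruct (Rdichotomy _ _ HX).
      - rewrite sign_eq_m1, Rabs_left; lra.
      - rewrite sign_eq_1, Rabs_right; lra. }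
    assert (HB2 : Rabs (vX W x y - vX W 0 0) <= x0 / 2) by lra.
    apply Rabs_le_between in HB2.
    destruct (Rdichotomy _ _ HX).
    - rewrite sign_eq_m1 in *; lra.
    - rewrite sign_eq_1 in *; lra. }
  assert (Hsgn : Rabs (sign (vX W 0 0)) = 1).
  { destruct (Rdichotomy _ _ HX).
    - rewrite sign_eq_m1, Rabs_left; lra.
    - rewrite sign_eq_1, Rabs_right; lra. }
  destruct (smooth_y_inv (vX W) Xy r D (x0 / 2)) as [E1 HE1]; [lra|lra|auto| |].
  { intros x y Hb. specialize (Hm x y Hb). apply Rle_trans with (1 := Hm).
    apply Rle_trans with (1 := Rle_abs _). rewrite Rabs_mult, Hsgn. lra. }
  destruct (smooth_y_mult _ _ _ _ r D E1 (Rlt_le _ _ Hr) SY HE1) as [E2 HE2].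
  set (rho := Rmin rho1 rho2). assert (Hrho : 0 < rho) by (apply Rmin_pos; auto).
  assert (Hpow : forall n rho', rho <= rho' -> rho ^ n <= rho' ^ n) by (intros; apply pow_incr; lra).
  exists (fun x y => Yy x y * / vX W x y + vY W x y * (- Xy x y * (/ vX W x y * / vX W x y))), r,
    (Rmax D E2), (x0 / 2), a, b, rho, (Rmax M1 M2).
  split; [|split; [auto|split; [|split]]].
  - split; [auto|]. split; [lra|]. split; [|split; [auto|split; [|split]]].
    + intros x y [Hx Hy]. apply Hr3. pose proof (cond_pos r3).
      split; simpl; unfold ball; simpl; unfold AbsRing_ball, minus, plus, opp, abs; simpl;
        rewrite Ropp_0, Rplus_0_r; lra.
    + apply lipschitz_box_mono with r D; [apply SX|lra|apply Rmax_l].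
    + apply lipschitz_box_mono with r D; [apply SY|lra|apply Rmax_l].
    + apply smooth_y_mono with r E2; [|lra|apply Rmax_r]. exact HE2.
  - intros n. apply Rle_trans with (2 := Rmax_l _ _). apply Rle_trans with (2 := HMa n).
    apply Rmult_le_compat_l; [apply Rabs_pos|]. apply Hpow, Rmin_l.
  - intros n. apply Rle_trans with (2 := Rmax_r _ _). apply Rle_trans with (2 := HMb n).
    apply Rmult_le_compat_l; [apply Rabs_pos|]. apply Hpow, Rmin_r.
  - intros x Hx. split; [apply Hpa|apply Hpb]; apply Rlt_le_trans with (1 := Hx); [apply Rmin_l|apply Rmin_r].
Qed.

(** * First integrals of dy/dx = F(x, y) *)

Lemma lipschitz_continuous (f : R -> R) (L x : R) :
  (forall a b, Rabs (f a - f b) <= L * Rabs (a - b)) -> continuous f x.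
Proof.
  intros H. apply continuous_eps. intros eps He.
  exists (eps / (Rabs L + 1)). pose proof (Rabs_pos L).
  split; [apply Rdiv_lt_0_compat; lra|]. intros y Hy.
  apply Rle_lt_trans with (1 := H y x).
  apply Rle_lt_trans with ((Rabs L + 1) * Rabs (y - x)).
  - apply Rmult_le_compat_r; [apply Rabs_pos|]. pose proof (Rle_abs L). lra.
  - apply Rmult_lt_compat_l with (r := Rabs L + 1) in Hy; [|lra].
    replace ((Rabs L + 1) * (eps / (Rabs L + 1))) with eps in Hy by (field; lra). exact Hy.
Qed.

Lemma RInt_bound (f : R -> R) (a b D : R) :
  (forall t, continuous f t) -> (forall t, Rmin a b <= t <= Rmax a b -> Rabs (f t) <= D) ->
  Rabs (RInt f a b) <= D * Rabs (b - a).
Proof.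
  intros Hc HD.
  assert (Hi : forall c d, ex_RInt f c d).
  { intros c d. apply (ex_RInt_continuous (V := R_CompleteNormedModule)). intros; apply Hc. }
  destruct (Rle_dec a b).
  - rewrite Rmin_left, Rmax_right in HD by lra.
    rewrite (Rabs_right (b - a)) by lra. rewrite Rmult_comm. apply abs_RInt_le_const; auto.
  - rewrite Rmin_right, Rmax_left in HD by lra.
    rewrite <- opp_RInt_swap by auto. unfold opp; simpl. rewrite Rabs_Ropp.
    rewrite (Rabs_left (b - a)) by lra. replace (D * - (b - a)) with ((a - b) * D) by ring.
    apply abs_RInt_le_const; auto; lra.
Qed.

Lemma geometric_limit (u : nat -> R) (D : R) :
  (forall n, Rabs (u (S n) - u n) <= D * (1 / 2) ^ n) ->
  exists l, forall n, Rabs (u n - l) <= 2 * D * (1 / 2) ^ n.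
Proof.
  intros H.
  assert (HD : 0 <= D) by (specialize (H 0%nat); simpl in H; pose proof (Rabs_pos (u 1%nat - u 0%nat)); lra).
  destruct (series_geom_bound (fun n => u (S n) - u n) D H) as [[l Hl] _].
  exists (u 0%nat + l). intros n.
  assert (Hm : forall k, Rabs (u n - u (n + k)%nat) <= 2 * D * (1 / 2) ^ n * (1 - (1 / 2) ^ k)).
  { induction k as [|k IH].
    - rewrite Nat.add_0_r, Rminus_diag, Rabs_R0. simpl. lra.
    - replace (n + S k)%nat with (S (n + k)) by lia.
      replace (u n - u (S (n + k))) with ((u n - u (n + k)%nat) - (u (S (n + k)) - u (n + k)%nat)) by ring.
      apply Rle_trans with (1 := Rabs_triang _ _). rewrite Rabs_Ropp.
      specialize (H (n + k)%nat). rewrite pow_add in H. simpl. lra. }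
  assert (Hlim : is_lim_seq u (u 0%nat + l)).
  { apply is_lim_seq_incr_1.
    apply is_lim_seq_ext with (fun m => u 0%nat + sum_n (fun n => u (S n) - u n) m).
    - induction n0 as [|m IH].
      + rewrite sum_O. ring.
      + rewrite sum_Sn. unfold plus; simpl. lra.
    - apply (is_lim_seq_plus' (fun _ => u 0%nat)); [apply is_lim_seq_const|exact Hl]. }
  apply Rnot_lt_le. intros Hlt.
  apply is_lim_seq_spec in Hlim.
  set (e := Rabs (u n - (u 0%nat + l)) - 2 * D * (1 / 2) ^ n).
  assert (He : 0 < e) by (unfold e; lra).
  destruct (Hlim (mkposreal e He)) as [N HN]. simpl in HN.
  specialize (HN (n + N)%nat ltac:(lia)). specialize (Hm N).
  assert (T := Rabs_triang (u n - u (n + N)%nat) (u (n + N)%nat - (u 0%nat + l))).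
  replace (u n - u (n + N)%nat + (u (n + N)%nat - (u 0%nat + l))) with (u n - (u 0%nat + l)) in T by ring.
  assert (0 <= (1 / 2) ^ N) by (apply pow_le; lra). assert (0 <= (1 / 2) ^ n) by (apply pow_le; lra).
  assert (0 <= 2 * D * (1 / 2) ^ n * (1 / 2) ^ N) by (repeat apply Rmult_le_pos; lra).
  unfold e in HN. lra.
Qed.

Lemma geometric_zero (x C : R) : (forall n, x <= C * (1 / 2) ^ n) -> x <= 0.
Proof.
  intros H. apply Rnot_lt_le. intros Hx.
  assert (HC : 0 < C) by (specialize (H 0%nat); simpl in H; lra).
  destruct (pow_lt_1_zero (1 / 2) ltac:(rewrite Rabs_right; lra) (x / C)) as [N HN].
  { apply Rdiv_lt_0_compat; lra. }
  specialize (HN N (le_n _)). specialize (H N).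
  rewrite Rabs_right in HN by (apply Rle_ge, pow_le; lra).
  apply Rmult_lt_compat_l with (r := C) in HN; auto.
  replace (C * (x / C)) with x in HN by (field; lra). lra.
Qed.

Section Solutions.

Variables (F Fy : R -> R -> R) (r K M : R).
Hypothesis r_pos : 0 < r.
Hypothesis K_pos : 0 <= K.
Hypothesis F_smooth : smooth_y F Fy r K.
Hypothesis F_bound : forall x y, box r x y -> Rabs (F x y) <= M.
(* makes the Picard operator on [-r, r] a contraction of ratio 1/2 *)
Hypothesis r_small : 4 * (K * r) <= 1.

(* The truncated right-hand side is bounded and Lipschitz on the whole plane. *)
Definition trunc (G : R -> R -> R) (x y : R) : R := G (clamp (- r) r x) (clamp (- r) r y).

Lemma clamp_box (x y : R) : box r (clamp (- r) r x) (clamp (- r) r y).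
Proof. split; apply Rabs_le; apply clamp_in; lra. Qed.

Lemma trunc_eq (G : R -> R -> R) (x y : R) : box r x y -> trunc G x y = G x y.
Proof.
  intros [Hx Hy]. apply Rabs_le_between in Hx. apply Rabs_le_between in Hy.
  unfold trunc. rewrite !clamp_id by lra. reflexivity.
Qed.

Lemma trunc_lipschitz (G : R -> R -> R) : lipschitz_box G r K -> forall x y x' y',
  Rabs (trunc G x y - trunc G x' y') <= K * (Rabs (x - x') + Rabs (y - y')).
Proof.
  intros HG x y x' y'. unfold trunc.
  apply Rle_trans with (1 := HG _ _ _ _ (clamp_box x y) (clamp_box x' y')).
  apply Rmult_le_compat_l; auto. apply Rplus_le_compat; apply clamp_lip; lra.
Qed.

Lemma trunc_bound (x y : R) : Rabs (trunc F x y) <= M.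
Proof. apply F_bound, clamp_box. Qed.

Lemma M_pos : 0 <= M.
Proof. pose proof (trunc_bound 0 0). pose proof (Rabs_pos (trunc F 0 0)). lra. Qed.

Lemma trunc_comp_continuous (G : R -> R -> R) (f : R -> R) (L s : R) : lipschitz_box G r K ->
  (forall a b, Rabs (f a - f b) <= L * Rabs (a - b)) -> continuous (fun t => trunc G t (f t)) s.
Proof.
  intros HG Hf. apply lipschitz_continuous with (K * (1 + L)). intros a b.
  apply Rle_trans with (1 := trunc_lipschitz G HG _ _ _ _). rewrite Rmult_assoc.
  apply Rmult_le_compat_l; auto. specialize (Hf a b). lra.
Qed.

(** Truncation makes every solution global, so [y0] is arbitrary; whether the solution stays in the
    square, where truncation is invisible, is checked later by [sol_box]. *)
Lemma picard (x0 y0 : R) : - r <= x0 <= r ->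
  exists Y : R -> R, Y x0 = y0 /\ (forall a b, Rabs (Y a - Y b) <= M * Rabs (a - b)) /\
    forall s, - r < s < r -> is_derive Y s (trunc F s (Y s)).
Proof.
  intros Hx0. destruct F_smooth as [FL _]. pose proof M_pos as HM.
  (* Clamping the upper bound of the integral makes all iterates M-Lipschitz on the whole line,
     hence all integrands continuous. *)
  set (step := fun (f : R -> R) (s : R) => y0 + RInt (fun t => trunc F t (f t)) x0 (clamp (- r) r s)).
  set (Yn := fun n => Nat.iter n step (fun _ => y0)).
  assert (Hex : forall f a b, (forall a b, Rabs (f a - f b) <= M * Rabs (a - b)) ->
     ex_RInt (fun t => trunc F t (f t)) a b).
  { intros f a b Hf. apply (ex_RInt_continuous (V := R_CompleteNormedModule)). intros s _.
    apply trunc_comp_continuous with M; auto. }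
  assert (Hstep : forall f, (forall a b, Rabs (f a - f b) <= M * Rabs (a - b)) ->
     forall a b, Rabs (step f a - step f b) <= M * Rabs (a - b)).
  { intros f Hf a b. unfold step.
    rewrite <- (RInt_Chasles (fun t => trunc F t (f t)) x0 (clamp (- r) r b) (clamp (- r) r a)) by auto.
    unfold plus; simpl.
    assert (E : forall u v : R, y0 + (u + v) - (y0 + u) = v) by (intros; ring). rewrite E.
    apply Rle_trans with (M * Rabs (clamp (- r) r a - clamp (- r) r b)).
    - apply RInt_bound; [intros; apply trunc_comp_continuous with M; auto|intros; apply trunc_bound].
    - apply Rmult_le_compat_l; auto. apply clamp_lip; lra. }
  assert (HYL : forall n a b, Rabs (Yn n a - Yn n b) <= M * Rabs (a - b)).
  { induction n as [|n IH]; intros a b.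
    - simpl. rewrite Rminus_diag, Rabs_R0. apply Rmult_le_pos; auto; apply Rabs_pos.
    - apply (Hstep (Yn n) IH). }
  assert (Hlen : forall s, Rabs (clamp (- r) r s - x0) <= 2 * r).
  { intros s. apply Rabs_le. pose proof (clamp_in (- r) r s ltac:(lra)). lra. }
  assert (Hcontr : forall f g B, (forall a b, Rabs (f a - f b) <= M * Rabs (a - b)) ->
     (forall a b, Rabs (g a - g b) <= M * Rabs (a - b)) -> (forall s, Rabs (f s - g s) <= B) ->
     forall s, Rabs (step f s - step g s) <= B / 2).
  { intros f g B Hf Hg HB s. unfold step.
    assert (E0 : forall a b c : R, c = a - b -> y0 + a - (y0 + b) = c) by (intros; subst; ring).
    rewrite (E0 _ _ _ (RInt_minus (V := R_CompleteNormedModule) _ _ _ _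
               (Hex f x0 (clamp (- r) r s) Hf) (Hex g x0 (clamp (- r) r s) Hg))).
    assert (HB0 : 0 <= B) by (pose proof (HB 0); pose proof (Rabs_pos (f 0 - g 0)); lra).
    apply Rle_trans with (K * B * Rabs (clamp (- r) r s - x0)).
    - apply RInt_bound.
      + intros t. apply (continuous_minus (V := R_NormedModule) (fun t => trunc F t (f t)) (fun t => trunc F t (g t)));
          apply trunc_comp_continuous with M; auto.
      + intros t _. apply Rle_trans with (1 := trunc_lipschitz F FL _ _ _ _).
        apply Rmult_le_compat_l; auto. rewrite Rminus_diag, Rabs_R0, Rplus_0_l. auto.
    - apply Rle_trans with (K * B * (2 * r)).
      + apply Rmult_le_compat_l; auto. apply Rmult_le_pos; auto.
      + replace (K * B * (2 * r)) with (4 * (K * r) * (B / 2)) by field.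
        rewrite <- (Rmult_1_l (B / 2)) at 2. apply Rmult_le_compat_r; lra. }
  set (D := M * (2 * r)).
  assert (HD : forall n s, Rabs (Yn (S n) s - Yn n s) <= D * (1 / 2) ^ n).
  { induction n as [|n IH]; intros s.
    - simpl. unfold step.
      assert (E : forall u : R, y0 + u - y0 = u) by (intros; ring). rewrite E.
      rewrite Rmult_1_r. apply Rle_trans with (M * Rabs (clamp (- r) r s - x0)).
      + apply RInt_bound; [|intros; apply trunc_bound].
        intros t. apply (trunc_comp_continuous F (fun _ => y0) M); auto. apply (HYL 0%nat).
      + apply Rmult_le_compat_l; auto.
    - assert (H := Hcontr (Yn (S n)) (Yn n) _ (HYL (S n)) (HYL n) IH s).
      simpl pow. replace (D * (1 / 2 * (1 / 2) ^ n)) with (D * (1 / 2) ^ n / 2) by field. exact H. }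
  destruct (functional_choice (fun s l => forall n, Rabs (Yn n s - l) <= 2 * D * (1 / 2) ^ n)) as [Y HY].
  { intros s. apply geometric_limit. intros n. apply HD. }
  assert (HYlip : forall a b, Rabs (Y a - Y b) <= M * Rabs (a - b)).
  { intros a b. apply Rminus_le. apply geometric_zero with (4 * D). intros n.
    assert (T1 := HY a n). assert (T2 := HY b n). assert (T3 := HYL n a b).
    replace (Y a - Y b) with (- (Yn n a - Y a) + (Yn n a - Yn n b) + (Yn n b - Y b)) by ring.
    assert (T4 := Rabs_triang (- (Yn n a - Y a) + (Yn n a - Yn n b)) (Yn n b - Y b)).
    assert (T5 := Rabs_triang (- (Yn n a - Y a)) (Yn n a - Yn n b)). rewrite Rabs_Ropp in T5. lra. }
  assert (HYfix : forall s, Y s = step Y s).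
  { intros s. apply Rminus_diag_uniq. apply Rabs_eq_0. apply Rle_antisym; [|apply Rabs_pos].
    apply geometric_zero with (2 * D). intros n.
    assert (T1 := HY s (S n)).
    assert (T2 := Hcontr (Yn n) Y (2 * D * (1 / 2) ^ n) (HYL n) HYlip (fun s => HY s n) s).
    change (step (Yn n) s) with (Yn (S n) s) in T2.
    replace (Y s - step Y s) with (- (Yn (S n) s - Y s) + (Yn (S n) s - step Y s)) by ring.
    assert (T4 := Rabs_triang (- (Yn (S n) s - Y s)) (Yn (S n) s - step Y s)). rewrite Rabs_Ropp in T4.
    simpl pow in T1. lra. }
  exists Y. split; [|split; auto].
  - rewrite HYfix. unfold step. rewrite clamp_id by lra. rewrite RInt_point. unfold zero; simpl. ring.
  - intros s Hs.
    apply (is_derive_ext_loc (fun s => y0 + RInt (fun t => trunc F t (Y t)) x0 s)).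
    + assert (Hd : 0 < Rmin (s + r) (r - s)) by (apply Rmin_pos; lra).
      exists (mkposreal _ Hd). intros t Ht. rewrite (HYfix t). unfold step. rewrite clamp_id; auto.
      unfold ball in Ht; simpl in Ht. unfold AbsRing_ball, minus, plus, opp, abs in Ht; simpl in Ht.
      apply Rabs_def2 in Ht. pose proof (Rmin_l (s + r) (r - s)). pose proof (Rmin_r (s + r) (r - s)). lra.
    + rewrite <- (Rplus_0_l (trunc F s (Y s))).
      apply (is_derive_plus (V := R_NormedModule) (fun _ => y0)); [apply (is_derive_const (V := R_NormedModule))|].
      apply (is_derive_RInt (fun t => trunc F t (Y t)) _ x0).
      * apply filter_forall. intros b. apply (RInt_correct (V := R_CompleteNormedModule)). apply Hex; auto.
      * apply trunc_comp_continuous with M; auto.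
Qed.

Definition solution (y : R -> R) : Prop := forall s, - r < s < r -> is_derive y s (trunc F s (y s)).

(** The squared difference, which is differentiable, grows at most by exp(2 K |s - t|); as 4 K r is
    at most 1 this is at most e, hence at most 3, and the square root of 3 is below 2. The estimate
    holds in both directions of x. *)
Lemma gronwall (y1 y2 : R -> R) (s t : R) :
  solution y1 -> solution y2 -> - r < s < r -> - r < t < r ->
  Rabs (y1 s - y2 s) <= 2 * Rabs (y1 t - y2 t).
Proof.
  intros H1 H2 Hs Ht. destruct F_smooth as [FL _].
  set (N := fun s => (y1 s - y2 s) ^ 2).
  assert (HN : forall s, 0 <= N s) by (intros; apply pow2_ge_0).
  set (dN := fun c z => (2 * (y1 z - y2 z) * (trunc F z (y1 z) - trunc F z (y2 z)) + c * N z) * exp (c * z)).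
  assert (Hder : forall c z, - r < z < r -> is_derive (fun z => N z * exp (c * z)) z (dN c z)).
  { intros c z Hz. unfold dN, N. specialize (H1 z Hz). specialize (H2 z Hz).
    evar_last.
    { auto_derive.
      - repeat split; [exists (trunc F z (y1 z))|exists (trunc F z (y2 z))]; auto.
      - reflexivity. }
    replace (Derive (fun x : R => y1 x) z) with (trunc F z (y1 z)) by (symmetry; apply is_derive_unique; exact H1).
    replace (Derive (fun x : R => y2 x) z) with (trunc F z (y2 z)) by (symmetry; apply is_derive_unique; exact H2).
    simpl. ring. }
  assert (Hest : forall z, Rabs (2 * (y1 z - y2 z) * (trunc F z (y1 z) - trunc F z (y2 z))) <= 2 * K * N z).
  { intros z. unfold N. rewrite <- (pow2_abs (y1 z - y2 z)). rewrite !Rabs_mult, (Rabs_right 2) by lra.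
    assert (T := trunc_lipschitz F FL z (y1 z) z (y2 z)). rewrite Rminus_diag, Rabs_R0, Rplus_0_l in T.
    pose proof (Rabs_pos (y1 z - y2 z)). nra. }
  assert (Hexp : forall x, x <= 1 -> exp x <= 3).
  { intros x Hx. apply Rle_trans with (exp 1); [|apply exp_le_3].
    destruct (Req_dec x 1) as [->|]; [lra|]. apply Rlt_le, exp_increasing; lra. }
  assert (Hmain : N s <= 3 * N t).
  { destruct (Rle_dec t s).
    - destruct (mean_value (fun z => N z * exp (- (2 * K) * z)) (dN (- (2 * K))) t s r0) as [c [Hc E]].
      { intros x Hx. apply Hder; lra. }
      assert (Hle : N s * exp (- (2 * K) * s) <= N t * exp (- (2 * K) * t)).
      { assert (T := Hest c). apply Rabs_le_between in T.
        pose proof (exp_pos (- (2 * K) * c)). unfold dN in E.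
        assert ((2 * (y1 c - y2 c) * (trunc F c (y1 c) - trunc F c (y2 c)) + - (2 * K) * N c) *
          exp (- (2 * K) * c) * (s - t) <= 0); [|lra].
        assert ((2 * (y1 c - y2 c) * (trunc F c (y1 c) - trunc F c (y2 c)) + - (2 * K) * N c) *
          exp (- (2 * K) * c) <= 0) by nra. nra. }
      assert (HE : N s <= N t * exp (2 * K * (s - t))).
      { replace (2 * K * (s - t)) with (- (2 * K) * t + 2 * K * s) by ring. rewrite exp_plus.
        replace (N s) with (N s * exp (- (2 * K) * s) * exp (2 * K * s)).
        - rewrite <- Rmult_assoc. apply Rmult_le_compat_r; auto. apply Rlt_le, exp_pos.
        - rewrite Rmult_assoc, <- exp_plus. replace (- (2 * K) * s + 2 * K * s) with 0 by ring. rewrite exp_0; ring. }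
      specialize (Hexp (2 * K * (s - t)) ltac:(nra)). specialize (HN t). nra.
    - destruct (mean_value (fun z => N z * exp ((2 * K) * z)) (dN (2 * K)) s t ltac:(lra)) as [c [Hc E]].
      { intros x Hx. apply Hder; lra. }
      assert (Hle : N s * exp (2 * K * s) <= N t * exp (2 * K * t)).
      { assert (T := Hest c). apply Rabs_le_between in T.
        pose proof (exp_pos (2 * K * c)). unfold dN in E.
        assert (0 <= (2 * (y1 c - y2 c) * (trunc F c (y1 c) - trunc F c (y2 c)) + (2 * K) * N c) *
          exp (2 * K * c) * (t - s)); [|lra].
        assert (0 <= (2 * (y1 c - y2 c) * (trunc F c (y1 c) - trunc F c (y2 c)) + (2 * K) * N c) *
          exp (2 * K * c)) by nra. nra. }
      assert (HE : N s <= N t * exp (2 * K * (t - s))).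
      { replace (2 * K * (t - s)) with (2 * K * t + - (2 * K) * s) by ring. rewrite exp_plus.
        replace (N s) with (N s * exp (2 * K * s) * exp (- (2 * K) * s)).
        - rewrite <- Rmult_assoc. apply Rmult_le_compat_r; auto. apply Rlt_le, exp_pos.
        - rewrite Rmult_assoc, <- exp_plus. replace (2 * K * s + - (2 * K) * s) with 0 by ring. rewrite exp_0; ring. }
      specialize (Hexp (2 * K * (t - s)) ltac:(nra)). specialize (HN t). nra. }
  unfold N in Hmain. rewrite <- (pow2_abs (y1 s - y2 s)), <- (pow2_abs (y1 t - y2 t)) in Hmain.
  pose proof (Rabs_pos (y1 s - y2 s)). pose proof (Rabs_pos (y1 t - y2 t)). nra.
Qed.

(** Two solutions changing order would meet, and by [gronwall] they would then coincide at t. *)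
Lemma solution_order (y1 y2 : R -> R) (s t : R) :
  solution y1 -> solution y2 -> - r < s < r -> - r < t < r -> y1 t < y2 t -> y1 s < y2 s.
Proof.
  intros H1 H2 Hs Ht Hlt. apply Rnot_le_lt. intros Hle.
  assert (Hz : exists c, Rmin s t <= c <= Rmax s t /\ y2 c - y1 c = 0).
  { apply (ivt (fun z => y2 z - y1 z)).
    - apply Rminmax.
    - intros z Hz. apply (continuous_minus (V := R_NormedModule) y2 y1).
      + apply (is_derive_continuous _ _ _ (H2 z ltac:(unfold Rmin, Rmax in Hz; destruct (Rle_dec s t); lra))).
      + apply (is_derive_continuous _ _ _ (H1 z ltac:(unfold Rmin, Rmax in Hz; destruct (Rle_dec s t); lra))).
    - unfold Rmin, Rmax; destruct (Rle_dec s t); repeat destruct Rle_dec; lra. }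
  destruct Hz as [c [Hc E]].
  assert (G := gronwall y1 y2 t c H1 H2 Ht ltac:(unfold Rmin, Rmax in Hc; destruct (Rle_dec s t); lra)).
  replace (y1 c - y2 c) with 0 in G by lra. rewrite Rabs_R0 in G.
  rewrite Rabs_left in G by lra. lra.
Qed.

Variable sol : R -> R -> R -> R.
Hypothesis sol_spec : forall x y, - r < x < r ->
  sol x y x = y /\ (forall a b, Rabs (sol x y a - sol x y b) <= M * Rabs (a - b)) /\ solution (sol x y).

Lemma sol_near (x y s : R) : - r < x < r -> Rabs (sol x y s - y) <= M * Rabs (s - x).
Proof.
  intros Hx. destruct (sol_spec x y Hx) as [E [HL _]].
  rewrite <- E at 2. apply HL.
Qed.

Lemma sol_unique (x y : R) (f : R -> R) (s : R) :
  - r < x < r -> - r < s < r -> solution f -> f x = y -> f s = sol x y s.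
Proof.
  intros Hx Hs Hf E. destruct (sol_spec x y Hx) as [E' [_ Hsol]].
  assert (G := gronwall f (sol x y) s x Hf Hsol Hs Hx).
  rewrite E, E', Rminus_diag, Rabs_R0, Rmult_0_r in G.
  pose proof (Rabs_pos (f s - sol x y s)).
  apply Rminus_diag_uniq, Rabs_eq_0. lra.
Qed.

(** First order expansion of the flow with respect to its starting point. It replaces
    differentiability of the flow in two variables: contracted with a curve tangent to the slope
    field its linear part vanishes. *)
Lemma sol_local (x y x' y' : R) : - r < x < r -> - r < x' < r -> box r x y ->
  Rabs (sol x' y' x - y - ((y' - y) - trunc F x y * (x' - x))) <=
    K * (1 + M) * (Rabs (x' - x) + Rabs (y' - y)) * Rabs (x' - x).
Proof.
  intros Hx Hx' Hb. destruct F_smooth as [FL _]. pose proof M_pos as HM.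
  destruct (sol_spec x' y' Hx') as [E' [HL Hsol]].
  assert (Hmv : exists c, Rmin x x' <= c <= Rmax x x' /\
     sol x' y' x - y' = trunc F c (sol x' y' c) * (x - x')).
  { destruct (Rle_dec x x').
    - destruct (mean_value (sol x' y') (fun z => trunc F z (sol x' y' z)) x x' r0) as [c [Hc E]].
      + intros z Hz. apply Hsol; lra.
      + exists c. rewrite Rmin_left, Rmax_right by lra. split; auto. rewrite E' in E. lra.
    - destruct (mean_value (sol x' y') (fun z => trunc F z (sol x' y' z)) x' x ltac:(lra)) as [c [Hc E]].
      + intros z Hz. apply Hsol; lra.
      + exists c. rewrite Rmin_right, Rmax_left by lra. split; auto. rewrite E' in E. lra. }
  destruct Hmv as [c [Hc E]].
  replace (sol x' y' x - y - ((y' - y) - trunc F x y * (x' - x)))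
    with ((trunc F x y - trunc F c (sol x' y' c)) * (x' - x)) by nra.
  rewrite Rabs_mult. apply Rmult_le_compat_r; [apply Rabs_pos|].
  apply Rle_trans with (1 := trunc_lipschitz F FL _ _ _ _).
  rewrite Rmult_assoc. apply Rmult_le_compat_l; auto.
  assert (H1 : Rabs (x - c) <= Rabs (x' - x)).
  { unfold Rmin, Rmax, Rabs in *; destruct (Rle_dec x x'); repeat destruct Rcase_abs; lra. }
  assert (H2 : Rabs (c - x') <= Rabs (x' - x)).
  { unfold Rmin, Rmax, Rabs in *; destruct (Rle_dec x x'); repeat destruct Rcase_abs; lra. }
  assert (H3 := sol_near x' y' c Hx').
  replace (y - sol x' y' c) with (- (sol x' y' c - y') - (y' - y)) by ring.
  assert (H4 := Rabs_triang (- (sol x' y' c - y')) (- (y' - y))). rewrite !Rabs_Ropp in H4.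
  assert (H5 : M * Rabs (c - x') <= M * Rabs (x' - x)) by (apply Rmult_le_compat_l; auto).
  pose proof (Rabs_pos (y' - y)). unfold Rminus at 2.
  assert (0 <= M * Rabs (y' - y)) by (apply Rmult_le_pos; auto). lra.
Qed.

(** * The first integral read on the line x = p *)

Variables (p rho : R).
Hypothesis p_in : - rho < p < rho.
Hypothesis rho_le : rho <= r.
Hypothesis rho_M : 4 * (M * rho) <= r.

(** A point is transported along its solution to the line x = p, where its ordinate is read. On that
    line the first integral is y itself, which makes its derivatives at p explicit. *)
Definition fi (x y : R) : R := sol x y p.

Lemma fi_flow (x y x' : R) : - r < x < r -> - r < x' < r -> fi x y = fi x' (sol x y x').
Proof.
  intros Hx Hx'. unfold fi. apply sol_unique; auto; try lra. apply (sol_spec x y Hx).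
Qed.

Lemma fi_lipschitz_y (x y y' : R) : - r < x < r -> Rabs (fi x y' - fi x y) <= 2 * Rabs (y' - y).
Proof.
  intros Hx. unfold fi. destruct (sol_spec x y Hx) as [E [_ H]]. destruct (sol_spec x y' Hx) as [E' [_ H']].
  assert (G := gronwall (sol x y') (sol x y) p x H' H ltac:(lra) Hx). rewrite E, E' in G. exact G.
Qed.

Lemma fi_increasing (x y y' : R) : - r < x < r -> y < y' -> y' - y <= 2 * (fi x y' - fi x y).
Proof.
  intros Hx Hlt. unfold fi. destruct (sol_spec x y Hx) as [E [_ H]]. destruct (sol_spec x y' Hx) as [E' [_ H']].
  assert (G := gronwall (sol x y') (sol x y) x p H' H Hx ltac:(lra)).
  assert (O := solution_order (sol x y) (sol x y') p x H H' ltac:(lra) Hx).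
  rewrite E, E' in *. specialize (O Hlt). rewrite !Rabs_right in G by lra. lra.
Qed.

Lemma fi_lipschitz (x y x' y' : R) : - r < x < r -> - r < x' < r ->
  Rabs (fi x' y' - fi x y) <= (2 + 2 * M) * (Rabs (x' - x) + Rabs (y' - y)).
Proof.
  intros Hx Hx'. rewrite (fi_flow x' y' x) by auto.
  apply Rle_trans with (1 := fi_lipschitz_y _ _ _ Hx).
  assert (H := sol_near x' y' x Hx'). rewrite Rabs_minus_sym in H.
  assert (H2 := Rabs_triang (sol x' y' x - y') (y' - y)).
  replace (sol x' y' x - y' + (y' - y)) with (sol x' y' x - y) in H2 by ring.
  rewrite (Rabs_minus_sym x x') in H. rewrite Rabs_minus_sym in H.
  pose proof M_pos. pose proof (Rabs_pos (x' - x)). pose proof (Rabs_pos (y' - y)). nra.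
Qed.

Lemma fi_constant (g1 g2 : R -> R) (t vx : R) :
  - r < g1 t < r -> - r < g2 t < r ->
  is_derive g1 t vx -> is_derive g2 t (F (g1 t) (g2 t) * vx) ->
  is_derive (fun s => fi (g1 s) (g2 s)) t 0.
Proof.
  intros Hx Hy H1 H2. set (x := g1 t) in *. set (y := g2 t) in *. set (vy := F x y * vx) in *.
  assert (Hb : box r x y) by (split; apply Rabs_le; lra).
  pose proof M_pos as HM.
  apply is_derive_eps. intros eps He.
  set (A := Rabs (F x y)). set (L := Rabs vx + Rabs vy + 2). set (C := K * (1 + M)).
  assert (HA : 0 <= A) by apply Rabs_pos.
  assert (HL : 0 < L) by (unfold L; pose proof (Rabs_pos vx); pose proof (Rabs_pos vy); lra).
  assert (HC : 0 <= C) by (apply Rmult_le_pos; lra).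
  set (e := Rmin 1 (eps / (4 * (1 + A)))).
  assert (He0 : 0 < e) by (apply Rmin_pos; [lra|apply Rdiv_lt_0_compat; lra]).
  assert (He1 : e <= 1) by apply Rmin_l.
  assert (He2 : e * (1 + A) <= eps / 4).
  { apply Rle_trans with (eps / (4 * (1 + A)) * (1 + A)); [apply Rmult_le_compat_r; [lra|apply Rmin_r]|].
    right; field; lra. }
  destruct (proj1 (is_derive_eps _ _ _) H1 e He0) as [d1 [Hd1 D1]].
  destruct (proj1 (is_derive_eps _ _ _) H2 e He0) as [d2 [Hd2 D2]].
  destruct (proj1 (continuous_eps _ _) (is_derive_continuous _ _ _ H1) (Rmin (x + r) (r - x))) as [d3 [Hd3 D3]].
  { apply Rmin_pos; lra. }
  set (d4 := eps / (4 * (C + 1) * L * L)).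
  assert (Hd4 : 0 < d4).
  { apply Rdiv_lt_0_compat; auto. repeat apply Rmult_lt_0_compat; lra. }
  exists (Rmin (Rmin d1 d2) (Rmin d3 d4)). split; [repeat apply Rmin_pos; auto|].
  intros s Hs.
  assert (Hs1 : Rabs (s - t) < d1) by rmin.
  assert (Hs2 : Rabs (s - t) < d2) by rmin.
  assert (Hs3 : Rabs (s - t) < d3) by rmin.
  assert (Hs4 : Rabs (s - t) < d4) by rmin.
  specialize (D1 s Hs1). specialize (D2 s Hs2). specialize (D3 s Hs3). fold x in D1, D3. fold y in D2.
  set (x' := g1 s) in *. set (y' := g2 s) in *. set (h := Rabs (s - t)) in *.
  assert (Hh : 0 <= h) by apply Rabs_pos.
  assert (Hx' : - r < x' < r).
  { apply Rabs_def2 in D3. pose proof (Rmin_l (x + r) (r - x)). pose proof (Rmin_r (x + r) (r - x)). lra. }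
  rewrite Rmult_0_l, Rminus_0_r. change (g1 t) with x. change (g2 t) with y.
  rewrite (fi_flow x' y' x) by auto.
  apply Rle_trans with (1 := fi_lipschitz_y _ _ _ Hx).
  assert (S := sol_local x y x' y' Hx Hx' Hb). rewrite trunc_eq in S by auto. fold C in S.
  assert (Bx : Rabs (x' - x) <= L * h).
  { replace (x' - x) with ((x' - x - vx * (s - t)) + vx * (s - t)) by ring.
    apply Rle_trans with (1 := Rabs_triang _ _). rewrite Rabs_mult. fold h.
    unfold L. pose proof (Rabs_pos vy). nra. }
  assert (Bxy : Rabs (x' - x) + Rabs (y' - y) <= L * h).
  { replace (x' - x) with ((x' - x - vx * (s - t)) + vx * (s - t)) by ring.
    replace (y' - y) with ((y' - y - vy * (s - t)) + vy * (s - t)) by ring.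
    assert (T1 := Rabs_triang (x' - x - vx * (s - t)) (vx * (s - t))).
    assert (T2 := Rabs_triang (y' - y - vy * (s - t)) (vy * (s - t))).
    rewrite Rabs_mult in T1, T2. fold h in T1, T2. unfold L. nra. }
  assert (Bm : Rabs (y' - y - F x y * (x' - x)) <= eps / 4 * h).
  { replace (y' - y - F x y * (x' - x)) with ((y' - y - vy * (s - t)) - F x y * (x' - x - vx * (s - t)))
      by (unfold vy; ring).
    apply Rle_trans with (1 := Rabs_triang _ _). rewrite Rabs_Ropp, Rabs_mult. fold A.
    assert (A * Rabs (x' - x - vx * (s - t)) <= A * (e * h)) by (apply Rmult_le_compat_l; auto). nra. }
  assert (Bq : C * (Rabs (x' - x) + Rabs (y' - y)) * Rabs (x' - x) <= eps / 4 * h).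
  { apply Rle_trans with (C * (L * h) * (L * h)).
    - pose proof (Rabs_pos (x' - x)). pose proof (Rabs_pos (y' - y)).
      apply Rmult_le_compat; auto; [apply Rmult_le_pos; lra|]. apply Rmult_le_compat_l; auto.
    - assert (Hq : C * L * L * h <= eps / 4).
      { apply Rle_trans with ((C + 1) * L * L * d4).
        - apply Rmult_le_compat; [repeat apply Rmult_le_pos; lra|auto| |lra].
          apply Rmult_le_compat_r; [lra|]. apply Rmult_le_compat_r; lra.
        - unfold d4. right. field. split; lra. }
      replace (C * (L * h) * (L * h)) with (C * L * L * h * h) by ring. apply Rmult_le_compat_r; auto. }
  assert (T := Rabs_triang (sol x' y' x - y - ((y' - y) - F x y * (x' - x))) ((y' - y) - F x y * (x' - x))).
  replace (sol x' y' x - y - (y' - y - F x y * (x' - x)) + (y' - y - F x y * (x' - x)))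
    with (sol x' y' x - y) in T by ring.
  lra.
Qed.

(** The logarithm of the solution, at p, of the linearized equation along the orbit through (x, 0)
    with value 1 at x: its exponential is the y-derivative of [fi] on the axis. *)
Definition fi_rate (x : R) : R := RInt (fun t => trunc Fy t (sol x 0 t)) x p.

Lemma rate_continuous (x t : R) : - r < x < r -> continuous (fun t => trunc Fy t (sol x 0 t)) t.
Proof.
  intros Hx. apply trunc_comp_continuous with M; [apply F_smooth|apply (sol_spec x 0 Hx)].
Qed.

Lemma sol_box (x y s : R) : - rho < x < rho -> - rho < s < rho -> Rabs y < r / 2 -> Rabs (sol x y s) < r.
Proof.
  intros Hx Hs Hy. assert (H := sol_near x y s ltac:(lra)). pose proof M_pos.
  assert (Rabs (s - x) <= 2 * rho) by (apply Rabs_le; lra).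
  assert (M * Rabs (s - x) <= M * (2 * rho)) by (apply Rmult_le_compat_l; auto).
  replace (sol x y s) with ((sol x y s - y) + y) by ring.
  apply Rle_lt_trans with (1 := Rabs_triang _ _). lra.
Qed.

Lemma fi_dy (x : R) : - rho < x < rho -> is_derive (fi x) 0 (exp (fi_rate x)).
Proof.
  intros Hx. assert (Hxr : - r < x < r) by lra. pose proof M_pos as HM.
  set (a := fun t => trunc Fy t (sol x 0 t)).
  assert (Hac : forall t, continuous a t) by (intros t; apply rate_continuous; auto).
  destruct (lipschitz_box_bounded Fy r K ltac:(lra) (proj1 (proj2 F_smooth))) as [B [HB0 HB]].
  assert (HaB : forall t, Rabs (a t) <= B) by (intros t; apply HB, clamp_box).
  set (I := fun s => RInt a x s).
  assert (HI : forall s, is_derive I s (a s)).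
  { intros s. apply (is_derive_RInt a I x); auto. apply filter_forall. intros b.
    apply (RInt_correct (V := R_CompleteNormedModule)).
    apply (ex_RInt_continuous (V := R_CompleteNormedModule)). auto. }
  set (Q := exp (B * (2 * r))).
  assert (HQ : 0 < Q) by apply exp_pos.
  assert (HIB : forall s, - r < s < r -> exp (- I s) <= Q /\ exp (I s) <= Q).
  { intros s Hs.
    assert (HIs : Rabs (I s) <= B * (2 * r)).
    { apply Rle_trans with (B * Rabs (s - x)).
      - apply RInt_bound; auto.
      - apply Rmult_le_compat_l; auto. apply Rabs_le; lra. }
    apply Rabs_le_between in HIs. unfold Q.
    split; (match goal with |- exp ?u <= exp ?v => destruct (Req_dec u v) as [->|]; [lra|] end);
      apply Rlt_le, exp_increasing; lra. }
  set (C := Q * (Q * (4 * K) * (2 * r))).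
  assert (HC : 0 <= C) by (unfold C; repeat apply Rmult_le_pos; lra).
  assert (Hest : forall y', Rabs y' < r / 2 -> Rabs (fi x y' - fi x 0 - exp (fi_rate x) * y') <= C * y' ^ 2).
  { intros y' Hy'.
    destruct (sol_spec x 0 Hxr) as [E0 [_ S0]]. destruct (sol_spec x y' Hxr) as [E1 [_ S1]].
    set (D := fun s => sol x y' s - sol x 0 s).
    set (rem := fun s => trunc F s (sol x y' s) - trunc F s (sol x 0 s) - D s * a s).
    assert (HD : forall s, - r < s < r -> Rabs (D s) <= 2 * Rabs y').
    { intros s Hs. assert (G := gronwall (sol x y') (sol x 0) s x S1 S0 Hs Hxr).
      rewrite E0, E1, Rminus_0_r in G. exact G. }
    assert (Hrem : forall s, - rho < s < rho -> Rabs (rem s) <= 4 * K * y' ^ 2).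
    { intros s Hs. assert (B0 := sol_box x 0 s Hx Hs ltac:(rewrite Rabs_R0; lra)).
      assert (B1 := sol_box x y' s Hx Hs Hy').
      assert (Hsr : Rabs s <= r) by (apply Rabs_le; lra).
      unfold rem, a, D. rewrite !trunc_eq by (split; lra).
      destruct F_smooth as [_ [_ F2]].
      assert (T := F2 s (sol x 0 s) (sol x y' s) ltac:(split; lra) ltac:(split; lra)).
      apply Rle_trans with (1 := T). specialize (HD s ltac:(lra)). unfold D in HD.
      rewrite <- (pow2_abs (sol x y' s - sol x 0 s)), <- (pow2_abs y').
      pose proof (Rabs_pos (sol x y' s - sol x 0 s)).
      replace (4 * K * Rabs y' ^ 2) with (K * (2 * Rabs y') ^ 2) by ring.
      apply Rmult_le_compat_l; auto. apply pow_incr. lra. }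
    (* With the integrating factor of the linearized equation, the difference of the two solutions
       has a derivative of order [y'] squared, so the quotient of its end values is the claimed
       derivative up to a quadratic error. *)
    set (f := fun s => D s * exp (- I s)).
    assert (Hf : forall s, - r < s < r -> is_derive f s (rem s * exp (- I s))).
    { intros s Hs. specialize (S0 s Hs). specialize (S1 s Hs). specialize (HI s). unfold f, D.
      evar_last.
      { auto_derive.
        - repeat split; eexists; eassumption.
        - reflexivity. }
      replace (Derive (fun x0 : R => sol x y' x0) s) with (trunc F s (sol x y' s)) by (symmetry; apply is_derive_unique; exact S1).
      replace (Derive (fun x0 : R => sol x 0 x0) s) with (trunc F s (sol x 0 s)) by (symmetry; apply is_derive_unique; exact S0).
      replace (Derive (fun x0 : R => I x0) s) with (a s) by (symmetry; apply is_derive_unique; exact HI).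
      unfold rem, D. simpl. ring. }
    assert (Hdiff : Rabs (f p - f x) <= Q * (4 * K) * (2 * r) * y' ^ 2).
    { assert (Hmv : exists c, - rho < c < rho /\ Rabs (f p - f x) = Rabs (rem c * exp (- I c) * (p - x))).
      { destruct (Rle_dec x p).
        - destruct (mean_value f (fun s => rem s * exp (- I s)) x p r0) as [c [Hc E]].
          + intros z Hz; apply Hf; lra.
          + exists c. split; [lra|]. rewrite E. reflexivity.
        - destruct (mean_value f (fun s => rem s * exp (- I s)) p x ltac:(lra)) as [c [Hc E]].
          + intros z Hz; apply Hf; lra.
          + exists c. split; [lra|]. rewrite Rabs_minus_sym, E, !Rabs_mult, (Rabs_minus_sym p x). reflexivity. }
      destruct Hmv as [c [Hc E]]. rewrite E, !Rabs_mult.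
      specialize (Hrem c Hc). destruct (HIB c ltac:(lra)) as [Q1 _].
      rewrite (Rabs_right (exp _)) by (apply Rle_ge, Rlt_le, exp_pos).
      assert (Hp : Rabs (p - x) <= 2 * r) by (apply Rabs_le; lra).
      pose proof (exp_pos (- I c)). pose proof (Rabs_pos (rem c)). pose proof (Rabs_pos (p - x)).
      replace (Q * (4 * K) * (2 * r) * y' ^ 2) with (4 * K * y' ^ 2 * Q * (2 * r)) by ring.
      apply Rmult_le_compat; auto; [apply Rmult_le_pos; lra|]. apply Rmult_le_compat; auto; lra. }
    assert (Ex : f x = y').
    { unfold f, D, I. rewrite E0, E1, RInt_point. unfold zero; simpl. rewrite Ropp_0, exp_0. ring. }
    assert (Ep : fi x y' - fi x 0 = f p * exp (fi_rate x)).
    { unfold f, fi_rate, fi. fold a. fold (I p). unfold D. rewrite Rmult_assoc, <- exp_plus.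
      replace (- I p + I p) with 0 by ring. rewrite exp_0. ring. }
    rewrite Ep, <- Ex.
    replace (f p * exp (fi_rate x) - exp (fi_rate x) * f x) with (exp (fi_rate x) * (f p - f x)) by ring.
    rewrite Ex, Rabs_mult, (Rabs_right (exp _)) by (apply Rle_ge, Rlt_le, exp_pos).
    destruct (HIB p ltac:(lra)) as [_ Q2]. unfold C.
    replace (Q * (Q * (4 * K) * (2 * r)) * y' ^ 2) with (Q * (Q * (4 * K) * (2 * r) * y' ^ 2)) by ring.
    rewrite <- Ex at 1. apply Rmult_le_compat; auto; [apply Rlt_le, exp_pos|apply Rabs_pos]. }
  apply is_derive_eps. intros eps He.
  exists (Rmin (r / 2) (eps / (C + 1))).
  split; [apply Rmin_pos; [lra|apply Rdiv_lt_0_compat; lra]|].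
  intros y Hy. rewrite !Rminus_0_r in *.
  assert (H1 : Rabs y < r / 2) by rmin.
  assert (H2 : Rabs y < eps / (C + 1)) by rmin.
  apply Rle_trans with (1 := Hest y H1). rewrite <- pow2_abs.
  pose proof (Rabs_pos y).
  assert (H3 : (C + 1) * Rabs y <= eps).
  { apply Rlt_le. apply Rmult_lt_compat_l with (r := C + 1) in H2; [|lra].
    replace ((C + 1) * (eps / (C + 1))) with eps in H2 by (field; lra). exact H2. }
  nra.
Qed.

(** Constancy along solutions exchanges a step in x for a step of - F(x, 0) in y, to which [fi_dy]
    applies. *)
Lemma fi_axis_derive (x : R) : - rho < x < rho ->
  is_derive (fun x => fi x 0) x (- F x 0 * exp (fi_rate x)).
Proof.
  intros Hx. assert (Hxr : - r < x < r) by lra. pose proof M_pos as HM.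
  assert (Hb : box r x 0) by (split; [apply Rabs_le|rewrite Rabs_R0]; lra).
  assert (Hd := fi_dy x Hx). set (e := exp (fi_rate x)) in *.
  apply is_derive_eps. intros eps He.
  assert (He0 : 0 < e) by apply exp_pos.
  set (C := K * (1 + M)). assert (HC : 0 <= C) by (apply Rmult_le_pos; lra).
  destruct (proj1 (is_derive_eps _ _ _) Hd (eps / (2 * (M + 1)))) as [d1 [Hd1 D1]].
  { apply Rdiv_lt_0_compat; lra. }
  set (d2 := d1 / (M + 1)). assert (Hd2 : 0 < d2) by (apply Rdiv_lt_0_compat; lra).
  set (d3 := eps / (2 * ((C + 1) * e))).
  assert (Hd3 : 0 < d3).
  { apply Rdiv_lt_0_compat; auto. apply Rmult_lt_0_compat; [lra|]. apply Rmult_lt_0_compat; lra. }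
  exists (Rmin (Rmin (x + r) (r - x)) (Rmin d2 d3)). split; [repeat apply Rmin_pos; lra|].
  intros x' Hx'.
  assert (A1 : Rabs (x' - x) < x + r) by rmin.
  assert (A2 : Rabs (x' - x) < r - x) by rmin.
  assert (A3 : Rabs (x' - x) < d2) by rmin.
  assert (A4 : Rabs (x' - x) < d3) by rmin.
  clear Hx'. assert (Hx'r : - r < x' < r) by (apply Rabs_def2 in A1; apply Rabs_def2 in A2; lra).
  rewrite (fi_flow x' 0 x) by auto.
  set (y' := sol x' 0 x).
  assert (S1 := sol_near x' 0 x Hx'r). fold y' in S1. rewrite Rminus_0_r, (Rabs_minus_sym x x') in S1.
  assert (S2 := sol_local x 0 x' 0 Hxr Hx'r Hb). fold y' in S2.
  rewrite trunc_eq, !Rminus_0_r, Rabs_R0, Rplus_0_r in S2 by auto. fold C in S2.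
  set (h := Rabs (x' - x)) in *. assert (Hh : 0 <= h) by apply Rabs_pos.
  assert (Hy1 : Rabs y' < d1).
  { apply Rle_lt_trans with (1 := S1). apply Rle_lt_trans with ((M + 1) * h); [apply Rmult_le_compat_r; lra|].
    apply Rmult_lt_compat_l with (r := M + 1) in A3; [|lra].
    unfold d2 in A3. replace ((M + 1) * (d1 / (M + 1))) with d1 in A3 by (field; lra). exact A3. }
  specialize (D1 y'). rewrite !Rminus_0_r in D1. specialize (D1 Hy1).
  replace (fi x y' - fi x 0 - - F x 0 * e * (x' - x))
    with ((fi x y' - fi x 0 - e * y') + e * (y' - (0 - F x 0 * (x' - x)))) by ring.
  apply Rle_trans with (1 := Rabs_triang _ _). rewrite Rabs_mult, (Rabs_right e) by lra.
  assert (B1 : eps / (2 * (M + 1)) * Rabs y' <= eps / 2 * h).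
  { apply Rle_trans with (eps / (2 * (M + 1)) * ((M + 1) * h)).
    - apply Rmult_le_compat_l; [apply Rlt_le, Rdiv_lt_0_compat; lra|].
      apply Rle_trans with (1 := S1). apply Rmult_le_compat_r; lra.
    - right. field. lra. }
  assert (B2 : e * (C * h * h) <= eps / 2 * h).
  { replace (e * (C * h * h)) with (e * C * h * h) by ring. apply Rmult_le_compat_r; auto.
    apply Rle_trans with (e * (C + 1) * d3).
    - apply Rmult_le_compat; [apply Rmult_le_pos; lra|lra|apply Rmult_le_compat_l; lra|lra].
    - unfold d3. right. field. split; lra. }
  assert (B3 : e * Rabs (y' - (0 - F x 0 * (x' - x))) <= e * (C * h * h)) by (apply Rmult_le_compat_l; lra).
  lra.
Qed.

(** The only place where the normalization at p pays off: the weight of the slope in the derivative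
    of the first integral is 1 - Fy(p, 0) (x - p) up to o(x - p), whatever the field does
    elsewhere. *)
Lemma fi_rate_derive : is_derive (fun x => exp (fi_rate x)) p (- Fy p 0) /\ fi_rate p = 0.
Proof.
  assert (E0 : fi_rate p = 0) by (unfold fi_rate; rewrite RInt_point; reflexivity).
  split; [|exact E0]. pose proof M_pos as HM.
  assert (Hpb : box r p 0) by (split; [apply Rabs_le|rewrite Rabs_R0]; lra).
  assert (HJ : is_derive fi_rate p (- Fy p 0)).
  { apply is_derive_eps. intros eps He.
    set (C := K * (1 + M)). assert (HC : 0 <= C) by (apply Rmult_le_pos; lra).
    exists (Rmin (Rmin (p + r) (r - p)) (eps / (C + 1))).
    split; [repeat apply Rmin_pos; try lra; apply Rdiv_lt_0_compat; lra|].
    intros x Hx.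
    assert (A1 : Rabs (x - p) < p + r) by rmin.
    assert (A2 : Rabs (x - p) < r - p) by rmin.
    assert (A3 : Rabs (x - p) < eps / (C + 1)) by rmin.
    clear Hx. assert (Hxr : - r < x < r) by (apply Rabs_def2 in A1; apply Rabs_def2 in A2; lra).
    rewrite E0, Rminus_0_r. unfold fi_rate. set (a := fun t => trunc Fy t (sol x 0 t)).
    assert (Hac : forall t, continuous a t) by (intros t; apply rate_continuous; auto).
    assert (Hex : ex_RInt a x p).
    { apply (ex_RInt_continuous (V := R_CompleteNormedModule)). auto. }
    assert (Es : RInt (fun t => a t - Fy p 0) x p = RInt a x p - - Fy p 0 * (x - p)).
    { transitivity (RInt a x p - RInt (fun _ => Fy p 0) x p).
      - exact (RInt_minus (V := R_CompleteNormedModule) a (fun _ => Fy p 0) x p Hex (ex_RInt_const _ _ _)).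
      - rewrite RInt_const. unfold scal; simpl; unfold mult; simpl. ring. }
    rewrite <- Es.
    set (h := Rabs (x - p)) in *. assert (Hh : 0 <= h) by apply Rabs_pos.
    apply Rle_trans with (C * h * Rabs (p - x)).
    - apply RInt_bound.
      + intros t. apply (continuous_minus (V := R_NormedModule) a); [auto|apply continuous_const].
      + intros t Ht. unfold a. rewrite <- (trunc_eq Fy p 0) by auto.
        apply Rle_trans with (1 := trunc_lipschitz Fy (proj1 (proj2 F_smooth)) _ _ _ _).
        unfold C. rewrite Rmult_assoc. apply Rmult_le_compat_l; auto.
        assert (S1 := sol_near x 0 t Hxr). rewrite Rminus_0_r in *.
        assert (Rabs (t - p) <= h) by (unfold h, Rmin, Rmax, Rabs in *; destruct (Rle_dec x p); repeat destruct Rcase_abs; lra).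
        assert (Rabs (t - x) <= h) by (unfold h, Rmin, Rmax, Rabs in *; destruct (Rle_dec x p); repeat destruct Rcase_abs; lra).
        assert (M * Rabs (t - x) <= M * h) by (apply Rmult_le_compat_l; auto). lra.
    - rewrite Rabs_minus_sym. fold h. apply Rmult_le_compat_r; auto.
      apply Rle_trans with ((C + 1) * (eps / (C + 1))).
      + apply Rmult_le_compat; lra.
      + right. field. lra. }
  replace (- Fy p 0) with (scal (- Fy p 0) (exp (fi_rate p))).
  - apply (is_derive_comp exp fi_rate); [apply is_derive_exp|exact HJ].
  - rewrite E0, exp_0. unfold scal; simpl; unfold mult; simpl. ring.
Qed.

End Solutions.

(* [H] is a first integral of dy/dx = F(x, y) near the axis, equal to y on the
   line x = p, so that [E] (its y-derivative on the axis) is known to first order at p. *)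
Definition first_integral (F : R -> R -> R) (H : R -> R -> R) (E : R -> R) (xl xr ry C : R) : Prop :=
  0 < C /\ 0 < ry /\
  (forall x x' y y', xl < x < xr -> xl < x' < xr ->
     Rabs (H x' y' - H x y) <= C * (Rabs (x' - x) + Rabs (y' - y))) /\
  (forall x y y', xl < x < xr -> y < y' -> y' - y <= C * (H x y' - H x y)) /\
  (forall (g1 g2 : R -> R) (t vx : R), xl < g1 t < xr -> Rabs (g2 t) < ry ->
     is_derive g1 t vx -> is_derive g2 t (F (g1 t) (g2 t) * vx) ->
     is_derive (fun s => H (g1 s) (g2 s)) t 0) /\
  (forall x y, xl < x < xr -> Rabs y < ry / 2 ->
     exists eta : R -> R, eta x = y /\ forall s, xl < s < xr ->
       Rabs (eta s) < ry /\ (forall s', Rabs (eta s - eta s') <= C * Rabs (s - s')) /\ H s (eta s) = H x y /\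
       is_derive eta s (F s (eta s))) /\
  (forall x, xl < x < xr -> 0 < E x /\ is_derive (fun x => H x 0) x (- F x 0 * E x)).

Lemma first_integral_exists (F Fy : R -> R -> R) (r K M rho : R) :
  0 < r -> 0 <= K -> smooth_y F Fy r K -> (forall x y, box r x y -> Rabs (F x y) <= M) ->
  4 * (K * r) <= 1 -> rho <= r -> 4 * (M * rho) <= r ->
  forall p, - rho < p < rho ->
  exists (H : R -> R -> R) (E : R -> R) (C : R),
    first_integral F H E (- rho) rho r C /\ E p = 1 /\ is_derive E p (- Fy p 0).
Proof.
  intros Hr HK HF HM Hs Hrho HrM p Hp.
  assert (HM0 : 0 <= M) by (apply (M_pos F r M Hr HM)).
  destruct (functional_choice (fun x (f : R -> R -> R) => - r < x < r -> forall y,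
      f y x = y /\ (forall a b, Rabs (f y a - f y b) <= M * Rabs (a - b)) /\ solution F r (f y)))
    as [sol Hsol].
  { intros x. destruct (classic (- r < x < r)) as [Hx|Hx].
    - destruct (functional_choice (fun y (f : R -> R) =>
        f x = y /\ (forall a b, Rabs (f a - f b) <= M * Rabs (a - b)) /\ solution F r f)) as [f Hf].
      + intros y. destruct (picard F Fy r K M Hr HK HF HM Hs x y) as [Y HY]; [lra|].
        exists Y. exact HY.
      + exists f. auto.
    - exists (fun _ _ => 0). intros H; contradiction. }
  assert (HS : forall x y, - r < x < r ->
      sol x y x = y /\ (forall a b, Rabs (sol x y a - sol x y b) <= M * Rabs (a - b)) /\ solution F r (sol x y)).
  { intros x y Hx. apply (Hsol x Hx y). }
  exists (fi sol p), (fun x => exp (fi_rate Fy r sol p x)), (2 + 2 * M).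
  destruct (fi_rate_derive F Fy r K M Hr HK HF HM sol HS p rho Hp Hrho) as [D1 D2].
  split; [|split; [rewrite D2; apply exp_0|exact D1]].
  split; [lra|]. split; [lra|]. split; [|split; [|split; [|split]]].
  - intros x x' y y' Hx Hx'. apply (fi_lipschitz F Fy r K M Hr HK HF HM Hs sol HS p rho Hp Hrho); lra.
  - intros x y y' Hx Hy. assert (T := fi_increasing F Fy r K M Hr HK HF Hs sol HS p rho Hp Hrho x y y' ltac:(lra) Hy).
    nra.
  - intros g1 g2 t vx Hx Hy H1 H2. apply Rabs_def2 in Hy.
    apply (fi_constant F Fy r K M Hr HK HF HM Hs sol HS p rho Hp Hrho g1 g2 t vx); auto; lra.
  - intros x y Hx Hy. exists (sol x y). destruct (HS x y ltac:(lra)) as [E1 [E2 E3]].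
    split; [auto|]. intros s Hsx.
    assert (B := sol_box F r M Hr HM sol HS rho Hrho HrM x y s Hx Hsx Hy).
    split; [exact B|]. split; [|split].
    + intros s'. apply Rle_trans with (1 := E2 s s').
      apply Rmult_le_compat_r; [apply Rabs_pos|lra].
    + symmetry. apply (fi_flow F Fy r K M Hr HK HF Hs sol HS p rho Hp Hrho); lra.
    + rewrite <- (trunc_eq r F); [|split; [apply Rabs_le|]; lra]. apply E3; lra.
  - intros x Hx. split; [apply exp_pos|].
    apply (fi_axis_derive F Fy r K M Hr HK HF HM Hs sol HS p rho Hp Hrho HrM x Hx).
Qed.

(** * Half-return maps and the pseudo-Hopf bifurcation on the axis *)

Lemma mean_value_strict (f df : R -> R) (a b : R) :
  a < b -> (forall x, a <= x <= b -> is_derive f x (df x)) ->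
  exists c, a < c < b /\ f b - f a = df c * (b - a).
Proof.
  intros Hab H. destruct (MVT_cor2 f df a b Hab) as [c [E Hc]].
  - intros x Hx. apply is_derive_Reals. auto.
  - exists c; auto.
Qed.

(* Local model of the restriction of a first integral to the switching line near an
   invisible tangency: [u' = x^n w] with [n] odd and [w > 0]. *)
Definition valley (u w : R -> R) (n : nat) (r : R) : Prop :=
  Nat.Odd n /\ forall x, Rabs x < r -> is_derive u x (x ^ n * w x) /\ 0 < w x.

Lemma odd_pow_opp (n : nat) (x : R) : Nat.Odd n -> (- x) ^ n = - x ^ n.
Proof.
  intros [m ->]. rewrite !pow_add, !pow_mult. simpl.
  replace (- x * (- x * 1)) with (x * (x * 1)) by ring. ring.
Qed.

Lemma odd_pow_neg (n : nat) (x : R) : Nat.Odd n -> x < 0 -> x ^ n < 0.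
Proof.
  intros Hn Hx. replace x with (- (- x)) by ring. rewrite odd_pow_opp by auto.
  assert (0 < (- x) ^ n) by (apply pow_lt; lra). lra.
Qed.

Lemma valley_increasing (u w : R -> R) (n : nat) (r x y : R) :
  valley u w n r -> 0 <= x -> x < y -> y < r -> u x < u y.
Proof.
  intros [Hn H] Hx Hxy Hy.
  destruct (mean_value_strict u (fun x => x ^ n * w x) x y Hxy) as [c [Hc E]].
  - intros z Hz. apply H. rewrite Rabs_right; lra.
  - destruct (H c) as [_ Hw]; [rewrite Rabs_right; lra|].
    assert (0 < c ^ n) by (apply pow_lt; lra).
    assert (0 < c ^ n * w c * (y - x)) by (apply Rmult_lt_0_compat; [apply Rmult_lt_0_compat|]; lra). lra.
Qed.

Lemma valley_decreasing (u w : R -> R) (n : nat) (r x y : R) :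
  valley u w n r -> - r < x -> x < y -> y <= 0 -> u y < u x.
Proof.
  intros [Hn H] Hx Hxy Hy.
  destruct (mean_value_strict u (fun x => x ^ n * w x) x y Hxy) as [c [Hc E]].
  - intros z Hz. apply H. apply Rabs_def1; lra.
  - destruct (H c) as [_ Hw]; [apply Rabs_def1; lra|].
    assert (c ^ n < 0) by (apply odd_pow_neg; auto; lra).
    assert (0 < - c ^ n * w c * (y - x)) by (apply Rmult_lt_0_compat; [apply Rmult_lt_0_compat|]; lra). lra.
Qed.

(** No smoothness of [phi] is assumed. It is trapped between the test curves - x + k x^2 for k
    slightly above and slightly below the expected coefficient, which requires a derivative of [w]
    at 0 only. *)
Lemma valley_expansion (u w phi : R -> R) (n : nat) (r w1 : R) :
  0 < r -> valley u w n r -> is_derive w 0 w1 ->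
  (exists d, 0 < d /\ forall x, 0 < Rabs x < d -> x * phi x < 0 /\ Rabs (phi x) < r /\ u (phi x) = u x) ->
  forall e, 0 < e -> exists d, 0 < d /\
    forall x, 0 < Rabs x < d -> Rabs (phi x + x - (- (2 / (INR n + 2)) * (w1 / w 0)) * x ^ 2) <= e * x ^ 2.
Proof.
  intros Hr Hv Hw1 [d0 [Hd0 Hphi]] e He. set (al := - (2 / (INR n + 2)) * (w1 / w 0)).
  assert (Hn := proj1 Hv). pose proof (pos_INR n) as Hn0.
  assert (Hw0 : 0 < w 0) by (apply (proj2 Hv); rewrite Rabs_R0; auto).
  (* The sign of u(-x + k x^2) - u(x) locates phi(x) relatively to -x + k x^2. *)
  assert (Htest : forall k, k <> al -> exists d, 0 < d /\ forall x, 0 < Rabs x < d ->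
     Rabs (- x + k * x ^ 2) < r /\ x * (- x + k * x ^ 2) < 0 /\
     (k - al) * (x * (u (- x + k * x ^ 2) - u x)) < 0).
  { intros k Hk.
    (* Since n is odd, the derivative of u(- x + k x^2) - u(x) is x^n B(x). Here B(0) = 0, and B'(0)
       = - (n + 2) w(0) k - 2 w1 vanishes exactly at k = [al]: this is the origin of the
       coefficient. *)
    set (B := fun x => (1 - 2 * k * x) * (1 - k * x) ^ n * w (- x + k * x ^ 2) - w x).
    assert (HB : is_derive B 0 (- (INR n + 2) * w 0 * (k - al))).
    { assert (Hw' : is_derive (fun x => w (- x + k * x ^ 2)) 0 (-1 * w1)).
      { apply (is_derive_comp w (fun x => - x + k * x ^ 2)).
        - replace (- 0 + k * 0 ^ 2) with 0 by ring. exact Hw1.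
        - auto_derive; auto. ring. }
      assert (Hq : is_derive (fun x => (1 - 2 * k * x) * (1 - k * x) ^ n) 0 (- (INR n + 2) * k)).
      { auto_derive; auto.
        replace (1 + - (k * 0)) with 1 by ring. rewrite !pow1.  ring. }
      unfold B.
      evar_last.
      { apply (is_derive_minus (V := R_NormedModule)); [|exact Hw1].
        apply (is_derive_mult (fun x => (1 - 2 * k * x) * (1 - k * x) ^ n) (fun x => w (- x + k * x ^ 2)) 0 _ _ Hq Hw').
        intros; apply Rmult_comm. }
      unfold minus, plus, opp, mult; simpl.
      replace (- 0 + k * (0 * (0 * 1))) with 0 by ring.
      replace (1 - k * 0) with 1 by ring. rewrite pow1. unfold al. field. lra. }
    destruct (proj1 (is_derive_eps _ _ _) HB ((INR n + 2) * w 0 * Rabs (k - al) / 2)) as [d1 [Hd1 D1]].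
    { assert (0 < Rabs (k - al)) by (apply Rabs_pos_lt; lra).
      assert (0 < (INR n + 2) * w 0 * Rabs (k - al)) by (repeat apply Rmult_lt_0_compat; lra). lra. }
    assert (HB0 : B 0 = 0).
    { unfold B. replace (- 0 + k * 0 ^ 2) with 0 by ring. rewrite !Rmult_0_r, !Rminus_0_r, pow1. ring. }
    set (d2 := 1 / (2 * (Rabs k + 1))).
    assert (Hk0 : 0 <= Rabs k) by apply Rabs_pos.
    assert (Hd2 : 0 < d2) by (apply Rdiv_lt_0_compat; lra).
    assert (Hkx : forall x, Rabs x < d2 -> Rabs (k * x) < 1 / 2).
    { intros x Hx. rewrite Rabs_mult. apply Rle_lt_trans with ((Rabs k + 1) * Rabs x).
      - apply Rmult_le_compat_r; [apply Rabs_pos|lra].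
      - apply Rmult_lt_compat_l with (r := Rabs k + 1) in Hx; [|lra].
        replace ((Rabs k + 1) * d2) with (1 / 2) in Hx by (unfold d2; field; lra). exact Hx. }
    assert (Hxi : forall x, Rabs x < Rmin d2 (r / 2) -> Rabs (- x + k * x ^ 2) < r).
    { intros x Hx. assert (Rabs x < d2) by rmin.
      assert (Rabs x < r / 2) by rmin.
      replace (- x + k * x ^ 2) with (- x * (1 - k * x)) by ring.
      rewrite Rabs_mult, Rabs_Ropp. assert (T := Hkx x H).
      assert (Rabs (1 - k * x) <= 3 / 2).
      { apply Rabs_def2 in T. apply Rabs_le; lra. }
      pose proof (Rabs_pos x). pose proof (Rabs_pos (1 - k * x)). nra. }
    set (psi := fun x => u (- x + k * x ^ 2) - u x).
    assert (Hpsi : forall x, Rabs x < Rmin d2 (r / 2) -> is_derive psi x (x ^ n * B x)).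
    { intros x Hx. assert (X1 := Hxi x Hx).
      assert (Rabs x < r / 2) by rmin.
      destruct (proj2 Hv _ X1) as [U1 _]. destruct (proj2 Hv x ltac:(lra)) as [U2 _].
      unfold psi. evar_last.
      { apply (is_derive_minus (V := R_NormedModule)); [|exact U2].
        apply (is_derive_comp u (fun x => - x + k * x ^ 2)); [exact U1|].
        instantiate (1 := -1 + 2 * k * x). auto_derive; auto. ring. }
      unfold minus, plus, opp, scal; simpl. unfold mult; simpl. unfold B.
      replace (- x + k * (x * (x * 1))) with (- (x * (1 - k * x))) by ring.
      replace (- x + k * x ^ 2) with (- (x * (1 - k * x))) by ring.
      rewrite odd_pow_opp, Rpow_mult_distr by auto. ring. }
    exists (Rmin d1 (Rmin d2 (r / 2))). split; [repeat apply Rmin_pos; lra|].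
    intros x [Hx0 Hx].
    assert (X1 : Rabs x < d1) by rmin.
    assert (X2 : Rabs x < Rmin d2 (r / 2)) by rmin.
    assert (X3 : Rabs x < d2) by rmin.
    split; [auto|]. split.
    { assert (T := Hkx x X3). apply Rabs_def2 in T.
      replace (x * (- x + k * x ^ 2)) with (- (x ^ 2 * (1 - k * x))) by ring.
      assert (0 < x ^ 2) by (apply pow2_gt_0; intros ->; rewrite Rabs_R0 in Hx0; lra).
      assert (0 < x ^ 2 * (1 - k * x)) by (apply Rmult_lt_0_compat; lra). lra. }
    assert (Hsgn : forall c, 0 < Rabs c -> Rabs c < d1 -> (k - al) * (c ^ n * B c) < 0).
    { intros c Hc0 Hc. specialize (D1 c). rewrite Rminus_0_r, HB0, Rminus_0_r in D1. specialize (D1 Hc).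
      set (q := (INR n + 2) * w 0) in *. assert (Hq : 0 < q) by (apply Rmult_lt_0_compat; lra).
      assert (Hc1 : c <> 0) by (intros ->; rewrite Rabs_R0 in Hc0; lra).
      assert (Hm : (k - al) * (c * B c) < 0).
      { replace ((k - al) * (c * B c))
          with ((k - al) * c * (B c - - (INR n + 2) * w 0 * (k - al) * c) - q * ((k - al) * c) ^ 2) by (unfold q; ring).
        assert (Z := Rle_abs ((k - al) * c * (B c - - (INR n + 2) * w 0 * (k - al) * c))).
        rewrite !Rabs_mult in Z. rewrite <- (pow2_abs ((k - al) * c)), Rabs_mult.
        set (m := Rabs (k - al)) in *. assert (0 < m) by (apply Rabs_pos_lt; lra).
        assert (m * Rabs c * Rabs (B c - - (INR n + 2) * w 0 * (k - al) * c) <= m * Rabs c * (q * m / 2 * Rabs c)).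
        { apply Rmult_le_compat_l; [apply Rmult_le_pos; lra|exact D1]. }
        assert (0 < q * (m * Rabs c) ^ 2).
        { apply Rmult_lt_0_compat; auto. apply pow_lt. apply Rmult_lt_0_compat; auto. }
        replace (m * Rabs c * (q * m / 2 * Rabs c)) with (q * (m * Rabs c) ^ 2 / 2) in H0 by field. lra. }
      destruct (Rdichotomy _ _ Hc1) as [Hneg|Hpos].
      - assert (c ^ n < 0) by (apply odd_pow_neg; auto). 
        assert (0 < (k - al) * B c) by nra.
        replace ((k - al) * (c ^ n * B c)) with (c ^ n * ((k - al) * B c)) by ring. nra.
      - assert (0 < c ^ n) by (apply pow_lt; auto).
        assert ((k - al) * B c < 0) by nra.
        replace ((k - al) * (c ^ n * B c)) with (c ^ n * ((k - al) * B c)) by ring. nra. }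
    change (u (- x + k * x ^ 2) - u x) with (psi x).
    assert (P0 : psi 0 = 0) by (unfold psi; replace (- 0 + k * 0 ^ 2) with 0 by ring; ring).
    assert (Hx1 : x <> 0) by (intros ->; rewrite Rabs_R0 in Hx0; lra).
    destruct (Rdichotomy _ _ Hx1) as [Hneg|Hpos].
    - rewrite Rabs_left in * by lra.
      destruct (mean_value_strict psi (fun x => x ^ n * B x) x 0 Hneg) as [c [Hc E]].
      { intros z Hz. apply Hpsi. apply Rle_lt_trans with (- x); [apply Rabs_le; lra|auto]. }
      rewrite P0 in E. assert (T := Hsgn c). rewrite Rabs_left in T by lra. specialize (T ltac:(lra) ltac:(lra)).
      replace ((k - al) * (x * psi x)) with ((k - al) * (c ^ n * B c) * x ^ 2).
      + assert (0 < x ^ 2) by (apply pow2_gt_0; auto). nra.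
      + replace (psi x) with (c ^ n * B c * x) by lra. ring.
    - rewrite Rabs_right in * by lra.
      destruct (mean_value_strict psi (fun x => x ^ n * B x) 0 x Hpos) as [c [Hc E]].
      { intros z Hz. apply Hpsi. apply Rle_lt_trans with x; [apply Rabs_le; lra|auto]. }
      rewrite P0 in E. assert (T := Hsgn c). rewrite Rabs_right in T by lra. specialize (T ltac:(lra) ltac:(lra)).
      replace ((k - al) * (x * psi x)) with ((k - al) * (c ^ n * B c) * x ^ 2).
      + assert (0 < x ^ 2) by (apply pow2_gt_0; auto). nra.
      + replace (psi x) with (c ^ n * B c * x) by lra. ring. }
  assert (Hside : forall k, k <> al -> exists d, 0 < d /\ forall x, 0 < Rabs x < d ->
     (k - al) * (phi x - (- x + k * x ^ 2)) < 0).
  { intros k Hk. destruct (Htest k Hk) as [d1 [Hd1 T]].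
    exists (Rmin d0 d1). split; [apply Rmin_pos; auto|]. intros x [Hx0 Hx].
    destruct (Hphi x) as [P1 [P2 P3]].
    { split; auto. apply Rlt_le_trans with (1 := Hx); apply Rmin_l. }
    destruct (T x) as [T1 [T2 T3]].
    { split; auto. apply Rlt_le_trans with (1 := Hx); apply Rmin_r. }
    rewrite <- P3 in T3. set (xi := - x + k * x ^ 2) in *.
    apply Rabs_def2 in P2. apply Rabs_def2 in T1.
    assert (Hmono : x * (u xi - u (phi x)) * (phi x - xi) >= 0).
    { assert (Hx1 : x <> 0) by (intros ->; rewrite Rabs_R0 in Hx0; lra).
      destruct (Rdichotomy _ _ Hx1) as [Hneg|Hpos].
      - assert (0 < phi x) by nra. assert (0 < xi) by nra.
        destruct (Rtotal_order (phi x) xi) as [L|[E|L]].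
        + assert (u (phi x) < u xi) by (apply (valley_increasing u w n r); auto; lra).
          assert (0 < (u xi - u (phi x)) * (xi - phi x)) by (apply Rmult_lt_0_compat; lra). nra.
        + rewrite E. lra.
        + assert (u xi < u (phi x)) by (apply (valley_increasing u w n r); auto; lra).
          assert (0 < (u (phi x) - u xi) * (phi x - xi)) by (apply Rmult_lt_0_compat; lra). nra.
      - assert (phi x < 0) by nra. assert (xi < 0) by nra.
        destruct (Rtotal_order (phi x) xi) as [L|[E|L]].
        + assert (u xi < u (phi x)) by (apply (valley_decreasing u w n r); auto; lra).
          assert (0 < (u (phi x) - u xi) * (xi - phi x)) by (apply Rmult_lt_0_compat; lra). nra.
        + rewrite E. lra.
        + assert (u (phi x) < u xi) by (apply (valley_decreasing u w n r); auto; lra).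
          assert (0 < (u xi - u (phi x)) * (phi x - xi)) by (apply Rmult_lt_0_compat; lra). nra. }
    assert (Hne : phi x - xi <> 0).
    { intros E. replace (phi x) with xi in T3 by lra. rewrite Rminus_diag in T3. lra. }
    set (a := x * (u xi - u (phi x))) in *. set (b := phi x - xi) in *.
    assert (0 < b ^ 2) by (apply pow2_gt_0; auto).
    assert ((k - al) * a * (a * b) <= 0) by nra.
    assert (a <> 0) by (intros E; rewrite E in T3; lra).
    assert (0 < a ^ 2) by (apply pow2_gt_0; auto).
    assert (a ^ 2 * ((k - al) * b) <= 0) by nra.
    assert ((k - al) * b <= 0) by nra.
    assert ((k - al) * b <> 0); [|lra].
    apply Rmult_integral_contrapositive_currified; auto. lra. }
  (* The two test curves k = [al] + e and k = [al] - e enclose [phi]. *)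
  destruct (Hside (al + e) ltac:(lra)) as [d1 [Hd1 S1]].
  destruct (Hside (al - e) ltac:(lra)) as [d2 [Hd2 S2]].
  exists (Rmin d1 d2). split; [apply Rmin_pos; auto|]. intros x [Hx0 Hx].
  specialize (S1 x). specialize (S2 x).
  assert (A1 : Rabs x < d1) by rmin.
  assert (A2 : Rabs x < d2) by rmin.
  specialize (S1 (conj Hx0 A1)). specialize (S2 (conj Hx0 A2)).
  apply Rabs_le. split; nra.
Qed.

Lemma neg_of_prod (a b : R) : 0 < a -> a * b < 0 -> b < 0.
Proof. intros Ha H. apply Rnot_le_lt. intros Hb. assert (0 <= a * b) by (apply Rmult_le_pos; lra). lra. Qed.

Lemma pos_of_prod_ge (q f : R) : 0 < q -> q * f >= 0 -> f <> 0 -> 0 < f.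
Proof. intros H1 H2 H3. destruct (Rtotal_order f 0) as [H|[H|H]]; auto; [nra|contradiction]. Qed.

Lemma neg_of_prod_ge (q f : R) : q < 0 -> q * f >= 0 -> f <> 0 -> f < 0.
Proof. intros H1 H2 H3. destruct (Rtotal_order f 0) as [H|[H|H]]; auto; [contradiction|nra]. Qed.

Lemma ivt_zero (f : R -> R) (a b : R) :
  a <= b -> (forall t, a <= t <= b -> continuous f t) -> f a * f b < 0 ->
  exists c, a <= c <= b /\ f c = 0.
Proof.
  intros Hab Hc Hf. apply ivt; auto. unfold Rmin, Rmax; repeat destruct Rle_dec; nra.
Qed.

Lemma factor_small (p q e : R) : 0 < p -> 0 < q -> 0 <= e -> (2 * p + 2 * q) * e <= p * q / 8 -> e <= p.
Proof.
  intros Hp Hq He H. apply Rmult_le_reg_l with q; auto.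
  assert (0 <= p * e) by (apply Rmult_le_pos; lra). nra.
Qed.

(** Existence comes from the intermediate value theorem on the opposite branch, and continuity from
    strict monotonicity there. Continuity is all that the zero search in [pseudo_hopf] asks for. *)
Lemma valley_involution (u w : R -> R) (n : nat) (r : R) :
  0 < r -> valley u w n r ->
  exists (d : R) (phi : R -> R), 0 < d /\ d <= r /\
    forall x, 0 < Rabs x < d ->
      x * phi x < 0 /\ Rabs (phi x) < r /\ u (phi x) = u x /\ continuous phi x.
Proof.
  intros Hr Hv.
  assert (Hc : forall x, Rabs x < r -> continuous u x).
  { intros x Hx. destruct (proj2 Hv x Hx) as [D _]. exact (is_derive_continuous _ _ _ D). }
  assert (Hm1 : u 0 < u (r / 2)) by (apply (valley_increasing u w n r); auto; lra).
  assert (Hm2 : u 0 < u (- (r / 2))) by (apply (valley_decreasing u w n r); auto; lra).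
  set (m := Rmin (u (r / 2)) (u (- (r / 2)))).
  assert (Hm : u 0 < m) by (apply Rmin_glb_lt; auto).
  destruct (proj1 (continuous_eps u 0) (Hc 0 ltac:(rewrite Rabs_R0; auto)) (m - u 0)) as [d1 [Hd1 D1]]; [lra|].
  set (d := Rmin d1 r).
  assert (Hex : forall x, exists y, 0 < Rabs x < d -> x * y < 0 /\ Rabs y < r /\ u y = u x).
  { intros x. destruct (classic (0 < Rabs x < d)) as [[Hx0 Hx]|Hx]; [|exists 0; intros H; contradiction].
    assert (Hx1 : x <> 0) by (intros ->; rewrite Rabs_R0 in Hx0; lra).
    assert (Hxd1 : Rabs (x - 0) < d1) by (rewrite Rminus_0_r; apply Rlt_le_trans with (1 := Hx); apply Rmin_l).
    assert (Hxr : Rabs x < r) by rmin.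
    specialize (D1 x Hxd1). apply Rabs_def2 in D1.
    assert (M1 : m <= u (r / 2)) by apply Rmin_l. assert (M2 : m <= u (- (r / 2))) by apply Rmin_r.
    apply Rabs_def2 in Hxr.
    destruct (Rdichotomy _ _ Hx1) as [Hneg|Hpos].
    - assert (u 0 < u x) by (apply (valley_decreasing u w n r); auto; lra).
      destruct (ivt u 0 (r / 2) (u x)) as [y [Hy E]]; [lra| |rewrite Rmin_left, Rmax_right; lra|].
      { intros t Ht. apply Hc, Rabs_def1; lra. }
      exists y. intros _. split; [|split; auto; apply Rabs_def1; lra].
      assert (y <> 0) by (intros ->; lra). nra.
    - assert (u 0 < u x) by (apply (valley_increasing u w n r); auto; lra).
      destruct (ivt u (- (r / 2)) 0 (u x)) as [y [Hy E]]; [lra| |rewrite Rmin_right, Rmax_left; lra|].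
      { intros t Ht. apply Hc, Rabs_def1; lra. }
      exists y. intros _. split; [|split; auto; apply Rabs_def1; lra].
      assert (y <> 0) by (intros ->; lra). nra. }
  destruct (functional_choice _ Hex) as [phi Hphi].
  exists d, phi. split; [apply Rmin_pos; auto|]. split; [apply Rmin_r|].
  intros x Hx. destruct (Hphi x Hx) as [P1 [P2 P3]].
  split; [auto|]. split; [auto|]. split; [auto|].
  assert (Hx1 : x <> 0) by (intros ->; rewrite Rabs_R0 in Hx; lra).
  set (z := phi x) in *.
  assert (Hz0 : z <> 0) by (intros E; rewrite E in P1; lra).
  assert (Hxr : Rabs x < r) by (apply Rlt_le_trans with (1 := proj2 Hx); apply Rmin_r).
  apply continuous_eps. intros eps Heps.
  apply Rabs_def2 in P2.
  set (e := Rmin (eps / 2) (Rmin (Rabs z / 2) (Rmin ((r - z) / 2) ((r + z) / 2)))).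
  assert (He : 0 < e).
  { assert (0 < Rabs z) by (apply Rabs_pos_lt; auto). unfold e. repeat apply Rmin_pos; lra. }
  assert (E1 : e <= eps / 2) by apply Rmin_l.
  assert (E2 : e <= Rabs z / 2) by rmin.
  assert (E3 : e <= (r - z) / 2) by rmin.
  assert (E4 : e <= (r + z) / 2) by rmin.
  assert (Hgap : exists g, 0 < g /\ forall z', z * z' > 0 -> Rabs z' < r -> Rabs (u z' - u z) < g -> Rabs (z' - z) <= e).
  { destruct (Rdichotomy _ _ Hz0) as [Hneg|Hpos].
    - rewrite Rabs_left in E2 by lra.
      assert (G1 : u (z + e) < u z) by (apply (valley_decreasing u w n r); auto; lra).
      assert (G2 : u z < u (z - e)) by (apply (valley_decreasing u w n r); auto; lra).
      exists (Rmin (u z - u (z + e)) (u (z - e) - u z)). split; [apply Rmin_pos; lra|].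
      intros z' S1 S2 S3. apply Rabs_def2 in S2. apply Rabs_def2 in S3.
      pose proof (Rmin_l (u z - u (z + e)) (u (z - e) - u z)).
      pose proof (Rmin_r (u z - u (z + e)) (u (z - e) - u z)).
      assert (z' < 0) by nra. apply Rabs_le. split; apply Rnot_lt_le; intros L.
      + assert (u (z - e) < u z') by (apply (valley_decreasing u w n r); auto; lra). lra.
      + assert (u z' < u (z + e)) by (apply (valley_decreasing u w n r); auto; lra). lra.
    - rewrite Rabs_right in E2 by lra.
      assert (G1 : u z < u (z + e)) by (apply (valley_increasing u w n r); auto; lra).
      assert (G2 : u (z - e) < u z) by (apply (valley_increasing u w n r); auto; lra).
      exists (Rmin (u (z + e) - u z) (u z - u (z - e))). split; [apply Rmin_pos; lra|].
      intros z' S1 S2 S3. apply Rabs_def2 in S2. apply Rabs_def2 in S3.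
      pose proof (Rmin_l (u (z + e) - u z) (u z - u (z - e))).
      pose proof (Rmin_r (u (z + e) - u z) (u z - u (z - e))).
      assert (0 < z') by nra. apply Rabs_le. split; apply Rnot_lt_le; intros L.
      + assert (u z' < u (z - e)) by (apply (valley_increasing u w n r); auto; lra). lra.
      + assert (u (z + e) < u z') by (apply (valley_increasing u w n r); auto; lra). lra. }
  destruct Hgap as [g [Hg G]].
  destruct (proj1 (continuous_eps u x) (Hc x Hxr) g Hg) as [d2 [Hd2 D2]].
  exists (Rmin d2 (Rmin (Rabs x) (d - Rabs x))). split; [repeat apply Rmin_pos; lra|].
  intros x' Hx'.
  assert (X1 : Rabs (x' - x) < d2) by rmin.
  assert (X2 : Rabs (x' - x) < Rabs x) by rmin.
  assert (X3 : Rabs (x' - x) < d - Rabs x) by rmin.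
  assert (Hxx : 0 < x * x').
  { unfold Rabs in X2; destruct (Rcase_abs (x' - x)); destruct (Rcase_abs x); nra. }
  assert (Hx'd : 0 < Rabs x' < d).
  { split; [apply Rabs_pos_lt; intros ->; lra|].
    replace x' with ((x' - x) + x) by ring. apply Rle_lt_trans with (1 := Rabs_triang _ _). lra. }
  destruct (Hphi x' Hx'd) as [Q1 [Q2 Q3]].
  apply Rle_lt_trans with e; [|lra]. apply G; auto.
  - assert (0 < (x * z) * (x' * phi x')) by nra.
    replace (x * z * (x' * phi x')) with ((x * x') * (z * phi x')) in H by ring. nra.
  - rewrite Q3, P3. apply D2; auto.
Qed.

(** The germ at 0 from the right; it lets a dozen smallness conditions on one parameter be gathered
    at once. *)
Definition small (P : R -> Prop) : Prop := exists d, 0 < d /\ forall t, 0 < t < d -> P t.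

Lemma small_and (P Q : R -> Prop) : small P -> small Q -> small (fun t => P t /\ Q t).
Proof.
  intros [d [Hd D]] [e [He E]]. exists (Rmin d e). split; [apply Rmin_pos; auto|].
  intros t Ht. pose proof (Rmin_l d e). pose proof (Rmin_r d e). split; [apply D|apply E]; lra.
Qed.

Lemma small_imp (P Q : R -> Prop) : (forall t, 0 < t -> P t -> Q t) -> small P -> small Q.
Proof. intros H [d [Hd D]]. exists d. split; auto. intros t Ht. apply H; [lra|auto]. Qed.

Lemma small_linear (c e : R) : 0 <= c -> 0 < e -> small (fun t => c * t < e).
Proof.
  intros Hc He. exists (e / (c + 1)). split; [apply Rdiv_lt_0_compat; lra|].
  intros t [Ht0 Ht]. apply Rmult_lt_compat_l with (r := c + 1) in Ht; [|lra].
  replace ((c + 1) * (e / (c + 1))) with e in Ht by (field; lra). nra.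
Qed.

Lemma small_ball (P : R -> Prop) (c : R) : 0 <= c ->
  (exists d, 0 < d /\ forall x, 0 < Rabs x < d -> P x) ->
  small (fun t => forall x, 0 < Rabs x -> Rabs x <= c * t -> P x).
Proof.
  intros Hc [d [Hd D]]. apply small_imp with (2 := small_linear c d Hc Hd).
  intros t Ht H x H0 Hx. apply D; lra.
Qed.

Lemma affine_estimate (w : R -> R) (w1 e : R) : 0 < w 0 -> is_derive w 0 w1 -> 0 < e ->
  exists d, 0 < d /\ forall x, 0 < Rabs x < d ->
    Rabs (w x - w 0 - w1 * x) <= e * Rabs x /\ Rabs (w x) <= 2 * w 0.
Proof.
  intros Hw0 Hw He.
  destruct (proj1 (is_derive_eps _ _ _) Hw e He) as [d1 [Hd1 D1]].
  destruct (proj1 (continuous_eps _ _) (is_derive_continuous _ _ _ Hw) (w 0) Hw0) as [d2 [Hd2 D2]].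
  exists (Rmin d1 d2). split; [apply Rmin_pos; auto|]. intros x [_ Hx].
  assert (Rabs x < d1) by rmin. assert (Rabs x < d2) by rmin.
  specialize (D1 x). specialize (D2 x). rewrite Rminus_0_r in D1, D2. split; [apply D1; lra|].
  specialize (D2 ltac:(lra)). apply Rabs_def2 in D2. apply Rabs_le. lra.
Qed.

(* Two valleys whose involutions differ at second order, one of them shifted by b:
   the two displacement equations are solved at a distance of order sqrt |b|. *)
Lemma pseudo_hopf (u v w z : R -> R) (r w1 z1 : R) :
  0 < r -> valley u w 1 r -> valley v z 1 r -> is_derive w 0 w1 -> is_derive z 0 z1 ->
  let A := - (2 / 3) * (w1 / w 0 - z1 / z 0) in
  forall eps, 0 < eps -> exists b0, 0 < b0 /\ forall b, 0 < Rabs b < b0 -> b * A < 0 ->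
    exists x1 x2, - eps < x1 < 0 /\ 0 < x2 < eps /\ x1 < b < x2 /\
      u (x1 - b) = u (x2 - b) /\ v x1 = v x2 /\
      0 < A * ((x2 - b) * w (x2 - b) * (x1 * z x1) - (x2 * z x2) * ((x1 - b) * w (x1 - b))).
Proof.
  intros Hr Hu Hv Hw Hz A eps Heps.
  destruct (Req_dec A 0) as [HA0|HA0].
  { exists 1. split; [lra|]. intros b _ H. rewrite HA0 in H. lra. }
  set (a := Rabs A). assert (Ha : 0 < a) by (apply Rabs_pos_lt; auto).
  destruct (valley_involution u w 1 r Hr Hu) as (du & phi & Hdu & Hdur & Hphi).
  destruct (valley_involution v z 1 r Hr Hv) as (dv & chi & Hdv & Hdvr & Hchi).
  (* The displacement behaves like 2b + A x^2 with A b < 0 and t^2 = |b|. At x = [c1] t the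
     quadratic term has size |b|, less than 2|b|; at x = [c] t it has size 3|b|. Any error below |b|
     therefore leaves opposite signs at the two ends. *)
  set (c := sqrt (3 / a)).
  assert (Hc : 0 < c) by (apply sqrt_lt_R0, Rdiv_lt_0_compat; lra).
  assert (Hc2 : a * c ^ 2 = 3).
  { unfold c. rewrite pow2_sqrt by (apply Rlt_le, Rdiv_lt_0_compat; lra). field. lra. }
  set (c1 := sqrt (1 / a)).
  assert (Hc1 : 0 < c1) by (apply sqrt_lt_R0, Rdiv_lt_0_compat; lra).
  assert (Hc12 : a * c1 ^ 2 = 1).
  { unfold c1. rewrite pow2_sqrt by (apply Rlt_le, Rdiv_lt_0_compat; lra). field. lra. }
  assert (Hcc : c1 < c).
  { apply sqrt_lt_1_alt. split; [apply Rlt_le, Rdiv_lt_0_compat; lra|].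
    apply Rmult_lt_compat_r; [apply Rinv_0_lt_compat; auto|lra]. }
  set (W := 2 * w 0). set (Z := 2 * z 0).
  assert (Hw0 : 0 < w 0) by (apply (proj2 Hu); rewrite Rabs_R0; auto).
  assert (Hz0 : 0 < z 0) by (apply (proj2 Hv); rewrite Rabs_R0; auto).
  set (P0 := w 0 * z 0). assert (HP0 : 0 < P0) by (apply Rmult_lt_0_compat; auto).
  set (k := 2 * (c + 1)).
  set (al := - (2 / (INR 1 + 2)) * (w1 / w 0)). set (be := - (2 / (INR 1 + 2)) * (z1 / z 0)).
  assert (HAab : A = al - be) by (unfold A, al, be; simpl; field; lra).
  (* Makes each expansion error at most t^2 / 8 as long as the abscissa is at most k t. *)
  set (e1 := 1 / (8 * k ^ 2)).
  assert (He1 : 0 < e1) by (apply Rdiv_lt_0_compat; [lra|]; apply Rmult_lt_0_compat; [lra|]; apply pow_lt; unfold k; lra).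
  (* Chosen so that the errors in the affine approximations of [w] and [z] weigh P0 / 16 in the
     final comparison. *)
  set (e2 := P0 / (128 * (W + Z) * c ^ 2)).
  assert (He2 : 0 < e2).
  { apply Rdiv_lt_0_compat; auto. repeat apply Rmult_lt_0_compat; unfold W, Z; try lra. }
  assert (Hk : 0 <= k) by (unfold k; lra).
  assert (EU := valley_expansion u w phi 1 r w1 Hr Hu Hw
    (ex_intro _ du (conj Hdu (fun x Hx => let '(conj p (conj q (conj s _))) := Hphi x Hx in conj p (conj q s)))) e1 He1).
  assert (EV := valley_expansion v z chi 1 r z1 Hr Hv Hz
    (ex_intro _ dv (conj Hdv (fun x Hx => let '(conj p (conj q (conj s _))) := Hchi x Hx in conj p (conj q s)))) e1 He1).
  fold al in EU. fold be in EV.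
  assert (LW := affine_estimate w w1 e2 Hw0 Hw He2). assert (LZ := affine_estimate z z1 e2 Hz0 Hz He2).
  fold W in LW. fold Z in LZ.
  pose proof (Rabs_pos al) as Hal. pose proof (Rabs_pos be) as Hbe.
  pose proof (Rabs_pos w1) as Hw1p. pose proof (Rabs_pos z1) as Hz1p.
  (* t = sqrt |b| *)
  assert (Hs :
    small (fun t => (forall x, 0 < Rabs x -> Rabs x <= k * t -> Rabs (phi x + x - al * x ^ 2) <= e1 * x ^ 2)
     /\ (forall x, 0 < Rabs x -> Rabs x <= k * t -> Rabs (chi x + x - be * x ^ 2) <= e1 * x ^ 2)
     /\ (forall x, 0 < Rabs x -> Rabs x <= k * t -> Rabs (w x - w 0 - w1 * x) <= e2 * Rabs x /\ Rabs (w x) <= W)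
     /\ (forall x, 0 < Rabs x -> Rabs x <= k * t -> Rabs (z x - z 0 - z1 * x) <= e2 * Rabs x /\ Rabs (z x) <= Z)
     /\ t < 1 /\ k * t < eps /\ k * t < du /\ k * t < dv /\ 4 * t < c1
     /\ Rabs al * (1 + 2 * c) * t < 1 / 4 /\ (Rabs be + e1) * c * t < 1 / 12
     /\ (W + Z) * (Rabs w1 + Rabs z1 + e2 + e2) * k * t < P0 / 8
     /\ 3 * Rabs w1 * Rabs z1 * c ^ 2 * t < P0 / 64)).
  { repeat apply small_and; try (apply small_ball; auto; fail); try (apply small_linear; auto; lra).
    - apply small_imp with (2 := small_linear 1 1 ltac:(lra) ltac:(lra)). intros; lra.
    - apply small_linear; [|lra]. apply Rmult_le_pos; lra.
    - apply small_linear; [|lra]. apply Rmult_le_pos; lra.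
    - apply small_linear; [|lra]. repeat apply Rmult_le_pos; unfold W, Z; lra.
    - apply small_linear; [|lra]. repeat apply Rmult_le_pos; try lra. }
  destruct Hs as [t0 [Ht0 Hs]].
  exists (t0 ^ 2). split; [apply pow_lt; auto|]. intros b [Hb0 Hb] HbA.
  set (t := sqrt (Rabs b)).
  assert (Ht : 0 < t) by (apply sqrt_lt_R0; auto).
  assert (Htb : t ^ 2 = Rabs b) by (unfold t; apply pow2_sqrt; lra).
  assert (Htt : t < t0).
  { apply Rnot_le_lt. intros L. assert (t0 ^ 2 <= t ^ 2) by (apply pow_incr; lra). lra. }
  destruct (Hs t (conj Ht Htt)) as (Sphi & Schi & Sw & Sz & St1 & Steps & Stu & Stv & Stc & St4 & St5 & St6 & St7).
  clear Hs.
  assert (Hbt : Rabs b <= t) by (rewrite <- Htb; nra).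
  assert (Hbt4 : 4 * Rabs b <= c1 * t) by (rewrite <- Htb; nra).
  assert (Hbb := Rle_abs b). assert (Hbb' := Rle_abs (- b)). rewrite Rabs_Ropp in Hbb'.
  assert (Hx1 : forall x, c1 * t <= x <= c * t ->
    Rabs (chi x + x - be * x ^ 2) <= e1 * x ^ 2 /\ Rabs (chi x + x) <= x / 12).
  { intros x Hx. assert (0 < x) by nra.
    assert (Rabs x <= k * t) by (rewrite Rabs_right by lra; unfold k; nra).
    assert (T := Schi x ltac:(rewrite Rabs_right; lra) H0). split; auto.
    replace (chi x + x) with ((chi x + x - be * x ^ 2) + be * x ^ 2) by ring.
    apply Rle_trans with (1 := Rabs_triang _ _). rewrite Rabs_mult, (Rabs_right (x ^ 2)) by (apply Rle_ge, pow2_ge_0).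
    assert ((Rabs be + e1) * x <= (Rabs be + e1) * (c * t)) by (apply Rmult_le_compat_l; lra). nra. }
  (* The displacement measured on the values of [u]: it has the sign of b + phi(x - b) - chi(x), and
     its continuity involves [chi] alone. *)
  set (f := fun x => u (chi x - b) - u (x - b)).
  assert (Hfs : forall x, c1 * t <= x <= c * t ->
     (b + phi (x - b) - chi x) * f x >= 0 /\ (b + phi (x - b) - chi x <> 0 -> f x <> 0)).
  { intros x Hx. destruct (Hx1 x Hx) as [_ T]. apply Rabs_le_between in T.
    assert (0 < x) by nra. assert (Rabs b <= x / 4) by nra.
    assert (X1 : 0 < x - b) by lra.
    assert (X2 : Rabs (x - b) <= k * t) by (rewrite Rabs_right by lra; unfold k; nra).
    destruct (Hphi (x - b)) as (F1 & F2 & F3 & _); [rewrite Rabs_right in X2 |- *; lra|].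
    unfold f. rewrite <- F3. apply Rabs_def2 in F2. assert (phi (x - b) < 0) by (apply (neg_of_prod (x - b)); auto).
    assert (chi x - b < 0) by lra. assert (k * t < r) by lra. assert (- r < chi x - b).
    { assert (c * t <= k * t / 2) by (unfold k; nra). lra. }
    set (p := phi (x - b)) in *. set (q := chi x - b) in *.
    replace (b + p - chi x) with (p - q) by (unfold q; ring).
    destruct (Rtotal_order p q) as [L|[E|L]].
    - assert (u q < u p) by (apply (valley_decreasing u w 1 r); auto; lra).
      assert (0 < (q - p) * (u p - u q)) by (apply Rmult_lt_0_compat; lra). split; [|intros _]; nra.
    - rewrite E. split; [lra|intros H'; exfalso; apply H'; lra].
    - assert (u p < u q) by (apply (valley_decreasing u w 1 r); auto; lra).
      assert (0 < (p - q) * (u q - u p)) by (apply Rmult_lt_0_compat; lra). split; [|intros _]; nra. }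
  assert (Hdisp : forall x, c1 * t <= x <= c * t ->
     Rabs (b + phi (x - b) - chi x - (2 * b + A * x ^ 2)) < t ^ 2).
  { intros x Hx. destruct (Hx1 x Hx) as [T _].
    assert (0 < x) by nra. assert (Rabs b <= x / 4) by nra.
    assert (X2 : Rabs (x - b) <= k * t) by (rewrite Rabs_right by lra; unfold k; nra).
    assert (T2 := Sphi (x - b) ltac:(rewrite Rabs_right; lra) X2).
    rewrite HAab.
    replace (b + phi (x - b) - chi x - (2 * b + (al - be) * x ^ 2))
      with ((phi (x - b) + (x - b) - al * (x - b) ^ 2) - (chi x + x - be * x ^ 2) + al * (b * (b - 2 * x))) by ring.
    assert (B1 : e1 * (x - b) ^ 2 <= t ^ 2 / 8).
    { apply Rle_trans with (e1 * (k * t) ^ 2).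
      - apply Rmult_le_compat_l; [lra|]. rewrite Rabs_right in X2 by lra. apply pow_incr; lra.
      - unfold e1. right. field. unfold k; lra. }
    assert (B2 : e1 * x ^ 2 <= t ^ 2 / 8).
    { apply Rle_trans with (e1 * (k * t) ^ 2).
      - apply Rmult_le_compat_l; [lra|]. apply pow_incr; unfold k; nra.
      - unfold e1. right. field. unfold k; lra. }
    assert (B3 : Rabs (al * (b * (b - 2 * x))) <= t ^ 2 / 4).
    { rewrite !Rabs_mult, <- Htb.
      assert (Rabs (b - 2 * x) <= (1 + 2 * c) * t) by (apply Rabs_le; nra).
      replace (Rabs al * (t ^ 2 * Rabs (b - 2 * x))) with (t ^ 2 * (Rabs al * Rabs (b - 2 * x))) by ring.
      assert (Rabs al * Rabs (b - 2 * x) <= Rabs al * ((1 + 2 * c) * t)) by (apply Rmult_le_compat_l; auto).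
      assert (0 < t ^ 2) by (apply pow_lt; auto). nra. }
    apply Rabs_le_between in T. apply Rabs_le_between in T2. apply Rabs_le_between in B3.
    assert (0 < t ^ 2) by (apply pow_lt; auto). apply Rabs_def1; lra. }
  assert (Hends : f (c1 * t) * f (c * t) < 0).
  { assert (c1 * t < c * t) by (apply Rmult_lt_compat_r; lra).
    assert (R1 : c1 * t <= c1 * t <= c * t) by lra. assert (R2 : c1 * t <= c * t <= c * t) by lra.
    destruct (Hfs _ R1) as [F1 N1]. destruct (Hfs _ R2) as [F2 N2].
    assert (D1 := Hdisp _ R1). assert (D2 := Hdisp _ R2).
    set (q1 := b + phi (c1 * t - b) - chi (c1 * t)) in *. set (q2 := b + phi (c * t - b) - chi (c * t)) in *.
    apply Rabs_def2 in D1. apply Rabs_def2 in D2.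
    assert (0 < t ^ 2) by (apply pow_lt; auto).
    assert (Hb1 : b <> 0) by (intros ->; rewrite Rabs_R0 in Hb0; lra).
    destruct (Rdichotomy _ _ Hb1) as [Hneg|Hpos].
    - assert (HA : 0 < A) by (assert (- A < 0) by (apply (neg_of_prod (- b)); lra); lra). rewrite Rabs_left in Htb by lra.
      assert (Ea : a = A) by (unfold a; apply Rabs_right; lra). rewrite Ea in *.
      assert (A * (c1 * t) ^ 2 = t ^ 2) by (rewrite Rpow_mult_distr, <- Rmult_assoc, Hc12; ring).
      assert (A * (c * t) ^ 2 = 3 * t ^ 2) by (rewrite Rpow_mult_distr, <- Rmult_assoc, Hc2; ring).
      assert (q1 < 0) by lra. assert (0 < q2) by lra.
      assert (f (c1 * t) <> 0) by (apply N1; lra). assert (f (c * t) <> 0) by (apply N2; lra).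
      assert (f (c1 * t) < 0) by (apply (neg_of_prod_ge q1); auto).
      assert (0 < f (c * t)) by (apply (pos_of_prod_ge q2); auto).
      apply Ropp_lt_cancel. rewrite Ropp_0, Ropp_mult_distr_l. apply Rmult_lt_0_compat; lra.
    - assert (HA : A < 0) by (apply (neg_of_prod b); auto). rewrite Rabs_right in Htb by lra.
      assert (Ea : a = - A) by (unfold a; apply Rabs_left; lra). rewrite Ea in *.
      assert (- A * (c1 * t) ^ 2 = t ^ 2) by (rewrite Rpow_mult_distr, <- Rmult_assoc, Hc12; ring).
      assert (- A * (c * t) ^ 2 = 3 * t ^ 2) by (rewrite Rpow_mult_distr, <- Rmult_assoc, Hc2; ring).
      assert (0 < q1) by lra. assert (q2 < 0) by lra.
      assert (f (c1 * t) <> 0) by (apply N1; lra). assert (f (c * t) <> 0) by (apply N2; lra).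
      assert (0 < f (c1 * t)) by (apply (pos_of_prod_ge q1); auto).
      assert (f (c * t) < 0) by (apply (neg_of_prod_ge q2); auto).
      apply Ropp_lt_cancel. rewrite Ropp_0, Ropp_mult_distr_r. apply Rmult_lt_0_compat; lra. }
  assert (Hc1t : c1 * t <= c * t) by (apply Rmult_le_compat_r; lra).
  assert (Hc1t0 : 0 < c1 * t) by (apply Rmult_lt_0_compat; lra).
  assert (Hcu : forall x, Rabs x < r -> continuous u x).
  { intros x Hx. destruct (proj2 Hu x Hx) as [D _]. exact (is_derive_continuous _ _ _ D). }
  destruct (ivt_zero f (c1 * t) (c * t)) as [x [Hx Hfx]].
  { exact Hc1t. }
  { intros x Hx. destruct (Hx1 x Hx) as [_ T]. apply Rabs_le_between in T.
    assert (0 < x) by lra. assert (Rabs b <= x / 4) by lra.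
    assert (k * t < r) by lra. assert (c * t <= k * t / 2) by (unfold k; lra).
    assert (Hsh : forall y, continuous (fun y => y - b) y).
    { intros y. apply (continuous_minus (V := R_NormedModule) (fun y => y)); [apply continuous_id|apply continuous_const]. }
    apply (continuous_minus (V := R_NormedModule) (fun x => u (chi x - b)) (fun x => u (x - b))).
    - apply (continuous_comp (fun x => chi x - b) u).
      + apply (continuous_comp chi (fun y => y - b)); [|apply Hsh].
        apply Hchi. rewrite Rabs_right; lra.
      + apply Hcu, Rabs_def1; lra.
    - apply (continuous_comp (fun x => x - b) u); [apply Hsh|]. apply Hcu, Rabs_def1; lra. }
  { exact Hends. }
  destruct (Hx1 x Hx) as [_ T]. set (y := chi x) in *. apply Rabs_le_between in T.
  assert (Hx0 : 0 < x) by lra. assert (Hbx : Rabs b <= x / 4) by lra.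
  assert (Hkt : c * t <= k * t / 2) by (unfold k; lra).
  exists y, x. split; [lra|]. split; [lra|]. split; [lra|].
  split; [unfold f in Hfx; fold y in Hfx; lra|]. split.
  { apply Hchi. rewrite Rabs_right; lra. }
  assert (Q1 : 0 < Rabs (x - b) /\ Rabs (x - b) <= 2 * x /\ Rabs (x - b) <= k * t) by (rewrite Rabs_right by lra; lra).
  assert (Q2 : 0 < Rabs (y - b) /\ Rabs (y - b) <= 2 * x /\ Rabs (y - b) <= k * t) by (rewrite Rabs_left by lra; lra).
  assert (Q3 : 0 < Rabs x /\ Rabs x <= 2 * x /\ Rabs x <= k * t) by (rewrite Rabs_right by lra; lra).
  assert (Q4 : 0 < Rabs y /\ Rabs y <= 2 * x /\ Rabs y <= k * t) by (rewrite Rabs_left by lra; lra).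
  destruct (Sw (x - b)) as [R1 R1']; try apply Q1.
  destruct (Sw (y - b)) as [R2 R2']; try apply Q2.
  destruct (Sz x) as [R3 R3']; try apply Q3.
  destruct (Sz y) as [R4 R4']; try apply Q4.
  set (r1 := w (x - b) - w 0 - w1 * (x - b)) in *. set (r2 := w (y - b) - w 0 - w1 * (y - b)) in *.
  set (r3 := z x - z 0 - z1 * x) in *. set (r4 := z y - z 0 - z1 * y) in *.
  set (W1 := w (x - b) * z y). set (W2 := z x * w (y - b)).
  assert (HWZ : 0 < W + Z) by (unfold W, Z; lra).
  (* At first order the shift b drops out of [W1 - W2], which leaves (w1 z(0) - w(0) z1)(x - y),
     that is - (3 / 2) A P0 (x - y). The product of the two linear terms leaves exactly w1 z1 b (x -
     y). *)
  assert (HE : Rabs (W1 - W2 - P0 * (- (3 / 2) * A) * (x - y)) <=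
      3 * Rabs w1 * Rabs z1 * t ^ 2 * x + 4 * (W + Z) * e2 * (2 * x)).
  { assert (Heq : W1 - W2 - P0 * (- (3 / 2) * A) * (x - y) =
       w1 * z1 * b * (x - y) + (r1 * z y + (w 0 + w1 * (x - b)) * r4 - (r3 * w (y - b) + (z 0 + z1 * x) * r2))).
    { unfold W1, W2, r1, r2, r3, r4, P0, A. field. lra. }
    rewrite Heq. clear Heq.
    assert (Hek : (2 * w 0 + 2 * z 0) * (e2 * (k * t)) <= w 0 * z 0 / 8).
    { apply Rle_trans with (2 := Rlt_le _ _ St6).
      replace ((W + Z) * (Rabs w1 + Rabs z1 + e2 + e2) * k * t) with
        ((2 * w 0 + 2 * z 0) * (e2 * (k * t)) + (W + Z) * ((Rabs w1 + Rabs z1 + e2) * (k * t))) by (unfold W, Z; ring).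
      assert (0 <= (W + Z) * ((Rabs w1 + Rabs z1 + e2) * (k * t))); [|lra].
      apply Rmult_le_pos; [lra|]. apply Rmult_le_pos; [lra|]. apply Rmult_le_pos; lra. }
    assert (Hekp : 0 <= e2 * (k * t)) by (apply Rmult_le_pos; [lra|apply Rmult_le_pos; lra]).
    assert (V : forall (g : R -> R) g1 s, e2 * (k * t) <= g 0 -> Rabs (g s - g 0 - g1 * s) <= e2 * Rabs s ->
      Rabs s <= k * t -> Rabs (g s) <= 2 * g 0 -> Rabs (g 0 + g1 * s) <= 2 * (2 * g 0)).
    { intros g g1 s G1 G2 G3 G4. replace (g 0 + g1 * s) with (g s - (g s - g 0 - g1 * s)) by ring.
      apply Rle_trans with (1 := Rabs_triang _ _). rewrite Rabs_Ropp.
      assert (e2 * Rabs s <= e2 * (k * t)) by (apply Rmult_le_compat_l; lra). lra. }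
    assert (V1 : Rabs (w 0 + w1 * (x - b)) <= 2 * W).
    { apply V; auto; [|apply Q1]. apply (factor_small (w 0) (z 0)); auto. }
    assert (V2 : Rabs (z 0 + z1 * x) <= 2 * Z).
    { apply V; auto; [|apply Q3]. apply (factor_small (z 0) (w 0)); auto. lra. }
    assert (V3 : Rabs (w1 * z1 * b * (x - y)) <= 3 * Rabs w1 * Rabs z1 * t ^ 2 * x).
    { rewrite !Rabs_mult, Htb. assert (Rabs (x - y) <= 3 * x) by (apply Rabs_le; lra).
      replace (3 * Rabs w1 * Rabs z1 * Rabs b * x) with (Rabs w1 * Rabs z1 * Rabs b * (3 * x)) by ring.
      apply Rmult_le_compat_l; auto. repeat apply Rmult_le_pos; lra. }
    assert (Be : forall q s B, Rabs q <= e2 * Rabs s -> Rabs s <= 2 * x -> 0 <= B -> B * Rabs q <= B * (e2 * (2 * x))).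
    { intros q s B Hq Hs' HB. apply Rmult_le_compat_l; auto. apply Rle_trans with (1 := Hq).
      apply Rmult_le_compat_l; lra. }
    assert (X1 : Rabs (r1 * z y) <= Z * (e2 * (2 * x))).
    { rewrite Rabs_mult, Rmult_comm. apply Rle_trans with (Z * Rabs r1).
      - apply Rmult_le_compat_r; [apply Rabs_pos|auto].
      - apply (Be r1 (x - b)); auto; [apply Q1|unfold Z; lra]. }
    assert (X2 : Rabs (r3 * w (y - b)) <= W * (e2 * (2 * x))).
    { rewrite Rabs_mult, Rmult_comm. apply Rle_trans with (W * Rabs r3).
      - apply Rmult_le_compat_r; [apply Rabs_pos|auto].
      - apply (Be r3 x); auto; [apply Q3|unfold W; lra]. }
    assert (X3 : Rabs ((w 0 + w1 * (x - b)) * r4) <= 2 * W * (e2 * (2 * x))).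
    { rewrite Rabs_mult. apply Rle_trans with (2 * W * Rabs r4).
      - apply Rmult_le_compat_r; [apply Rabs_pos|auto].
      - apply (Be r4 y); auto; [apply Q4|unfold W; lra]. }
    assert (X4 : Rabs ((z 0 + z1 * x) * r2) <= 2 * Z * (e2 * (2 * x))).
    { rewrite Rabs_mult. apply Rle_trans with (2 * Z * Rabs r2).
      - apply Rmult_le_compat_r; [apply Rabs_pos|auto].
      - apply (Be r2 (y - b)); auto; [apply Q2|unfold Z; lra]. }
    apply Rabs_le_between in X1. apply Rabs_le_between in X2. apply Rabs_le_between in X3.
    apply Rabs_le_between in X4. apply Rabs_le_between in V3.
    assert (0 <= (W + Z) * (e2 * (2 * x))) by (apply Rmult_le_pos; [lra|apply Rmult_le_pos; lra]).
    apply Rabs_le. lra. }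
  assert (HcP : forall (g : R -> R) g0 g1 s G, Rabs (g s - g0 - g1 * s) <= e2 * Rabs s -> Rabs s <= k * t ->
     0 <= g0 -> G = 2 * g0 -> Rabs g1 <= Rabs w1 + Rabs z1 -> Rabs (g s - g0) <= (Rabs w1 + Rabs z1 + e2) * (k * t)).
  { intros g g0 g1 s G H1 H2 _ _ H3. replace (g s - g0) with ((g s - g0 - g1 * s) + g1 * s) by ring.
    apply Rle_trans with (1 := Rabs_triang _ _). rewrite Rabs_mult.
    assert (Rabs g1 * Rabs s <= (Rabs w1 + Rabs z1) * (k * t)) by (apply Rmult_le_compat; auto; apply Rabs_pos).
    assert (e2 * Rabs s <= e2 * (k * t)) by (apply Rmult_le_compat_l; lra). lra. }
  set (q := (Rabs w1 + Rabs z1 + e2) * (k * t)) in *.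
  assert (Hq0 : 0 <= q) by (unfold q; apply Rmult_le_pos; [lra|apply Rmult_le_pos; lra]).
  assert (Hq : (W + Z) * q <= P0 / 8).
  { apply Rle_trans with (2 := Rlt_le _ _ St6). unfold q.
    replace ((W + Z) * (Rabs w1 + Rabs z1 + e2 + e2) * k * t) with
      ((W + Z) * ((Rabs w1 + Rabs z1 + e2) * (k * t)) + (W + Z) * (e2 * (k * t))) by ring.
    assert (0 <= (W + Z) * (e2 * (k * t))); [|lra].
    apply Rmult_le_pos; [lra|]. apply Rmult_le_pos; [lra|]. apply Rmult_le_pos; lra. }
  assert (C1 : Rabs (w (x - b) - w 0) <= q) by (apply (HcP w (w 0) w1 (x - b) W); auto; try apply Q1; lra).
  assert (C2 : Rabs (w (y - b) - w 0) <= q) by (apply (HcP w (w 0) w1 (y - b) W); auto; try apply Q2; lra).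
  assert (C3 : Rabs (z x - z 0) <= q) by (apply (HcP z (z 0) z1 x Z); auto; try apply Q3; lra).
  assert (C4 : Rabs (z y - z 0) <= q) by (apply (HcP z (z 0) z1 y Z); auto; try apply Q4; lra).
  assert (HWb : forall p s, Rabs (p - w 0) <= q -> Rabs s <= Z -> Rabs (s - z 0) <= q -> p * s <= P0 + P0 / 8).
  { intros p s H1 H2 H3. apply Rle_trans with (2 := Rplus_le_compat_l P0 _ _ Hq).
    replace (p * s) with (P0 + ((p - w 0) * s + w 0 * (s - z 0))) by (unfold P0; ring).
    apply Rplus_le_compat_l. apply Rle_trans with (1 := Rle_abs _).
    apply Rle_trans with (1 := Rabs_triang _ _). rewrite !Rabs_mult, (Rabs_right (w 0)) by lra.
    assert (Rabs (p - w 0) * Rabs s <= q * Z) by (apply Rmult_le_compat; auto; apply Rabs_pos).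
    assert (w 0 * Rabs (s - z 0) <= w 0 * q) by (apply Rmult_le_compat_l; lra).
    assert (0 <= w 0 * q) by (apply Rmult_le_pos; lra). unfold W. lra. }
  assert (HW1 : W1 <= P0 + P0 / 8) by (apply HWb; auto).
  assert (HW2 : W2 <= P0 + P0 / 8) by (unfold W2; rewrite Rmult_comm; apply HWb; auto).
  set (Er := W1 - W2 - P0 * (- (3 / 2) * A) * (x - y)) in *.
  set (m := - y) in *. assert (Hm : 11 / 12 * x <= m <= 13 / 12 * x) by (unfold m; lra).
  assert (HAb : A * b = - (a * t ^ 2)).
  { assert (Rabs (A * b) = a * t ^ 2) by (rewrite Rabs_mult, Htb; reflexivity).
    rewrite Rabs_left in H by lra. lra. }
  (* The bracket compares the products of the end slopes, whose sign decides between contraction and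
     expansion. In units of a t^2 P0 (x + m) the main term is at least 11/8 because m is at least
     11x/12 and a x^2 at least t^2, the term coming from b costs at most 9/8 and the error at most
     1/8. *)
  assert (HS : A * ((x - b) * w (x - b) * (y * z y) - x * z x * ((y - b) * w (y - b))) =
     3 / 2 * (a * a) * P0 * (x * m) * (x + m) - A * (x * m) * Er - a * t ^ 2 * (x * W2 + m * W1)).
  { assert (Haa : a * a = A * A) by (unfold a; rewrite <- Rabs_mult; apply Rabs_right, Rle_ge, (Rle_0_sqr A)).
    rewrite Haa.
    replace (A * ((x - b) * w (x - b) * (y * z y) - x * z x * ((y - b) * w (y - b))))
      with (A * (x * y) * (W1 - W2) + A * b * (x * W2 - y * W1)) by (unfold W1, W2; ring).
    rewrite HAb. replace (W1 - W2) with (Er + P0 * (- (3 / 2) * A) * (x - y)) by (unfold Er; ring).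
    unfold m. ring. }
  rewrite HS.
  assert (Hax : t ^ 2 <= a * x ^ 2).
  { replace (t ^ 2) with (a * (c1 * t) ^ 2) by (rewrite Rpow_mult_distr, <- Rmult_assoc, Hc12; ring).
    apply Rmult_le_compat_l; [lra|]. apply pow_incr. split; [apply Rmult_le_pos|]; lra. }
  assert (Hax' : a * x ^ 2 <= a * (c ^ 2 * t ^ 2)).
  { apply Rmult_le_compat_l; [lra|]. rewrite <- Rpow_mult_distr. apply pow_incr; lra. }
  assert (K1 : 11 / 8 * (a * t ^ 2) * P0 * (x + m) <= 3 / 2 * (a * a) * P0 * (x * m) * (x + m)).
  { apply Rmult_le_compat_r; [lra|].
    replace (3 / 2 * (a * a) * P0 * (x * m)) with (3 / 2 * (a * (x * m)) * a * P0) by ring.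
    apply Rmult_le_compat_r; [lra|].
    replace (11 / 8 * (a * t ^ 2)) with (11 / 8 * t ^ 2 * a) by ring. apply Rmult_le_compat_r; [lra|].
    assert (a * (x * (11 / 12 * x)) <= a * (x * m)).
    { apply Rmult_le_compat_l; [lra|]. apply Rmult_le_compat_l; lra. }
    replace (a * (x * (11 / 12 * x))) with (11 / 12 * (a * x ^ 2)) in H by field. lra. }
  assert (K2 : a * t ^ 2 * (x * W2 + m * W1) <= a * t ^ 2 * ((P0 + P0 / 8) * (x + m))).
  { apply Rmult_le_compat_l; [apply Rmult_le_pos; [lra|apply pow2_ge_0]|].
    assert (x * W2 <= x * (P0 + P0 / 8)) by (apply Rmult_le_compat_l; lra).
    assert (m * W1 <= m * (P0 + P0 / 8)) by (apply Rmult_le_compat_l; lra). lra. }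
  assert (K3 : Rabs (A * (x * m) * Er) <= a * t ^ 2 * ((x + m) * (P0 / 8))).
  { rewrite !Rabs_mult. fold a. rewrite (Rabs_right x), (Rabs_right m) by lra.
    apply Rle_trans with (a * (x * m) * (3 * Rabs w1 * Rabs z1 * t ^ 2 * x + 4 * (W + Z) * e2 * (2 * x))).
    { apply Rmult_le_compat_l; [repeat apply Rmult_le_pos; lra|exact HE]. }
    replace (a * (x * m) * (3 * Rabs w1 * Rabs z1 * t ^ 2 * x + 4 * (W + Z) * e2 * (2 * x)))
      with (a * x ^ 2 * m * (3 * Rabs w1 * Rabs z1 * t ^ 2 + 8 * (W + Z) * e2)) by ring.
    set (G := 3 * Rabs w1 * Rabs z1 * t ^ 2 + 8 * (W + Z) * e2).
    assert (HG0 : 0 <= G).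
    { unfold G. apply Rplus_le_le_0_compat.
      - apply Rmult_le_pos; [apply Rmult_le_pos; lra|apply pow2_ge_0].
      - apply Rmult_le_pos; [apply Rmult_le_pos; lra|lra]. }
    assert (HG : c ^ 2 * G <= P0 / 8).
    { unfold G. rewrite Rmult_plus_distr_l.
      replace (c ^ 2 * (8 * (W + Z) * e2)) with (P0 / 16) by (unfold e2; field; split; lra).
      assert (c ^ 2 * (3 * Rabs w1 * Rabs z1 * t ^ 2) <= P0 / 64); [|lra].
      apply Rle_trans with (2 := Rlt_le _ _ St7).
      replace (c ^ 2 * (3 * Rabs w1 * Rabs z1 * t ^ 2)) with (3 * Rabs w1 * Rabs z1 * c ^ 2 * t * t) by ring.
      rewrite <- (Rmult_1_r (3 * Rabs w1 * Rabs z1 * c ^ 2 * t)) at 2.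
      apply Rmult_le_compat_l; [|lra]. assert (0 <= c ^ 2) by apply pow2_ge_0. repeat apply Rmult_le_pos; lra. }
    assert (m <= x + m) by lra.
    apply Rle_trans with (a * (c ^ 2 * t ^ 2) * (x + m) * G).
    { assert (0 <= a * x ^ 2) by (apply Rmult_le_pos; [lra|apply pow2_ge_0]).
      apply Rmult_le_compat_r; auto. apply Rmult_le_compat; lra. }
    replace (a * (c ^ 2 * t ^ 2) * (x + m) * G) with (a * t ^ 2 * ((x + m) * (c ^ 2 * G))) by ring.
    apply Rmult_le_compat_l; [apply Rmult_le_pos; [lra|apply pow2_ge_0]|]. apply Rmult_le_compat_l; lra. }
  apply Rabs_le_between in K3.
  assert (0 < a * t ^ 2 * ((x + m) * P0)).
  { apply Rmult_lt_0_compat; [apply Rmult_lt_0_compat; [auto|apply pow_lt; auto]|]. apply Rmult_lt_0_compat; lra. }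
  lra.
Qed.

(** * Filippov trajectories *)

(* A Filippov trajectory on [0, T], extended to a continuous curve on R. *)
Definition traj (S : filippov_system) (T : R) (g : R -> R * R) : Prop :=
  (forall t, continuous g t) /\ (forall t, 0 <= t <= T -> sys_dom S (g t)) /\
  exists L : list R, forall t, 0 < t < T -> ~ In t L ->
    exists v, filippov_velocity S (g t) v /\ is_derive g t v.

Lemma traj_filippov (S : filippov_system) (T : R) (g : R -> R * R) :
  traj S T g -> filippov_trajectory S 0 T g.
Proof.
  intros [H1 [H2 H3]]. split; [|split; auto].
  intros t _ P HP. generalize (H1 t P HP). unfold filtermap, within. apply filter_imp. auto.
Qed.

Lemma locally_interval (a b t : R) (P : R -> Prop) :
  a < t < b -> (forall u, a < u < b -> P u) -> locally t P.
Proof.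
  intros Ht HP. assert (Hd : 0 < Rmin (t - a) (b - t)) by (apply Rmin_pos; lra).
  exists (mkposreal _ Hd). intros u Hu. apply HP.
  unfold ball in Hu; simpl in Hu. unfold AbsRing_ball, minus, plus, opp, abs in Hu; simpl in Hu.
  apply Rabs_def2 in Hu. pose proof (Rmin_l (t - a) (b - t)). pose proof (Rmin_r (t - a) (b - t)). lra.
Qed.

Lemma filippov_traj (S : filippov_system) (T : R) (g : R -> R * R) :
  0 <= T -> filippov_trajectory S 0 T g ->
  exists g', traj S T g' /\ forall t, 0 <= t <= T -> g' t = g t.
Proof.
  intros HT [H1 [H2 [L H3]]].
  exists (fun t => g (clamp 0 T t)). split; [split; [|split]|].
  - intros t.
    apply (filterlim_comp _ _ _ (clamp 0 T) g (locally t) (within (fun u => 0 <= u <= T) (locally (clamp 0 T t)))).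
    + intros P HP. unfold within in HP.
      assert (C := clamp_continuous 0 T t HT _ HP). unfold filtermap in *.
      revert C. apply filter_imp. intros x Hx. apply Hx. apply clamp_in; auto.
    + apply H1, clamp_in; auto.
  - intros t Ht. rewrite clamp_id; auto.
  - exists L. intros t Ht Hn. destruct (H3 t Ht Hn) as [v [Hv Hd]].
    exists v. rewrite clamp_id by lra. split; auto.
    apply (is_derive_ext_loc g); auto.
    apply (locally_interval 0 T); auto. intros u Hu. rewrite clamp_id; auto; lra.
  - intros t Ht. rewrite clamp_id; auto.
Qed.

Lemma filippov_ext (S : filippov_system) (T : R) (f g : R -> R * R) :
  (forall t, 0 <= t <= T -> f t = g t) -> filippov_trajectory S 0 T f -> filippov_trajectory S 0 T g.
Proof.
  intros E [H1 [H2 [L H3]]]. split; [|split].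
  - intros t Ht. rewrite <- (E t Ht).
    apply (filterlim_ext_loc f); [|apply H1; auto].
    unfold within. apply filter_forall. intros u Hu. apply E; auto.
  - intros t Ht. rewrite <- E; auto.
  - exists L. intros t Ht Hn. destruct (H3 t Ht Hn) as [v [Hv Hd]].
    exists v. rewrite <- E by lra. split; auto.
    apply (is_derive_ext_loc f); auto.
    apply (locally_interval 0 T); auto. intros u Hu. apply E; lra.
Qed.

Lemma traj_restrict (S : filippov_system) (T T' : R) (g : R -> R * R) :
  T' <= T -> traj S T g -> traj S T' g.
Proof.
  intros HT [H1 [H2 [L H3]]]. split; auto. split.
  - intros t Ht; apply H2; lra.
  - exists L. intros t Ht; apply H3; lra.
Qed.

Definition join {A : Type} (T : R) (f g : R -> A) (t : R) : A :=
  if Rle_dec t T then f t else g (t - T).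

Lemma join_l {A : Type} (T : R) (f g : R -> A) (t : R) : t <= T -> join T f g t = f t.
Proof. intros H. unfold join. destruct Rle_dec; auto; lra. Qed.

Lemma join_r {A : Type} (T : R) (f g : R -> A) (t : R) :
  f T = g 0 -> T <= t -> join T f g t = g (t - T).
Proof.
  intros E H. unfold join. destruct Rle_dec; auto.
  replace t with T by lra. rewrite Rminus_diag. exact E.
Qed.

Lemma join_continuous (T : R) (f g : R -> R) :
  (forall t, continuous f t) -> (forall t, continuous g t) -> f T = g 0 ->
  forall t, continuous (join T f g) t.
Proof.
  intros Hf Hg E t.
  (* This form of the concatenation has no case distinction, so continuity is inherited from [f] and
     [g]. *)
  apply (continuous_ext (fun t => f (Rmin t T) + (g (Rmax 0 (t - T)) - g 0))).
  - intros x. unfold join, Rmin, Rmax. destruct (Rle_dec x T); destruct (Rle_dec 0 (x - T)); try lra.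
    + replace x with T by lra. rewrite Rminus_diag. lra.
  - apply (continuous_plus (V := R_NormedModule) (fun t => f (Rmin t T))).
    + apply (continuous_comp (fun t => Rmin t T) f); [|apply Hf].
      apply lipschitz_continuous with 1. intros a b.
      unfold Rmin, Rabs; repeat destruct Rle_dec; repeat destruct Rcase_abs; lra.
    + apply (continuous_minus (V := R_NormedModule) (fun t => g (Rmax 0 (t - T))) (fun _ => g 0)); [|apply continuous_const].
      apply (continuous_comp (fun t => Rmax 0 (t - T)) g); [|apply Hg].
      apply lipschitz_continuous with 1. intros a b.
      unfold Rmax, Rabs; repeat destruct Rle_dec; repeat destruct Rcase_abs; lra.
Qed.

Lemma join_map {A B : Type} (h : A -> B) (T : R) (f g : R -> A) (t : R) :
  h (join T f g t) = join T (fun t => h (f t)) (fun t => h (g t)) t.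
Proof. unfold join. destruct Rle_dec; reflexivity. Qed.

Lemma traj_concat (S : filippov_system) (T1 T2 : R) (f g : R -> R * R) :
  0 <= T1 -> 0 <= T2 -> traj S T1 f -> traj S T2 g -> f T1 = g 0 -> traj S (T1 + T2) (join T1 f g).
Proof.
  intros HT1 HT2 [F1 [F2 [L F3]]] [G1 [G2 [L' G3]]] E. split; [|split].
  - intros t. apply continuous_prod_iff. split.
    + apply (continuous_ext (join T1 (fun t => fst (f t)) (fun t => fst (g t)))).
      { intros x. symmetry. apply join_map. }
      apply join_continuous; [intros x; apply (continuous_prod_iff f x); auto
        |intros x; apply (continuous_prod_iff g x); auto|rewrite E; reflexivity].
    + apply (continuous_ext (join T1 (fun t => snd (f t)) (fun t => snd (g t)))).
      { intros x. symmetry. apply join_map. }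
      apply join_continuous; [intros x; apply (continuous_prod_iff f x); auto
        |intros x; apply (continuous_prod_iff g x); auto|rewrite E; reflexivity].
  - intros t Ht. unfold join. destruct Rle_dec; [apply F2|apply G2]; lra.
  - exists (T1 :: L ++ map (fun t => t + T1) L'). intros t Ht Hn. simpl in Hn.
    destruct (Rlt_le_dec t T1) as [Hlt|Hle].
    + destruct (F3 t) as [v [Hv Hd]]; [lra| |].
      { intros Hi. apply Hn. right. apply in_or_app; auto. }
      exists v. rewrite join_l by lra. split; auto.
      apply (is_derive_ext_loc f); auto. apply (locally_interval 0 T1); [lra|].
      intros u Hu. rewrite join_l; auto; lra.
    + assert (Hgt : T1 < t) by (destruct Hle as [|<-]; auto; exfalso; apply Hn; auto).
      destruct (G3 (t - T1)) as [v [Hv Hd]]; [lra| |].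
      { intros Hi. apply Hn. right. apply in_or_app. right.
        apply in_map_iff. exists (t - T1). split; [ring|auto]. }
      exists v. rewrite join_r by (auto; lra). split; auto.
      apply (is_derive_ext_loc (fun t => g (t - T1))).
      * apply (locally_interval T1 (t + 1)); [lra|]. intros u Hu. rewrite join_r; auto; lra.
      * evar_last.
        -- apply (is_derive_comp g (fun t => t - T1)); [exact Hd|].
           instantiate (1 := 1). auto_derive; auto.
        -- apply (scal_one v).
Qed.

(** The uniform lower bound [tau] on the durations prevents the junction times from accumulating, so
    the glued curve is defined for all positive times, with finitely many junctions in each bounded
    interval. *)
Lemma traj_glue (S : filippov_system) (f : nat -> R -> R * R) (T : nat -> R) (tau : R) :
  0 < tau -> (forall n, tau <= T n) -> (forall n, traj S (T n) (f n)) ->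
  (forall n, f n (T n) = f (Datatypes.S n) 0) ->
  exists g, g 0 = f 0%nat 0 /\ forall t, 0 < t -> filippov_trajectory S 0 t g.
Proof.
  intros Htau HT Hf Hm.
  set (G := fix G (n : nat) : R * (R -> R * R) := match n with
     | 0%nat => (T 0%nat, f 0%nat)
     | Datatypes.S n => (fst (G n) + T (Datatypes.S n), join (fst (G n)) (snd (G n)) (f (Datatypes.S n))) end).
  assert (HGt : forall n, INR (Datatypes.S n) * tau <= fst (G n)).
  { induction n as [|n IH]; [simpl; specialize (HT 0%nat); lra|].
    change (fst (G (Datatypes.S n))) with (fst (G n) + T (Datatypes.S n)).
    rewrite S_INR. specialize (HT (Datatypes.S n)). lra. }
  assert (HGp : forall n, 0 < fst (G n)).
  { intros n. specialize (HGt n). rewrite S_INR in HGt. pose proof (pos_INR n). nra. }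
  assert (HG : forall n, traj S (fst (G n)) (snd (G n)) /\ snd (G n) (fst (G n)) = f n (T n)).
  { induction n as [|n [IH1 IH2]]; [simpl; auto|].
    change (snd (G (Datatypes.S n))) with (join (fst (G n)) (snd (G n)) (f (Datatypes.S n))).
    change (fst (G (Datatypes.S n))) with (fst (G n) + T (Datatypes.S n)).
    assert (E : snd (G n) (fst (G n)) = f (Datatypes.S n) 0) by (rewrite IH2; apply Hm).
    specialize (HGp n). specialize (HT (Datatypes.S n)).
    split.
    - apply traj_concat; auto; lra.
    - rewrite join_r by (auto; lra). f_equal. ring. }
  assert (Hext : forall n m t, (n <= m)%nat -> t <= fst (G n) -> snd (G m) t = snd (G n) t /\ fst (G n) <= fst (G m)).
  { intros n m t Hnm Ht. induction Hnm as [|m Hnm [IH1 IH2]]; [split; [auto|lra]|].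
    change (snd (G (Datatypes.S m))) with (join (fst (G m)) (snd (G m)) (f (Datatypes.S m))).
    change (fst (G (Datatypes.S m))) with (fst (G m) + T (Datatypes.S m)).
    specialize (HT (Datatypes.S m)).
    rewrite join_l by lra. split; auto; lra. }
  assert (HN : forall t, exists n, t <= fst (G n)).
  { intros t. destruct (INR_unbounded (t / tau)) as [n Hn].
    exists n. apply Rle_trans with (2 := HGt n). rewrite S_INR.
    apply Rmult_gt_compat_r with (r := tau) in Hn; [|lra].
    replace (t / tau * tau) with t in Hn by (field; lra). lra. }
  destruct (functional_choice _ HN) as [N HN'].
  assert (Hall : forall n t, t <= fst (G n) -> snd (G (N t)) t = snd (G n) t).
  { intros n t Ht. destruct (Nat.le_ge_cases n (N t)) as [L|L].
    - apply (Hext n (N t) t L Ht).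
    - symmetry. apply (Hext (N t) n t L (HN' t)). }
  exists (fun t => snd (G (N t)) t). split.
  - rewrite (Hall 0%nat); [reflexivity|]. specialize (HGp 0%nat). lra.
  - intros t Ht. destruct (HN t) as [n Hn].
    apply (filippov_ext S t (snd (G n))).
    + intros u Hu. symmetry. apply Hall. lra.
    + apply traj_filippov. apply traj_restrict with (fst (G n)); auto. apply HG.
Qed.

(* Time parametrization of a graph y = eta(x) invariant under [W], travelled
   from x0 in the direction [dir] over a length [len]. *)
Lemma graph_curve (W : vector_field) (eta : R -> R) (xl xr m Mx dir x0 len : R) :
  dir = 1 \/ dir = -1 -> 0 < m -> 0 < len ->
  xl < x0 < xr -> xl < x0 + dir * len < xr ->
  (forall x, xl < x < xr -> m <= dir * vX W x (eta x) <= Mx) ->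
  (forall x, xl < x < xr -> continuous (fun x => vX W x (eta x)) x) ->
  (forall x, xl < x < xr -> is_derive eta x (slope W x (eta x))) ->
  exists (T : R) (xi : R -> R), 0 < T /\ len <= Mx * T /\
    (forall t, continuous xi t /\ continuous (fun t => eta (xi t)) t) /\
    xi 0 = x0 /\ xi T = x0 + dir * len /\
    (forall t, 0 <= t <= T -> 0 <= dir * (xi t - x0) <= len) /\
    (forall t, 0 < t < T -> 0 < dir * (xi t - x0) < len /\
       is_derive (fun t => (xi t, eta (xi t))) t (veval W (xi t, eta (xi t)))).
Proof.
  intros Hdir Hm Hlen Hx0 Hx3 HX HXc Heta.
  set (cl := fun z => x0 + dir * clamp 0 len z).
  assert (Hcl : forall z, xl < cl z < xr).
  { intros z. unfold cl. pose proof (clamp_in 0 len z ltac:(lra)). destruct Hdir as [-> | ->]; lra. }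
  assert (Hclc : forall z, continuous cl z).
  { intros z. unfold cl. apply (continuous_plus (V := R_NormedModule) (fun _ => x0)); [apply continuous_const|].
    apply (continuous_mult (K := R_AbsRing) (fun _ => dir)); [apply continuous_const|apply clamp_continuous; lra]. }
  set (kap := fun z => / (dir * vX W (cl z) (eta (cl z)))).
  assert (Hkp : forall z, 0 < dir * vX W (cl z) (eta (cl z)) <= Mx).
  { intros z. specialize (HX _ (Hcl z)). lra. }
  assert (Hk : forall z, 0 < kap z) by (intros z; apply Rinv_0_lt_compat, Hkp).
  assert (Hkc : forall z, continuous kap z).
  { intros z. unfold kap.
    apply (continuous_comp (fun z => dir * vX W (cl z) (eta (cl z))) Rinv).
    - apply (continuous_mult (K := R_AbsRing) (fun _ => dir)); [apply continuous_const|].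
      apply (continuous_comp cl (fun x => vX W x (eta x))); auto.
    - apply continuous_Rinv. specialize (Hkp z). lra. }
  (* [tm z] is the time needed to cover the distance z, the integral of the inverse horizontal
     speed; the motion is its inverse function. It is inverted on (-1, len + 1) so that both ends of
     the arc are interior points. *)
  set (tm := fun z => RInt kap 0 z).
  assert (Htm : forall z, is_derive tm z (kap z)).
  { intros z. apply (is_derive_RInt kap tm 0); auto. apply filter_forall. intros b.
    apply (RInt_correct (V := R_CompleteNormedModule)).
    apply (ex_RInt_continuous (V := R_CompleteNormedModule)). auto. }
  destruct (inverse_function tm kap (-1) (len + 1)) as [v [V1 [V2 V3]]]; [lra|auto|auto|].
  assert (Hinc := strictly_increasing_of_derive tm kap (-1) (len + 1) (fun x _ => Htm x) (fun x _ => Hk x)).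
  assert (T0 : tm 0 = 0) by (unfold tm; rewrite RInt_point; reflexivity).
  set (T := tm len).
  assert (HT : 0 < T) by (rewrite <- T0; apply Hinc; lra).
  assert (HTa : tm (-1) < 0) by (rewrite <- T0; apply Hinc; lra).
  assert (HTb : T < tm (len + 1)) by (apply Hinc; lra).
  assert (Hv0 : v 0 = 0) by (rewrite <- T0 at 1; apply V1; lra).
  assert (HvT : v T = len) by (apply V1; lra).
  assert (Hvm : forall s t, 0 <= s -> s < t -> t <= T -> v s < v t).
  { intros s t H1 H2 H3. destruct (V2 s) as [A1 B1]; [lra|]. destruct (V2 t) as [A2 B2]; [lra|].
    apply Rnot_le_lt. intros L. destruct L as [L|L].
    - assert (tm (v t) < tm (v s)) by (apply Hinc; lra). lra.
    - rewrite L in B2. lra. }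
  assert (Hvr : forall t, 0 <= t <= T -> 0 <= v t <= len).
  { intros t Ht. destruct (Req_dec t 0) as [->|N0]; [lra|]. destruct (Req_dec t T) as [->|NT]; [lra|].
    assert (v 0 < v t) by (apply Hvm; lra). assert (v t < v T) by (apply Hvm; lra). lra. }
  set (xi := fun t => x0 + dir * v (clamp 0 T t)).
  assert (Hxr : forall t, 0 <= v (clamp 0 T t) <= len) by (intros t; apply Hvr, clamp_in; lra).
  assert (Hxd : forall t, xl < xi t < xr).
  { intros t. unfold xi. specialize (Hxr t). destruct Hdir as [-> | ->]; lra. }
  assert (Hdd : dir * dir = 1) by (destruct Hdir as [-> | ->]; ring).
  assert (Hxc : forall t, continuous xi t).
  { intros t. unfold xi. apply (continuous_plus (V := R_NormedModule) (fun _ => x0)); [apply continuous_const|].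
    apply (continuous_mult (K := R_AbsRing) (fun _ => dir)); [apply continuous_const|].
    apply (continuous_comp (clamp 0 T) v); [apply clamp_continuous; lra|].
    pose proof (clamp_in 0 T t ltac:(lra)).
    apply (is_derive_continuous v _ _ (V3 (clamp 0 T t) ltac:(lra))). }
  exists T, xi. split; [auto|]. split; [|split; [|split; [|split; [|split]]]].
  - destruct (mean_value tm kap 0 len) as [c [Hc E]]; [lra|auto|].
    rewrite T0 in E. fold T in E. replace T with (kap c * len) by lra.
    specialize (Hkp c). unfold kap.
    assert (1 <= Mx * / (dir * vX W (cl c) (eta (cl c)))); [|nra].
    apply Rmult_le_reg_r with (dir * vX W (cl c) (eta (cl c))); [lra|].
    rewrite Rmult_assoc, Rinv_l by lra. lra.
  - intros t. split; [apply Hxc|]. apply (continuous_comp xi eta); [apply Hxc|].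
    apply (is_derive_continuous eta _ _ (Heta _ (Hxd t))).
  - unfold xi. rewrite clamp_id, Hv0 by lra. ring.
  - unfold xi. rewrite clamp_id, HvT by lra. ring.
  - intros t Ht. unfold xi. specialize (Hxr t).
    replace (dir * (x0 + dir * v (clamp 0 T t) - x0)) with (dir * dir * v (clamp 0 T t)) by ring.
    rewrite Hdd. lra.
  - intros t Ht.
    assert (Hvt : 0 < v t < len).
    { assert (v 0 < v t) by (apply Hvm; lra). assert (v t < v T) by (apply Hvm; lra). lra. }
    assert (Hxt : xi t = x0 + dir * v t) by (unfold xi; rewrite clamp_id by lra; reflexivity).
    split.
    + rewrite Hxt. replace (dir * (x0 + dir * v t - x0)) with (dir * dir * v t) by ring. rewrite Hdd. lra.
    + assert (Hxi : is_derive xi t (vX W (xi t) (eta (xi t)))).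
      { apply (is_derive_ext_loc (fun t => x0 + dir * v t)).
        - apply (locally_interval 0 T); auto. intros u Hu. unfold xi. rewrite clamp_id; auto; lra.
        - evar_last.
          + apply (is_derive_plus (V := R_NormedModule) (fun _ => x0)); [apply (is_derive_const (V := R_NormedModule))|].
            apply (is_derive_scal v t dir). apply V3. lra.
          + unfold plus, zero; simpl. rewrite Rplus_0_l.
            unfold kap. rewrite Rinv_inv. unfold cl. rewrite clamp_id by lra. rewrite <- Hxt.
            rewrite <- Rmult_assoc, Hdd. ring. }
      apply is_derive_pair. simpl. split; [exact Hxi|].
      evar_last.
      * apply (is_derive_comp eta xi); [apply Heta; apply Hxd|exact Hxi].
      * unfold scal; simpl; unfold mult; simpl. unfold slope. field.
        specialize (HX _ (Hxd t)). intros E. rewrite E in HX. lra.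
Qed.

(** * Crossing ovals *)

Definition sgn (b : bool) : R := if b then 1 else -1.

Lemma sgn_cases (b : bool) : sgn b = 1 \/ sgn b = -1.
Proof. destruct b; simpl; auto. Qed.

Lemma sgn_sqr (b : bool) : sgn b * sgn b = 1.
Proof. destruct b; simpl; ring. Qed.

(* One half of an oval around a tangency at c0: an orbit arc of [W] on the side
   sgn b * y > 0 joins (x1, 0) and (x2, 0); sgn o is the direction of [W] for b = true. *)
Definition half_oval (W : vector_field) (b o : bool) (xl x1 c0 x2 xr ry m Mx C : R)
    (H : R -> R -> R) (E : R -> R) : Prop :=
  xl < x1 /\ x1 < c0 /\ c0 < x2 /\ x2 < xr /\ 0 < m /\ C * (x2 - x1) < ry / 4 /\
  (forall x y, xl < x < xr -> Rabs y < ry ->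
     vdom W (x, y) /\ m <= sgn b * sgn o * vX W x y <= Mx) /\
  (forall x y x' y', xl < x < xr -> xl < x' < xr -> Rabs y < ry -> Rabs y' < ry ->
     Rabs (vX W x y - vX W x' y') <= C * (Rabs (x - x') + Rabs (y - y')) /\
     Rabs (vY W x y - vY W x' y') <= C * (Rabs (x - x') + Rabs (y - y'))) /\
  first_integral (slope W) H E xl xr ry C /\
  (forall x, xl < x < c0 -> 0 < sgn b * slope W x 0) /\
  (forall x, c0 < x < xr -> sgn b * slope W x 0 < 0) /\
  H x1 0 = H x2 0.

Section HalfOval.

Context {W : vector_field} {b o : bool} {xl x1 c0 x2 xr ry m Mx C : R}
  {H : R -> R -> R} {E : R -> R}.
Hypothesis HO : half_oval W b o xl x1 c0 x2 xr ry m Mx C H E.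

Let du (x : R) : R := - slope W x 0 * E x.

Lemma ho_order : xl < x1 /\ x1 < c0 /\ c0 < x2 /\ x2 < xr /\ 0 < m /\ 0 < C /\ 0 < ry /\ C * (x2 - x1) < ry / 4.
Proof. destruct HO as (? & ? & ? & ? & ? & ? & ? & ? & (? & ? & _) & _). intuition. Qed.

Lemma ho_field (x y : R) : xl < x < xr -> Rabs y < ry ->
  vdom W (x, y) /\ m <= sgn b * sgn o * vX W x y <= Mx.
Proof. destruct HO as (_ & _ & _ & _ & _ & _ & HF & _). apply HF. Qed.

Lemma ho_lipschitz (x y x' y' : R) : xl < x < xr -> xl < x' < xr -> Rabs y < ry -> Rabs y' < ry ->
  Rabs (vX W x y - vX W x' y') <= C * (Rabs (x - x') + Rabs (y - y')) /\
  Rabs (vY W x y - vY W x' y') <= C * (Rabs (x - x') + Rabs (y - y')).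
Proof. destruct HO as (_ & _ & _ & _ & _ & _ & _ & HL & _). apply HL. Qed.

Lemma ho_fi : first_integral (slope W) H E xl xr ry C.
Proof. apply HO. Qed.

Lemma ho_du (x : R) : xl < x < xr -> is_derive (fun x => H x 0) x (du x).
Proof. intros Hx. apply ho_fi. exact Hx. Qed.

Lemma ho_du_neg (x : R) : xl < x < c0 -> sgn b * du x < 0.
Proof.
  intros Hx. destruct ho_order as (_ & _ & O1 & O2 & _).
  destruct ho_fi as (_ & _ & _ & _ & _ & _ & HE). destruct (HE x ltac:(lra)) as [Ep _].
  destruct HO as (_ & _ & _ & _ & _ & _ & _ & _ & _ & HS & _). specialize (HS x Hx).
  unfold du. replace (sgn b * (- slope W x 0 * E x)) with (- (sgn b * slope W x 0 * E x)) by ring.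
  assert (0 < sgn b * slope W x 0 * E x) by (apply Rmult_lt_0_compat; auto). lra.
Qed.

Lemma ho_du_pos (x : R) : c0 < x < xr -> 0 < sgn b * du x.
Proof.
  intros Hx. destruct ho_order as (O0 & O1 & _).
  destruct ho_fi as (_ & _ & _ & _ & _ & _ & HE). destruct (HE x ltac:(lra)) as [Ep _].
  destruct HO as (_ & _ & _ & _ & _ & _ & _ & _ & _ & _ & HS & _). specialize (HS x Hx).
  unfold du. replace (sgn b * (- slope W x 0 * E x)) with ((- (sgn b * slope W x 0)) * E x) by ring.
  apply Rmult_lt_0_compat; lra.
Qed.

Lemma ho_decreasing (x y : R) : xl < x -> x < y -> y <= c0 -> sgn b * H y 0 < sgn b * H x 0.
Proof.
  intros Hx Hxy Hy. destruct ho_order as (_ & _ & O1 & O2 & _).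
  destruct (mean_value_strict (fun x => H x 0) du x y Hxy) as [c [Hc Ec]].
  - intros z Hz. apply ho_du; lra.
  - assert (T := ho_du_neg c ltac:(lra)).
    assert (0 < - (sgn b * du c) * (y - x)) by (apply Rmult_lt_0_compat; lra).
    replace (sgn b * H y 0) with (sgn b * H x 0 + sgn b * (H y 0 - H x 0)) by ring. rewrite Ec. lra.
Qed.

Lemma ho_increasing (x y : R) : c0 <= x -> x < y -> y < xr -> sgn b * H x 0 < sgn b * H y 0.
Proof.
  intros Hx Hxy Hy. destruct ho_order as (O0 & O1 & _).
  destruct (mean_value_strict (fun x => H x 0) du x y Hxy) as [c [Hc Ec]].
  - intros z Hz. apply ho_du; lra.
  - assert (T := ho_du_pos c ltac:(lra)).
    assert (0 < sgn b * du c * (y - x)) by (apply Rmult_lt_0_compat; lra).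
    replace (sgn b * H y 0) with (sgn b * H x 0 + sgn b * (H y 0 - H x 0)) by ring. rewrite Ec. lra.
Qed.

(** The restriction to the axis has a single turning point [c0], so no interior abscissa reaches the
    larger end value. Hence a level curve between two axis points of equal level stays off the
    axis. *)
Lemma ho_valley (x z xi : R) : xl < x -> x < xi -> xi < z -> z < xr ->
  sgn b * H xi 0 < Rmax (sgn b * H x 0) (sgn b * H z 0).
Proof.
  intros H1 H2 H3 H4. destruct (Rle_dec xi c0).
  - apply Rlt_le_trans with (2 := Rmax_l _ _). apply ho_decreasing; auto.
  - apply Rlt_le_trans with (2 := Rmax_r _ _). apply ho_increasing; lra.
Qed.

Lemma ho_inc_y (x y y' : R) : xl < x < xr -> y < y' -> y' - y <= C * (H x y' - H x y).
Proof. intros Hx. apply ho_fi; auto. Qed.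

Lemma ho_lip_H (x y x' y' : R) : xl < x < xr -> xl < x' < xr ->
  Rabs (H x' y' - H x y) <= C * (Rabs (x' - x) + Rabs (y' - y)).
Proof. intros Hx Hx'. apply ho_fi; auto. Qed.

Lemma ho_dist_y (x y y' : R) : xl < x < xr -> Rabs (y' - y) <= C * Rabs (H x y' - H x y).
Proof.
  intros Hx. destruct ho_order as (_ & _ & _ & _ & _ & HC & _).
  destruct (Rtotal_order y y') as [L|[->|L]].
  - assert (T := ho_inc_y x y y' Hx L). rewrite Rabs_right by lra.
    apply Rle_trans with (1 := T). apply Rmult_le_compat_l; [lra|apply Rle_abs].
  - rewrite !Rminus_diag, Rabs_R0. lra.
  - assert (T := ho_inc_y x y' y Hx L). rewrite Rabs_left by lra.
    rewrite Rabs_minus_sym. apply Rle_trans with (C * (H x y - H x y')); [lra|].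
    apply Rmult_le_compat_l; [lra|apply Rle_abs].
Qed.

Lemma ho_lt_iff (x y y' : R) : xl < x < xr -> sgn b * H x y < sgn b * H x y' <-> sgn b * y < sgn b * y'.
Proof.
  intros Hx. destruct ho_order as (_ & _ & _ & _ & _ & HC & _).
  assert (Hm : forall u v, u < v -> H x u < H x v).
  { intros u v L. assert (T := ho_inc_y x u v Hx L).
    apply Rnot_le_lt. intros N. assert (C * (H x v - H x u) <= 0); [|lra].
    assert (0 <= C * (H x u - H x v)) by (apply Rmult_le_pos; lra). lra. }
  destruct (sgn_cases b) as [-> | ->]; split; intros L.
  - destruct (Rtotal_order y y') as [K|[K|K]]; [lra|subst; lra|assert (T := Hm _ _ K); lra].
  - assert (T := Hm y y' ltac:(lra)). lra.
  - destruct (Rtotal_order y' y) as [K|[K|K]]; [lra|subst; lra|assert (T := Hm _ _ K); lra].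
  - assert (T := Hm y' y ltac:(lra)). lra.
Qed.

Lemma ho_injective (x y y' : R) : xl < x < xr -> H x y = H x y' -> y = y'.
Proof.
  intros Hx Heq. assert (T := ho_dist_y x y y' Hx). rewrite Heq, Rminus_diag, Rabs_R0, Rmult_0_r in T.
  pose proof (Rabs_pos (y' - y)). symmetry. apply Rminus_diag_uniq, Rabs_eq_0. lra.
Qed.

Lemma ho_level (x y : R) : xl < x < xr -> Rabs y < ry / 2 ->
  exists eta : R -> R, eta x = y /\ forall s, xl < s < xr ->
       Rabs (eta s) < ry /\ (forall s', Rabs (eta s - eta s') <= C * Rabs (s - s')) /\ H s (eta s) = H x y /\
       is_derive eta s (slope W s (eta s)).
Proof. intros Hx Hy. apply ho_fi; auto. Qed.

Lemma ho_X_continuous (eta : R -> R) :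
  (forall x, xl < x < xr -> Rabs (eta x) < ry /\ (forall x', Rabs (eta x - eta x') <= C * Rabs (x - x'))) ->
  forall x, xl < x < xr -> continuous (fun x => vX W x (eta x)) x.
Proof.
  intros He x Hx. destruct ho_order as (_ & _ & _ & _ & _ & HC & _).
  apply continuous_eps. intros eps Heps.
  exists (Rmin (eps / (C * (1 + C) + 1)) (Rmin (x - xl) (xr - x))).
  assert (HCC : 0 < C * (1 + C)) by (apply Rmult_lt_0_compat; lra).
  split; [repeat apply Rmin_pos; try lra; apply Rdiv_lt_0_compat; lra|].
  intros y Hy.
  assert (A1 : Rabs (y - x) < eps / (C * (1 + C) + 1)) by rmin.
  assert (A2 : Rabs (y - x) < x - xl) by rmin.
  assert (A3 : Rabs (y - x) < xr - x) by rmin.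
  apply Rabs_def2 in A2. apply Rabs_def2 in A3. assert (Hyr : xl < y < xr) by lra.
  destruct (He x Hx) as [B1 _]. destruct (He y Hyr) as [B2 B3].
  destruct (ho_lipschitz y (eta y) x (eta x) Hyr Hx B2 B1) as [T _].
  specialize (B3 x).
  apply Rle_lt_trans with (1 := T). apply Rle_lt_trans with (C * (1 + C) * Rabs (y - x)).
  - rewrite Rmult_assoc. apply Rmult_le_compat_l; lra.
  - apply Rle_lt_trans with ((C * (1 + C) + 1) * Rabs (y - x)); [pose proof (Rabs_pos (y - x)); lra|].
    apply Rmult_lt_compat_l with (r := C * (1 + C) + 1) in A1; [|lra].
    replace ((C * (1 + C) + 1) * (eps / (C * (1 + C) + 1))) with eps in A1 by (field; lra). exact A1.
Qed.

(** The level graph through (x, y) is invariant, so it only has to be parametrized by time. The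
    assumption on intermediate abscissas says that the axis has a lower level there, and
    monotonicity in y puts the graph on the side [sgn b]. *)
Lemma ho_arc (x y z : R) :
  xl < x < xr -> Rabs y < ry / 2 -> xl < z < xr -> H x y = H z 0 -> 0 < sgn b * sgn o * (z - x) ->
  (forall xi, Rmin x z < xi < Rmax x z -> sgn b * H xi 0 < sgn b * H z 0) ->
  exists (T : R) (g : R -> R * R), 0 < T /\ Rabs (z - x) <= Mx * T /\
    (forall t, continuous g t) /\ g 0 = (x, y) /\ g T = (z, 0) /\
    (forall t, 0 <= t <= T -> xl < fst (g t) < xr /\ Rabs (snd (g t)) < ry /\
       H (fst (g t)) (snd (g t)) = H z 0 /\ Rmin x z <= fst (g t) <= Rmax x z) /\
    (forall t, 0 < t < T -> 0 < sgn b * snd (g t) /\ is_derive g t (veval W (g t)) /\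
       Rmin x z < fst (g t) < Rmax x z) /\
    (forall xi, Rmin x z <= xi <= Rmax x z -> exists t, 0 <= t <= T /\ fst (g t) = xi).
Proof.
  intros Hx Hy Hz Hlev Hdir Hval. destruct ho_order as (_ & _ & _ & _ & Hm & HC & _).
  destruct (ho_level x y Hx Hy) as [eta [He0 He]].
  set (dir := sgn b * sgn o) in *.
  assert (Hd : dir = 1 \/ dir = -1).
  { unfold dir. destruct (sgn_cases b) as [-> | ->]; destruct (sgn_cases o) as [-> | ->]; [left|right|right|left]; ring. }
  set (len := dir * (z - x)) in *.
  assert (Hzl : x + dir * len = z) by (unfold len; destruct Hd as [-> | ->]; ring).
  destruct (graph_curve W eta xl xr m Mx dir x len Hd Hm Hdir Hx) as (T & xi & HT & HTl & Hc & X0 & XT & Xr & Xd).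
  { rewrite Hzl; auto. }
  { intros s Hs. apply ho_field; auto. apply He; auto. }
  { apply ho_X_continuous. intros s Hs. destruct (He s Hs) as (A & B & _). auto. }
  { intros s Hs. apply He; auto. }
  rewrite Hzl in XT.
  assert (Hrange : forall t, 0 <= t <= T -> Rmin x z <= xi t <= Rmax x z).
  { intros t Ht. specialize (Xr t Ht). unfold len in Xr.
    unfold Rmin, Rmax. destruct Hd as [Ed|Ed]; rewrite Ed in *; destruct (Rle_dec x z); lra. }
  assert (Hin : forall u, Rmin x z <= u <= Rmax x z -> xl < u < xr).
  { intros u Hu. unfold Rmin, Rmax in Hu. destruct (Rle_dec x z); lra. }
  assert (Hez : eta z = 0).
  { apply (ho_injective z); auto. destruct (He z Hz) as (_ & _ & Eq & _). rewrite Eq. exact Hlev. }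
  exists T, (fun t => (xi t, eta (xi t))). simpl.
  split; [auto|]. split.
  { replace (Rabs (z - x)) with len; auto. unfold len. symmetry.
    destruct Hd as [Ed|Ed]; rewrite Ed in *; [rewrite Rabs_right|rewrite Rabs_left]; lra. }
  split; [intros t; apply continuous_prod_iff; simpl; apply Hc|].
  split; [rewrite X0, He0; auto|]. split; [rewrite XT, Hez; auto|].
  split; [|split].
  - intros t Ht. assert (R1 := Hrange t Ht). assert (R2 := Hin _ R1).
    destruct (He _ R2) as (A & _ & B & _). rewrite B. auto.
  - intros t Ht. destruct (Xd t Ht) as [D1 D2].
    assert (R1 := Hrange t ltac:(lra)). assert (R2 := Hin _ R1).
    assert (R3 : Rmin x z < xi t < Rmax x z).
    { unfold len in D1. unfold Rmin, Rmax. destruct Hd as [Ed|Ed]; rewrite Ed in *; destruct (Rle_dec x z); lra. }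
    split; [|split; auto].
    specialize (Hval _ R3). destruct (He _ R2) as (_ & _ & B & _).
    rewrite <- Hlev, <- B in Hval. apply ho_lt_iff in Hval; auto. lra.
  - intros u Hu. destruct (ivt xi 0 T u) as [t [Ht Et]]; [lra| | |exists t; auto].
    + intros t _. apply Hc.
    + rewrite X0, XT. exact Hu.
Qed.

Lemma ho_end_inverse (xe del : R) : xe = x1 \/ xe = x2 -> 0 < del ->
  exists (V : R -> R) (d : R), 0 < d /\ V (H xe 0) = xe /\
    forall h, Rabs (h - H xe 0) < d -> Rabs (V h - xe) < del /\ xl < V h < xr /\ H (V h) 0 = h /\
      is_derive V h (/ du (V h)).
Proof.
  intros Hxe Hdel. destruct ho_order as (O1 & O2 & O3 & O4 & _).
  set (e := Rmin (del / 2) (Rmin (Rmin ((x1 - xl) / 2) ((c0 - x1) / 2)) (Rmin ((x2 - c0) / 2) ((xr - x2) / 2)))).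
  assert (He : 0 < e) by (unfold e; repeat apply Rmin_pos; lra).
  assert (E0 : e <= del / 2) by apply Rmin_l.
  assert (E1 : e <= (x1 - xl) / 2) by rmin.
  assert (E2 : e <= (c0 - x1) / 2) by rmin.
  assert (E3 : e <= (x2 - c0) / 2) by rmin.
  assert (E4 : e <= (xr - x2) / 2) by rmin.
  (* The sign [tau] makes the restricted first integral increasing near the chosen end, so that one
     inverse function lemma serves both ends. *)
  assert (Ht : exists tau, tau * tau = 1 /\ forall x, xe - e <= x <= xe + e -> xl < x < xr /\ 0 < tau * du x).
  { destruct Hxe as [-> | ->].
    - exists (- sgn b). split; [rewrite <- (sgn_sqr b); ring|]. intros x Hx. split; [lra|].
      assert (T := ho_du_neg x ltac:(lra)). lra.
    - exists (sgn b). split; [apply sgn_sqr|]. intros x Hx. split; [lra|].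
      apply ho_du_pos; lra. }
  destruct Ht as (tau & Ht2 & Htau).
  destruct (inverse_function (fun x => tau * H x 0) (fun x => tau * du x) (xe - e) (xe + e)) as [v [V1 [V2 V3]]].
  { lra. }
  { intros x Hx. apply (is_derive_scal (fun x => H x 0) x tau). apply ho_du. apply Htau; auto. }
  { intros x Hx. apply Htau; auto. }
  assert (Hinc := strictly_increasing_of_derive (fun x => tau * H x 0) (fun x => tau * du x) (xe - e) (xe + e)
    (fun x Hx => is_derive_scal (fun x => H x 0) x tau _ (ho_du x (proj1 (Htau x Hx)))) (fun x Hx => proj2 (Htau x Hx))).
  simpl in Hinc.
  assert (I1 : tau * H (xe - e) 0 < tau * H xe 0) by (apply Hinc; lra).
  assert (I2 : tau * H xe 0 < tau * H (xe + e) 0) by (apply Hinc; lra).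
  set (d := Rmin (tau * H xe 0 - tau * H (xe - e) 0) (tau * H (xe + e) 0 - tau * H xe 0)).
  exists (fun h => v (tau * h)), d. split; [apply Rmin_pos; lra|]. split; [apply V1; lra|].
  intros h Hh.
  assert (Hat : Rabs tau = 1).
  { pose proof (Rabs_pos tau). assert (Rabs tau * Rabs tau = 1) by (rewrite <- Rabs_mult, Ht2; apply Rabs_R1). nra. }
  assert (Hth : Rabs (tau * h - tau * H xe 0) < d) by (rewrite <- Rmult_minus_distr_l, Rabs_mult, Hat; lra).
  apply Rabs_def2 in Hth.
  assert (D1 : d <= tau * H xe 0 - tau * H (xe - e) 0) by apply Rmin_l.
  assert (D2 : d <= tau * H (xe + e) 0 - tau * H xe 0) by apply Rmin_r.
  assert (Hth2 : tau * H (xe - e) 0 < tau * h < tau * H (xe + e) 0) by lra.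
  destruct (V2 (tau * h)) as [R1 R2]; [lra|].
  split; [apply Rabs_def1; lra|]. split; [apply Htau; auto|]. split.
  - apply Rmult_eq_reg_l with tau; auto. intros Z; rewrite Z in Ht2; lra.
  - evar_last.
    + apply (is_derive_comp v (fun h => tau * h)); [apply V3; exact Hth2|].
      instantiate (1 := tau). auto_derive; auto. ring.
    + destruct (Htau _ R1) as [_ R3]. unfold scal; simpl; unfold mult; simpl. field.
      split; intros Z; rewrite Z in *; lra.
Qed.

Lemma ho_eta : exists eta : R -> R,
  eta x1 = 0 /\ eta x2 = 0 /\
  (forall s, xl < s < xr -> Rabs (eta s) < ry /\ (forall s', Rabs (eta s - eta s') <= C * Rabs (s - s')) /\
     H s (eta s) = H x1 0) /\
  (forall s, x1 < s < x2 -> 0 < sgn b * eta s) /\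
  (forall s, x1 <= s <= x2 -> Rabs (eta s) < ry / 4).
Proof.
  destruct ho_order as (O1 & O2 & O3 & O4 & _ & HC & Hry & Hsm).
  assert (H12 : H x1 0 = H x2 0) by apply HO.
  destruct (ho_level x1 0) as [eta [E1 He]]; [lra|rewrite Rabs_R0; lra|].
  exists eta. split; [auto|]. split.
  { apply (ho_injective x2); [lra|]. rewrite <- H12. apply He; lra. }
  split; [intros s Hs; destruct (He s Hs) as (A & B & D & _); auto|]. split.
  - intros s Hs.
    assert (T := ho_valley x1 x2 s ltac:(lra) ltac:(lra) ltac:(lra) ltac:(lra)).
    rewrite <- H12, Rmax_left in T by lra.
    destruct (He s ltac:(lra)) as (_ & _ & D & _). rewrite <- D in T.
    apply ho_lt_iff in T; [|lra]. lra.
  - intros s Hs. destruct (He s ltac:(lra)) as (_ & B & _). specialize (B x1). rewrite E1, Rminus_0_r in B.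
    apply Rle_lt_trans with (1 := B). rewrite Rabs_right by lra.
    apply Rle_lt_trans with (2 := Hsm). apply Rmult_le_compat_l; lra.
Qed.

Lemma ho_constant (g : R -> R * R) (t : R) :
  xl < fst (g t) < xr -> Rabs (snd (g t)) < ry -> is_derive g t (veval W (g t)) ->
  is_derive (fun t => H (fst (g t)) (snd (g t))) t 0.
Proof.
  intros Hx Hy Hg. apply is_derive_pair in Hg. destruct Hg as [G1 G2]. simpl in G1, G2.
  destruct ho_fi as (_ & _ & _ & _ & HK & _).
  apply (HK (fun t => fst (g t)) (fun t => snd (g t)) t (vX W (fst (g t)) (snd (g t)))); auto.
  replace (slope W (fst (g t)) (snd (g t)) * vX W (fst (g t)) (snd (g t))) with (vY W (fst (g t)) (snd (g t))); auto.
  unfold slope. field. destruct (ho_field _ _ Hx Hy) as [_ B]. intros Z. rewrite Z in B.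
  destruct ho_order as (_ & _ & _ & _ & Hm & _). lra.
Qed.

(** The sign does not depend on the side [b]. With two tangencies this yields crossing in one
    direction to the left of both, crossing in the other direction to the right of both, and sliding
    in between. *)
Lemma ho_sign_Y (x : R) : (xl < x < c0 -> 0 < sgn o * vY W x 0) /\ (c0 < x < xr -> sgn o * vY W x 0 < 0).
Proof.
  destruct ho_order as (O1 & O2 & O3 & O4 & Hm & HC & Hry & _).
  assert (HY : xl < x < xr -> sgn o * vY W x 0 = sgn b * slope W x 0 * (sgn b * sgn o * vX W x 0) /\
                 0 < sgn b * sgn o * vX W x 0).
  { intros Hx. destruct (ho_field x 0 Hx ltac:(rewrite Rabs_R0; lra)) as [_ B]. split; [|lra].
    unfold slope. replace (sgn b * (vY W x 0 * / vX W x 0) * (sgn b * sgn o * vX W x 0))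
      with (sgn b * sgn b * (sgn o * vY W x 0)) by (field; intros Z; rewrite Z in B; lra).
    rewrite sgn_sqr; ring. }
  destruct HO as (_ & _ & _ & _ & _ & _ & _ & _ & _ & S1 & S2 & _).
  split; intros Hx; destruct (HY ltac:(lra)) as [-> B].
  - apply Rmult_lt_0_compat; auto.
  - specialize (S2 x Hx).
    assert (0 < - (sgn b * slope W x 0) * (sgn b * sgn o * vX W x 0)) by (apply Rmult_lt_0_compat; lra). lra.
Qed.

End HalfOval.

Definition half_field (S : filippov_system) (b : bool) : vector_field := if b then Zp S else Zm S.

Lemma sgn_negb (b : bool) : sgn (negb b) = - sgn b.
Proof. destruct b; simpl; ring. Qed.

Lemma abs_sgn (b : bool) (x : R) : Rabs (sgn b * x) = Rabs x.
Proof. destruct b; simpl; [rewrite Rmult_1_l; auto|]. replace (-1 * x) with (- x) by ring. apply Rabs_Ropp. Qed.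

Section Oval.

Variables (S : filippov_system) (o : bool) (xl x1 x2 xr ry m Mx C : R)
  (c0 : bool -> R) (H : bool -> R -> R -> R) (E : bool -> R -> R) (eta : bool -> R -> R).
Hypothesis HO : forall b, half_oval (half_field S b) b o xl x1 (c0 b) x2 xr ry m Mx C (H b) (E b).
Hypothesis Heta : forall b,
  eta b x1 = 0 /\ eta b x2 = 0 /\
  (forall s, xl < s < xr -> Rabs (eta b s) < ry /\ (forall s', Rabs (eta b s - eta b s') <= C * Rabs (s - s')) /\
     H b s (eta b s) = H b x1 0) /\
  (forall s, x1 < s < x2 -> 0 < sgn b * eta b s) /\
  (forall s, x1 <= s <= x2 -> Rabs (eta b s) < ry / 4).

Let du (b : bool) (x : R) : R := - slope (half_field S b) x 0 * E b x.
Let dir (b : bool) : R := sgn b * sgn o.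

(** * The oval and its gauge *)

Definition oval (p : R * R) : Prop :=
  x1 <= fst p <= x2 /\ exists b, snd p = eta b (fst p).

(* Vanishes exactly on the oval, positive inside. *)
Definition gauge (p : R * R) : R :=
  Rmin (eta true (clamp x1 x2 (fst p)) - snd p) (snd p - eta false (clamp x1 x2 (fst p)))
  - Rabs (fst p - clamp x1 x2 (fst p)).

Lemma ov_order : xl < x1 /\ x1 < x2 /\ x2 < xr /\ 0 < m /\ 0 < C /\ 0 < ry /\
  (forall b, x1 < c0 b < x2).
Proof.
  assert (T := ho_order (HO true)).
  assert (T' := ho_order (HO false)).
  repeat split; try lra; destruct b; lra.
Qed.

Lemma eta_nonneg (b : bool) (x : R) : x1 <= x <= x2 -> 0 <= sgn b * eta b x.
Proof.
  intros Hx. destruct (Heta b) as (A1 & A2 & _ & A3 & _).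
  destruct (Req_dec x x1) as [->|N1]; [rewrite A1; lra|].
  destruct (Req_dec x x2) as [->|N2]; [rewrite A2; lra|].
  apply Rlt_le, A3; lra.
Qed.

Lemma gauge_inside (x y : R) : x1 <= x <= x2 ->
  gauge (x, y) = Rmin (eta true x - y) (y - eta false x).
Proof. intros Hx. unfold gauge; simpl. rewrite clamp_id by auto. rewrite Rminus_diag, Rabs_R0. ring. Qed.

Lemma gauge_outside (x y xe : R) : xe = x1 /\ x <= x1 \/ xe = x2 /\ x2 <= x ->
  gauge (x, y) = - Rabs y - Rabs (x - xe).
Proof.
  intros Hx. destruct ov_order as (O1 & O2 & _). unfold gauge; simpl.
  assert (Hc : clamp x1 x2 x = xe) by (unfold clamp, Rmax, Rmin; repeat destruct Rle_dec; lra).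
  rewrite Hc. assert (He : forall b, eta b xe = 0) by (intros b; destruct (Heta b) as (A1 & A2 & _); destruct Hx as [[-> _]|[-> _]]; auto).
  rewrite !He. unfold Rmin, Rabs; repeat destruct Rle_dec; repeat destruct Rcase_abs; lra.
Qed.

Lemma gauge_zero (p : R * R) : gauge p = 0 <-> oval p.
Proof.
  destruct ov_order as (O1 & O2 & O3 & _). destruct p as [x y]. unfold oval; simpl.
  destruct (Rle_dec x1 x) as [L1|L1]; [destruct (Rle_dec x x2) as [L2|L2]|].
  - rewrite gauge_inside by lra. assert (P1 := eta_nonneg true x ltac:(lra)). assert (P2 := eta_nonneg false x ltac:(lra)).
    simpl in P1, P2. split.
    + intros Hz. split; [lra|]. unfold Rmin in Hz. destruct Rle_dec; [exists true|exists false]; lra.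
    + intros [_ [b Hb]]. destruct b; subst y; unfold Rmin; destruct Rle_dec; lra.
  - rewrite (gauge_outside x y x2) by lra. split; [|lra].
    intros Hz. rewrite (Rabs_right (x - x2)) in Hz by lra. pose proof (Rabs_pos y). lra.
  - rewrite (gauge_outside x y x1) by lra. split; [|lra].
    intros Hz. rewrite (Rabs_left (x - x1)) in Hz by lra. pose proof (Rabs_pos y). lra.
Qed.

Lemma gauge_lipschitz (p q : R * R) :
  Rabs (gauge p - gauge q) <= (C + 2) * (Rabs (fst p - fst q) + Rabs (snd p - snd q)).
Proof.
  destruct ov_order as (O1 & O2 & O3 & _ & HC & _). destruct p as [x y], q as [x' y']. unfold gauge; simpl.
  set (c := clamp x1 x2 x). set (c' := clamp x1 x2 x').
  assert (Hc : Rabs (c - c') <= Rabs (x - x')) by (apply clamp_lip; lra).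
  assert (Hcr : xl < c < xr) by (pose proof (clamp_in x1 x2 x ltac:(lra)); unfold c; lra).
  assert (T1 : Rabs (eta true c - eta true c') <= C * Rabs (x - x')).
  { destruct (Heta true) as (_ & _ & A & _). destruct (A c Hcr) as (_ & B & _).
    apply Rle_trans with (1 := B c'). apply Rmult_le_compat_l; lra. }
  assert (T2 : Rabs (eta false c - eta false c') <= C * Rabs (x - x')).
  { destruct (Heta false) as (_ & _ & A & _). destruct (A c Hcr) as (_ & B & _).
    apply Rle_trans with (1 := B c'). apply Rmult_le_compat_l; lra. }
  assert (T3 : Rabs (Rabs (x - c) - Rabs (x' - c')) <= 2 * Rabs (x - x')).
  { apply Rle_trans with (1 := Rabs_triang_inv2 _ _).
    replace (x - c - (x' - c')) with ((x - x') - (c - c')) by ring.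
    apply Rle_trans with (1 := Rabs_triang _ _). rewrite Rabs_Ropp. lra. }
  assert (T4 : forall a b a' b' d, Rabs (a - a') <= d -> Rabs (b - b') <= d -> Rabs (Rmin a b - Rmin a' b') <= d).
  { intros a b a' b' d D1 D2. apply Rabs_le_between in D1. apply Rabs_le_between in D2.
    apply Rabs_le. unfold Rmin; repeat destruct Rle_dec; lra. }
  assert (T5 := T4 (eta true c - y) (y - eta false c) (eta true c' - y') (y' - eta false c')
    (C * Rabs (x - x') + Rabs (y - y'))).
  assert (T6 : Rabs (eta true c - y - (eta true c' - y')) <= C * Rabs (x - x') + Rabs (y - y')).
  { replace (eta true c - y - (eta true c' - y')) with ((eta true c - eta true c') - (y - y')) by ring.
    apply Rle_trans with (1 := Rabs_triang _ _). rewrite Rabs_Ropp. lra. }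
  assert (T7 : Rabs (y - eta false c - (y' - eta false c')) <= C * Rabs (x - x') + Rabs (y - y')).
  { replace (y - eta false c - (y' - eta false c')) with (- (eta false c - eta false c') + (y - y')) by ring.
    apply Rle_trans with (1 := Rabs_triang _ _). rewrite Rabs_Ropp. lra. }
  specialize (T5 T6 T7).
  match goal with |- Rabs (?u - ?v - (?u' - ?v')) <= _ => replace (u - v - (u' - v')) with ((u - u') - (v - v')) by ring end.
  apply Rle_trans with (1 := Rabs_triang _ _). rewrite Rabs_Ropp.
  pose proof (Rabs_pos (x - x')). pose proof (Rabs_pos (y - y')).
  assert (0 <= C * Rabs (y - y')) by (apply Rmult_le_pos; lra). lra.
Qed.

Lemma ball_pair (p q : R * R) (e : R) :
  ball p e q <-> Rabs (fst q - fst p) < e /\ Rabs (snd q - snd p) < e.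
Proof. reflexivity. Qed.

Lemma near_gauge (e : R) (p : R * R) : near_set oval e p -> Rabs (gauge p) <= (C + 2) * (2 * e).
Proof.
  intros [q [Hq Hb]]. destruct ov_order as (_ & _ & _ & _ & HC & _).
  apply gauge_zero in Hq. destruct (proj1 (ball_pair q p e) Hb) as [Hb1 Hb2].
  assert (T := gauge_lipschitz p q). rewrite Hq, Rminus_0_r in T.
  apply Rle_trans with (1 := T). apply Rmult_le_compat_l; lra.
Qed.

(** With [near_gauge] this makes |gauge| equivalent to the distance to the oval, and later estimates
    use the gauge only. *)
Lemma gauge_near (e : R) (p : R * R) : Rabs (gauge p) < e -> near_set oval e p.
Proof.
  intros Hg. destruct ov_order as (O1 & O2 & O3 & _). destruct p as [x y].
  assert (He : 0 < e) by (pose proof (Rabs_pos (gauge (x, y))); lra).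
  destruct (Rle_dec x1 x) as [L1|L1]; [destruct (Rle_dec x x2) as [L2|L2]|].
  - rewrite gauge_inside in Hg by lra. unfold Rmin in Hg. destruct Rle_dec.
    + exists (x, eta true x). split; [split; simpl; [lra|exists true; auto]|].
      apply (proj2 (ball_pair _ _ _)); simpl. rewrite Rminus_diag, Rabs_R0, Rabs_minus_sym. auto.
    + exists (x, eta false x). split; [split; simpl; [lra|exists false; auto]|].
      apply (proj2 (ball_pair _ _ _)); simpl. rewrite Rminus_diag, Rabs_R0. auto.
  - rewrite (gauge_outside x y x2) in Hg by lra. exists (x2, 0).
    split; [split; simpl; [lra|exists true; symmetry; apply Heta]|].
    apply (proj2 (ball_pair _ _ _)); simpl. rewrite Rminus_0_r. rewrite Rabs_left1 in Hg.
    + pose proof (Rabs_pos y). pose proof (Rabs_pos (x - x2)). lra.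
    + pose proof (Rabs_pos y). pose proof (Rabs_pos (x - x2)). lra.
  - rewrite (gauge_outside x y x1) in Hg by lra. exists (x1, 0).
    split; [split; simpl; [lra|exists true; symmetry; apply Heta]|].
    apply (proj2 (ball_pair _ _ _)); simpl. rewrite Rminus_0_r. rewrite Rabs_left1 in Hg.
    + pose proof (Rabs_pos y). pose proof (Rabs_pos (x - x1)). lra.
    + pose proof (Rabs_pos y). pose proof (Rabs_pos (x - x1)). lra.
Qed.

Lemma eta_min (del : R) : 0 < del ->
  exists c, 0 < c /\ forall b x, x1 + del <= x <= x2 - del -> c <= sgn b * eta b x.
Proof.
  intros Hdel. destruct ov_order as (O1 & O2 & O3 & _ & HC & _).
  destruct (Rle_dec (x1 + del) (x2 - del)) as [L|L]; [|exists 1; split; [lra|intros; lra]].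
  assert (Hb : forall b, exists c, 0 < c /\ forall x, x1 + del <= x <= x2 - del -> c <= sgn b * eta b x).
  { intros b. destruct (Heta b) as (_ & _ & A & B & _).
    destruct (continuity_ab_min (fun x => sgn b * eta b x) (x1 + del) (x2 - del) L) as [xm [H1 H2]].
    - intros c Hc. apply continuity_pt_filterlim.
      apply (continuous_mult (K := R_AbsRing) (fun _ => sgn b)); [apply continuous_const|].
      apply continuous_eps. intros e He. exists (e / C). split; [apply Rdiv_lt_0_compat; auto|].
      intros y Hy. destruct (A c ltac:(lra)) as (_ & D & _). specialize (D y).
      rewrite Rabs_minus_sym. apply Rle_lt_trans with (1 := D). rewrite Rabs_minus_sym.
      apply Rmult_lt_compat_l with (r := C) in Hy; auto.
      replace (C * (e / C)) with e in Hy by (field; lra). exact Hy.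
    - exists (sgn b * eta b xm). split; [apply B; lra|]. intros x Hx. apply H1; auto. }
  destruct (Hb true) as [c1 [P1 Q1]]. destruct (Hb false) as [c2 [P2 Q2]].
  exists (Rmin c1 c2). split; [apply Rmin_pos; auto|]. intros b x Hx. destruct b.
  - apply Rle_trans with (1 := Rmin_l _ _). auto.
  - apply Rle_trans with (1 := Rmin_r _ _). auto.
Qed.

(** Away from the two ends both arcs keep a positive distance from the axis, so a point near the
    oval and near the axis is near an end. *)
Lemma near_axis (del : R) : 0 < del ->
  exists th, 0 < th /\ forall x y, Rabs (gauge (x, y)) < th -> Rabs y < th ->
    Rabs (x - x1) < del \/ Rabs (x - x2) < del.
Proof.
  intros Hdel. destruct ov_order as (O1 & O2 & O3 & _).
  destruct (eta_min (del / 2)) as [c [Hc Hm]]; [lra|].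
  exists (Rmin (c / 2) del). split; [apply Rmin_pos; lra|]. intros x y Hg Hy.
  assert (G1 : Rabs (gauge (x, y)) < c / 2) by rmin.
  assert (G2 : Rabs (gauge (x, y)) < del) by rmin.
  assert (Y1 : Rabs y < c / 2) by rmin.
  destruct (Rle_dec x1 x) as [L1|L1]; [destruct (Rle_dec x x2) as [L2|L2]|].
  - destruct (Rle_dec (x1 + del / 2) x) as [L3|L3].
    + destruct (Rle_dec x (x2 - del / 2)) as [L4|L4].
      * exfalso. assert (P1 := Hm true x ltac:(lra)). assert (P2 := Hm false x ltac:(lra)). simpl in P1, P2.
        rewrite gauge_inside in G1 by lra. apply Rabs_def2 in Y1. apply Rabs_def2 in G1.
        unfold Rmin in G1; destruct Rle_dec; lra.
      * right. apply Rabs_def1; lra.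
    + left. apply Rabs_def1; lra.
  - right. rewrite (gauge_outside x y x2) in G2 by lra.
    pose proof (Rabs_pos y). pose proof (Rabs_pos (x - x2)). rewrite Rabs_left1 in G2 by lra. lra.
  - left. rewrite (gauge_outside x y x1) in G2 by lra.
    pose proof (Rabs_pos y). pose proof (Rabs_pos (x - x1)). rewrite Rabs_left1 in G2 by lra. lra.
Qed.

(* |H b - H b x1 0| and |gauge| are comparable on the side sgn b * y >= 0. *)
Definition lev (b : bool) (x y : R) : R := Rabs (H b x y - H b x1 0).

(** * Level functions compared with the gauge *)

Lemma H12 (b : bool) : H b x1 0 = H b x2 0.
Proof. apply (HO b). Qed.

Lemma slope_end (b : bool) (xe : R) : xe = x1 \/ xe = x2 ->
  du b xe <> 0 /\ is_derive (fun x => H b x 0) xe (du b xe).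
Proof.
  intros Hxe. destruct ov_order as (O1 & O2 & O3 & _ & _ & _ & Hc). specialize (Hc b).
  split.
  - intros Z. destruct Hxe as [-> | ->].
    + assert (T := ho_du_neg (HO b) x1 ltac:(lra)). cbv beta zeta in T.
      unfold du in Z. rewrite Z in T. lra.
    + assert (T := ho_du_pos (HO b) x2 ltac:(lra)). cbv beta zeta in T.
      unfold du in Z. rewrite Z in T. lra.
  - apply (ho_du (HO b)). destruct Hxe as [-> | ->]; lra.
Qed.

(** Where a trajectory crosses, the levels of the two sides are compared through the common distance
    to the end; their ratio is a ratio of end slopes. *)
Lemma lev_axis (b : bool) (xe e : R) : xe = x1 \/ xe = x2 -> 0 < e ->
  exists del, 0 < del /\ forall x, Rabs (x - xe) < del ->
    (Rabs (du b xe) - e) * Rabs (x - xe) <= lev b x 0 <= (Rabs (du b xe) + e) * Rabs (x - xe).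
Proof.
  intros Hxe He. destruct (slope_end b xe Hxe) as [_ Hd].
  destruct (proj1 (is_derive_eps _ _ _) Hd e He) as [del [Hdel D]].
  exists del. split; auto. intros x Hx. specialize (D x Hx).
  assert (Eh : H b x1 0 = H b xe 0) by (destruct Hxe as [-> | ->]; [auto|apply H12]).
  unfold lev. rewrite Eh. set (k := du b xe) in *.
  assert (T1 := Rabs_triang (H b x 0 - H b xe 0 - k * (x - xe)) (k * (x - xe))).
  assert (T2 := Rabs_triang (H b x 0 - H b xe 0) (- (H b x 0 - H b xe 0 - k * (x - xe)))).
  replace (H b x 0 - H b xe 0 - k * (x - xe) + k * (x - xe)) with (H b x 0 - H b xe 0) in T1 by ring.
  replace (H b x 0 - H b xe 0 + - (H b x 0 - H b xe 0 - k * (x - xe))) with (k * (x - xe)) in T2 by ring.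
  rewrite Rabs_Ropp in T2. rewrite Rabs_mult in T1, T2. lra.
Qed.

Lemma gauge_le_lev : exists K th, 0 < K /\ 0 < th /\
  forall b x y, Rabs (gauge (x, y)) < th -> 0 <= sgn b * y -> Rabs (gauge (x, y)) <= K * lev b x y.
Proof.
  destruct ov_order as (O1 & O2 & O3 & _ & HC & _ & Hc0).
  assert (Hside : forall b xe, xe = x1 \/ xe = x2 -> exists del k, 0 < del /\ 0 < k /\ forall x, Rabs (x - xe) < del ->
     k * Rabs (x - xe) <= lev b x 0).
  { intros b xe Hxe. destruct (slope_end b xe Hxe) as [Hn _].
    assert (Hk : 0 < Rabs (du b xe)) by (apply Rabs_pos_lt; auto).
    destruct (lev_axis b xe (Rabs (du b xe) / 2) Hxe ltac:(lra)) as [del [Hdel D]].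
    exists del, (Rabs (du b xe) / 2). split; auto. split; [lra|].
    intros x Hx. destruct (D x Hx) as [D1 _]. lra. }
  assert (Hout : forall b xe, xe = x1 \/ xe = x2 -> exists K th, 0 < K /\ 0 < th /\
     forall x y, (xe = x1 /\ x <= x1 \/ xe = x2 /\ x2 <= x) -> Rabs (gauge (x, y)) < th -> 0 <= sgn b * y ->
       Rabs (gauge (x, y)) <= K * lev b x y).
  { intros b xe Hxe. destruct (Hside b xe Hxe) as (del & k & Hdel & Hk & D).
    exists (C + / k), (Rmin del (Rmin (x1 - xl) (xr - x2))).
    assert (Hik : 0 < / k) by (apply Rinv_0_lt_compat; auto).
    split; [lra|]. split; [repeat apply Rmin_pos; lra|].
    intros x y Hx Hg Hy.
    assert (Eh : H b x1 0 = H b xe 0) by (destruct Hxe as [-> | ->]; [auto|apply H12]).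
    rewrite (gauge_outside x y xe Hx) in *.
    pose proof (Rabs_pos y) as Py. pose proof (Rabs_pos (x - xe)) as Px.
    rewrite Rabs_left1 in * by lra.
    assert (G1 : Rabs (x - xe) < del) by (pose proof (Rmin_l del (Rmin (x1 - xl) (xr - x2))); lra).
    assert (G2 : Rabs (x - xe) < Rmin (x1 - xl) (xr - x2)) by (pose proof (Rmin_r del (Rmin (x1 - xl) (xr - x2))); lra).
    pose proof (Rmin_l (x1 - xl) (xr - x2)). pose proof (Rmin_r (x1 - xl) (xr - x2)).
    assert (Hxr : xl < x < xr) by (apply Rabs_def2 in G2; destruct Hx as [[-> ?]|[-> ?]]; lra).
    specialize (D x G1).
    assert (A1 : 0 <= sgn b * (H b x 0 - H b xe 0)).
    { destruct (Req_dec x xe) as [->|Nx]; [rewrite Rminus_diag; lra|].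
      specialize (Hc0 b). destruct Hx as [[-> ?]|[-> ?]].
      - assert (T := ho_decreasing (HO b) x x1 ltac:(lra) ltac:(lra) ltac:(lra)). lra.
      - assert (T := ho_increasing (HO b) x2 x ltac:(lra) ltac:(lra) ltac:(lra)). lra. }
    assert (A2 : 0 <= sgn b * (H b x y - H b x 0)).
    { destruct (Req_dec y 0) as [->|Ny]; [rewrite Rminus_diag; lra|].
      assert (T : sgn b * H b x 0 < sgn b * H b x y).
      { apply (ho_lt_iff (HO b) x 0 y Hxr).
        rewrite Rmult_0_r. destruct Hy as [|Z]; auto. exfalso. apply Ny.
        symmetry in Z. apply Rmult_integral in Z. destruct Z; auto. destruct b; simpl in *; lra. }
      lra. }
    assert (A3 := ho_dist_y (HO b) x 0 y Hxr). rewrite Rminus_0_r in A3.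
    rewrite <- (abs_sgn b), Rabs_right in A3 by (try rewrite abs_sgn; lra || (apply Rle_ge; auto)).
    assert (A4 : Rabs y <= C * (sgn b * (H b x y - H b x 0))).
    { assert (T := ho_dist_y (HO b) x 0 y Hxr). rewrite Rminus_0_r in T.
      rewrite <- (abs_sgn b (H b x y - H b x 0)), (Rabs_right (sgn b * _)) in T by (apply Rle_ge; auto). exact T. }
    assert (A5 : lev b x 0 = sgn b * (H b x 0 - H b xe 0)).
    { unfold lev. rewrite Eh, <- (abs_sgn b). apply Rabs_right, Rle_ge; auto. }
    (* Beyond the ends, moving outwards along the axis and moving away from it both raise sgn b
       times H: the two contributions add up and cannot cancel. *)
    assert (A6 : lev b x y = sgn b * (H b x y - H b x 0) + sgn b * (H b x 0 - H b xe 0)).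
    { unfold lev. rewrite Eh, <- (abs_sgn b), Rabs_right; [ring|].
      replace (sgn b * (H b x y - H b xe 0)) with (sgn b * (H b x y - H b x 0) + sgn b * (H b x 0 - H b xe 0)) by ring. lra. }
    rewrite A6. rewrite A5 in D.
    assert (A7 : Rabs (x - xe) <= / k * (sgn b * (H b x 0 - H b xe 0))).
    { apply Rmult_le_reg_l with k; auto. rewrite <- Rmult_assoc, Rinv_r by lra. lra. }
    set (u := sgn b * (H b x y - H b x 0)) in *. set (v := sgn b * (H b x 0 - H b xe 0)) in *.
    assert (0 <= / k * u) by (apply Rmult_le_pos; lra). assert (0 <= C * v) by (apply Rmult_le_pos; lra). lra. }
  destruct (Hout true x1 (or_introl eq_refl)) as (K1 & t1 & PK1 & Pt1 & Q1).
  destruct (Hout true x2 (or_intror eq_refl)) as (K2 & t2 & PK2 & Pt2 & Q2).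
  destruct (Hout false x1 (or_introl eq_refl)) as (K3 & t3 & PK3 & Pt3 & Q3).
  destruct (Hout false x2 (or_intror eq_refl)) as (K4 & t4 & PK4 & Pt4 & Q4).
  exists (C + K1 + K2 + K3 + K4), (Rmin (Rmin t1 t2) (Rmin t3 t4)).
  split; [lra|]. split; [repeat apply Rmin_pos; auto|].
  intros b x y Hg Hy.
  assert (L1 : Rmin (Rmin t1 t2) (Rmin t3 t4) <= t1) by rmin.
  assert (L2 : Rmin (Rmin t1 t2) (Rmin t3 t4) <= t2) by rmin.
  assert (L3 : Rmin (Rmin t1 t2) (Rmin t3 t4) <= t3) by rmin.
  assert (L4 : Rmin (Rmin t1 t2) (Rmin t3 t4) <= t4) by rmin.
  assert (Hlev : 0 <= lev b x y) by apply Rabs_pos.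
  assert (Hfin : forall K, K <= C + K1 + K2 + K3 + K4 -> Rabs (gauge (x, y)) <= K * lev b x y ->
     Rabs (gauge (x, y)) <= (C + K1 + K2 + K3 + K4) * lev b x y).
  { intros K HK HB. apply Rle_trans with (1 := HB). apply Rmult_le_compat_r; auto. }
  destruct (Rle_dec x1 x) as [X1|X1]; [destruct (Rle_dec x x2) as [X2|X2]|].
  - apply (Hfin C); [lra|].
    destruct (Heta b) as (_ & _ & A & _). destruct (A x ltac:(lra)) as (_ & _ & Ah).
    apply Rle_trans with (Rabs (eta b x - y)).
    + rewrite gauge_inside by lra. assert (P := eta_nonneg (negb b) x ltac:(lra)). rewrite sgn_negb in P.
      destruct b; simpl in *; unfold Rmin, Rabs; repeat destruct Rle_dec; repeat destruct Rcase_abs; lra.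
    + rewrite Rabs_minus_sym. apply Rle_trans with (1 := ho_dist_y (HO b) x (eta b x) y ltac:(lra)).
      rewrite Ah. apply Rle_refl.
  - destruct b; [apply (Hfin K2)|apply (Hfin K4)]; try lra; [apply Q2|apply Q4]; auto; lra.
  - destruct b; [apply (Hfin K1)|apply (Hfin K3)]; try lra; [apply Q1|apply Q3]; auto; lra.
Qed.

(** A point with 0 <= sgn b * y can be near the oval by being near the arc of the other side. That
    happens only near an end, where both arcs are close to the axis, so the level of side [b] is
    small there too. *)
Lemma lev_small (e : R) : 0 < e -> exists th, 0 < th /\
  forall b x y, Rabs (gauge (x, y)) < th -> 0 <= sgn b * y -> lev b x y < e.
Proof.
  intros He. destruct ov_order as (O1 & O2 & O3 & _ & HC & _).
  set (q := e / (4 * C)). assert (Hq : 0 < q) by (apply Rdiv_lt_0_compat; lra).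
  assert (HqC : C * q = e / 4) by (unfold q; field; lra).
  set (del := q / C). assert (Hdel : 0 < del) by (apply Rdiv_lt_0_compat; lra).
  destruct (eta_min del Hdel) as [c [Hc Hm]].
  exists (Rmin (Rmin q c) (Rmin (x1 - xl) (xr - x2))). split; [repeat apply Rmin_pos; lra|].
  intros b x y Hg Hy.
  assert (G1 : Rabs (gauge (x, y)) < q) by rmin.
  assert (G2 : Rabs (gauge (x, y)) < c) by rmin.
  assert (G3 : Rabs (gauge (x, y)) < x1 - xl) by rmin.
  assert (G4 : Rabs (gauge (x, y)) < xr - x2) by rmin.
  clear Hg.
  assert (Hout : forall xe, xe = x1 /\ x <= x1 \/ xe = x2 /\ x2 <= x -> lev b x y < e).
  { intros xe Hx. rewrite (gauge_outside x y xe Hx) in *.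
    pose proof (Rabs_pos y) as Py. pose proof (Rabs_pos (x - xe)) as Px. rewrite Rabs_left1 in * by lra.
    assert (Eh : H b x1 0 = H b xe 0) by (destruct Hx as [[-> _]|[-> _]]; [auto|apply H12]).
    assert (Hxr : xl < x < xr).
    { assert (T3 : Rabs (x - xe) < x1 - xl) by lra. assert (T4 : Rabs (x - xe) < xr - x2) by lra.
      apply Rabs_def2 in T3. apply Rabs_def2 in T4. destruct Hx as [[-> ?]|[-> ?]]; lra. }
    unfold lev. rewrite Eh.
    assert (Hxe : xl < xe < xr) by (destruct Hx as [[-> ?]|[-> ?]]; lra).
    apply Rle_lt_trans with (1 := ho_lip_H (HO b) xe 0 x y Hxe Hxr).
    rewrite Rminus_0_r. assert (C * (Rabs (x - xe) + Rabs y) <= C * q) by (apply Rmult_le_compat_l; lra). lra. }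
  destruct (Rle_dec x1 x) as [X1|X1]; [destruct (Rle_dec x x2) as [X2|X2]|].
  2:{ apply (Hout x2); lra. } 2:{ apply (Hout x1); lra. }
  rewrite gauge_inside in * by lra.
  destruct (Heta b) as (E1 & E2 & A & _). destruct (A x ltac:(lra)) as (_ & Al & Ah).
  assert (Hlip : lev b x y <= C * Rabs (y - eta b x)).
  { unfold lev. rewrite <- Ah.
    apply Rle_trans with (1 := ho_lip_H (HO b) x (eta b x) x y ltac:(lra) ltac:(lra)).
    rewrite Rminus_diag, Rabs_R0, Rplus_0_l. apply Rle_refl. }
  apply Rle_lt_trans with (1 := Hlip).
  assert (Hb0 := eta_nonneg b x ltac:(lra)). assert (Hnb := eta_nonneg (negb b) x ltac:(lra)).
  (* The gauge is realized either by the arc of side [b] or by the opposite one; in the latter case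
     the opposite arc is lower than [c], which forces x near an end. *)
  assert (Hcase : Rabs (y - eta b x) < q \/ (sgn (negb b) * eta (negb b) x < Rmin q c /\ Rabs y < q)).
  { rewrite sgn_negb in *. apply Rabs_def2 in G1. apply Rabs_def2 in G2.
    destruct b; simpl in *; unfold Rmin in *; destruct (Rle_dec (eta true x - y) (y - eta false x));
      try (left; apply Rabs_def1; lra); right; (split; [destruct Rle_dec; lra|apply Rabs_def1; lra]). }
  destruct Hcase as [Hcase|[H1 H2]].
  - assert (C * Rabs (y - eta b x) <= C * q) by (apply Rmult_le_compat_l; lra). lra.
  - assert (Hend : Rabs (eta b x) <= q).
    { assert (Hx : x < x1 + del \/ x2 - del < x).
      { destruct (Rlt_le_dec x (x1 + del)); auto. destruct (Rlt_le_dec (x2 - del) x); auto.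
        exfalso. assert (T := Hm (negb b) x ltac:(lra)). pose proof (Rmin_r q c). lra. }
      destruct Hx as [Hx|Hx].
      - specialize (Al x1). rewrite E1, Rminus_0_r, (Rabs_right (x - x1)) in Al by lra.
        apply Rle_trans with (1 := Al). apply Rle_trans with (C * del); [apply Rmult_le_compat_l; lra|].
        unfold del. right; field; lra.
      - specialize (Al x2). rewrite E2, Rminus_0_r, (Rabs_left1 (x - x2)) in Al by lra.
        apply Rle_trans with (1 := Al). apply Rle_trans with (C * del); [apply Rmult_le_compat_l; lra|].
        unfold del. right; field; lra. }
    assert (Rabs (y - eta b x) <= q + q).
    { apply Rle_trans with (1 := Rabs_triang _ _). rewrite Rabs_Ropp. lra. }
    assert (C * Rabs (y - eta b x) <= C * (q + q)) by (apply Rmult_le_compat_l; lra). lra.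
Qed.

Lemma dir_cases (b : bool) : dir b = 1 \/ dir b = -1.
Proof. unfold dir. destruct (sgn_cases b) as [-> | ->]; destruct (sgn_cases o) as [-> | ->]; [left|right|right|left]; ring. Qed.

Lemma dir_negb (b : bool) : dir (negb b) = - dir b.
Proof. unfold dir. rewrite sgn_negb. ring. Qed.

(* A neighborhood of the oval where the switching line is only met near its two
   ends, and where it is crossed in a definite direction. *)
Definition tube (th del e0 : R) : Prop :=
  0 < th /\ 0 < del /\ 0 < e0 /\ 2 * del < x2 - x1 /\
  (forall p, Rabs (gauge p) < th -> xl < fst p < xr /\ Rabs (snd p) < ry / 2) /\
  (forall x y, Rabs (gauge (x, y)) < th -> Rabs y < th -> Rabs (x - x1) < del \/ Rabs (x - x2) < del) /\
  (forall b x y, Rabs (x - x1) < del -> Rabs y < th -> e0 <= sgn o * vY (half_field S b) x y) /\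
  (forall b x y, Rabs (x - x2) < del -> Rabs y < th -> sgn o * vY (half_field S b) x y <= - e0).

Lemma vY_near (b : bool) (xe : R) : xe = x1 \/ xe = x2 ->
  exists k d, 0 < k /\ 0 < d /\ forall x y, Rabs (x - xe) < d -> Rabs y < d ->
    (xe = x1 -> k <= sgn o * vY (half_field S b) x y) /\ (xe = x2 -> sgn o * vY (half_field S b) x y <= - k).
Proof.
  intros Hxe. destruct ov_order as (O1 & O2 & O3 & _ & HC & Hry & Hc0). specialize (Hc0 b).
  assert (HS := ho_sign_Y (HO b)).
  set (Y0 := sgn o * vY (half_field S b) xe 0).
  assert (HY0 : Y0 <> 0).
  { unfold Y0. destruct Hxe as [-> | ->].
    - destruct (HS x1) as [T _]. specialize (T ltac:(lra)). lra.
    - destruct (HS x2) as [_ T]. specialize (T ltac:(lra)). lra. }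
  set (a := Rabs Y0). assert (Ha : 0 < a) by (apply Rabs_pos_lt; auto).
  set (d := Rmin (a / (8 * C)) (Rmin ry (Rmin (x1 - xl) (xr - x2)))).
  assert (Hq : 0 < a / (8 * C)) by (apply Rdiv_lt_0_compat; lra).
  exists (a / 2), d. split; [lra|]. split; [unfold d; repeat apply Rmin_pos; lra|].
  intros x y Hx Hy.
  assert (D1 : d <= a / (8 * C)) by apply Rmin_l.
  assert (D2 : d <= ry) by rmin.
  assert (D3 : d <= x1 - xl) by rmin.
  assert (D4 : d <= xr - x2) by rmin.
  assert (Hxr : xl < x < xr) by (apply Rabs_def2 in Hx; destruct Hxe as [-> | ->]; lra).
  destruct (ho_lipschitz (HO b) x y xe 0) as [_ T].
  { exact Hxr. } { destruct Hxe as [-> | ->]; lra. } { lra. } { rewrite Rabs_R0; lra. }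
  rewrite Rminus_0_r in T.
  assert (T2 : Rabs (sgn o * vY (half_field S b) x y - Y0) <= a / 2).
  { unfold Y0. rewrite <- Rmult_minus_distr_l, abs_sgn. apply Rle_trans with (1 := T).
    apply Rle_trans with (C * (2 * (a / (8 * C)))); [apply Rmult_le_compat_l; lra|].
    replace (C * (2 * (a / (8 * C)))) with (a / 4) by (field; lra). lra. }
  apply Rabs_le_between in T2. unfold a in T2 |- *. split; intros ->.
  - destruct (HS x1) as [P _]. specialize (P ltac:(lra)). fold Y0 in P. rewrite Rabs_right in * by lra. lra.
  - destruct (HS x2) as [_ P]. specialize (P ltac:(lra)). fold Y0 in P. rewrite Rabs_left in * by lra. lra.
Qed.

Lemma tube_exists (del0 : R) : 0 < del0 -> exists th del e0, tube th del e0 /\ del <= del0.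
Proof.
  intros Hdel0. destruct ov_order as (O1 & O2 & O3 & _ & HC & Hry & Hc0).
  destruct (vY_near true x1 (or_introl eq_refl)) as (k1 & d1 & Pk1 & Pd1 & Q1).
  destruct (vY_near true x2 (or_intror eq_refl)) as (k2 & d2 & Pk2 & Pd2 & Q2).
  destruct (vY_near false x1 (or_introl eq_refl)) as (k3 & d3 & Pk3 & Pd3 & Q3).
  destruct (vY_near false x2 (or_intror eq_refl)) as (k4 & d4 & Pk4 & Pd4 & Q4).
  set (d := Rmin (Rmin d1 d2) (Rmin d3 d4)).
  assert (Pd : 0 < d) by (unfold d; repeat apply Rmin_pos; auto).
  assert (L1 : d <= d1) by rmin.
  assert (L2 : d <= d2) by rmin.
  assert (L3 : d <= d3) by rmin.
  assert (L4 : d <= d4) by rmin.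
  set (k := Rmin (Rmin k1 k2) (Rmin k3 k4)).
  assert (Pk : 0 < k) by (unfold k; repeat apply Rmin_pos; auto).
  assert (M1 : k <= k1) by rmin.
  assert (M2 : k <= k2) by rmin.
  assert (M3 : k <= k3) by rmin.
  assert (M4 : k <= k4) by rmin.
  clearbody d k.
  set (del := Rmin (Rmin d del0) ((x2 - x1) / 4)).
  assert (Hdel : 0 < del) by (unfold del; repeat apply Rmin_pos; lra).
  assert (N1 : del <= d) by rmin.
  assert (N2 : del <= del0) by rmin.
  assert (N3 : del <= (x2 - x1) / 4) by apply Rmin_r.
  clearbody del.
  destruct (near_axis del Hdel) as [t1 [Pt1 Qt1]].
  set (th := Rmin (Rmin t1 d) (Rmin (ry / 8) (Rmin (x1 - xl) (xr - x2)))).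
  assert (Hth : 0 < th) by (unfold th; repeat apply Rmin_pos; lra).
  assert (U1 : th <= t1) by rmin.
  assert (U2 : th <= d) by rmin.
  assert (U3 : th <= ry / 8) by rmin.
  assert (U4 : th <= x1 - xl) by rmin.
  assert (U5 : th <= xr - x2) by rmin.
  clearbody th.
  exists th, del, k. split; [|auto].
  split; [auto|]. split; [auto|]. split; [auto|]. split; [lra|]. split; [|split; [|split]].
  - intros p Hp. destruct (gauge_near th p Hp) as [q [[Hq1 [b Hq2]] Hb]].
    destruct (proj1 (ball_pair q p th) Hb) as [B1 B2].
    destruct (Heta b) as (_ & _ & _ & _ & A). specialize (A _ Hq1). rewrite <- Hq2 in A.
    apply Rabs_def2 in B1. split; [lra|].
    replace (snd p) with ((snd p - snd q) + snd q) by ring.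
    apply Rle_lt_trans with (1 := Rabs_triang _ _). lra.
  - intros x y Hg Hy. apply (Qt1 x y); lra.
  - intros b x y Hx Hy. destruct b.
    + destruct (Q1 x y ltac:(lra) ltac:(lra)) as [T _]. specialize (T eq_refl). lra.
    + destruct (Q3 x y ltac:(lra) ltac:(lra)) as [T _]. specialize (T eq_refl). lra.
  - intros b x y Hx Hy. destruct b.
    + destruct (Q2 x y ltac:(lra) ltac:(lra)) as [_ T]. specialize (T eq_refl). lra.
    + destruct (Q4 x y ltac:(lra) ltac:(lra)) as [_ T]. specialize (T eq_refl). lra.
Qed.

Lemma velocity_side (b : bool) (p v : R * R) :
  0 < sgn b * snd p -> filippov_velocity S p v -> v = veval (half_field S b) p.
Proof.
  intros Hp [[P Hv]|[[P Hv]|[P _]]]; destruct b; simpl in *; auto; lra.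
Qed.

Section Along.

Variables (th del e0 T : R) (g : R -> R * R).
Hypothesis Htube : tube th del e0.
Hypothesis HT : 0 <= T.
Hypothesis Hg : traj S T g.
Hypothesis Hin : forall t, 0 <= t <= T -> Rabs (gauge (g t)) < th.

Let X (t : R) := fst (g t).
Let Y (t : R) := snd (g t).

Lemma X_continuous (t : R) : continuous X t.
Proof. apply (continuous_prod_iff g t). apply Hg. Qed.

Lemma Y_continuous (t : R) : continuous Y t.
Proof. apply (continuous_prod_iff g t). apply Hg. Qed.

(** Off the axis the inclusion is an equation: the level is conserved and the abscissa advances at
    speed at least [m]. The side is imposed on the open interval only, since runs begin and end on
    the axis. *)
Lemma side_run (b : bool) (s t : R) : 0 <= s -> s <= t -> t <= T ->
  (forall u, s < u < t -> 0 < sgn b * Y u) ->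
  H b (X t) (Y t) = H b (X s) (Y s) /\ m * (t - s) <= dir b * (X t - X s).
Proof.
  intros Hs Hst HtT Hside. destruct ov_order as (O1 & O2 & O3 & Hm & HC & Hry & _).
  destruct Htube as (_ & _ & _ & _ & HN & _).
  destruct Hg as [Hc [Hd [L HL]]].
  assert (HXY : forall u, s <= u <= t -> xl < X u < xr /\ Rabs (Y u) < ry).
  { intros u Hu. destruct (HN (g u)) as [A B]; [apply Hin; lra|]. unfold X, Y. split; auto. lra. }
  assert (Hder : forall u, s < u < t -> ~ In u L -> is_derive g u (veval (half_field S b) (g u))).
  { intros u Hu Hn. destruct (HL u ltac:(lra) Hn) as [v [Hv Hdv]].
    rewrite <- (velocity_side b (g u) v); auto. apply (Hside u Hu). }
  split.
  - symmetry. apply (constant_except L (fun u => H b (X u) (Y u)) s t Hst).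
    + intros u Hu. apply continuous_eps. intros e He.
      destruct (HXY u Hu) as [Xu _].
      set (e' := e / (2 * C)). assert (He' : 0 < e') by (apply Rdiv_lt_0_compat; lra).
      destruct (proj1 (continuous_eps _ _) (X_continuous u) (Rmin e' (Rmin (X u - xl) (xr - X u)))) as [d1 [Pd1 Q1]].
      { repeat apply Rmin_pos; lra. }
      destruct (proj1 (continuous_eps _ _) (Y_continuous u) e' He') as [d2 [Pd2 Q2]].
      exists (Rmin d1 d2). split; [apply Rmin_pos; auto|]. intros w Hw.
      assert (W1 := Q1 w ltac:(pose proof (Rmin_l d1 d2); lra)).
      assert (W2 := Q2 w ltac:(pose proof (Rmin_r d1 d2); lra)).
      assert (A1 : Rabs (X w - X u) < e') by rmin.
      assert (A2 : Rabs (X w - X u) < X u - xl) by rmin.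
      assert (A3 : Rabs (X w - X u) < xr - X u) by rmin.
      apply Rabs_def2 in A2. apply Rabs_def2 in A3.
      apply Rle_lt_trans with (1 := ho_lip_H (HO b) (X u) (Y u) (X w) (Y w) Xu ltac:(lra)).
      apply Rlt_le_trans with (C * (e' + e')); [apply Rmult_lt_compat_l; lra|]. unfold e'. right; field; lra.
    + intros u Hu Hn. destruct (HXY u ltac:(lra)) as [A B].
      apply (ho_constant (HO b) g u A B). apply Hder; auto.
  - assert (T1 : dir b * X s - m * s <= dir b * X t - m * t); [|lra].
    apply (increasing_except L (fun u => dir b * X u - m * u) s t Hst).
    + intros u Hu. apply (continuous_minus (V := R_NormedModule) (fun u => dir b * X u) (fun u => m * u)).
      * apply (continuous_mult (K := R_AbsRing) (fun _ => dir b) X); [apply continuous_const|apply X_continuous].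
      * apply (continuous_mult (K := R_AbsRing) (fun _ => m) (fun u => u)); [apply continuous_const|apply continuous_id].
    + intros u Hu Hn. assert (D := Hder u Hu Hn). apply is_derive_pair in D. destruct D as [D _]. simpl in D.
      destruct (HXY u ltac:(lra)) as [A B].
      destruct (ho_field (HO b) (X u) (Y u) A B) as [_ F].
      exists (dir b * vX (half_field S b) (X u) (Y u) - m). split; [|unfold dir; lra].
      apply (is_derive_minus (V := R_NormedModule) (fun u => dir b * X u) (fun u => m * u)).
      * apply (is_derive_scal X u (dir b)). exact D.
      * auto_derive; auto. ring.
Qed.

(* Near an end the vertical component of a trajectory is monotone, so that the
   switching line is crossed once, from side q to side (negb q). *)
Lemma crossing (t : R) : 0 <= t <= T -> Y t = 0 ->
  exists (q : bool) (d : R), 0 < d /\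
    (Rabs (X t - x2) < del /\ q = o \/ Rabs (X t - x1) < del /\ q = negb o) /\
    forall s, 0 <= s <= T -> (t - d < s < t -> 0 < sgn q * Y s) /\ (t < s < t + d -> sgn q * Y s < 0).
Proof.
  intros Ht HY. destruct Htube as (Pth & Pdel & Pe0 & _ & _ & HA & H1 & H2).
  destruct Hg as [Hc [Hd [L HL]]].
  assert (Hq : exists (q : bool) (xe : R), (Rabs (X t - x2) < del /\ q = o \/ Rabs (X t - x1) < del /\ q = negb o) /\
     Rabs (X t - xe) < del /\
     forall b x y, Rabs (x - xe) < del -> Rabs y < th -> sgn q * vY (half_field S b) x y <= - e0).
  { destruct (HA (X t) (Y t)) as [K|K].
    - assert (A := Hin t Ht). unfold X, Y. rewrite <- surjective_pairing. exact A.
    - rewrite HY, Rabs_R0. auto.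
    - exists (negb o), x1. split; [right; auto|]. split; auto. intros b x y Hx Hy.
      rewrite sgn_negb. specialize (H1 b x y Hx Hy). lra.
    - exists o, x2. split; [left; auto|]. split; auto. }
  destruct Hq as (q & xe & Hq1 & Hq2 & Hq3).
  destruct (proj1 (continuous_eps _ _) (X_continuous t) (del - Rabs (X t - xe))) as [d1 [Pd1 Q1]]; [lra|].
  destruct (proj1 (continuous_eps _ _) (Y_continuous t) th Pth) as [d2 [Pd2 Q2]].
  exists q, (Rmin d1 d2). split; [apply Rmin_pos; auto|]. split; [auto|].
  pose proof (Rmin_l d1 d2). pose proof (Rmin_r d1 d2).
  (* Every admissible velocity near this end, convex combinations on the axis included, has sgn q
     times its vertical component at most - [e0]. Hence sgn q * Y + e0 * time is nonincreasing,
     whichever solution is followed. *)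
  assert (Hmono : forall a c, 0 <= a -> a <= c -> c <= T -> t - Rmin d1 d2 < a -> c < t + Rmin d1 d2 ->
     - (sgn q * Y a) - e0 * a <= - (sgn q * Y c) - e0 * c).
  { intros a c Ha Hac HcT B1 B2.
    apply (increasing_except L (fun u => - (sgn q * Y u) - e0 * u) a c Hac).
    - intros u _. apply (continuous_minus (V := R_NormedModule) (fun u => - (sgn q * Y u)) (fun u => e0 * u)).
      + apply (continuous_opp (V := R_NormedModule) (fun u => sgn q * Y u)).
        apply (continuous_mult (K := R_AbsRing) (fun _ => sgn q) Y); [apply continuous_const|apply Y_continuous].
      + apply (continuous_mult (K := R_AbsRing) (fun _ => e0) (fun u => u)); [apply continuous_const|apply continuous_id].
    - intros u Hu Hn. destruct (HL u ltac:(lra) Hn) as [v [Hv D]].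
      apply is_derive_pair in D. destruct D as [_ D].
      exists (- (sgn q * snd v) - e0). split.
      + apply (is_derive_minus (V := R_NormedModule) (fun u => - (sgn q * Y u)) (fun u => e0 * u)).
        * apply (is_derive_opp (fun u => sgn q * Y u)). apply (is_derive_scal Y u (sgn q)). exact D.
        * auto_derive; auto. ring.
      + assert (Bx : Rabs (X u - xe) < del).
        { assert (Z := Q1 u ltac:(apply Rabs_def1; lra)).
          replace (X u - xe) with ((X u - X t) + (X t - xe)) by ring.
          apply Rle_lt_trans with (1 := Rabs_triang _ _). lra. }
        assert (By : Rabs (Y u) < th).
        { assert (Z := Q2 u ltac:(apply Rabs_def1; lra)). rewrite HY, Rminus_0_r in Z. exact Z. }
        assert (F := fun b => Hq3 b (X u) (Y u) Bx By).
        assert (F1 := F true). assert (F2 := F false). simpl in F1, F2. unfold X, Y in F1, F2.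
        destruct Hv as [[_ ->]|[[_ ->]|[_ [s [Hs ->]]]]]; simpl; try lra.
        unfold plus, scal; simpl. unfold plus, mult; simpl.
        set (a1 := vY (Zp S) (fst (g u)) (snd (g u))) in *. set (a2 := vY (Zm S) (fst (g u)) (snd (g u))) in *.
        replace (sgn q * (s * a1 + (1 - s) * a2)) with (s * (sgn q * a1) + (1 - s) * (sgn q * a2)) by ring.
        assert (s * (sgn q * a1) <= s * - e0) by (apply Rmult_le_compat_l; lra).
        assert ((1 - s) * (sgn q * a2) <= (1 - s) * - e0) by (apply Rmult_le_compat_l; lra). lra. }
  intros s Hs. split; intros Hst.
  - assert (Z := Hmono s t ltac:(lra) ltac:(lra) ltac:(lra) ltac:(lra) ltac:(lra)). rewrite HY in Z.
    assert (0 < e0 * (t - s)) by (apply Rmult_lt_0_compat; lra). lra.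
  - assert (Z := Hmono t s ltac:(lra) ltac:(lra) ltac:(lra) ltac:(lra) ltac:(lra)). rewrite HY in Z.
    assert (0 < e0 * (s - t)) by (apply Rmult_lt_0_compat; lra). lra.
Qed.

(** The axis is arbitrarily assigned to the upper side. At a crossing time either choice lies
    between the incoming and the outgoing value in [piecewise_decreasing]. *)
Definition upper (y : R) : bool := if Rle_dec 0 y then true else false.

Lemma upper_side (b : bool) (y : R) : 0 < sgn b * y -> upper y = b.
Proof. unfold upper. destruct b; simpl; destruct Rle_dec; intros; auto; lra. Qed.

Lemma upper_nonneg (y : R) : 0 <= sgn (upper y) * y.
Proof. unfold upper. destruct Rle_dec; simpl; lra. Qed.

(** A quantity given by one formula per side decreases along a trajectory if it does so on each run
    and jumps downwards at each crossing. Crossings are isolated, but they need not be enumerated: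
    the local criterion treats them one at a time. *)
Lemma piecewise_decreasing (Psi : bool -> R -> R) :
  (forall b s t, 0 <= s -> s <= t -> t <= T -> (forall u, s < u < t -> 0 < sgn b * Y u) -> Psi b t <= Psi b s) ->
  (forall t, 0 <= t <= T -> Y t = 0 -> Rabs (X t - x2) < del -> Psi (negb o) t <= Psi o t) ->
  (forall t, 0 <= t <= T -> Y t = 0 -> Rabs (X t - x1) < del -> Psi o t <= Psi (negb o) t) ->
  Psi (upper (Y T)) T <= Psi (upper (Y 0)) 0.
Proof.
  intros Hrun H2 H1. apply (local_decreasing (fun t => Psi (upper (Y t)) t) T HT).
  intros t Ht. destruct (Req_dec (Y t) 0) as [HY|HY].
  - destruct (crossing t Ht HY) as (q & d & Pd & Hq & Hs). exists d. split; auto.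
    assert (Hjump : Psi (negb q) t <= Psi q t).
    { destruct Hq as [[A ->]|[A ->]]; [apply H2; auto|]. rewrite negb_involutive. apply H1; auto. }
    assert (Hmid : Psi (negb q) t <= Psi (upper (Y t)) t <= Psi q t).
    { destruct q, (upper (Y t)); simpl in *; lra. }
    intros s Hs0. split; intros Hst.
    + destruct (Req_dec s t) as [->|N]; [lra|].
      destruct (Hs s Hs0) as [A _]. specialize (A ltac:(lra)).
      rewrite (upper_side q (Y s) A). apply Rle_trans with (Psi q t); [lra|].
      apply Hrun; try lra. intros u Hu. apply (Hs u ltac:(lra)). lra.
    + destruct (Req_dec s t) as [->|N]; [lra|].
      destruct (Hs s Hs0) as [_ A]. specialize (A ltac:(lra)).
      rewrite (upper_side (negb q) (Y s)) by (rewrite sgn_negb; lra).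
      apply Rle_trans with (Psi (negb q) t); [|lra].
      apply Hrun; try lra. intros u Hu. destruct (Hs u ltac:(lra)) as [_ B]. specialize (B ltac:(lra)).
      rewrite sgn_negb. lra.
  - assert (Hb : 0 < sgn (upper (Y t)) * Y t).
    { destruct (upper_nonneg (Y t)) as [|Z]; auto. exfalso. symmetry in Z. apply Rmult_integral in Z.
      destruct Z as [Z|Z]; [|contradiction]. destruct (sgn_cases (upper (Y t))) as [K|K]; rewrite K in Z; lra. }
    set (b := upper (Y t)) in *.
    destruct (proj1 (continuous_eps _ _) (Y_continuous t) (Rabs (Y t)) (Rabs_pos_lt _ HY)) as [d [Pd Q]].
    assert (Hall : forall u, Rabs (u - t) < d -> 0 < sgn b * Y u).
    { intros u Hu. specialize (Q u Hu). rewrite <- (abs_sgn b), <- (abs_sgn b (Y t)) in Q.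
      rewrite Rmult_minus_distr_l, (Rabs_right (sgn b * Y t)) in Q by lra. apply Rabs_def2 in Q. lra. }
    exists d. split; auto. intros s Hs. split; intros Hst.
    + rewrite (upper_side b (Y s)) by (apply Hall, Rabs_def1; lra).
      apply Hrun; try lra. intros u Hu. apply Hall, Rabs_def1; lra.
    + rewrite (upper_side b (Y s)) by (apply Hall, Rabs_def1; lra).
      apply Hrun; try lra. intros u Hu. apply Hall, Rabs_def1; lra.
Qed.

End Along.

(** * The Lyapunov function *)

Lemma dir_o : dir o = 1.
Proof. apply sgn_sqr. Qed.

Lemma dir_no : dir (negb o) = -1.
Proof. rewrite dir_negb, dir_o. ring. Qed.

Lemma du_abs_pos (b : bool) (xe : R) : xe = x1 \/ xe = x2 -> 0 < Rabs (du b xe).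
Proof. intros Hxe. apply Rabs_pos_lt. apply (slope_end b xe Hxe). Qed.

(* The derivative at x1 of the return map x1 -> x2 -> x1 has absolute value < 1. *)
Definition contracting : Prop :=
  Rabs (du (negb o) x2) * Rabs (du o x1) < Rabs (du o x2) * Rabs (du (negb o) x1).

Lemma contraction_constants : contracting ->
  exists kap vt e, 0 < kap /\ 0 < vt < 1 /\ 0 < e /\
    kap * (Rabs (du (negb o) x2) + e) <= vt * (Rabs (du o x2) - e) /\
    Rabs (du o x1) + e <= kap * vt * (Rabs (du (negb o) x1) - e).
Proof.
  unfold contracting.
  assert (P1 := du_abs_pos o x1 (or_introl eq_refl)). assert (P2 := du_abs_pos o x2 (or_intror eq_refl)).
  assert (P3 := du_abs_pos (negb o) x1 (or_introl eq_refl)). assert (P4 := du_abs_pos (negb o) x2 (or_intror eq_refl)).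
  set (a1 := Rabs (du o x1)) in *. set (a2 := Rabs (du o x2)) in *.
  set (b1 := Rabs (du (negb o) x1)) in *. set (b2 := Rabs (du (negb o) x2)) in *.
  clearbody a1 a2 b1 b2. intros Hlt.
  (* Contraction says a1 / b1 < a2 / b2. Weighting the second side by a number strictly between the
     two ratios turns the contraction of the full turn into a strict decrease at each of the two
     crossings; [vt] and [e] share out the slack. *)
  set (kap := (a1 / b1 + a2 / b2) / 2).
  assert (Hab : a1 / b1 < a2 / b2).
  { apply Rmult_lt_reg_r with (b1 * b2); [apply Rmult_lt_0_compat; auto|].
    replace (a1 / b1 * (b1 * b2)) with (b2 * a1) by (field; lra).
    replace (a2 / b2 * (b1 * b2)) with (a2 * b1) by (field; lra). exact Hlt. }
  assert (H1 : 0 < a1 / b1) by (apply Rdiv_lt_0_compat; auto).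
  assert (Hk : 0 < kap) by (unfold kap; lra).
  assert (K1 : kap * b2 < a2).
  { apply Rmult_lt_reg_r with (/ b2); [apply Rinv_0_lt_compat; auto|].
    rewrite Rmult_assoc, Rinv_r, Rmult_1_r by lra. unfold kap. unfold Rdiv in *. lra. }
  assert (K2 : a1 < kap * b1).
  { apply Rmult_lt_reg_r with (/ b1); [apply Rinv_0_lt_compat; auto|].
    rewrite Rmult_assoc, Rinv_r, Rmult_1_r by lra. unfold kap. unfold Rdiv in *. lra. }
  set (v1 := kap * b2 / a2). set (v2 := a1 / (kap * b1)).
  assert (Hkb : 0 < kap * b1) by (apply Rmult_lt_0_compat; auto).
  assert (V1 : v1 < 1) by (apply Rmult_lt_reg_r with a2; auto; unfold v1, Rdiv; rewrite Rmult_assoc, Rinv_l; lra).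
  assert (V2 : v2 < 1) by (apply Rmult_lt_reg_r with (kap * b1); auto; unfold v2, Rdiv; rewrite Rmult_assoc, Rinv_l; lra).
  set (vt := (1 + Rmax v1 v2) / 2).
  assert (M1 := Rmax_l v1 v2). assert (M2 := Rmax_r v1 v2).
  assert (M3 : Rmax v1 v2 < 1) by (apply Rmax_lub_lt; auto).
  assert (P5 : 0 < v2) by (apply Rdiv_lt_0_compat; auto).
  assert (Hvt : 0 < vt < 1) by (unfold vt; lra).
  assert (W1 : kap * b2 < vt * a2).
  { apply Rle_lt_trans with (v1 * a2); [unfold v1; right; field; lra|]. apply Rmult_lt_compat_r; auto. unfold vt; lra. }
  assert (W2 : a1 < kap * vt * b1).
  { apply Rle_lt_trans with (v2 * (kap * b1)); [unfold v2; right; field; lra|].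
    replace (kap * vt * b1) with (vt * (kap * b1)) by ring. apply Rmult_lt_compat_r; auto. unfold vt; lra. }
  assert (Hkv : 0 < kap * vt) by (apply Rmult_lt_0_compat; lra).
  exists kap, vt, (Rmin ((vt * a2 - kap * b2) / (kap + vt)) ((kap * vt * b1 - a1) / (1 + kap * vt))).
  set (e := Rmin _ _).
  assert (E1 : e <= (vt * a2 - kap * b2) / (kap + vt)) by apply Rmin_l.
  assert (E2 : e <= (kap * vt * b1 - a1) / (1 + kap * vt)) by apply Rmin_r.
  split; [auto|]. split; [auto|]. split; [apply Rmin_pos; apply Rdiv_lt_0_compat; lra|]. split.
  - apply Rmult_le_compat_r with (r := kap + vt) in E1; [|lra].
    replace ((vt * a2 - kap * b2) / (kap + vt) * (kap + vt)) with (vt * a2 - kap * b2) in E1 by (field; lra). lra.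
  - apply Rmult_le_compat_r with (r := 1 + kap * vt) in E2; [|lra].
    replace ((kap * vt * b1 - a1) / (1 + kap * vt) * (1 + kap * vt)) with (kap * vt * b1 - a1) in E2 by (field; lra). lra.
Qed.

(** Decay is required along every trajectory in the tube, not along a flow. As L is discontinuous
    across the axis, its relation to the distance is expressed by the last two clauses: small L
    means small gauge within the tube, and conversely. *)
Definition lyapunov_function (L : R * R -> R) (th c : R) : Prop :=
  0 < c /\ (exists del e0, tube th del e0) /\ (forall p, 0 <= L p) /\
  (forall T g, 0 <= T -> traj S T g -> (forall t, 0 <= t <= T -> Rabs (gauge (g t)) < th) ->
     L (g T) * exp (c * T) <= L (g 0)) /\
  (forall e, 0 < e -> exists d, 0 < d /\ forall p, Rabs (gauge p) < th -> L p < d -> Rabs (gauge p) < e) /\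
  (forall d, 0 < d -> exists e, 0 < e /\ forall p, Rabs (gauge p) < e -> L p < d).

Lemma tube_shrink (th th' del e0 : R) : tube th del e0 -> 0 < th' -> th' <= th -> tube th' del e0.
Proof.
  intros (A1 & A2 & A3 & A4 & A5 & A6 & A7 & A8) H1 H2.
  split; [auto|]. split; [auto|]. split; [auto|]. split; [auto|]. split; [|split; [|split]].
  - intros p Hp. apply A5. lra.
  - intros x y Hp Hy. apply (A6 x y); lra.
  - intros b x y Hx Hy. apply A7; lra.
  - intros b x y Hx Hy. apply A8; lra.
Qed.

(* Each |H b - const| is weighted by an exponential of the abscissa decreasing along
   the arcs; the slack in [contracting] makes room for these weights at the crossings. *)
Lemma lyapunov_exists : contracting -> exists L th c, lyapunov_function L th c.
Proof.
  intros Hcon. destruct (contraction_constants Hcon) as (kap & vt & e & Hkap & Hvt & He & K1 & K2).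
  destruct ov_order as (O1 & O2 & O3 & Hm & HC & Hry & _).
  destruct (lev_axis o x1 e (or_introl eq_refl) He) as [d1 [Pd1 D1]].
  destruct (lev_axis o x2 e (or_intror eq_refl) He) as [d2 [Pd2 D2]].
  destruct (lev_axis (negb o) x1 e (or_introl eq_refl) He) as [d3 [Pd3 D3]].
  destruct (lev_axis (negb o) x2 e (or_intror eq_refl) He) as [d4 [Pd4 D4]].
  set (dd := Rmin (Rmin d1 d2) (Rmin d3 d4)).
  assert (Pdd : 0 < dd) by (unfold dd; repeat apply Rmin_pos; auto).
  assert (L1 : dd <= d1) by rmin.
  assert (L2 : dd <= d2) by rmin.
  assert (L3 : dd <= d3) by rmin.
  assert (L4 : dd <= d4) by rmin.
  clearbody dd.
  destruct (tube_exists dd Pdd) as (th0 & del & e0 & Htube0 & Hdel).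
  destruct gauge_le_lev as (K & th1 & PK & Pth1 & HK).
  set (th := Rmin th0 th1).
  assert (Hth0 : 0 < th0) by apply Htube0.
  assert (Pth : 0 < th) by (unfold th; apply Rmin_pos; auto).
  assert (Htube : tube th del e0) by (apply tube_shrink with th0; auto; apply Rmin_l).
  assert (Hth1 : th <= th1) by apply Rmin_r. clearbody th.
  set (ell := x2 - x1). assert (Pell : 0 < ell) by (unfold ell; lra).
  (* At a crossing the exponential weight rises by a factor near exp(mu ell). The factor [vt] =
     exp(- 2 mu ell) gained on the levels pays for it, with room for the deviation [del] from the
     end. *)
  set (mu := - ln vt / (2 * ell)).
  assert (Hln : ln vt < 0) by (rewrite <- ln_1; apply ln_increasing; lra).
  assert (Pmu : 0 < mu) by (apply Rdiv_lt_0_compat; lra).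
  assert (Evt : exp (- (mu * (2 * ell))) = vt).
  { replace (- (mu * (2 * ell))) with (ln vt) by (unfold mu; field; lra). apply exp_ln; lra. }
  (* The distance covered on the current arc, measured in the direction of motion; it grows at speed
     at least [m], whence the decay rate c = mu m. *)
  set (prog := fun b x => if Bool.eqb b o then x - x1 else x2 - x).
  set (kp := fun b => if Bool.eqb b o then 1 else kap).
  assert (Pkp : forall b, 0 < kp b) by (intros b; unfold kp; destruct Bool.eqb; lra).
  set (Lb := fun b x y => kp b * lev b x y * exp (- (mu * prog b x))).
  assert (Hprog : forall b x x', prog b x - prog b x' = dir b * (x - x')).
  { intros b x x'. unfold prog. destruct (Bool.eqb b o) eqn:Eb.
    - apply Bool.eqb_prop in Eb. rewrite Eb, dir_o. ring.
    - replace b with (negb o) by (destruct b, o; simpl in *; congruence). rewrite dir_no. ring. }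
  assert (Po : forall x, prog o x = x - x1) by (intros x; unfold prog; rewrite Bool.eqb_reflx; auto).
  assert (Pno : forall x, prog (negb o) x = x2 - x) by (intros x; unfold prog; rewrite Bool.eqb_negb1; auto).
  assert (Ko : kp o = 1) by (unfold kp; rewrite Bool.eqb_reflx; auto).
  assert (Kno : kp (negb o) = kap) by (unfold kp; rewrite Bool.eqb_negb1; auto).
  assert (Hlev0 : forall b x y, 0 <= lev b x y) by (intros; apply Rabs_pos).
  assert (Hexp : forall a b, a <= b -> exp a <= exp b).
  { intros a b [L| ->]; [apply Rlt_le, exp_increasing; auto|lra]. }
  set (c := mu * m). assert (Pc : 0 < c) by (apply Rmult_lt_0_compat; auto).
  set (L := fun p => Lb (upper (snd p)) (fst p) (snd p)).
  assert (Hbounds : forall b x, xl < x < xr -> exp (- (mu * (xr - xl))) <= exp (- (mu * prog b x)) <= exp (mu * (xr - xl))).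
  { intros b x Hx. assert (- (xr - xl) <= prog b x <= xr - xl) by (unfold prog; destruct Bool.eqb; lra).
    assert (mu * - (xr - xl) <= mu * prog b x <= mu * (xr - xl)) by (split; apply Rmult_le_compat_l; lra).
    split; apply Hexp; lra. }
  exists L, th, c. split; [auto|]. split; [exists del, e0; auto|]. split; [|split; [|split]].
  - intros p. unfold L, Lb. apply Rmult_le_pos; [|apply Rlt_le, exp_pos].
    apply Rmult_le_pos; [apply Rlt_le, Pkp|auto].
  - intros T g HT Hg Hin. set (X := fun t => fst (g t)). set (Y := fun t => snd (g t)).
    set (Psi := fun b t => Lb b (X t) (Y t) * exp (c * t)).
    assert (Hfin := piecewise_decreasing th del e0 T g Htube HT Hg Hin Psi).
    unfold Psi in Hfin. rewrite Rmult_0_r, exp_0, Rmult_1_r in Hfin. apply Hfin.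
    + intros b s t Hs Hst HtT Hside.
      destruct (side_run th del e0 T g Htube Hg Hin b s t Hs Hst HtT Hside) as [R1 R2].
      fold (X t) (X s) (Y t) (Y s) in R1, R2.
      unfold Lb, lev. rewrite R1, !Rmult_assoc, <- !exp_plus.
      apply Rmult_le_compat_l; [apply Rlt_le, Pkp|]. apply Rmult_le_compat_l; [apply Rabs_pos|].
      apply Hexp. specialize (Hprog b (X t) (X s)).
      assert (mu * (m * (t - s)) <= mu * (prog b (X t) - prog b (X s))) by (apply Rmult_le_compat_l; lra).
      unfold c. lra.
    + intros t Ht HY HX. apply Rmult_le_compat_r; [apply Rlt_le, exp_pos|].
      unfold Lb. fold (X t) in HX. change (Y t = 0) in HY. rewrite HY, Ko, Kno, Po, Pno, Rmult_1_l.
      destruct (D2 (X t) ltac:(lra)) as [Q1 _]. destruct (D4 (X t) ltac:(lra)) as [_ Q2].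
      assert (Hd := proj1 (proj2 (proj2 (proj2 Htube)))).
      apply Rabs_def2 in HX.
      assert (S1 : kap * lev (negb o) (X t) 0 <= vt * lev o (X t) 0).
      { set (w := Rabs (X t - x2)) in *. assert (0 <= w) by apply Rabs_pos.
        apply Rle_trans with (kap * ((Rabs (du (negb o) x2) + e) * w)); [apply Rmult_le_compat_l; lra|].
        apply Rle_trans with (vt * ((Rabs (du o x2) - e) * w)); [|apply Rmult_le_compat_l; lra].
        rewrite <- !Rmult_assoc. apply Rmult_le_compat_r; auto. }
      apply Rle_trans with (vt * lev o (X t) 0 * exp (- (mu * (x2 - X t)))).
      { apply Rmult_le_compat_r; [apply Rlt_le, exp_pos|auto]. }
      rewrite <- Evt.
      replace (exp (- (mu * (2 * ell))) * lev o (X t) 0 * exp (- (mu * (x2 - X t))))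
        with (lev o (X t) 0 * (exp (- (mu * (2 * ell))) * exp (- (mu * (x2 - X t))))) by ring.
      rewrite <- exp_plus. apply Rmult_le_compat_l; auto. apply Hexp.
      assert (mu * (X t - x1) <= mu * (2 * ell + (x2 - X t))); [|lra].
      apply Rmult_le_compat_l; [lra|]. unfold ell. lra.
    + intros t Ht HY HX. apply Rmult_le_compat_r; [apply Rlt_le, exp_pos|].
      unfold Lb. fold (X t) in HX. change (Y t = 0) in HY. rewrite HY, Ko, Kno, Po, Pno, Rmult_1_l.
      destruct (D1 (X t) ltac:(lra)) as [_ Q1]. destruct (D3 (X t) ltac:(lra)) as [Q2 _].
      assert (Hd := proj1 (proj2 (proj2 (proj2 Htube)))).
      apply Rabs_def2 in HX.
      assert (S1 : lev o (X t) 0 <= vt * (kap * lev (negb o) (X t) 0)).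
      { set (w := Rabs (X t - x1)) in *. assert (0 <= w) by apply Rabs_pos.
        apply Rle_trans with (1 := Q1).
        apply Rle_trans with (kap * vt * ((Rabs (du (negb o) x1) - e) * w)).
        - rewrite <- Rmult_assoc. apply Rmult_le_compat_r; auto.
        - replace (vt * (kap * lev (negb o) (X t) 0)) with (kap * vt * lev (negb o) (X t) 0) by ring.
          apply Rmult_le_compat_l; auto. apply Rmult_le_pos; lra. }
      apply Rle_trans with (vt * (kap * lev (negb o) (X t) 0) * exp (- (mu * (X t - x1)))).
      { apply Rmult_le_compat_r; [apply Rlt_le, exp_pos|auto]. }
      rewrite <- Evt.
      replace (exp (- (mu * (2 * ell))) * (kap * lev (negb o) (X t) 0) * exp (- (mu * (X t - x1))))
        with (kap * lev (negb o) (X t) 0 * (exp (- (mu * (2 * ell))) * exp (- (mu * (X t - x1))))) by ring.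
      rewrite <- exp_plus. apply Rmult_le_compat_l; [apply Rmult_le_pos; [lra|auto]|]. apply Hexp.
      assert (mu * (x2 - X t) <= mu * (2 * ell + (X t - x1))); [|lra].
      apply Rmult_le_compat_l; [lra|]. unfold ell. lra.
  - intros r Hr. set (q := Rmin 1 kap * exp (- (mu * (xr - xl))) / K).
    assert (Hmin : 0 < Rmin 1 kap) by (apply Rmin_pos; lra).
    assert (Hq : 0 < q) by (apply Rdiv_lt_0_compat; auto; apply Rmult_lt_0_compat; auto; apply exp_pos).
    exists (q * r). split; [apply Rmult_lt_0_compat; auto|]. intros p Hp HLp.
    destruct Htube as (_ & _ & _ & _ & HN & _). destruct (HN p Hp) as [Hx _].
    set (b := upper (snd p)) in *.
    assert (G := HK b (fst p) (snd p)). rewrite <- surjective_pairing in G.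
    specialize (G ltac:(lra) (upper_nonneg (snd p))).
    destruct (Hbounds b (fst p) Hx) as [B1 _].
    assert (Hkb : Rmin 1 kap <= kp b).
    { unfold kp. destruct Bool.eqb; [apply Rmin_l|apply Rmin_r]. }
    assert (HL2 : q * K * lev b (fst p) (snd p) <= L p).
    { unfold L, Lb. fold b. replace (q * K) with (Rmin 1 kap * exp (- (mu * (xr - xl)))) by (unfold q; field; lra).
      replace (kp b * lev b (fst p) (snd p) * exp (- (mu * prog b (fst p))))
        with (kp b * exp (- (mu * prog b (fst p))) * lev b (fst p) (snd p)) by ring.
      apply Rmult_le_compat_r; auto. apply Rmult_le_compat; auto; try lra. apply Rlt_le, exp_pos. }
    apply Rmult_lt_reg_l with q; auto. apply Rle_lt_trans with (2 := HLp). apply Rle_trans with (2 := HL2).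
    rewrite Rmult_assoc. apply Rmult_le_compat_l; lra.
  - intros r Hr. set (q := (1 + kap) * exp (mu * (xr - xl))).
    assert (Hq : 0 < q) by (apply Rmult_lt_0_compat; [lra|apply exp_pos]).
    destruct (lev_small (r / q)) as [t2 [Pt2 Q2]]; [apply Rdiv_lt_0_compat; auto|].
    exists (Rmin th t2). split; [apply Rmin_pos; auto|]. intros p Hp.
    assert (Hp1 : Rabs (gauge p) < th) by rmin.
    assert (Hp2 : Rabs (gauge p) < t2) by rmin.
    destruct Htube as (_ & _ & _ & _ & HN & _). destruct (HN p Hp1) as [Hx _].
    set (b := upper (snd p)).
    assert (G := Q2 b (fst p) (snd p)). rewrite <- surjective_pairing in G.
    specialize (G Hp2 (upper_nonneg (snd p))).
    destruct (Hbounds b (fst p) Hx) as [_ B2].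
    assert (Hkb : kp b <= 1 + kap) by (unfold kp; destruct Bool.eqb; lra).
    unfold L, Lb. fold b.
    apply Rle_lt_trans with (q * lev b (fst p) (snd p)).
    + unfold q. replace (kp b * lev b (fst p) (snd p) * exp (- (mu * prog b (fst p))))
        with (kp b * exp (- (mu * prog b (fst p))) * lev b (fst p) (snd p)) by ring.
      apply Rmult_le_compat_r; auto. apply Rmult_le_compat; auto; [apply Rlt_le, Pkp|apply Rlt_le, exp_pos].
    + apply Rmult_lt_compat_l with (r := q) in G; auto.
      replace (q * (r / q)) with r in G by (field; lra). exact G.
Qed.

(** * Stability and attraction *)

Lemma gauge_continuous (g : R -> R * R) (t : R) : continuous g t -> continuous (fun t => gauge (g t)) t.
Proof.
  intros Hg. destruct ov_order as (_ & _ & _ & _ & HC & _). apply continuous_prod_iff in Hg. destruct Hg as [G1 G2].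
  apply continuous_eps. intros e He. set (d := e / (2 * (C + 2))).
  assert (Hd : 0 < d) by (apply Rdiv_lt_0_compat; lra).
  destruct (proj1 (continuous_eps _ _) G1 d Hd) as [d1 [P1 Q1]].
  destruct (proj1 (continuous_eps _ _) G2 d Hd) as [d2 [P2 Q2]].
  exists (Rmin d1 d2). split; [apply Rmin_pos; auto|]. intros s Hs.
  specialize (Q1 s ltac:(pose proof (Rmin_l d1 d2); lra)). specialize (Q2 s ltac:(pose proof (Rmin_r d1 d2); lra)).
  apply Rle_lt_trans with (1 := gauge_lipschitz _ _).
  apply Rlt_le_trans with ((C + 2) * (d + d)); [apply Rmult_lt_compat_l; lra|].
  unfold d. right; field; lra.
Qed.

Lemma stays (L : R * R -> R) (th c : R) : lyapunov_function L th c ->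
  forall r, 0 < r -> r <= th -> exists e, 0 < e /\ forall T g, 0 <= T -> traj S T g -> Rabs (gauge (g 0)) < e ->
    forall t, 0 <= t <= T -> Rabs (gauge (g t)) < r.
Proof.
  intros (Pc & _ & HL0 & HL1 & HL2 & HL3) r Hr Hrth.
  destruct (HL2 (r / 2)) as [d [Pd Qd]]; [lra|]. destruct (HL3 d Pd) as [e [Pe Qe]].
  exists (Rmin e (r / 2)). split; [apply Rmin_pos; lra|]. intros T g HT Hg H0.
  assert (H01 : Rabs (gauge (g 0)) < e) by rmin.
  assert (H02 : Rabs (gauge (g 0)) < r / 2) by rmin.
  assert (Hgc : forall t, continuous (fun t => gauge (g t)) t) by (intros t; apply gauge_continuous, Hg).
  assert (Hkey : forall t, 0 <= t <= T -> (forall s, 0 <= s < t -> Rabs (gauge (g s)) < r) ->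
     forall s, 0 <= s < t -> Rabs (gauge (g s)) < r / 2).
  { intros t Ht Hlt s Hs. apply Qd; [specialize (Hlt s Hs); lra|].
    assert (A := HL1 s g ltac:(lra) (traj_restrict S T s g ltac:(lra) Hg)).
    assert (B : L (g s) * exp (c * s) <= L (g 0)).
    { apply A. intros u Hu. specialize (Hlt u ltac:(lra)). lra. }
    specialize (Qe _ H01). specialize (HL0 (g s)).
    assert (1 <= exp (c * s)).
    { rewrite <- exp_0. destruct (Req_dec s 0) as [->|N]; [rewrite Rmult_0_r; lra|].
      apply Rlt_le, exp_increasing. apply Rmult_lt_0_compat; lra. }
    assert (L (g s) * 1 <= L (g s) * exp (c * s)) by (apply Rmult_le_compat_l; auto). lra. }
  (* Bootstrap: the decay of L is available only while the trajectory remains in the tube, and it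
     then improves the bound r to r / 2, so the bound r cannot be lost. *)
  set (E0 := fun t => 0 <= t <= T /\ forall s, 0 <= s <= t -> Rabs (gauge (g s)) < r).
  assert (HE0 : E0 0) by (split; [lra|]; intros s Hs; replace s with 0 by lra; lra).
  destruct (completeness E0) as [M [Hub Hlub]].
  { exists T. intros t [Ht _]; lra. } { exists 0; auto. }
  assert (HM0 : 0 <= M) by (apply Hub; auto).
  assert (HMT : M <= T) by (apply Hlub; intros t [Ht _]; lra).
  assert (Hlt : forall s, 0 <= s < M -> Rabs (gauge (g s)) < r).
  { intros s Hs. destruct (classic (exists t, E0 t /\ s < t)) as [[t [[_ Ht] Hst]]|N].
    - apply Ht; lra.
    - exfalso. assert (M <= s); [|lra]. apply Hlub. intros t Ht. apply Rnot_lt_le. intros K. apply N. exists t; auto. }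
  assert (HM : Rabs (gauge (g M)) <= r / 2).
  { destruct (Req_dec M 0) as [->|N]; [lra|]. apply Rnot_lt_le. intros K.
    destruct (proj1 (continuous_eps _ _) (Hgc M) (Rabs (gauge (g M)) - r / 2)) as [d' [Pd' Q']]; [lra|].
    set (s := Rmax 0 (M - d' / 2)).
    assert (Hs : 0 <= s < M /\ M - d' < s) by (unfold s, Rmax; destruct Rle_dec; lra).
    assert (A := Hkey M ltac:(lra) Hlt s ltac:(lra)). specialize (Q' s ltac:(apply Rabs_def1; lra)).
    assert (B := Rabs_triang_inv (gauge (g M)) (gauge (g s))). rewrite Rabs_minus_sym in B. lra. }
  assert (HMeq : M = T).
  { destruct HMT as [K|]; auto. exfalso.
    destruct (proj1 (continuous_eps _ _) (Hgc M) (r / 2)) as [d' [Pd' Q']]; [lra|].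
    set (t := Rmin T (M + d' / 2)).
    assert (Ht : M < t <= T /\ t < M + d') by (unfold t, Rmin; destruct Rle_dec; lra).
    assert (E0 t).
    { split; [lra|]. intros s Hs. destruct (Rlt_le_dec s M); [apply Hlt; lra|].
      specialize (Q' s ltac:(apply Rabs_def1; lra)).
      assert (B := Rabs_triang_inv (gauge (g s)) (gauge (g M))). lra. }
    specialize (Hub t H1). lra. }
  intros t Ht. destruct (Rlt_le_dec t M); [apply Hlt; lra|]. replace t with M by lra. lra.
Qed.

Lemma stable_first_part (L : R * R -> R) (th c : R) : lyapunov_function L th c ->
  forall eps, 0 < eps -> exists e, 0 < e /\ forall T g, 0 < T -> filippov_trajectory S 0 T g ->
    near_set oval e (g 0) -> forall t, 0 <= t <= T -> near_set oval eps (g t) /\ Rabs (gauge (g t)) < th.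
Proof.
  intros HL eps Heps. destruct ov_order as (_ & _ & _ & _ & HC & _).
  assert (Pth : 0 < th) by (destruct HL as (_ & (del & e0 & Ht) & _); apply Ht).
  destruct (stays L th c HL (Rmin eps th)) as [e [Pe Qe]]; [apply Rmin_pos; auto|apply Rmin_r|].
  exists (e / (4 * (C + 2))). split; [apply Rdiv_lt_0_compat; lra|].
  intros T g HT Hg H0 t Ht.
  destruct (filippov_traj S T g ltac:(lra) Hg) as [g' [Hg' Eg]].
  assert (A : Rabs (gauge (g' t)) < Rmin eps th).
  { apply (Qe T g'); auto; [lra|]. rewrite Eg by lra.
    apply Rle_lt_trans with (1 := near_gauge _ _ H0).
    replace ((C + 2) * (2 * (e / (4 * (C + 2))))) with (e / 2) by (field; lra). lra. }
  rewrite Eg in A by auto. split.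
  - apply gauge_near. apply Rlt_le_trans with (1 := A). apply Rmin_l.
  - apply Rlt_le_trans with (1 := A). apply Rmin_r.
Qed.

Lemma attracted (L : R * R -> R) (th c : R) (g : R -> R * R) : lyapunov_function L th c ->
  (forall T, 0 < T -> filippov_trajectory S 0 T g) -> (forall t, 0 <= t -> Rabs (gauge (g t)) < th) ->
  forall eps, 0 < eps -> exists T0, forall t, 0 <= t -> T0 <= t -> near_set oval eps (g t).
Proof.
  intros (Pc & _ & HL0 & HL1 & HL2 & HL3) Hg Hin eps Heps.
  destruct (HL2 eps Heps) as [d [Pd Qd]].
  set (l0 := L (g 0)).
  (* From this time on [l0] is at most c t d, hence less than d exp(c t), and the decay estimate
     gives L < d. The 1 keeps the time positive. *)
  exists (Rmax 1 (l0 / (c * d))). intros t Ht HT.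
  assert (T1 : 1 <= t) by (apply Rle_trans with (2 := HT); apply Rmax_l).
  assert (T2 : l0 / (c * d) <= t) by (apply Rle_trans with (2 := HT); apply Rmax_r).
  apply gauge_near. apply Qd; [auto|].
  destruct (filippov_traj S t g ltac:(lra) (Hg t ltac:(lra))) as [g' [Hg' Eg]].
  assert (A := HL1 t g' ltac:(lra) Hg').
  rewrite !Eg in A by lra. fold l0 in A.
  assert (B : L (g t) * exp (c * t) <= l0).
  { apply A. intros s Hs. rewrite Eg by auto. apply Hin; lra. }
  assert (Hcd : 0 < c * d) by (apply Rmult_lt_0_compat; auto).
  assert (Hl : l0 <= c * t * d).
  { apply Rmult_le_compat_l with (r := c * d) in T2; [|lra].
    replace (c * d * (l0 / (c * d))) with l0 in T2 by (field; lra). lra. }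
  assert (He : c * t < exp (c * t)).
  { assert (0 < c * t) by (apply Rmult_lt_0_compat; lra). assert (Z := exp_ineq1 (c * t) ltac:(lra)). lra. }
  apply Rnot_le_lt. intros K.
  assert (d * (c * t) < d * exp (c * t)) by (apply Rmult_lt_compat_l; auto).
  assert (d * exp (c * t) <= L (g t) * exp (c * t)) by (apply Rmult_le_compat_r; [apply Rlt_le, exp_pos|auto]). lra.
Qed.

(** * Orbit arcs and the return map *)

Definition arc (b : bool) (x y z T : R) (g : R -> R * R) : Prop :=
  0 < T /\ Rabs (z - x) <= Mx * T /\ traj S T g /\ g 0 = (x, y) /\ g T = (z, 0) /\
  (forall t, 0 < t < T -> 0 < sgn b * snd (g t)) /\
  (forall t, 0 <= t <= T -> xl < fst (g t) < xr /\ H b (fst (g t)) (snd (g t)) = H b z 0 /\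
     Rmin x z <= fst (g t) <= Rmax x z) /\
  (forall xi, Rmin x z <= xi <= Rmax x z -> exists t, 0 <= t <= T /\ fst (g t) = xi).

Lemma sys_dom_box (x y : R) : xl < x < xr -> Rabs y < ry -> sys_dom S (x, y).
Proof.
  intros Hx Hy. split; intros _.
  - apply (ho_field (HO true) x y Hx Hy).
  - apply (ho_field (HO false) x y Hx Hy).
Qed.

(** The start may be on the axis or inside the half-plane: since 0 <= sgn b * y, the landing point
    has a level at least that of (x, 0), which is what [ho_arc] needs. The bound of |z - x| by Mx T
    gives the lower bounds on travel times. *)
Lemma arc_exists (b : bool) (x y z : R) :
  xl < x < xr -> Rabs y < ry / 2 -> xl < z < xr -> H b x y = H b z 0 -> 0 < dir b * (z - x) ->
  0 <= sgn b * y -> exists T g, arc b x y z T g.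
Proof.
  intros Hx Hy Hz Hlev Hdir Hs.
  destruct (ho_arc (HO b) x y z Hx Hy Hz Hlev Hdir)
    as (T & g & HT & HTl & Hc & G0 & GT & Gr & Gd & Gcov).
  { intros xi Hxi.
    assert (A : sgn b * H b x 0 <= sgn b * H b z 0).
    { rewrite <- Hlev. destruct (Req_dec y 0) as [->|N]; [lra|].
      apply Rlt_le. apply (ho_lt_iff (HO b) x 0 y Hx).
      rewrite Rmult_0_r. destruct Hs as [|Z]; auto. exfalso. symmetry in Z. apply Rmult_integral in Z.
      destruct Z as [Z|Z]; [|contradiction]. destruct (sgn_cases b) as [K|K]; rewrite K in Z; lra. }
    destruct (Rle_dec x z) as [L|L].
    - rewrite Rmin_left, Rmax_right in Hxi by lra.
      assert (V := ho_valley (HO b) x z xi ltac:(lra) ltac:(lra) ltac:(lra) ltac:(lra)).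
      rewrite Rmax_right in V by lra. exact V.
    - rewrite Rmin_right, Rmax_left in Hxi by lra.
      assert (V := ho_valley (HO b) z x xi ltac:(lra) ltac:(lra) ltac:(lra) ltac:(lra)).
      rewrite Rmax_left in V by lra. exact V. }
  exists T, g. split; [auto|]. split; [auto|]. split; [split; [auto|split]|split; [auto|split; [auto|split; [|split; auto]]]].
  - intros t Ht. rewrite (surjective_pairing (g t)). apply sys_dom_box; apply Gr; auto.
  - exists nil. intros t Ht _. destruct (Gd t Ht) as [D1 [D2 _]].
    exists (veval (half_field S b) (g t)). split; auto.
    destruct b; simpl in D1; [left|right; left]; split; auto; lra.
  - intros t Ht. apply Gd; auto.
  - intros t Ht. split; [apply Gr; auto|]. split; apply Gr; auto.
Qed.

Definition ends (b : bool) (xs xe : R) : Prop :=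
  b = o /\ xs = x1 /\ xe = x2 \/ b = negb o /\ xs = x2 /\ xe = x1.

Lemma ends_dir (b : bool) (xs xe : R) : ends b xs xe ->
  dir b * (xe - xs) = x2 - x1 /\ (xs = x1 \/ xs = x2) /\ (xe = x1 \/ xe = x2) /\
  xl < xs < xr /\ xl < xe < xr /\ H b xs 0 = H b xe 0.
Proof.
  destruct ov_order as (O1 & O2 & O3 & _).
  intros [(-> & -> & ->)|(-> & -> & ->)].
  - rewrite dir_o. assert (T := H12 o). repeat split; auto; lra.
  - rewrite dir_no. assert (T := H12 (negb o)). repeat split; auto; lra.
Qed.

Lemma Mx_pos : 0 < Mx.
Proof.
  destruct ov_order as (O1 & O2 & O3 & Hm & _ & Hry & _).
  destruct (ho_field (HO true) x1 0 ltac:(lra) ltac:(rewrite Rabs_R0; lra)) as [_ B]. lra.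
Qed.

Lemma half_map (b : bool) (xs xe del : R) : ends b xs xe -> 0 < del ->
  exists (psi : R -> R) (d : R), 0 < d /\ psi xs = xe /\ is_derive psi xs (du b xs / du b xe) /\
    forall x, Rabs (x - xs) < d -> Rabs (psi x - xe) < del /\
      exists T g, (x2 - x1) / (2 * Mx) <= T /\ arc b x 0 (psi x) T g.
Proof.
  intros He Hdel. destruct (ends_dir b xs xe He) as (E1 & E2 & E3 & E4 & E5 & E6).
  destruct ov_order as (O1 & O2 & O3 & Hm & HC & Hry & _). assert (PM := Mx_pos).
  set (ell := x2 - x1) in *. assert (Pell : 0 < ell) by (unfold ell; lra).
  (* The half-map is the local inverse at [xe] composed with the level at the start, so its
     derivative is a quotient of end slopes. Keeping both ends within ell / 4 leaves a length at
     least ell / 2, hence a time at least ell / (2 Mx). *)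
  destruct (ho_end_inverse (HO b) xe (Rmin del (ell / 4)) E3) as (V & d & Pd & V0 & Vd).
  { apply Rmin_pos; lra. }
  set (d' := Rmin (Rmin (d / C) (ell / 4)) (Rmin (xs - xl) (xr - xs))).
  assert (PdC : 0 < d / C) by (apply Rdiv_lt_0_compat; lra).
  exists (fun x => V (H b x 0)), d'. split; [unfold d'; repeat apply Rmin_pos; lra|].
  split; [rewrite E6; exact V0|]. split.
  { evar_last.
    - apply (is_derive_comp V (fun x => H b x 0)).
      + destruct (Vd (H b xs 0)) as (_ & _ & _ & D); [rewrite E6, Rminus_diag, Rabs_R0; auto|]. exact D.
      + apply (proj2 (slope_end b xs E2)).
    - rewrite E6, V0. reflexivity. }
  intros x Hx.
  assert (A1 : Rabs (x - xs) < d / C) by rmin.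
  assert (A2 : Rabs (x - xs) < ell / 4) by rmin.
  assert (A3 : Rabs (x - xs) < xs - xl) by rmin.
  assert (A4 : Rabs (x - xs) < xr - xs) by rmin.
  clear Hx. apply Rabs_def2 in A3. apply Rabs_def2 in A4. assert (Hxr : xl < x < xr) by lra.
  assert (Hh : Rabs (H b x 0 - H b xe 0) < d).
  { rewrite <- E6. apply Rle_lt_trans with (1 := ho_lip_H (HO b) xs 0 x 0 E4 Hxr).
    rewrite Rminus_diag, Rabs_R0, Rplus_0_r. apply Rmult_lt_compat_l with (r := C) in A1; auto.
    replace (C * (d / C)) with d in A1 by (field; lra). exact A1. }
  destruct (Vd _ Hh) as (V1 & V2 & V3 & _).
  set (z := V (H b x 0)) in *.
  assert (B1 : Rabs (z - xe) < del) by rmin.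
  assert (B2 : Rabs (z - xe) < ell / 4) by rmin.
  split; [auto|].
  apply Rabs_def2 in A2. apply Rabs_def2 in B2.
  assert (Hdir : ell / 2 <= dir b * (z - x)).
  { destruct (dir_cases b) as [K|K]; rewrite K in *; lra. }
  destruct (arc_exists b x 0 z) as (T & g & Ha); auto; try lra.
  { rewrite Rabs_R0; lra. }
  exists T, g. split; auto. destruct Ha as (HT & Hl & _).
  assert (Hab : ell / 2 <= Rabs (z - x)).
  { apply Rle_trans with (1 := Hdir). destruct (dir_cases b) as [K|K]; rewrite K.
    - rewrite Rmult_1_l. apply Rle_abs.
    - replace (-1 * (z - x)) with (- (z - x)) by ring. rewrite <- Rabs_Ropp. apply Rle_abs. }
  apply Rmult_le_reg_l with Mx; auto. replace (Mx * (ell / (2 * Mx))) with (ell / 2) by (field; lra). lra.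
Qed.

Lemma arc_from (b : bool) (xs xe del : R) : ends b xs xe -> 0 < del ->
  exists e, 0 < e /\ forall p, Rabs (gauge p) < e -> 0 < sgn b * snd p ->
    exists z T g, Rabs (z - xe) < del /\ arc b (fst p) (snd p) z T g.
Proof.
  intros He Hdel. destruct (ends_dir b xs xe He) as (E1 & E2 & E3 & E4 & E5 & E6).
  destruct ov_order as (O1 & O2 & O3 & Hm & HC & Hry & Hc0). specialize (Hc0 b).
  destruct (tube_exists 1 ltac:(lra)) as (th & del1 & e0 & Ht & _).
  set (r := Rmin (c0 b - x1) (x2 - c0 b)).
  assert (Pr : 0 < r) by (apply Rmin_pos; lra).
  assert (R1 : r <= c0 b - x1) by apply Rmin_l. assert (R2 : r <= x2 - c0 b) by apply Rmin_r.
  destruct (ho_end_inverse (HO b) xe (Rmin del r) E3) as (V & d & Pd & V0 & Vd).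
  { apply Rmin_pos; lra. }
  destruct (lev_small d Pd) as [t2 [Pt2 Q2]].
  assert (Pth : 0 < th) by apply Ht.
  exists (Rmin th t2). split; [apply Rmin_pos; auto|]. intros [x y] Hp Hs. simpl in Hs |- *.
  assert (Hp1 : Rabs (gauge (x, y)) < th) by rmin.
  assert (Hp2 : Rabs (gauge (x, y)) < t2) by rmin.
  destruct Ht as (_ & _ & _ & _ & HN & _). destruct (HN _ Hp1) as [Hx Hy]. simpl in Hx, Hy.
  assert (Hl := Q2 b x y Hp2 ltac:(lra)). unfold lev in Hl.
  assert (Ee : H b x1 0 = H b xe 0) by (destruct E3 as [-> | ->]; [auto|apply H12]).
  rewrite Ee in Hl. destruct (Vd _ Hl) as (V1 & V2 & V3 & _).
  set (z := V (H b x y)) in *.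
  assert (B1 : Rabs (z - xe) < del) by rmin.
  assert (B2 : Rabs (z - xe) < r) by rmin.
  apply Rabs_def2 in B2.
  assert (Hlt : sgn b * H b x 0 < sgn b * H b z 0).
  { rewrite V3. apply (ho_lt_iff (HO b) x 0 y Hx). lra. }
  (* The landing point lies ahead: were it behind x, monotonicity on the exit side of the tangency
     would give (x, 0) a level at least that of (z, 0), against [Hlt]. *)
  assert (Hdir : 0 < dir b * (z - x)).
  { destruct He as [(-> & -> & ->)|(-> & -> & ->)].
    - rewrite dir_o. destruct (Rlt_le_dec x z) as [|[K|K]]; [lra| |rewrite K in Hlt; lra].
      assert (T := ho_increasing (HO o) z x ltac:(lra) K ltac:(lra)). lra.
    - rewrite dir_no. destruct (Rlt_le_dec z x) as [|[K|K]]; [lra| |rewrite K in Hlt; lra].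
      assert (T := ho_decreasing (HO (negb o)) x z ltac:(lra) K ltac:(lra)). lra. }
  destruct (arc_exists b x y z) as (T & g & Ha); auto; try lra.
  exists z, T, g. split; auto.
Qed.

Lemma full_turn (del : R) : 0 < del ->
  exists (rho : R -> R) (d : R), 0 < d /\ rho x1 = x1 /\
    is_derive rho x1 (du o x1 / du o x2 * (du (negb o) x2 / du (negb o) x1)) /\
    forall x, Rabs (x - x1) < d -> Rabs (rho x - x1) < del /\
      exists z T1 T2 g1 g2, Rabs (z - x2) < del /\ (x2 - x1) / (2 * Mx) <= T1 /\
        arc o x 0 z T1 g1 /\ arc (negb o) z 0 (rho x) T2 g2.
Proof.
  intros Hdel.
  destruct (half_map (negb o) x2 x1 del) as (psi2 & d2 & Pd2 & P20 & P2d & P2); auto.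
  { right; auto. }
  destruct (half_map o x1 x2 (Rmin del d2)) as (psi1 & d1 & Pd1 & P10 & P1d & P1).
  { left; auto. } { apply Rmin_pos; auto. }
  exists (fun x => psi2 (psi1 x)), d1. split; [auto|]. split; [rewrite P10; auto|]. split.
  { apply (is_derive_comp psi2 psi1); [rewrite P10; exact P2d|exact P1d]. }
  intros x Hx. destruct (P1 x Hx) as (A1 & T1 & g1 & A2 & A3).
  destruct (P2 (psi1 x)) as (B1 & T2 & g2 & B2 & B3).
  { apply Rlt_le_trans with (1 := A1). apply Rmin_r. }
  split; [auto|]. exists (psi1 x), T1, T2, g1, g2. split; [|auto].
  apply Rlt_le_trans with (1 := A1). apply Rmin_l.
Qed.

Lemma arcs_concat (b b' : bool) (x y z w T1 T2 : R) (g1 g2 : R -> R * R) :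
  arc b x y z T1 g1 -> arc b' z 0 w T2 g2 ->
  traj S (T1 + T2) (join T1 g1 g2) /\ join T1 g1 g2 0 = (x, y) /\ join T1 g1 g2 (T1 + T2) = (w, 0) /\
  join T1 g1 g2 T1 = (z, 0) /\
  (forall t, 0 < t < T1 -> 0 < sgn b * snd (join T1 g1 g2 t)) /\
  (forall t, T1 < t < T1 + T2 -> 0 < sgn b' * snd (join T1 g1 g2 t)).
Proof.
  intros (A1 & A2 & A3 & A4 & A5 & A6 & _) (B1 & B2 & B3 & B4 & B5 & B6 & _).
  assert (E0 : g1 T1 = g2 0) by (rewrite A5, B4; auto).
  split; [apply traj_concat; auto; lra|]. split; [rewrite join_l by lra; auto|].
  split; [rewrite join_r by (auto; lra); rewrite <- B5; f_equal; ring|].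
  split; [rewrite join_l by lra; auto|]. split.
  - intros t Ht. rewrite join_l by lra. auto.
  - intros t Ht. rewrite join_r by (auto; lra). apply B6. lra.
Qed.

Lemma oval_hyperbolic :
  Rabs (du (negb o) x2) * Rabs (du o x1) <> Rabs (du o x2) * Rabs (du (negb o) x1) -> hyperbolic S oval.
Proof.
  intros Hne. destruct ov_order as (O1 & O2 & O3 & _).
  (* So short a section around x1 is missed at the intermediate crossing near x2, hence the first
     return takes place after a full turn. *)
  set (eps := (x2 - x1) / 4).
  destruct (full_turn eps) as (rho & d & Pd & R0 & Rd & Rt); [unfold eps; lra|].
  exists x1, rho, (du o x1 / du o x2 * (du (negb o) x2 / du (negb o) x1)).
  split; [split; simpl; [lra|exists true; symmetry; apply Heta]|].
  split; [|split; [auto|split; [auto|]]].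
  - exists eps. split; [unfold eps; lra|]. exists (mkposreal d Pd). intros x Hx.
    destruct (Rt x Hx) as (A1 & z & T1 & T2 & g1 & g2 & A2 & A3 & A4 & A5).
    destruct (arcs_concat _ _ _ _ _ _ _ _ _ _ A4 A5) as (B1 & B2 & B3 & B4 & B5 & B6).
    assert (PT1 : 0 < T1) by apply A4. assert (PT2 : 0 < T2) by apply A5.
    exists (T1 + T2), (join T1 g1 g2).
    split; [lra|]. split; [apply traj_filippov; auto|]. split; [auto|]. split; [auto|]. split; [auto|].
    intros t w Ht Hw Et.
    destruct (Rtotal_order t T1) as [K|[K|K]].
    + specialize (B5 t ltac:(lra)). rewrite Et in B5. simpl in B5. lra.
    + rewrite K, B4 in Et. injection Et as ->. unfold eps in *. apply Rabs_def2 in A2. apply Rabs_def2 in Hw. lra.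
    + specialize (B6 t ltac:(lra)). rewrite Et in B6. simpl in B6. lra.
  - assert (P1 := du_abs_pos o x1 (or_introl eq_refl)). assert (P2 := du_abs_pos o x2 (or_intror eq_refl)).
    assert (P3 := du_abs_pos (negb o) x1 (or_introl eq_refl)). assert (P4 := du_abs_pos (negb o) x2 (or_intror eq_refl)).
    unfold Rdiv. rewrite !Rabs_mult, !Rabs_inv. intros K. apply Hne.
    apply Rmult_eq_reg_r with (/ (Rabs (du o x2) * Rabs (du (negb o) x1))).
    + rewrite Rinv_r by (apply Rgt_not_eq, Rmult_lt_0_compat; auto).
      rewrite <- K. field. split; lra.
    + apply Rinv_neq_0_compat. apply Rgt_not_eq, Rmult_lt_0_compat; auto.
Qed.

Lemma oval_periodic : periodic_orbit S oval.
Proof.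
  destruct ov_order as (O1 & O2 & O3 & _).
  destruct (full_turn 1) as (rho & d & Pd & R0 & _ & _); [lra|].
  destruct (arc_exists o x1 0 x2) as (T1 & g1 & A4); try lra.
  { rewrite Rabs_R0. destruct ov_order as (_ & _ & _ & _ & _ & Q & _). lra. }
  { apply H12. } { rewrite dir_o. lra. }
  destruct (arc_exists (negb o) x2 0 x1) as (T2 & g2 & A5); try lra.
  { rewrite Rabs_R0. destruct ov_order as (_ & _ & _ & _ & _ & Q & _). lra. }
  { symmetry. apply H12. } { rewrite dir_no. lra. }
  destruct (arcs_concat _ _ _ _ _ _ _ _ _ _ A4 A5) as (B1 & B2 & B3 & B4 & B5 & B6).
  assert (PT1 : 0 < T1) by apply A4. assert (PT2 : 0 < T2) by apply A5.
  exists (join T1 g1 g2), (T1 + T2). split; [lra|]. split; [apply traj_filippov; auto|].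
  split; [rewrite B2, B3; auto|]. split.
  { exists T1. split; [lra|]. rewrite B2, B4. intros K. injection K as K. lra. }
  destruct A4 as (_ & _ & _ & G0 & GT & _ & Gr & Gc). destruct A5 as (_ & _ & _ & F0 & FT & _ & Fr & Fc).
  rewrite Rmin_left, Rmax_right in * by lra. rewrite Rmin_right, Rmax_left in * by lra.
  assert (Hon : forall b p, xl < fst p < xr -> H b (fst p) (snd p) = H b x1 0 -> snd p = eta b (fst p)).
  { intros b p Hp Hh. apply (ho_injective (HO b) (fst p)); auto.
    rewrite Hh. symmetry. apply Heta; auto. }
  intros p. split.
  - intros [Hp [b Hb]].
    assert (Hbo : b = o \/ b = negb o) by (destruct b, o; auto).
    destruct Hbo as [-> | ->].
    + destruct (Gc (fst p) Hp) as [t [Ht Et]]. exists t. split; [lra|].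
      rewrite join_l by lra. destruct (Gr t Ht) as (C1 & C2 & _).
      rewrite <- H12 in C2. rewrite (surjective_pairing (g1 t)), (surjective_pairing p).
      rewrite (Hon o (g1 t) C1 C2), Et, Hb. reflexivity.
    + destruct (Fc (fst p) Hp) as [t [Ht Et]]. exists (T1 + t). split; [lra|].
      rewrite join_r by (try (rewrite GT, F0; auto); lra). replace (T1 + t - T1) with t by ring.
      destruct (Fr t Ht) as (C1 & C2 & _).
      rewrite (surjective_pairing (g2 t)), (surjective_pairing p).
      rewrite (Hon (negb o) (g2 t) C1 C2), Et, Hb. reflexivity.
  - intros [t [Ht <-]]. destruct (Rle_dec t T1) as [K|K].
    + rewrite join_l by lra. destruct (Gr t ltac:(lra)) as (C1 & C2 & C3). rewrite <- H12 in C2.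
      split; [lra|]. exists o. apply Hon; auto.
    + rewrite join_r by (try (rewrite GT, F0; auto); lra). destruct (Fr (t - T1) ltac:(lra)) as (C1 & C2 & C3).
      split; [lra|]. exists (negb o). apply Hon; auto.
Qed.

(* Near the oval, trajectories reach the section near x1, where the return map is
   a contraction; gluing the successive turns gives a trajectory for all times. *)
Lemma infinite_trajectory : contracting ->
  exists e, 0 < e /\ forall p, Rabs (gauge p) < e ->
    exists g, g 0 = p /\ forall T, 0 < T -> filippov_trajectory S 0 T g.
Proof.
  intros Hcon. destruct ov_order as (O1 & O2 & O3 & _). assert (PM := Mx_pos).
  destruct (full_turn ((x2 - x1) / 4)) as (rho & d & Pd & R0 & Rd & Rt); [lra|].
  set (l := du o x1 / du o x2 * (du (negb o) x2 / du (negb o) x1)) in *.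
  assert (Hl : Rabs l < 1).
  { assert (P2 := du_abs_pos o x2 (or_intror eq_refl)). assert (P3 := du_abs_pos (negb o) x1 (or_introl eq_refl)).
    unfold l, Rdiv. rewrite !Rabs_mult, !Rabs_inv. unfold contracting in Hcon.
    set (a2 := Rabs (du o x2)) in *. set (b1 := Rabs (du (negb o) x1)) in *.
    apply Rmult_lt_reg_r with (a2 * b1); [apply Rmult_lt_0_compat; auto|].
    match goal with |- ?u < _ => replace u with (Rabs (du (negb o) x2) * Rabs (du o x1)) by (field; split; lra) end. lra. }
  (* The accuracy 1 - |l| gives a return map that does not increase the distance to x1, so it maps a
     small interval into itself and can be iterated forever. *)
  destruct (proj1 (is_derive_eps _ _ _) Rd (1 - Rabs l) ltac:(lra)) as [d' [Pd' D']].
  set (dd := Rmin d d').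
  assert (Pdd : 0 < dd) by (apply Rmin_pos; auto).
  assert (Hcontr : forall x, Rabs (x - x1) < dd -> Rabs (rho x - x1) < dd).
  { intros x Hx. specialize (D' x ltac:(pose proof (Rmin_r d d'); unfold dd in Hx; lra)). rewrite R0 in D'.
    replace (rho x - x1) with ((rho x - x1 - l * (x - x1)) + l * (x - x1)) by ring.
    apply Rle_lt_trans with (1 := Rabs_triang _ _). rewrite Rabs_mult. lra. }
  assert (Hturn : forall x, exists fT : R * (R -> R * R), Rabs (x - x1) < dd ->
     (x2 - x1) / (2 * Mx) <= fst fT /\ traj S (fst fT) (snd fT) /\ snd fT 0 = (x, 0) /\ snd fT (fst fT) = (rho x, 0)).
  { intros x. destruct (classic (Rabs (x - x1) < dd)) as [Hx|Hx]; [|exists (0, fun _ => (0, 0)); intros K; contradiction].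
    destruct (Rt x ltac:(pose proof (Rmin_l d d'); unfold dd in Hx; lra)) as (A1 & z & T1 & T2 & g1 & g2 & A2 & A3 & A4 & A5).
    destruct (arcs_concat _ _ _ _ _ _ _ _ _ _ A4 A5) as (B1 & B2 & B3 & _).
    assert (PT2 : 0 < T2) by apply A5.
    exists (T1 + T2, join T1 g1 g2). intros _. simpl. split; [lra|auto]. }
  destruct (functional_choice _ Hturn) as [F HF].
  destruct (half_map (negb o) x2 x1 dd) as (psi & d2 & Pd2 & P20 & P2d & P2); [right; auto|auto|].
  destruct (arc_from o x1 x2 d2) as (e1 & Pe1 & Q1); [left; auto|auto|].
  destruct (arc_from (negb o) x2 x1 dd) as (e2 & Pe2 & Q2); [right; auto|auto|].
  destruct (near_axis (Rmin dd d2)) as (e3 & Pe3 & Q3); [apply Rmin_pos; auto|].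
  exists (Rmin (Rmin e1 e2) e3). split; [repeat apply Rmin_pos; auto|]. intros [x y] Hp.
  assert (Hp1 : Rabs (gauge (x, y)) < e1) by rmin.
  assert (Hp2 : Rabs (gauge (x, y)) < e2) by rmin.
  assert (Hp3 : Rabs (gauge (x, y)) < e3) by rmin.
  clear Hp.
  assert (Hstart : exists z T g, Rabs (z - x1) < dd /\ 0 < T /\ (x2 - x1) / (2 * Mx) <= T /\
     traj S T g /\ g 0 = (x, y) /\ g T = (rho z, 0)).
  { assert (Hadd : forall z T g, Rabs (z - x1) < dd -> 0 <= T -> traj S T g -> g 0 = (x, y) -> g T = (z, 0) ->
       exists z T g, Rabs (z - x1) < dd /\ 0 < T /\ (x2 - x1) / (2 * Mx) <= T /\
         traj S T g /\ g 0 = (x, y) /\ g T = (rho z, 0)).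
    { intros z T g Hz HT Hg G0 GT. destruct (HF z Hz) as (F1 & F2 & F3 & F4).
      assert (Pt : 0 < (x2 - x1) / (2 * Mx)) by (apply Rdiv_lt_0_compat; lra).
      exists z, (T + fst (F z)), (join T g (snd (F z))).
      split; [auto|]. split; [lra|]. split; [lra|].
      assert (E0 : g T = snd (F z) 0) by (rewrite GT, F3; auto).
      split; [apply traj_concat; auto; lra|]. split; [rewrite join_l by lra; auto|].
      rewrite join_r by (auto; lra). rewrite <- F4. f_equal. ring. }
    assert (Hno : forall w, Rabs (w - x2) < d2 -> exists T g, 0 < T /\ traj S T g /\ g 0 = (w, 0) /\ g T = (psi w, 0) /\ Rabs (psi w - x1) < dd).
    { intros w Hw. destruct (P2 w Hw) as (A1 & T & g & _ & (A2 & _ & A3 & A4 & A5 & _)). exists T, g. auto. }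
    destruct (Req_dec y 0) as [->|Ny].
    - destruct (Q3 x 0 Hp3 ltac:(rewrite Rabs_R0; auto)) as [K|K].
      + destruct (HF x) as (F1 & F2 & F3 & F4); [apply Rlt_le_trans with (1 := K); apply Rmin_l|].
        assert (Pt : 0 < (x2 - x1) / (2 * Mx)) by (apply Rdiv_lt_0_compat; lra).
        exists x, (fst (F x)), (snd (F x)). split; [apply Rlt_le_trans with (1 := K); apply Rmin_l|].
        split; [lra|]. auto.
      + destruct (Hno x) as (T & g & A1 & A2 & A3 & A4 & A5); [apply Rlt_le_trans with (1 := K); apply Rmin_r|].
        apply (Hadd (psi x) T g); auto; lra.
    - assert (Hs : 0 < sgn o * y \/ 0 < sgn (negb o) * y).
      { rewrite sgn_negb. destruct (sgn_cases o) as [-> | ->]; destruct (Rdichotomy _ _ Ny); lra. }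
      destruct Hs as [Hs|Hs].
      + destruct (Q1 (x, y) Hp1 Hs) as (z & T & g & A1 & (A2 & _ & A3 & A4 & A5 & _)).
        destruct (Hno z A1) as (T' & g' & B1 & B2 & B3 & B4 & B5).
        assert (E0 : g T = g' 0) by (rewrite A5, B3; auto).
        apply (Hadd (psi z) (T + T') (join T g g')); auto; try lra.
        * apply traj_concat; auto; lra.
        * rewrite join_l by lra; auto.
        * rewrite join_r by (auto; lra). rewrite <- B4. f_equal. ring.
      + destruct (Q2 (x, y) Hp2 Hs) as (z & T & g & A1 & (A2 & _ & A3 & A4 & A5 & _)).
        apply (Hadd z T g); auto; lra. }
  destruct Hstart as (z0 & T0 & g0 & Z1 & Z2 & Z3 & Z4 & Z5 & Z6).
  set (z := fun n => Nat.iter n rho (rho z0)).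
  assert (Hz : forall n, Rabs (z n - x1) < dd).
  { induction n as [|n IH]; [apply (Hcontr z0 Z1)|]. apply (Hcontr (z n) IH). }
  destruct (traj_glue S (fun n => match n with 0%nat => g0 | Datatypes.S n => snd (F (z n)) end)
    (fun n => match n with 0%nat => T0 | Datatypes.S n => fst (F (z n)) end) ((x2 - x1) / (2 * Mx))) as (g & G0 & G).
  - apply Rdiv_lt_0_compat; lra.
  - intros [|n]; auto. apply (HF (z n) (Hz n)).
  - intros [|n]; auto. apply (HF (z n) (Hz n)).
  - intros [|n].
    + destruct (HF (z 0%nat) (Hz 0%nat)) as (_ & _ & F3 & _). rewrite F3. exact Z6.
    + destruct (HF (z n) (Hz n)) as (_ & _ & _ & F4).
      destruct (HF (z (Datatypes.S n)) (Hz (Datatypes.S n))) as (_ & _ & F3 & _). rewrite F3. exact F4.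
  - exists g. split; auto. rewrite G0. exact Z5.
Qed.

Lemma oval_stable : contracting -> asymptotically_stable S oval.
Proof.
  intros Hcon. destruct (lyapunov_exists Hcon) as (L & th & c & HL).
  destruct ov_order as (_ & _ & _ & _ & HC & _). split.
  - intros eps Heps. destruct (stable_first_part L th c HL eps Heps) as [e [Pe Q]].
    exists e. split; auto. intros T g HT Hg H0 t Ht. apply (Q T g HT Hg H0 t Ht).
  - destruct (infinite_trajectory Hcon) as [e1 [Pe1 Q1]].
    destruct (stable_first_part L th c HL 1 ltac:(lra)) as [e2 [Pe2 Q2]].
    set (e := Rmin e2 (e1 / (4 * (C + 2)))).
    assert (Pq : 0 < e1 / (4 * (C + 2))) by (apply Rdiv_lt_0_compat; lra).
    exists e. split; [apply Rmin_pos; auto|]. intros p Hp. split.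
    + apply Q1. apply Rle_lt_trans with (1 := near_gauge _ _ Hp).
      apply Rle_lt_trans with ((C + 2) * (2 * (e1 / (4 * (C + 2))))).
      * apply Rmult_le_compat_l; [lra|]. apply Rmult_le_compat_l; [lra|]. apply Rmin_r.
      * replace ((C + 2) * (2 * (e1 / (4 * (C + 2))))) with (e1 / 2) by (field; lra). lra.
    + intros g G0 Hg. apply (attracted L th c g HL Hg).
      intros t Ht. destruct (Q2 (t + 1) g) with (t := t) as [_ A]; auto; try lra.
      { apply Hg; lra. }
      rewrite G0. destruct Hp as [q [Hq Hb]]. exists q. split; auto.
      apply ball_le with e; auto. apply Rmin_l.
Qed.

Lemma oval_axis (x : R) : oval (x, 0) -> x = x1 \/ x = x2.
Proof.
  intros [Hx [b Hb]]. simpl in *. destruct (Heta b) as (_ & _ & _ & A & _).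
  destruct (Req_dec x x1) as [|N1]; auto. destruct (Req_dec x x2) as [|N2]; auto.
  exfalso. specialize (A x ltac:(lra)). rewrite <- Hb in A. lra.
Qed.

Lemma end_on_oval (xe : R) : xe = x1 \/ xe = x2 -> oval (xe, 0).
Proof.
  intros Hxe. destruct ov_order as (_ & O2 & _). split; simpl; [destruct Hxe; lra|].
  exists true. destruct (Heta true) as (E1 & E2 & _). destruct Hxe as [-> | ->]; auto.
Qed.

(* If q were not visited, the oval cut at q would carry an angular coordinate
   increasing along the trajectory, which then could not close up. *)
Lemma periodic_covers (th del e0 T : R) (g : R -> R * R) :
  tube th del e0 -> 0 < T -> traj S T g -> (forall t, 0 <= t <= T -> oval (g t)) -> g T = g 0 ->
  forall q, oval q -> exists t, 0 <= t <= T /\ g t = q.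
Proof.
  intros Htube HT Hg Hon Hper q Hq. destruct ov_order as (O1 & O2 & O3 & Hm & _).
  apply NNPP. intros Hno.
  assert (Hnq : forall t, 0 <= t <= T -> g t <> q) by (intros t Ht K; apply Hno; exists t; auto). clear Hno.
  assert (Hin : forall t, 0 <= t <= T -> Rabs (gauge (g t)) < th).
  { intros t Ht. rewrite (proj2 (gauge_zero (g t)) (Hon t Ht)), Rabs_R0. apply Htube. }
  destruct Hq as [Hq1 [b1 Hq2]]. set (xi := fst q) in *.
  assert (Eq : q = (xi, eta b1 xi)) by (rewrite (surjective_pairing q), Hq2; reflexivity).
  assert (Hends : exists xs xe, ends b1 xs xe).
  { destruct (Bool.bool_dec b1 o) as [->|N]; [exists x1, x2; left; auto|].
    exists x2, x1. right. destruct b1, o; auto; congruence. }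
  destruct Hends as (xs & xe & Hends). destruct (ends_dir b1 xs xe Hends) as (E1 & E2 & E3 & _).
  set (ell := x2 - x1) in *. set (d1 := dir b1) in *.
  (* The travelled distance since q, of total range 2 ell: on the arc of q the points ahead of q
     start the count and those not ahead receive 2 ell. The opposite arc continues the count from
     [xe], and the values agree at both ends. *)
  set (ang := fun (b : bool) (x : R) => if Bool.eqb b b1
     then d1 * (x - xi) + (if Rlt_dec 0 (d1 * (x - xi)) then 0 else 2 * ell)
     else d1 * (xe - xi) - d1 * (x - xe)).
  assert (A1 : forall x, ang b1 x = d1 * (x - xi) + (if Rlt_dec 0 (d1 * (x - xi)) then 0 else 2 * ell)).
  { intros x. unfold ang. rewrite Bool.eqb_reflx. reflexivity. }
  assert (A2 : forall x, ang (negb b1) x = d1 * (xe - xi) - d1 * (x - xe)).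
  { intros x. unfold ang. rewrite Bool.eqb_negb1. reflexivity. }
  set (X := fun t => fst (g t)). set (Y := fun t => snd (g t)).
  (* On the closed side of q, having the abscissa of q means being q. At an end of the oval both
     arcs have ordinate 0, so the opposite arc creates no exception. *)
  assert (Hvisit : forall t, 0 <= t <= T -> X t = xi -> 0 <= sgn b1 * Y t -> False).
  { intros t Ht HX HY. apply (Hnq t Ht). rewrite Eq, (surjective_pairing (g t)). fold (X t) (Y t).
    rewrite HX. f_equal. destruct (Hon t Ht) as [Hx [b Hb]]. fold (X t) (Y t) in Hx, Hb. rewrite HX in *.
    assert (N1 := eta_nonneg b xi Hx). assert (N2 := eta_nonneg b1 xi Hx).
    destruct (Bool.bool_dec b b1) as [->|N]; [auto|].
    assert (Ebn : b = negb b1) by (destruct b, b1; auto; congruence). rewrite Ebn, sgn_negb in N1. rewrite Hb, Ebn in *.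
    assert (Z : eta (negb b1) xi = 0) by (destruct (sgn_cases b1) as [K|K]; rewrite K in *; lra).
    assert (Hax : oval (xi, 0)) by (split; [auto|exists (negb b1); simpl; auto]).
    rewrite Z. destruct (Heta b1) as (E1' & E2' & _). destruct (oval_axis xi Hax) as [-> | ->]; auto. }
  set (Psi := fun b t => m * t - ang b (X t)).
  assert (Hfin := piecewise_decreasing th del e0 T g Htube ltac:(lra) Hg Hin Psi).
  assert (Hax : forall t, 0 <= t <= T -> Y t = 0 -> X t = x1 \/ X t = x2).
  { intros t Ht HY. apply oval_axis. rewrite <- HY. unfold X, Y. rewrite <- surjective_pairing. auto. }
  assert (Hdl : 2 * del < ell) by apply Htube.
  assert (Hstep : Psi (upper (Y T)) T <= Psi (upper (Y 0)) 0).
  { apply Hfin.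
    - intros b s t Hs Hst HtT Hside.
      destruct (side_run th del e0 T g Htube Hg Hin b s t Hs Hst HtT Hside) as [_ R2].
      fold (X t) (X s) in R2. unfold Psi.
      assert (Hmp : 0 <= m * (t - s)) by (apply Rmult_le_pos; lra).
      destruct (Bool.bool_dec b b1) as [->|N].
      + rewrite !A1. fold d1 in R2.
        assert (Hcase : 0 < d1 * (X t - xi) -> 0 < d1 * (X s - xi)).
        { intros Kt. apply Rnot_le_lt. intros Ks.
          destruct Hst as [Hst|E0]; [|rewrite E0 in Ks; lra].
          destruct (ivt X s t xi) as [u [Hu Xu]].
          - lra.
          - intros w _. apply X_continuous with (1 := Hg).
          - unfold d1 in *. destruct (dir_cases b1) as [K|K]; rewrite K in *;
              unfold Rmin, Rmax; destruct (Rle_dec (X s) (X t)); lra.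
          - apply (Hvisit u ltac:(lra) Xu).
            destruct (Req_dec u s) as [->|Nu].
            + apply Rnot_lt_le. intros Kn.
              destruct (proj1 (continuous_eps _ _) (Y_continuous T g Hg s) (- (sgn b1 * Y s))) as [dd [Pdd Qd]]; [lra|].
              set (w := Rmin (s + dd / 2) ((s + t) / 2)).
              assert (Hw : s < w < t /\ w < s + dd) by (unfold w, Rmin; destruct Rle_dec; lra).
              specialize (Qd w ltac:(apply Rabs_def1; lra)). specialize (Hside w ltac:(lra)).
              fold (Y w) (Y s) in Qd. fold (Y w) in Hside.
              rewrite <- (abs_sgn b1), Rmult_minus_distr_l in Qd. apply Rabs_def2 in Qd. lra.
            + destruct (Req_dec u t) as [->|Nu2]; [rewrite Xu, Rminus_diag, Rmult_0_r in Kt; lra|].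
              apply Rlt_le, Hside; lra. }
        destruct (Rlt_dec 0 (d1 * (X t - xi))) as [Kt|Kt]; destruct (Rlt_dec 0 (d1 * (X s - xi))) as [Ks|Ks]; try lra.
      + assert (Ebn : b = negb b1) by (destruct b, b1; auto; congruence). rewrite Ebn in *. rewrite !A2.
        rewrite dir_negb in R2. fold d1 in R2. lra.
    - intros t Ht HY HX. fold (X t) in HX. change (Y t = 0) in HY. apply Rabs_def2 in HX.
      assert (Xt : X t = x2) by (destruct (Hax t Ht HY); unfold ell in *; lra).
      unfold Psi. rewrite Xt. destruct Hends as [(Eb & -> & ->)|(Eb & -> & ->)].
      + assert (Ed : d1 = 1) by (unfold d1; rewrite Eb; apply dir_o). rewrite <- Eb, A1, A2, Ed.
        destruct (Rlt_dec 0 (1 * (x2 - xi))) as [K|K]; [lra|]. exfalso.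
        apply (Hvisit t Ht); [lra|]. rewrite HY. lra.
      + assert (Eo : o = negb b1) by (rewrite Eb, negb_involutive; auto).
        assert (Ed : d1 = -1) by (unfold d1; rewrite Eb; apply dir_no). rewrite <- Eb, Eo, A1, A2, Ed.
        unfold ell in *. destruct (Rlt_dec 0 (-1 * (x2 - xi))) as [K|K]; lra.
    - intros t Ht HY HX. fold (X t) in HX. change (Y t = 0) in HY. apply Rabs_def2 in HX.
      assert (Xt : X t = x1) by (destruct (Hax t Ht HY); unfold ell in *; lra).
      unfold Psi. rewrite Xt. destruct Hends as [(Eb & -> & ->)|(Eb & -> & ->)].
      + assert (Ed : d1 = 1) by (unfold d1; rewrite Eb; apply dir_o). rewrite <- Eb, A1, A2, Ed.
        unfold ell in *. destruct (Rlt_dec 0 (1 * (x1 - xi))) as [K|K]; lra.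
      + assert (Eo : o = negb b1) by (rewrite Eb, negb_involutive; auto).
        assert (Ed : d1 = -1) by (unfold d1; rewrite Eb; apply dir_no). rewrite <- Eb, Eo, A1, A2, Ed.
        destruct (Rlt_dec 0 (-1 * (x1 - xi))) as [K|K]; [lra|]. exfalso.
        apply (Hvisit t Ht); [lra|]. rewrite HY. lra. }
  (* The angle grows by at least m T over a period, yet it takes the same value at both ends of a
     closed orbit. *)
  unfold Psi, X, Y in Hstep. rewrite Hper in Hstep.
  assert (0 < m * T) by (apply Rmult_lt_0_compat; auto). lra.
Qed.

Lemma oval_crossing (x : R) : oval (x, 0) -> crossing_point S x.
Proof.
  intros Hx. destruct ov_order as (O1 & O2 & O3 & _ & _ & Hry & Hc0).
  destruct (oval_axis x Hx) as [-> | ->]; (split; [apply sys_dom_box; [lra|rewrite Rabs_R0; lra]|]);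
    assert (A := fun b => ho_sign_Y (HO b)).
  - destruct (A true x1) as [B1 _]. destruct (A false x1) as [B2 _]. simpl in B1, B2.
    specialize (Hc0 true) as C1. specialize (Hc0 false) as C2. specialize (B1 ltac:(lra)). specialize (B2 ltac:(lra)).
    assert (P := Rmult_lt_0_compat _ _ B1 B2).
    replace (sgn o * vY (Zp S) x1 0 * (sgn o * vY (Zm S) x1 0)) with (sgn o * sgn o * (vY (Zp S) x1 0 * vY (Zm S) x1 0)) in P by ring.
    rewrite sgn_sqr in P. lra.
  - destruct (A true x2) as [_ B1]. destruct (A false x2) as [_ B2]. simpl in B1, B2.
    specialize (Hc0 true) as C1. specialize (Hc0 false) as C2. specialize (B1 ltac:(lra)). specialize (B2 ltac:(lra)).
    assert (P := Rmult_lt_0_compat _ _ (Ropp_0_gt_lt_contravar _ B1) (Ropp_0_gt_lt_contravar _ B2)).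
    replace (- (sgn o * vY (Zp S) x2 0) * - (sgn o * vY (Zm S) x2 0)) with (sgn o * sgn o * (vY (Zp S) x2 0 * vY (Zm S) x2 0)) in P by ring.
    rewrite sgn_sqr in P. lra.
Qed.

(** On a nearby periodic orbit L returns to its value after having been multiplied by at most exp(-
    c T), so it vanishes and the orbit lies on the oval; [periodic_covers] gives the converse
    inclusion. *)
Lemma oval_limit_cycle : contracting -> limit_cycle S oval.
Proof.
  intros Hcon. destruct (lyapunov_exists Hcon) as (L & th & c & HL).
  destruct ov_order as (_ & _ & _ & _ & HC & _).
  split; [apply oval_periodic|]. split; [exists x1; apply end_on_oval; auto|].
  split; [apply oval_crossing|].
  destruct HL as (Pc & (del & e0 & Htube) & HL0 & HL1 & HL2 & HL3).
  assert (Pth : 0 < th) by apply Htube.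
  exists (th / (4 * (C + 2))). split; [apply Rdiv_lt_0_compat; lra|].
  intros G' (g & T & HT & Hg & Hper & _ & HG') Hnear.
  destruct (filippov_traj S T g ltac:(lra) Hg) as [f [Hf Ef]].
  assert (Hin : forall t, 0 <= t <= T -> Rabs (gauge (f t)) < th).
  { intros t Ht. assert (A : near_set oval (th / (4 * (C + 2))) (g t)) by (apply Hnear, HG'; exists t; auto).
    rewrite Ef by auto. apply Rle_lt_trans with (1 := near_gauge _ _ A).
    replace ((C + 2) * (2 * (th / (4 * (C + 2))))) with (th / 2) by (field; lra). lra. }
  assert (Hf0 : f T = f 0) by (rewrite !Ef by lra; auto).
  assert (HL00 : L (f 0) = 0).
  { assert (A := HL1 T f ltac:(lra) Hf Hin). rewrite Hf0 in A. specialize (HL0 (f 0)).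
    assert (B : 1 < exp (c * T)).
    { rewrite <- exp_0. apply exp_increasing. apply Rmult_lt_0_compat; auto. }
    destruct HL0 as [K|K]; auto. exfalso.
    assert (L (f 0) * 1 < L (f 0) * exp (c * T)) by (apply Rmult_lt_compat_l; auto). lra. }
  assert (Hon : forall t, 0 <= t <= T -> oval (f t)).
  { intros t Ht. apply gauge_zero.
    assert (A := HL1 t f ltac:(lra) (traj_restrict S T t f ltac:(lra) Hf) ltac:(intros s Hs; apply Hin; lra)).
    rewrite HL00 in A.
    assert (B : L (f t) = 0).
    { specialize (HL0 (f t)). destruct HL0 as [K|K]; auto. exfalso.
      assert (0 < L (f t) * exp (c * t)) by (apply Rmult_lt_0_compat; [auto|apply exp_pos]). lra. }
    apply Rabs_eq_0. apply Rle_antisym; [|apply Rabs_pos]. apply Rnot_lt_le. intros K.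
    destruct (HL2 _ K) as [d [Pd Qd]]. specialize (Qd (f t) (Hin t Ht)). rewrite B in Qd. specialize (Qd Pd). lra. }
  intros p. split.
  - intros Hp. apply HG' in Hp. destruct Hp as [t [Ht <-]]. rewrite <- Ef by auto. auto.
  - intros Hp. destruct (periodic_covers th del e0 T f Htube HT Hf Hon Hf0 p Hp) as [t [Ht Et]].
    apply HG'. exists t. split; auto. rewrite <- Ef by auto. exact Et.
Qed.

(** * Enclosed points and sliding segments *)

Lemma norm_fst_le (p : R * R) : Rabs (fst p) <= norm p.
Proof.
  destruct p as [x y]. destruct (norm_prod (K := R_AbsRing) (U := R_NormedModule) (V := R_NormedModule) x y) as [A _].
  apply Rle_trans with (2 := A). apply Rmax_l.
Qed.

(** A path avoiding the oval cannot change the sign of the gauge, and the region where the gauge is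
    positive is bounded. *)
Lemma enclosed_inside (p : R * R) : 0 < gauge p -> encloses oval p.
Proof.
  intros Hp. destruct ov_order as (O1 & O2 & O3 & _ & _ & Hry & _). split.
  - intros K. apply gauge_zero in K. lra.
  - exists (2 * (Rabs x1 + Rabs x2 + ry)). intros c Hc Hc0 Hn.
    assert (Hcc : forall t, continuous (fun t => c (clamp 0 1 t)) t).
    { intros t. apply (filterlim_comp _ _ _ (clamp 0 1) c (locally t) (within (fun u => 0 <= u <= 1) (locally (clamp 0 1 t)))).
      - intros P HP. unfold within in HP.
        assert (A := clamp_continuous 0 1 t ltac:(lra) _ HP). unfold filtermap in *.
        revert A. apply filter_imp. intros x Hx. apply Hx. apply clamp_in; lra.
      - apply Hc, clamp_in; lra. }
    assert (H1 : 0 < gauge (c 1)).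
    { apply Rnot_le_lt. intros K.
      destruct (ivt (fun t => gauge (c (clamp 0 1 t))) 0 1 0) as [t [Ht Et]].
      - lra.
      - intros t _. apply gauge_continuous. apply Hcc.
      - rewrite !clamp_id by lra. rewrite Hc0. rewrite Rmin_right, Rmax_left; lra.
      - rewrite clamp_id in Et by lra. apply (Hn t Ht). apply gauge_zero. exact Et. }
    destruct (c 1) as [x y].
    assert (Hx : x1 <= x <= x2).
    { destruct (Rle_dec x1 x); [destruct (Rle_dec x x2); auto|]; exfalso.
      - rewrite (gauge_outside x y x2) in H1 by lra. pose proof (Rabs_pos y). pose proof (Rabs_pos (x - x2)). lra.
      - rewrite (gauge_outside x y x1) in H1 by lra. pose proof (Rabs_pos y). pose proof (Rabs_pos (x - x1)). lra. }
    rewrite gauge_inside in H1 by auto.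
    assert (Hy : Rabs y <= ry).
    { destruct (Heta true) as (_ & _ & _ & _ & B1). destruct (Heta false) as (_ & _ & _ & _ & B2).
      specialize (B1 x Hx). specialize (B2 x Hx). apply Rabs_def2 in B1. apply Rabs_def2 in B2.
      apply Rabs_le. unfold Rmin in H1; destruct Rle_dec; lra. }
    destruct (norm_prod (K := R_AbsRing) (U := R_NormedModule) (V := R_NormedModule) x y) as [_ A].
    apply Rle_trans with (1 := A).
    assert (Hs : sqrt 2 <= 2).
    { rewrite <- (sqrt_square 2) at 2 by lra. apply sqrt_le_1; lra. }
    assert (Hmx : Rmax (norm x) (norm y) <= Rabs x1 + Rabs x2 + ry).
    { pose proof (Rabs_pos x1). pose proof (Rabs_pos x2). apply Rmax_lub.
      - change (Rabs x <= Rabs x1 + Rabs x2 + ry). unfold Rabs. repeat destruct Rcase_abs; lra.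
      - change (Rabs y <= Rabs x1 + Rabs x2 + ry). lra. }
    apply Rmult_le_compat; auto; [apply sqrt_pos|]. apply Rle_trans with (2 := Rmax_l _ _). apply norm_ge_0.
Qed.

(** A point of the axis outside [x1, x2] escapes to infinity along a horizontal ray, as the oval
    lies over [x1, x2]. *)
Lemma enclosed_axis (x : R) : encloses oval (x, 0) -> x1 < x < x2.
Proof.
  destruct ov_order as (O1 & O2 & O3 & _). intros [Hn [M HM]].
  assert (Hray : forall s, s = 1 \/ s = -1 -> (forall r, 0 <= r -> ~ oval (x + s * r, 0)) -> False).
  { intros s Hs Hr. set (k := Rabs M + Rabs x + 1).
    assert (Hk : 0 < k) by (unfold k; pose proof (Rabs_pos M); pose proof (Rabs_pos x); lra).
    assert (K := HM (fun t => (x + s * (t * k), 0))). simpl in K.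
    assert (C1 : norm (x + s * (1 * k), 0) <= M).
    { apply K.
      - intros t _.
        assert (Hcont : continuous (fun t => (x + s * (t * k), 0)) t).
        { apply continuous_prod_iff. simpl. split; [|apply continuous_const].
          apply (continuous_plus (V := R_NormedModule) (fun _ => x)); [apply continuous_const|].
          apply (continuous_mult (K := R_AbsRing) (fun _ => s)); [apply continuous_const|].
          apply (continuous_mult (K := R_AbsRing) (fun t => t)); [apply continuous_id|apply continuous_const]. }
        intros P HP. generalize (Hcont P HP). unfold filtermap, within. apply filter_imp. auto.
      - f_equal. ring.
      - intros t Ht. apply Hr. apply Rmult_le_pos; lra. }
    assert (C2 := norm_fst_le (x + s * (1 * k), 0)). simpl in C2.
    assert (C3 : k - Rabs x <= Rabs (x + s * (1 * k))).
    { unfold Rabs. destruct Hs as [-> | ->]; repeat destruct Rcase_abs; lra. }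
    pose proof (Rle_abs M). unfold k in *. lra. }
  assert (Hno : x <> x1 /\ x <> x2) by (split; intros ->; apply Hn, end_on_oval; auto).
  destruct (Rlt_le_dec x1 x) as [L1|L1]; [destruct (Rlt_le_dec x x2) as [L2|L2]; auto|]; exfalso.
  - apply (Hray 1); auto. intros r Hr [[_ K] _]. simpl in K. lra.
  - apply (Hray (-1)); auto. intros r Hr [[K _] _]. simpl in K. lra.
Qed.

(** The segment joins the two tangencies. The system may have other sliding segments elsewhere;
    enclosed ones lie between x1 and x2, where every point strictly outside the tangencies is a
    crossing point, and maximality then gives uniqueness. *)
Lemma oval_single_sliding_segment : c0 true <> c0 false -> surrounds_single_sliding_segment S oval.
Proof.
  intros Hne. destruct ov_order as (O1 & O2 & O3 & _ & _ & Hry & Hc0).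
  assert (C1 := Hc0 true). assert (C2 := Hc0 false).
  set (lo := Rmin (c0 true) (c0 false)). set (hi := Rmax (c0 true) (c0 false)).
  assert (Hlh : x1 < lo /\ lo < hi /\ hi < x2).
  { unfold lo, hi, Rmin, Rmax. destruct (Rle_dec (c0 true) (c0 false)); lra. }
  assert (A := fun b => ho_sign_Y (HO b)).
  assert (Hdom : forall x, xl < x < xr -> sys_dom S (x, 0)) by (intros x Hx; apply sys_dom_box; [auto|rewrite Rabs_R0; auto]).
  assert (Hprod : forall u v, u * v = sgn o * u * (sgn o * v)).
  { intros u v. replace (sgn o * u * (sgn o * v)) with (sgn o * sgn o * (u * v)) by ring. rewrite sgn_sqr. ring. }
  assert (Hsl : forall x, lo < x < hi -> sliding_point S x).
  { intros x Hx. split; [apply Hdom; lra|]. rewrite Hprod.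
    destruct (A true x) as [T1 T2]. destruct (A false x) as [F1 F2]. simpl in T1, T2, F1, F2.
    unfold lo, hi, Rmin, Rmax in Hx. destruct (Rle_dec (c0 true) (c0 false)) as [L|L].
    - specialize (T2 ltac:(lra)). specialize (F1 ltac:(lra)).
      assert (P := Rmult_lt_0_compat _ _ (Ropp_0_gt_lt_contravar _ T2) F1). lra.
    - specialize (T1 ltac:(lra)). specialize (F2 ltac:(lra)).
      assert (P := Rmult_lt_0_compat _ _ T1 (Ropp_0_gt_lt_contravar _ F2)). lra. }
  assert (Hns : forall x, xl < x < lo \/ hi < x < xr -> ~ sliding_point S x).
  { intros x Hx [_ K]. rewrite Hprod in K.
    destruct (A true x) as [T1 T2]. destruct (A false x) as [F1 F2]. simpl in T1, T2, F1, F2.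
    assert (lo <= c0 true /\ lo <= c0 false) by (split; [apply Rmin_l|apply Rmin_r]).
    assert (c0 true <= hi /\ c0 false <= hi) by (split; [apply Rmax_l|apply Rmax_r]).
    destruct Hx as [Hx|Hx].
    - specialize (T1 ltac:(lra)). specialize (F1 ltac:(lra)). assert (P := Rmult_lt_0_compat _ _ T1 F1). lra.
    - specialize (T2 ltac:(lra)). specialize (F2 ltac:(lra)).
      assert (P := Rmult_lt_0_compat _ _ (Ropp_0_gt_lt_contravar _ T2) (Ropp_0_gt_lt_contravar _ F2)). lra. }
  exists lo, hi. split; [split|].
  - split; [lra|]. split; [auto|]. intros c' d' Hc Hd Hs. split.
    + destruct Hc as [Hc|]; auto. exfalso. set (x := Rmax ((c' + lo) / 2) ((x1 + lo) / 2)).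
      assert (Hx : c' < x < lo /\ x1 < x) by (unfold x, Rmax; destruct Rle_dec; lra).
      apply (Hns x); [lra|]. apply Hs. lra.
    + destruct Hd as [Hd|]; auto. exfalso. set (x := Rmin ((d' + hi) / 2) ((x2 + hi) / 2)).
      assert (Hx : hi < x < d' /\ x < x2) by (unfold x, Rmin; destruct Rle_dec; lra).
      apply (Hns x); [lra|]. apply Hs. lra.
  - intros x Hx. apply enclosed_inside. rewrite gauge_inside by lra.
    destruct (Heta true) as (_ & _ & _ & P1 & _). destruct (Heta false) as (_ & _ & _ & P2 & _).
    specialize (P1 x ltac:(lra)). specialize (P2 x ltac:(lra)). simpl in P1, P2.
    apply Rmin_glb_lt; lra.
  - intros c' d' (Hcd & Hs & Hmax) Hsur.
    assert (Hsub : forall x, c' < x < d' -> lo <= x <= hi).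
    { intros x Hx. assert (Hi := enclosed_axis x (Hsur x Hx)). specialize (Hs x Hx).
      split; apply Rnot_lt_le; intros K; apply (Hns x); auto; lra. }
    assert (Hc : lo <= c').
    { apply Rnot_lt_le. intros K. set (x := Rmin ((c' + lo) / 2) ((c' + d') / 2)).
      assert (Hx : c' < x < d' /\ x < lo) by (unfold x, Rmin; destruct Rle_dec; lra).
      specialize (Hsub x ltac:(lra)). lra. }
    assert (Hd : d' <= hi).
    { apply Rnot_lt_le. intros K. set (x := Rmax ((d' + hi) / 2) ((c' + d') / 2)).
      assert (Hx : c' < x < d' /\ hi < x) by (unfold x, Rmax; destruct Rle_dec; lra).
      specialize (Hsub x ltac:(lra)). lra. }
    destruct (Hmax lo hi Hc Hd Hsl). auto.
Qed.

Lemma oval_in_box (p : R * R) : oval p -> x1 <= fst p <= x2 /\ Rabs (snd p) < ry / 4.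
Proof. intros [Hx [b Hb]]. split; auto. rewrite Hb. apply Heta; auto. Qed.

End Oval.

(** * Time reversal *)

Lemma slope_reverse (W : vector_field) : slope (reverse_field W) = slope W.
Proof.
  apply functional_extensionality. intros x. apply functional_extensionality. intros y.
  unfold slope; simpl. rewrite Rinv_opp. ring.
Qed.

(** The slope, hence the first integral and the oval, are unchanged; only the orientation flips. So
    an expanding oval is the same set, contracting for the reversed system. *)
Lemma half_oval_reverse (W : vector_field) (b o : bool) (xl x1 c0 x2 xr ry m Mx C : R)
    (H : R -> R -> R) (E : R -> R) :
  half_oval W b o xl x1 c0 x2 xr ry m Mx C H E ->
  half_oval (reverse_field W) b (negb o) xl x1 c0 x2 xr ry m Mx C H E.
Proof.
  intros (A1 & A2 & A3 & A4 & A5 & A6 & A7 & A8 & A9 & A10 & A11 & A12).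
  unfold half_oval. rewrite slope_reverse, sgn_negb. simpl.
  repeat (split; [solve [auto]|]). split; [|split; [|auto]].
  - intros x y Hx Hy. destruct (A7 x y Hx Hy) as [B1 B2]. split; auto.
    replace (sgn b * - sgn o * - vX W x y) with (sgn b * sgn o * vX W x y) by ring. exact B2.
  - intros x y x' y' Hx Hx' Hy Hy'. destruct (A8 x y x' y' Hx Hx' Hy Hy') as [B1 B2].
    replace (- vX W x y - - vX W x' y') with (- (vX W x y - vX W x' y')) by ring.
    replace (- vY W x y - - vY W x' y') with (- (vY W x y - vY W x' y')) by ring.
    rewrite !Rabs_Ropp. auto.
Qed.

Lemma reverse_field_involutive (W : vector_field) : reverse_field (reverse_field W) = W.
Proof.
  destruct W as [D X Y]. unfold reverse_field; simpl.
  replace (fun x y : R => - - X x y) with X by (do 2 (apply functional_extensionality; intro); ring).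
  replace (fun x y : R => - - Y x y) with Y by (do 2 (apply functional_extensionality; intro); ring).
  reflexivity.
Qed.

Lemma reverse_system_involutive (S : filippov_system) : reverse_system (reverse_system S) = S.
Proof. destruct S as [P M]. unfold reverse_system; simpl. rewrite !reverse_field_involutive. reflexivity. Qed.

Lemma velocity_reverse (S : filippov_system) (p v : R * R) :
  filippov_velocity S p v -> filippov_velocity (reverse_system S) p (opp v).
Proof.
  intros [[Hp ->]|[[Hp ->]|[Hp [s [Hs ->]]]]]; [left|right; left|right; right]; split; auto.
  exists s. split; auto.
  unfold veval, opp, plus, scal; simpl. unfold prod_opp, prod_plus, prod_scal; simpl.
  unfold opp, plus, scal; simpl. unfold mult; simpl. f_equal; ring.
Qed.

Lemma traj_reverse (S : filippov_system) (T : R) (g : R -> R * R) :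
  traj S T g -> traj (reverse_system S) T (fun t => g (T - t)).
Proof.
  intros [H1 [H2 [L H3]]]. split; [|split].
  - intros t. apply (continuous_comp (fun t => T - t) g); [|apply H1].
    apply (continuous_minus (V := R_NormedModule) (fun _ => T)); [apply continuous_const|apply continuous_id].
  - intros t Ht. destruct (H2 (T - t) ltac:(lra)) as [A B]. split; auto.
  - exists (map (fun t => T - t) L). intros t Ht Hn.
    destruct (H3 (T - t)) as [v [Hv Hd]]; [lra| |].
    { intros K. apply Hn. apply in_map_iff. exists (T - t). split; [ring|auto]. }
    exists (opp v). split; [apply velocity_reverse; auto|].
    assert (D : is_derive (fun t => T - t) t (-1)) by (auto_derive; auto; ring).
    assert (E := is_derive_comp g (fun t => T - t) t v (-1) Hd D).
    replace (opp v) with (scal (-1) v : R * R); [exact E|].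
    destruct v as [v1 v2]. unfold scal, opp; simpl. unfold prod_scal, prod_opp, scal, opp; simpl.
    unfold mult; simpl. f_equal; ring.
Qed.

Lemma periodic_orbit_reverse (S : filippov_system) (G : R * R -> Prop) :
  periodic_orbit S G -> periodic_orbit (reverse_system S) G.
Proof.
  intros (g & T & HT & Hg & Hper & (t0 & Ht0 & Hne) & HG).
  destruct (filippov_traj S T g ltac:(lra) Hg) as [f [Hf Ef]].
  exists (fun t => f (T - t)), T. split; [auto|]. split; [apply traj_filippov, traj_reverse; auto|].
  split; [rewrite Rminus_0_r, Rminus_diag, !Ef by lra; auto|]. split.
  - exists (T - t0). split; [lra|]. replace (T - (T - t0)) with t0 by ring.
    rewrite Rminus_0_r, !Ef by lra. rewrite <- Hper. exact Hne.
  - intros p. rewrite HG. split; intros [t [Ht Et]]; exists (T - t); (split; [lra|]).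
    + replace (T - (T - t)) with t by ring. rewrite Ef by lra. exact Et.
    + rewrite <- Ef by lra. exact Et.
Qed.

Lemma limit_cycle_reverse (S : filippov_system) (G : R * R -> Prop) :
  limit_cycle (reverse_system S) G -> limit_cycle S G.
Proof.
  intros (A1 & A2 & A3 & eps & Peps & A4). split; [|split; [auto|split]].
  - rewrite <- (reverse_system_involutive S). apply periodic_orbit_reverse; auto.
  - intros x Hx. destruct (A3 x Hx) as [B1 B2]. split; [exact B1|]. simpl in B2. lra.
  - exists eps. split; auto. intros G' HG'. apply A4. apply periodic_orbit_reverse; auto.
Qed.

Definition end_rate (S : filippov_system) (E : bool -> R -> R) (b : bool) (x : R) : R :=
  Rabs (- slope (half_field S b) x 0 * E b x).

(** D < 0 is contraction and D > 0 is contraction in reversed time, so isolation is proved in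
    whichever direction of time contracts; periodic orbits are the same for both. *)
Lemma oval_cycle (S : filippov_system) (o : bool) (xl x1 x2 xr ry m Mx C : R)
    (c0 : bool -> R) (H : bool -> R -> R -> R) (E : bool -> R -> R) :
  (forall b, half_oval (half_field S b) b o xl x1 (c0 b) x2 xr ry m Mx C (H b) (E b)) ->
  c0 true <> c0 false ->
  let rate := end_rate S E in
  let D := rate (negb o) x2 * rate o x1 - rate o x2 * rate (negb o) x1 in
  D <> 0 ->
  exists G, G (x1, 0) /\ (forall p, G p -> x1 <= fst p <= x2 /\ Rabs (snd p) < ry / 4) /\
    limit_cycle S G /\ hyperbolic S G /\ surrounds_single_sliding_segment S G /\
    (D < 0 -> asymptotically_stable S G) /\ (0 < D -> repelling S G).
Proof.
  intros HO Hc rate D HD.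
  destruct (functional_choice _ (fun b => ho_eta (HO b))) as [eta Heta].
  assert (HO' : forall b, half_oval (half_field (reverse_system S) b) b (negb o) xl x1 (c0 b) x2 xr ry m Mx C (H b) (E b)).
  { intros b. specialize (HO b). apply half_oval_reverse in HO. destruct b; exact HO. }
  assert (Hrate : forall b x, - slope (half_field (reverse_system S) b) x 0 * E b x = - slope (half_field S b) x 0 * E b x).
  { intros b x. replace (half_field (reverse_system S) b) with (reverse_field (half_field S b)) by (destruct b; reflexivity).
    rewrite slope_reverse. reflexivity. }
  exists (oval x1 x2 eta).
  split; [apply (end_on_oval S o xl x1 x2 xr ry m Mx C c0 H E eta HO Heta); auto|].
  split; [apply (oval_in_box xl x1 x2 xr ry C H eta Heta)|].
  assert (Hstab : D < 0 -> contracting S o x1 x2 E).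
  { intros K. unfold contracting. unfold D, rate, end_rate in K. lra. }
  assert (Hunst : 0 < D -> contracting (reverse_system S) (negb o) x1 x2 E).
  { intros K. unfold contracting. rewrite negb_involutive, !Hrate. unfold D, rate, end_rate in K. lra. }
  split; [|split; [|split; [|split]]].
  - destruct (Rdichotomy _ _ HD) as [K|K].
    + apply (oval_limit_cycle S o xl x1 x2 xr ry m Mx C c0 H E eta HO Heta). auto.
    + apply limit_cycle_reverse.
      apply (oval_limit_cycle (reverse_system S) (negb o) xl x1 x2 xr ry m Mx C c0 H E eta HO' Heta). auto.
  - apply (oval_hyperbolic S o xl x1 x2 xr ry m Mx C c0 H E eta HO Heta).
    intros K. apply HD. unfold D, rate, end_rate. lra.
  - apply (oval_single_sliding_segment S o xl x1 x2 xr ry m Mx C c0 H E eta HO Heta Hc).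
  - intros K. apply (oval_stable S o xl x1 x2 xr ry m Mx C c0 H E eta HO Heta). auto.
  - intros K. apply (oval_stable (reverse_system S) (negb o) xl x1 x2 xr ry m Mx C c0 H E eta HO' Heta). auto.
Qed.

(** * Unfolding of a tangency *)

Lemma bound_nonneg (a : nat -> R) (rho M : R) : power_series_bound a rho M -> 0 <= M.
Proof. intros H. specialize (H 0%nat). simpl in H. pose proof (Rabs_pos (a 0%nat)). lra. Qed.

Lemma bound_radius (a : nat -> R) (rho M x : R) :
  power_series_bound a rho M -> Rabs x < rho -> Rbar_lt (Rabs x) (CV_radius a).
Proof.
  intros H Hx. apply Rbar_lt_le_trans with rho; [exact Hx|].
  apply (CV_radius_bounded a). exists M. intros n. pose proof (Rabs_pos x).
  rewrite Rabs_mult, (Rabs_right (rho ^ n)) by (apply Rle_ge, pow_le; lra). apply H.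
Qed.

Lemma bound_ex_pseries (a : nat -> R) (rho M x : R) :
  power_series_bound a rho M -> Rabs x < rho -> ex_pseries a x.
Proof. intros H Hx. apply CV_radius_inside, (bound_radius a rho M); auto. Qed.

Lemma bound_is_derive (a : nat -> R) (rho M x : R) :
  power_series_bound a rho M -> Rabs x < rho -> is_derive (PSeries a) x (PSeries (PS_derive a) x).
Proof. intros H Hx. apply is_derive_PSeries, (bound_radius a rho M); auto. Qed.

Lemma half_pow_le (x rho : R) (n : nat) : Rabs x <= rho / 2 -> Rabs (x ^ n) <= rho ^ n * (1 / 2) ^ n.
Proof.
  intros H. rewrite <- Rpow_mult_distr. replace (rho * (1 / 2)) with (rho / 2) by lra. apply pow_abs_le; auto.
Qed.

Lemma bound_PSeries (a : nat -> R) (rho M x : R) :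
  power_series_bound a rho M -> Rabs x <= rho / 2 -> Rabs (PSeries a x) <= 2 * M.
Proof.
  intros H Hx. apply series_geom_bound. intros n. rewrite Rabs_mult.
  apply Rle_trans with (Rabs (a n) * (rho ^ n * (1 / 2) ^ n)).
  - apply Rmult_le_compat_l; [apply Rabs_pos|apply half_pow_le; auto].
  - rewrite <- Rmult_assoc. apply Rmult_le_compat_r; [apply pow_le; lra|apply H].
Qed.

Lemma succ_le_pow2 (n : nat) : INR (S n) <= 2 ^ n.
Proof.
  induction n as [|n IH]; [simpl; lra|]. rewrite S_INR. change (2 ^ S n) with (2 * 2 ^ n).
  assert (1 <= 2 ^ n) by (apply pow_R1_Rle; lra). lra.
Qed.

Lemma bound_derive (a : nat -> R) (rho M : R) : 0 < rho ->
  power_series_bound a rho M -> power_series_bound (PS_derive a) (rho / 2) (M / rho).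
Proof.
  intros Hr H n. unfold PS_derive. rewrite Rabs_mult, (Rabs_right (INR (S n))) by (apply Rle_ge, pos_INR).
  specialize (H (S n)). pose proof (succ_le_pow2 n) as H2. pose proof (Rabs_pos (a (S n))).
  assert (Hp : 0 < rho ^ n) by (apply pow_lt; auto). assert (0 < 2 ^ n) by (apply pow_lt; lra).
  apply Rle_trans with (2 ^ n * Rabs (a (S n)) * (rho / 2) ^ n).
  { apply Rmult_le_compat_r; [apply pow_le; lra|]. apply Rmult_le_compat_r; auto. }
  unfold Rdiv at 1. rewrite Rpow_mult_distr, pow_inv. simpl in H.
  replace (2 ^ n * Rabs (a (S n)) * (rho ^ n * / 2 ^ n)) with (Rabs (a (S n)) * (rho * rho ^ n) / rho)
    by (field; split; apply Rgt_not_eq; auto).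
  apply Rmult_le_compat_r; auto. apply Rlt_le, Rinv_0_lt_compat; auto.
Qed.

Lemma bound_PSeries_derive (a : nat -> R) (rho M x : R) : 0 < rho ->
  power_series_bound a rho M -> Rabs x <= rho / 4 -> Rabs (PSeries (PS_derive a) x) <= 2 * (M / rho).
Proof.
  intros Hr H Hx. apply (bound_PSeries _ (rho / 2)); [apply bound_derive; auto|lra].
Qed.

Lemma bound_plus (a b : nat -> R) (rho M N : R) :
  0 <= rho -> power_series_bound a rho M -> power_series_bound b rho N ->
  power_series_bound (fun i => a i + b i) rho (M + N).
Proof.
  intros Hr Ha Hb n. specialize (Ha n). specialize (Hb n).
  apply Rle_trans with ((Rabs (a n) + Rabs (b n)) * rho ^ n); [|lra].
  apply Rmult_le_compat_r; [apply pow_le; auto|apply Rabs_triang].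
Qed.

Lemma bound_scal (a : nat -> R) (rho M c : R) :
  power_series_bound a rho M -> power_series_bound (fun i => c * a i) rho (Rabs c * M).
Proof.
  intros Ha n. rewrite Rabs_mult, Rmult_assoc. apply Rmult_le_compat_l; [apply Rabs_pos|apply Ha].
Qed.

Lemma bound_mono (a : nat -> R) (rho M N : R) :
  power_series_bound a rho M -> M <= N -> power_series_bound a rho N.
Proof. intros Ha H n. specialize (Ha n). lra. Qed.

Lemma bound_decr (a : nat -> R) (rho M : R) (k : nat) : 0 < rho ->
  power_series_bound a rho M -> power_series_bound (PS_decr_n a k) rho (M / rho ^ k).
Proof.
  intros Hr Ha n. specialize (Ha (k + n)%nat). rewrite pow_add in Ha.
  assert (Hp : 0 < rho ^ k) by (apply pow_lt; auto).
  apply Rmult_le_reg_r with (rho ^ k); auto.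
  replace (M / rho ^ k * rho ^ k) with M by (field; apply Rgt_not_eq; auto).
  unfold PS_decr_n. lra.
Qed.

Lemma PSeries_linear (a b : nat -> R) (rho M N c x : R) :
  power_series_bound a rho M -> power_series_bound b rho N -> Rabs x < rho ->
  PSeries (fun i => a i + c * b i) x = PSeries a x + c * PSeries b x.
Proof.
  intros Ha Hb Hx. rewrite <- PSeries_scal. rewrite <- PSeries_plus; [reflexivity| |].
  - apply (bound_ex_pseries a rho M); auto.
  - apply (bound_ex_pseries _ rho (Rabs c * N)); auto. apply (bound_scal b); auto.
Qed.

(* The coefficients of (f(x) - f(e)) / (x - e) when [a] are those of f. *)
Definition divided_difference (a : nat -> R) (e : R) (i : nat) : R := PSeries (PS_decr_n a (S i)) e.

Lemma divided_difference_bound (a : nat -> R) (rho M e : R) : 0 < rho ->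
  power_series_bound a rho M -> Rabs e <= rho / 2 ->
  power_series_bound (divided_difference a e) rho (2 * (M / rho)).
Proof.
  intros Hr Ha He i. unfold divided_difference.
  assert (T := bound_PSeries _ _ _ _ (bound_decr a rho M (S i) Hr Ha) He).
  assert (Hp : 0 < rho ^ i) by (apply pow_lt; auto).
  apply Rle_trans with (2 * (M / rho ^ S i) * rho ^ i).
  - apply Rmult_le_compat_r; lra.
  - simpl. right. field. split; apply Rgt_not_eq; auto.
Qed.

Lemma divided_difference_eq (a : nat -> R) (rho M e x : R) : 0 < rho ->
  power_series_bound a rho M -> Rabs e <= rho / 2 -> Rabs x < rho ->
  PSeries a x = PSeries a e + (x - e) * PSeries (divided_difference a e) x.
Proof.
  intros Hr Ha He Hx. set (d := divided_difference a e).
  assert (Hd : power_series_bound d rho (2 * (M / rho))) by (apply divided_difference_bound; auto).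
  (* Horner's recursion: the tail of the series from index i on, evaluated at e, is a_i plus e times
     the next tail. *)
  assert (Ed : forall i, PSeries (PS_decr_n a i) e = a i + e * d i).
  { intros i. rewrite PSeries_decr_1.
    2:{ apply (bound_ex_pseries _ rho (M / rho ^ i)); [apply bound_decr; auto|lra]. }
    f_equal; [unfold PS_decr_n; f_equal; lia|]. f_equal. apply PSeries_ext.
    intros n. unfold PS_decr_1, PS_decr_n. f_equal. lia. }
  assert (E0 : PSeries a e = a 0%nat + e * d 0%nat).
  { rewrite <- Ed. apply PSeries_ext. intros n. reflexivity. }
  rewrite (PSeries_decr_1 a x) by (apply (bound_ex_pseries a rho M); auto).
  replace ((x - e) * PSeries d x) with (x * PSeries d x + - e * PSeries d x) by ring.
  rewrite (PSeries_decr_1 d x) at 2 by (apply (bound_ex_pseries d rho (2 * (M / rho))); auto).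
  assert (ES : PSeries d x = PSeries (PS_decr_1 a) x + e * PSeries (PS_decr_1 d) x).
  { rewrite <- (PSeries_linear (PS_decr_1 a) (PS_decr_1 d) rho (M / rho) (2 * (M / rho) / rho)); auto.
    - apply PSeries_ext. intros i. unfold d at 1, divided_difference. rewrite Ed. reflexivity.
    - replace (M / rho) with (M / rho ^ 1) by (simpl; f_equal; ring).
      exact (bound_decr a rho M 1 Hr Ha).
    - replace (2 * (M / rho) / rho) with (2 * (M / rho) / rho ^ 1) by (simpl; f_equal; ring).
      exact (bound_decr d rho _ 1 Hr Hd). }
  rewrite E0, ES. ring.
Qed.

(** * Splitting a multiple zero by polynomials *)

Lemma poly_eval_S (m : nat) (c : nat -> R) (x : R) : poly_eval (S m) c x = poly_eval m c x + c (S m) * x ^ S m.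
Proof. reflexivity. Qed.

Lemma poly_eval_shift (m : nat) (c : nat -> R) (x : R) :
  poly_eval (S m) (fun j => match j with O => 0 | S j => c j end) x = x * poly_eval m c x.
Proof.
  induction m as [|m IH]; [unfold poly_eval; simpl; ring|].
  rewrite poly_eval_S, IH, poly_eval_S. simpl. ring.
Qed.

Lemma poly_eval_linear (m : nat) (c d : nat -> R) (t x : R) :
  poly_eval m (fun j => c j + t * d j) x = poly_eval m c x + t * poly_eval m d x.
Proof.
  induction m as [|m IH]; [unfold poly_eval; simpl; ring|].
  rewrite !poly_eval_S, IH. ring.
Qed.

(** The monic polynomial with zeros m e, (m + 1) e, ..., (m + l - 1) e. *)
Fixpoint nodes (e : R) (m l : nat) (x : R) : R :=
  match l with O => 1 | S l => nodes e m l x * (x - INR (m + l) * e) end.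

(** The bound on the coefficients is uniform in e, so the next zero can be added at a cost
    proportional to its abscissa. *)
Lemma nodes_poly (l : nat) : exists B, 0 <= B /\ forall e, 0 <= e <= 1 ->
  exists q, (forall j, Rabs (q j) <= B) /\ (forall j, (l < j)%nat -> q j = 0) /\
    forall x, nodes e 1 l x = poly_eval l q x.
Proof.
  induction l as [|l [B [HB IH]]].
  - exists 1. split; [lra|]. intros e _. exists (fun j => match j with O => 1 | _ => 0 end).
    split; [|split].
    + intros [|j]; [rewrite Rabs_R1|rewrite Rabs_R0]; lra.
    + intros [|j] Hj; [lia|reflexivity].
    + intros x. unfold poly_eval. simpl. ring.
  - pose proof (pos_INR (1 + l)) as Hl.
    assert (0 <= INR (1 + l) * B) by (apply Rmult_le_pos; auto).
    exists (B + INR (1 + l) * B). split; [lra|]. intros e He.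
    destruct (IH e He) as (q & H1 & H2 & H3).
    exists (fun j => match j with O => 0 | S j => q j end + - (INR (1 + l) * e) * q j).
    split; [|split].
    + intros j. apply Rle_trans with (1 := Rabs_triang _ _). apply Rplus_le_compat.
      * destruct j; [rewrite Rabs_R0; auto|apply H1].
      * rewrite Rabs_mult. apply Rmult_le_compat; auto; try apply Rabs_pos.
        rewrite Rabs_Ropp, Rabs_right; [|apply Rle_ge, Rmult_le_pos; lra].
        rewrite <- (Rmult_1_r (INR (1 + l))) at 2. apply Rmult_le_compat_l; lra.
    + intros [|j] Hj; [lia|]. rewrite !H2 by lia. ring.
    + intros x. rewrite poly_eval_linear, poly_eval_shift, poly_eval_S, (H2 (S l)) by lia.
      cbn [nodes]. rewrite H3. ring.
Qed.

Lemma nodes_cat (e : R) (m l l' : nat) (x : R) :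
  nodes e m (l + l') x = nodes e m l x * nodes e (m + l) l' x.
Proof.
  induction l' as [|l' IH]; [rewrite Nat.add_0_r; simpl; ring|].
  rewrite Nat.add_succ_r. cbn [nodes]. rewrite IH, Nat.add_assoc. ring.
Qed.

Lemma nodes_pos_right (e : R) (m l : nat) (x : R) :
  0 <= e -> INR (m + l) * e < x + e -> 0 < nodes e m l x.
Proof.
  intros He. induction l as [|l IH]; intros Hx; [simpl; lra|].
  cbn [nodes]. replace (m + S l)%nat with (S (m + l)) in Hx by lia. rewrite S_INR in Hx.
  apply Rmult_lt_0_compat; [apply IH|]; lra.
Qed.

(** All factors are negative, and their number is even. *)
Lemma nodes_pos_left (e : R) (m l : nat) (x : R) :
  0 <= e -> x < INR m * e -> 0 < nodes e m (2 * l) x.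
Proof.
  intros He Hx. induction l as [|l IH]; [simpl; lra|].
  replace (2 * S l)%nat with (S (S (2 * l))) by lia. cbn [nodes].
  rewrite Rmult_assoc. apply Rmult_lt_0_compat; auto.
  assert (forall j, x - INR (m + j) * e < 0).
  { intros j. rewrite plus_INR. pose proof (pos_INR j). assert (0 <= INR j * e) by (apply Rmult_le_pos; lra). lra. }
  apply Rmult_neg_neg; auto.
Qed.

Lemma nodes_ex_derive (e : R) (m l : nat) (x : R) : ex_derive (nodes e m l) x.
Proof.
  induction l as [|l IH]; [apply ex_derive_const|].
  apply (ex_derive_mult (nodes e m l) (fun x => x - INR (m + l) * e)); auto. auto_derive. auto.
Qed.

(* The tangency of order n at 0 is unfolded into simple zeros at e, 2e, ..., ne by adding
   X times a small polynomial, one zero at a time: if h = g(e') / X(e') then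
   x g = (x - e') (g + e' (g - h X) / (x - e')) + e' h X, since g - h X vanishes at e'. *)
Lemma unfold_zeros (a d : nat -> R) (rho M mX : R) :
  0 < rho -> power_series_bound a rho M -> power_series_bound d rho M ->
  0 < mX -> (forall x, Rabs x < rho -> mX <= Rabs (PSeries a x)) ->
  forall n eta, 0 < eta -> exists e0, 0 < e0 /\ forall e, 0 < e < e0 ->
    exists c d', (forall j, Rabs (c j) <= eta) /\ (forall j, (n <= j)%nat -> c j = 0) /\
      power_series_bound (fun i => d' i - d i) rho eta /\
      forall x, Rabs x < rho ->
        x ^ n * PSeries d x + PSeries a x * poly_eval n c x = nodes e 1 n x * PSeries d' x.
Proof.
  intros Hr Ha Hd HmX HaX. assert (HM := bound_nonneg _ _ _ Ha).
  assert (Hir : 0 < / rho) by (apply Rinv_0_lt_compat; auto).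
  assert (HimX : 0 < / mX) by (apply Rinv_0_lt_compat; auto).
  induction n as [|n IH]; intros eta Heta.
  { exists 1. split; [lra|]. intros e _. exists (fun _ => 0), d. split; [|split; [|split]].
    - intros j. rewrite Rabs_R0. lra.
    - auto.
    - intros i. rewrite Rminus_diag, Rabs_R0. lra.
    - intros x _. unfold poly_eval. simpl. ring. }
  set (eta' := Rmin 1 (eta / 2)). assert (He' : 0 < eta') by (apply Rmin_pos; lra).
  assert (He'1 : eta' <= 1) by apply Rmin_l. assert (He'2 : eta' <= eta / 2) by apply Rmin_r.
  destruct (IH eta' He') as [e1 [He1 H1]]. destruct (nodes_poly n) as [B [HB Hq]].
  set (N := INR (S n)). assert (HN : 1 <= N) by (unfold N; rewrite S_INR; pose proof (pos_INR n); lra).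
  set (K := 2 * (M + 1) * / mX). assert (HK : 0 <= K) by (unfold K; apply Rmult_le_pos; lra).
  set (D := 2 * ((M + 1) * / rho) + K * (2 * (M * / rho))).
  assert (HMr : 0 <= M * / rho) by (apply Rmult_le_pos; lra).
  assert (HD : 0 <= D).
  { unfold D. assert (0 <= (M + 1) * / rho) by (apply Rmult_le_pos; lra).
    assert (0 <= K * (2 * (M * / rho))) by (apply Rmult_le_pos; lra). lra. }
  (* Everything added at this stage is f times a quantity bounded by Q: K bounds h, B the
     coefficients of the node polynomial, D the new divided differences. The condition f Q <= eta /
     2 leaves half of [eta] to the induction hypothesis. *)
  set (Q := D + K * B + 1). assert (HKB : 0 <= K * B) by (apply Rmult_le_pos; auto).
  set (lim := Rmin (rho / 2) (eta / 2 / Q)).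
  assert (HQ : 0 < eta / 2 / Q) by (apply Rdiv_lt_0_compat; unfold Q; lra).
  assert (Hlim : 0 < lim) by (apply Rmin_pos; lra).
  exists (Rmin (Rmin e1 1) (lim / N)). split.
  { repeat apply Rmin_pos; try lra. apply Rdiv_lt_0_compat; lra. }
  intros e [He0 He].
  assert (Hee1 : e < e1) by rmin.
  assert (He1' : e < 1) by rmin.
  assert (HeN : e < lim / N) by rmin.
  destruct (H1 e (conj He0 Hee1)) as (c & g & Hc1 & Hc2 & Hg & Heq).
  destruct (Hq e ltac:(lra)) as (q & Hq1 & Hq2 & Hq3).
  set (f := N * e).
  assert (Hf0 : 0 < f) by (apply Rmult_lt_0_compat; lra).
  assert (Hf : f < lim).
  { apply Rmult_lt_compat_l with (r := N) in HeN; [|lra].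
    replace (N * (lim / N)) with lim in HeN by (field; lra). exact HeN. }
  assert (Hfr : f <= rho / 2) by (apply Rlt_le, Rlt_le_trans with (1 := Hf); apply Rmin_l).
  assert (HfQ : f * Q <= eta / 2).
  { assert (Hf' : f <= eta / 2 / Q) by (apply Rlt_le, Rlt_le_trans with (1 := Hf); apply Rmin_r).
    apply Rmult_le_compat_r with (r := Q) in Hf'; [|unfold Q; lra].
    replace (eta / 2 / Q * Q) with (eta / 2) in Hf' by (field; unfold Q; lra). exact Hf'. }
  assert (Haf : Rabs f <= rho / 2) by (rewrite Rabs_right; lra).
  assert (Hgb : power_series_bound g rho (M + 1)).
  { intros i. assert (T := bound_plus _ _ _ _ _ (Rlt_le _ _ Hr) Hg Hd i). cbv beta in T.
    replace (g i - d i + d i) with (g i) in T by ring. lra. }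
  assert (HXf : mX <= Rabs (PSeries a f)) by (apply HaX; lra).
  assert (HXf0 : PSeries a f <> 0) by (intros E; rewrite E, Rabs_R0 in HXf; lra).
  set (h := PSeries g f * / PSeries a f).
  assert (Hh : Rabs h <= K).
  { unfold h, K. rewrite Rabs_mult, Rabs_inv. apply Rmult_le_compat; try apply Rabs_pos.
    - apply Rlt_le, Rinv_0_lt_compat, Rabs_pos_lt; auto.
    - apply (bound_PSeries g rho); auto.
    - apply Rinv_le_contravar; auto. }
  assert (Hdg := divided_difference_bound g rho (M + 1) f Hr Hgb Haf).
  assert (Hda := divided_difference_bound a rho M f Hr Ha Haf).
  set (dg := divided_difference g f) in *. set (da := divided_difference a f) in *.
  set (dd := fun i => dg i + - h * da i).
  assert (Hdd : power_series_bound dd rho D).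
  { apply bound_mono with (2 * ((M + 1) / rho) + Rabs (- h) * (2 * (M / rho))).
    - apply bound_plus; auto; [lra|]. apply bound_scal; auto.
    - rewrite Rabs_Ropp. unfold D, Rdiv. apply Rplus_le_compat_l.
      apply Rmult_le_compat_r; auto. lra. }
  (* Multiplying the old identity by x shifts the coefficients of the polynomial; subtracting f h
     times the old nodes moves the extra zero from 0 to f = (n + 1) e. *)
  exists (fun j => match j with O => 0 | S j => c j end + - (f * h) * q j), (fun i => g i + f * dd i).
  assert (Hfh : Rabs (- (f * h)) <= f * K).
  { rewrite Rabs_Ropp, Rabs_mult, (Rabs_right f) by lra. apply Rmult_le_compat_l; lra. }
  assert (HfKB : f * K * B <= eta / 2).
  { apply Rle_trans with (2 := HfQ). rewrite Rmult_assoc. apply Rmult_le_compat_l; unfold Q; lra. }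
  assert (HfD : f * D <= eta / 2).
  { apply Rle_trans with (2 := HfQ). apply Rmult_le_compat_l; unfold Q; lra. }
  split; [|split; [|split]].
  - intros j. apply Rle_trans with (1 := Rabs_triang _ _). rewrite Rabs_mult.
    assert (Rabs (- (f * h)) * Rabs (q j) <= f * K * B) by (apply Rmult_le_compat; auto; apply Rabs_pos).
    destruct j as [|j]; [rewrite Rabs_R0; lra|]. specialize (Hc1 j). lra.
  - intros [|j] Hj; [lia|]. rewrite Hc2, Hq2 by lia. ring.
  - intros i. assert (T := bound_plus _ _ _ _ _ (Rlt_le _ _ Hr) Hg (bound_scal _ _ _ f Hdd) i). cbv beta in T.
    replace (g i + f * dd i - d i) with (g i - d i + f * dd i) by ring.
    rewrite (Rabs_right f) in T by lra. lra.
  - intros x Hx. specialize (Heq x Hx).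
    rewrite poly_eval_linear, poly_eval_shift, poly_eval_S, (Hq2 (S n)), <- Hq3 by lia.
    rewrite (PSeries_linear g dd rho (M + 1) D f x) by auto.
    unfold dd. rewrite (PSeries_linear dg da rho (2 * ((M + 1) / rho)) (2 * (M / rho)) (- h) x) by auto.
    assert (E1 := divided_difference_eq g rho (M + 1) f x Hr Hgb Haf Hx). fold dg in E1.
    assert (E2 := divided_difference_eq a rho M f x Hr Ha Haf Hx). fold da in E2.
    assert (E3 : PSeries g f = h * PSeries a f) by (unfold h; field; auto).
    cbn [nodes pow]. change (INR (1 + n)) with N. fold f.
    replace (x * x ^ n * PSeries d x + PSeries a x * (x * poly_eval n c x + - (f * h) * (nodes e 1 n x + 0 * (x * x ^ n))))
      with (x * (x ^ n * PSeries d x + PSeries a x * poly_eval n c x) - PSeries a x * f * h * nodes e 1 n x) by ring.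
    rewrite Heq.
    set (gx := PSeries g x) in *. set (ax := PSeries a x) in *. set (dgx := PSeries dg x) in *. set (dax := PSeries da x) in *.
    set (nx := nodes e 1 n x) in *.
    assert (E4 : (x - f) * (dgx - h * dax) = gx - h * ax) by (rewrite E1, E2, E3; ring).
    replace (nx * (x - f) * (gx + f * (dgx + - h * dax))) with (nx * ((x - f) * gx + f * ((x - f) * (dgx - h * dax)))) by ring.
    rewrite E4. ring.
Qed.

Definition log_derivative (a : nat -> R) (x : R) : R := PSeries (PS_derive a) x * / PSeries a x.

Lemma log_derivative_continuous (a : nat -> R) (rho M : R) :
  0 < rho -> power_series_bound a rho M -> PSeries a 0 <> 0 -> continuous (log_derivative a) 0.
Proof.
  intros Hr Ha H0. unfold log_derivative.
  assert (R0 : Rabs 0 < rho) by (rewrite Rabs_R0; auto).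
  assert (R1 : Rabs 0 < rho / 2) by (rewrite Rabs_R0; lra).
  assert (D0 := bound_is_derive a rho M 0 Ha R0).
  assert (D1 := bound_is_derive _ _ _ 0 (bound_derive a rho M Hr Ha) R1).
  apply (ex_derive_continuous (K := R_AbsRing) (V := R_NormedModule) (fun x : R => PSeries (PS_derive a) x * / PSeries a x) 0).
  apply ex_derive_mult; [eexists; exact D1|].
  apply ex_derive_inv; [eexists; exact D0|exact H0].
Qed.

Lemma quotient_close (D D' G G' g L t s : R) :
  0 < g -> g <= Rabs G -> g <= Rabs G' -> Rabs D <= L -> Rabs (D' - D) <= s -> Rabs (G' - G) <= t ->
  Rabs (D' * / G' - D * / G) <= s * / g + L * (t * (/ g * / g)).
Proof.
  intros Hg HG HG' HD Hs Ht.
  assert (G <> 0) by (intros E; rewrite E, Rabs_R0 in HG; lra).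
  assert (G' <> 0) by (intros E; rewrite E, Rabs_R0 in HG'; lra).
  assert (I1 : Rabs (/ G) <= / g) by (rewrite Rabs_inv; apply Rinv_le_contravar; auto).
  assert (I2 : Rabs (/ G') <= / g) by (rewrite Rabs_inv; apply Rinv_le_contravar; auto).
  replace (D' * / G' - D * / G) with ((D' - D) * / G' + - (D * ((G' - G) * (/ G * / G')))) by (field; auto).
  apply Rle_trans with (1 := Rabs_triang _ _). rewrite Rabs_Ropp, !Rabs_mult.
  apply Rplus_le_compat; apply Rmult_le_compat; auto; try apply Rabs_pos.
  - repeat apply Rmult_le_pos; apply Rabs_pos.
  - apply Rmult_le_compat; auto; try apply Rabs_pos.
    + apply Rmult_le_pos; apply Rabs_pos.
    + apply Rmult_le_compat; auto; apply Rabs_pos.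
Qed.

(** Uniform over all series coefficientwise close to [d] and over all points near 0: after the
    unfolding both the quotient series and the point of evaluation depend on e. *)
Lemma log_derivative_close (d : nat -> R) (rho N : R) :
  0 < rho -> power_series_bound d rho N -> PSeries d 0 <> 0 ->
  forall eta, 0 < eta -> exists tau, 0 < tau /\ forall d', power_series_bound (fun i => d' i - d i) rho tau ->
    (forall x, Rabs x < tau -> 0 < PSeries d' x * PSeries d 0) /\
    forall x, Rabs x < tau -> Rabs (log_derivative d' x - log_derivative d 0) <= eta.
Proof.
  intros Hr Hd H0 eta Heta. set (g := Rabs (PSeries d 0) / 4).
  assert (Hg : 0 < g) by (unfold g; apply Rabs_pos_lt in H0; lra).
  assert (R0 : Rabs 0 < rho) by (rewrite Rabs_R0; auto).
  assert (C0 := is_derive_continuous _ _ _ (bound_is_derive d rho N 0 Hd R0)).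
  destruct (proj1 (continuous_eps _ _) C0 g Hg) as [t1 [Ht1 H1]].
  assert (C1 := log_derivative_continuous d rho N Hr Hd H0).
  destruct (proj1 (continuous_eps _ _) C1 (eta / 2) ltac:(lra)) as [t2 [Ht2 H2]].
  assert (HN := bound_nonneg _ _ _ Hd).
  set (L := 2 * (N / rho)).
  set (Q := 2 * / rho * / g + L * (2 * (/ g * / g))).
  assert (Hig : 0 < / g) by (apply Rinv_0_lt_compat; auto).
  assert (Hir : 0 < / rho) by (apply Rinv_0_lt_compat; auto).
  assert (HL : 0 <= L) by (unfold L, Rdiv; assert (0 <= N * / rho) by (apply Rmult_le_pos; lra); lra).
  assert (HQ : 0 < Q).
  { unfold Q. assert (0 < 2 * / rho * / g) by (repeat apply Rmult_lt_0_compat; lra).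
    assert (0 <= L * (2 * (/ g * / g))) by (apply Rmult_le_pos; auto; apply Rmult_le_pos; [lra|]; apply Rmult_le_pos; lra).
    lra. }
  assert (He : 0 < eta / 2 / Q) by (apply Rdiv_lt_0_compat; lra).
  set (tau := Rmin (Rmin t1 t2) (Rmin (Rmin (rho / 4) (g / 2)) (eta / 2 / Q))).
  assert (Htau : 0 < tau) by (repeat apply Rmin_pos; lra).
  assert (A1 : tau <= t1) by rmin.
  assert (A2 : tau <= t2) by rmin.
  assert (A3 : tau <= rho / 4) by rmin.
  assert (A4 : tau <= g / 2) by rmin.
  assert (A5 : tau <= eta / 2 / Q) by rmin.
  exists tau. split; auto. intros d' Hdd.
  set (e := fun i => d' i - d i) in *.
  assert (Ee : forall x, Rabs x < rho -> PSeries d' x - PSeries d x = PSeries e x).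
  { intros x Hx. assert (T := PSeries_linear d e rho N tau 1 x Hd Hdd Hx).
    rewrite (PSeries_ext _ d') in T by (intros; unfold e; ring). lra. }
  assert (Hd' : power_series_bound d' rho (N + tau)).
  { intros i. assert (T := bound_plus _ _ _ _ _ (Rlt_le _ _ Hr) Hd Hdd i). cbv beta in T.
    unfold e in T. replace (d i + (d' i - d i)) with (d' i) in T by ring. exact T. }
  assert (Ee' : forall x, Rabs x < rho / 2 -> PSeries (PS_derive d') x - PSeries (PS_derive d) x = PSeries (PS_derive e) x).
  { intros x Hx.
    assert (T := PSeries_linear _ _ _ _ _ 1 x (bound_derive d rho N Hr Hd) (bound_derive e rho tau Hr Hdd) Hx).
    rewrite (PSeries_ext _ (PS_derive d')) in T by (intros; unfold PS_derive, e; ring). lra. }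
  assert (B1 : forall x, Rabs x < tau -> Rabs (PSeries d x - PSeries d 0) < g).
  { intros x Hx. apply H1. rewrite Rminus_0_r. lra. }
  assert (B2 : forall x, Rabs x < tau -> Rabs (PSeries d' x - PSeries d x) <= 2 * tau).
  { intros x Hx. rewrite Ee by lra. apply (bound_PSeries e rho); auto; lra. }
  assert (B3 : forall x, Rabs x < tau -> g <= Rabs (PSeries d x) /\ g <= Rabs (PSeries d' x) /\ 0 < PSeries d' x * PSeries d 0).
  { intros x Hx. specialize (B1 x Hx). specialize (B2 x Hx).
    apply Rabs_def2 in B1. apply Rabs_le_between in B2. unfold g in *.
    destruct (Rdichotomy _ _ H0) as [K|K].
    - rewrite (Rabs_left (PSeries d 0)) in * by lra.
      rewrite (Rabs_left (PSeries d x)), (Rabs_left (PSeries d' x)) by lra.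
      split; [lra|split; [lra|]]. apply Rmult_neg_neg; lra.
    - rewrite (Rabs_right (PSeries d 0)) in * by lra.
      rewrite (Rabs_right (PSeries d x)), (Rabs_right (PSeries d' x)) by lra.
      split; [lra|split; [lra|]]. apply Rmult_lt_0_compat; lra. }
  split; [intros x Hx; apply B3; auto|].
  intros x Hx. destruct (B3 x Hx) as (G1 & G2 & _).
  replace (log_derivative d' x - log_derivative d 0)
    with ((log_derivative d' x - log_derivative d x) + (log_derivative d x - log_derivative d 0)) by ring.
  apply Rle_trans with (1 := Rabs_triang _ _).
  assert (T2 : Rabs (log_derivative d x - log_derivative d 0) < eta / 2) by (apply H2; rewrite Rminus_0_r; lra).
  assert (T1 : Rabs (log_derivative d' x - log_derivative d x) <= 2 * (tau / rho) * / g + L * (2 * tau * (/ g * / g))).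
  { apply quotient_close; auto.
    - apply (bound_PSeries_derive d rho N); auto; lra.
    - rewrite Ee' by lra. apply bound_PSeries_derive; auto; lra. }
  replace (2 * (tau / rho) * / g + L * (2 * tau * (/ g * / g))) with (tau * Q) in T1 by (unfold Q, Rdiv; ring).
  assert (tau * Q <= eta / 2); [|lra].
  apply Rmult_le_compat_r with (r := Q) in A5; [|lra].
  replace (eta / 2 / Q * Q) with (eta / 2) in A5 by (field; lra). exact A5.
Qed.

(** The derivative on the axis is - F E, so w is - sg times the product of q, d / a and E. Its
    logarithmic derivative at p is additive, and E contributes - fy because E(p) = 1. The factor sg
    makes w positive, that is, the tangency invisible. *)
Lemma tangency_valley (F H : R -> R -> R) (E q : R -> R) (a d : nat -> R)
    (sg p rho M N r C s fy q1 : R) (n : nat) :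
  first_integral F H E (- rho) rho r C -> E p = 1 -> is_derive E p (- fy) ->
  power_series_bound a rho M -> power_series_bound d rho N -> Nat.Odd n ->
  0 < s -> - rho <= p - s -> p + s <= rho -> is_derive q 0 q1 ->
  (forall x, Rabs x < s -> F (p + x) 0 = x ^ n * (q x * (PSeries d (p + x) * / PSeries a (p + x))) /\
     PSeries a (p + x) <> 0 /\
     0 < q x /\ sg * (PSeries d (p + x) * / PSeries a (p + x)) < 0) ->
  exists w w1, valley (fun x => sg * H (p + x) 0) w n s /\ is_derive w 0 w1 /\
    w1 / w 0 = q1 / q 0 + (log_derivative d p - log_derivative a p - fy) /\
    forall x, Rabs x < s -> x ^ n * w x = sg * (- F (p + x) 0 * E (p + x)).
Proof.
  intros HI HE0 HE Ha Hd Hn Hs Hp1 Hp2 Hq HF.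
  set (w := fun x => - sg * (q x * (PSeries d (p + x) * / PSeries a (p + x)) * E (p + x))).
  set (D := PSeries d p). set (A := PSeries a p).
  set (D1 := PSeries (PS_derive d) p). set (A1 := PSeries (PS_derive a) p).
  set (w1 := - sg * (q1 * (D * / A) + q 0 * ((D1 * A - D * A1) / A ^ 2) - q 0 * (D * / A) * fy)).
  assert (H0 := HF 0 ltac:(rewrite Rabs_R0; auto)).
  rewrite Rplus_0_r in H0. destruct H0 as (_ & HA & Hq0 & Hs0). fold A D in HA, Hs0.
  assert (Hpr : Rabs p < rho) by (apply Rabs_def1; lra).
  assert (DA := bound_is_derive a rho M p Ha Hpr). fold A1 in DA.
  assert (DD := bound_is_derive d rho N p Hd Hpr). fold D1 in DD.
  assert (Hsh : forall (f : R -> R) l, is_derive f p l -> is_derive (fun x => f (p + x)) 0 l).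
  { intros f l Hf. replace l with (1 * l) by ring.
    apply (is_derive_comp f (fun x => p + x)); [rewrite Rplus_0_r; exact Hf|].
    auto_derive; auto. }
  assert (Dw : is_derive w 0 w1).
  { assert (G : forall f g h : R -> R, forall f1 g1 h1, is_derive f 0 f1 -> is_derive g 0 g1 -> is_derive h 0 h1 ->
      g 0 <> 0 -> h 0 = 1 -> is_derive (fun x => - sg * (q x * (f x * / g x) * h x)) 0
        (- sg * (q1 * (f 0 * / g 0) + q 0 * ((f1 * g 0 - f 0 * g1) / g 0 ^ 2) + q 0 * (f 0 * / g 0) * h1))).
    { intros f g h f1 g1 h1 T1 T2 T3 G0 G1. auto_derive.
      - repeat split; try (eexists; eassumption). exact G0.
      - assert (E1 : Derive (fun x : R => f x) 0 = f1) by (apply is_derive_unique; exact T1).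
        assert (E2 : Derive (fun x : R => g x) 0 = g1) by (apply is_derive_unique; exact T2).
        assert (E3 : Derive (fun x : R => h x) 0 = h1) by (apply is_derive_unique; exact T3).
        assert (E4 : Derive (fun x : R => q x) 0 = q1) by (apply is_derive_unique; exact Hq).
        rewrite E1, E2, E3, E4, G1.
        field. auto. }
    specialize (G _ _ _ _ _ _ (Hsh _ _ DD) (Hsh _ _ DA) (Hsh _ _ HE)). cbv beta in G.
    rewrite Rplus_0_r in G. specialize (G HA HE0). unfold w.
    replace w1 with (- sg * (q1 * (PSeries d p * / PSeries a p) +
          q 0 * ((D1 * PSeries a p - PSeries d p * A1) / PSeries a p ^ 2) +
          q 0 * (PSeries d p * / PSeries a p) * - fy)); [exact G|].
    unfold w1, D, A. ring. }
  assert (Ew : forall x, Rabs x < s -> x ^ n * w x = sg * (- F (p + x) 0 * E (p + x))).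
  { intros x Hx. destruct (HF x Hx) as (EF & _). rewrite EF. unfold w. ring. }
  exists w, w1. split; [|split; [exact Dw|split; [|exact Ew]]].
  - split; [exact Hn|]. intros x Hx.
    assert (Hx' := Rabs_def2 _ _ Hx). destruct (HF x Hx) as (_ & _ & Q1 & Q2).
    destruct HI as (_ & _ & _ & _ & _ & _ & HX). destruct (HX (p + x) ltac:(lra)) as [Ep Ed].
    split.
    + rewrite (Ew x Hx). apply (is_derive_scal (fun x => H (p + x) 0)).
      replace (- F (p + x) 0 * E (p + x)) with (1 * (- F (p + x) 0 * E (p + x))) by ring.
      apply (is_derive_comp (fun x => H x 0) (fun x => p + x)); [exact Ed|]. auto_derive; auto.
    + unfold w. set (f := PSeries d (p + x) * / PSeries a (p + x)) in *.
      replace (- sg * (q x * f * E (p + x))) with (q x * E (p + x) * (- (sg * f))) by ring.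
      repeat apply Rmult_lt_0_compat; lra.
  - unfold w, w1, log_derivative. rewrite Rplus_0_r. fold A D A1 D1. rewrite HE0.
    assert (sg <> 0) by (intros ->; lra).
    assert (D <> 0) by (intros E1; rewrite E1 in Hs0; lra).
    field. repeat split; auto. lra.
Qed.

(** * The second Lyapunov coefficient *)

(** Continuous induction: a bound that becomes strict whenever it has held so far is never lost. *)
Lemma barrier (F : R -> R) (a : R) :
  (forall t, 0 <= t <= 1 -> continuous F t) -> F 0 <= a ->
  (forall t, 0 <= t <= 1 -> (forall s, 0 <= s <= t -> F s <= a) -> F t < a) ->
  forall t, 0 <= t <= 1 -> F t < a.
Proof.
  intros Hc H0 Hstep.
  set (A := fun t => 0 <= t <= 1 /\ forall s, 0 <= s <= t -> F s <= a).
  destruct (completeness A) as [m [Hm1 Hm2]].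
  { exists 1. intros t [Ht _]. lra. }
  { exists 0. split; [lra|]. intros s Hs. replace s with 0 by lra. exact H0. }
  assert (Hm0 : 0 <= m).
  { apply Hm1. split; [lra|]. intros s Hs. replace s with 0 by lra. exact H0. }
  assert (Hm01 : m <= 1) by (apply Hm2; intros t [Ht _]; lra).
  assert (Hlt : forall s, 0 <= s < m -> F s <= a).
  { intros s Hs. apply Rnot_lt_le. intros K.
    assert (m <= s); [|lra]. apply Hm2. intros t [Ht Ht']. apply Rnot_lt_le. intros K2.
    specialize (Ht' s ltac:(lra)). lra. }
  assert (HFm : F m <= a).
  { apply Rnot_lt_le. intros K.
    destruct (proj1 (continuous_eps F m) (Hc m ltac:(lra)) (F m - a) ltac:(lra)) as [d [Hd Hd']].
    destruct (Req_dec m 0) as [E|E]; [rewrite E in K; lra|].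
    set (s := Rmax 0 (m - d / 2)).
    assert (s1 : 0 <= s) by apply Rmax_l. assert (s2 : m - d / 2 <= s) by apply Rmax_r.
    assert (s3 : s < m) by (apply Rmax_lub_lt; lra).
    specialize (Hd' s ltac:(apply Rabs_def1; lra)). specialize (Hlt s ltac:(lra)).
    apply Rabs_def2 in Hd'. lra. }
  assert (Hle : forall s, 0 <= s <= m -> F s <= a).
  { intros s Hs. destruct (Req_dec s m) as [->|E]; [exact HFm|apply Hlt; lra]. }
  assert (Em : m = 1).
  { apply Rle_antisym; auto. apply Rnot_lt_le. intros K.
    assert (HFm' := Hstep m ltac:(lra) Hle).
    destruct (proj1 (continuous_eps F m) (Hc m ltac:(lra)) (a - F m) ltac:(lra)) as [d [Hd Hd']].
    set (t := Rmin 1 (m + d / 2)).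
    assert (t1 : t <= 1) by apply Rmin_l. assert (t2 : t <= m + d / 2) by apply Rmin_r.
    assert (t3 : m < t) by (apply Rmin_glb_lt; lra).
    assert (t <= m); [|lra]. apply Hm1. split; [lra|]. intros s Hs.
    destruct (Rle_dec s m); [apply Hle; lra|].
    specialize (Hd' s ltac:(apply Rabs_def1; lra)). apply Rabs_def2 in Hd'. lra. }
  intros t Ht. apply Hstep; auto. intros s Hs. apply Hle. lra.
Qed.

Lemma pos_of_mul (c z : R) : 0 < c -> 0 < c * z -> 0 < z.
Proof. intros Hc H. apply Rmult_lt_reg_l with c; auto. lra. Qed.

Lemma scaled_between (s T : R) : 0 <= s <= 1 -> Rmin 0 T <= s * T <= Rmax 0 T.
Proof. intros Hs. unfold Rmin, Rmax. destruct (Rle_dec 0 T); nra. Qed.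

Lemma scaled_strictly_between (s T : R) : T <> 0 -> 0 < s < 1 -> Rmin 0 T < s * T < Rmax 0 T.
Proof. intros HT Hs. apply Rdichotomy in HT. unfold Rmin, Rmax. destruct (Rle_dec 0 T); nra. Qed.

Lemma integral_curve_scaled (W : vector_field) (T : R) (g : R -> R * R) :
  integral_curve W (Rmin 0 T) (Rmax 0 T) g ->
  forall s, 0 <= s <= 1 ->
    is_derive (fun s => fst (g (s * T))) s (vX W (fst (g (s * T))) (snd (g (s * T))) * T) /\
    is_derive (fun s => snd (g (s * T))) s (vY W (fst (g (s * T))) (snd (g (s * T))) * T).
Proof.
  intros Hg s Hs.
  assert (Ht : Rmin 0 T <= s * T <= Rmax 0 T).
  { apply scaled_between; auto. }
  destruct (Hg _ Ht) as [_ D]. apply is_derive_pair in D. destruct D as [D1 D2]. simpl in D1, D2.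
  assert (Hs' : is_derive (fun s : R => s * T) s T) by (auto_derive; auto; ring).
  split.
  - rewrite Rmult_comm. apply (is_derive_comp (fun t => fst (g t)) (fun s => s * T)); auto.
  - rewrite Rmult_comm. apply (is_derive_comp (fun t => snd (g t)) (fun s => s * T)); auto.
Qed.

Lemma valley_mono (u w : R -> R) (n : nat) (r r' : R) : valley u w n r -> r' <= r -> valley u w n r'.
Proof. intros [H1 H2] Hr. split; auto. intros x Hx. apply H2. lra. Qed.

(* An orbit starting near the tangency cannot leave the box where the first integral is
   defined: while it is there, its x-coordinate stays in a sublevel set of [u]. *)
Lemma half_return_level (W : vector_field) (sg rho r C s : R) (phi : R -> R)
    (H : R -> R -> R) (E w : R -> R) (n : nat) :
  sg = 1 \/ sg = -1 ->
  first_integral (slope W) H E (- rho) rho r C ->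
  (forall x y, Rabs x < rho -> Rabs y < r -> vX W x y <> 0) ->
  0 < s <= rho -> valley (fun x => sg * H x 0) w n s ->
  half_return_map W sg phi ->
  exists d, 0 < d /\ forall x, 0 < Rabs x < d ->
    x * phi x < 0 /\ Rabs (phi x) < s /\ sg * H (phi x) 0 = sg * H x 0.
Proof.
  intros Hsg HI HX Hs Hv [_ [dp Hphi]]. set (u := fun x => sg * H x 0) in *.
  destruct HI as (HC & Hr & _ & Hinc & Hconst & _).
  set (a := Rmin (s / 2) (r / 2)). assert (Ha : 0 < a) by (apply Rmin_pos; lra).
  assert (Has : a <= s / 2) by apply Rmin_l. assert (Har : a <= r / 2) by apply Rmin_r.
  assert (Hva : valley u w n a) by (apply valley_mono with s; auto; lra).
  destruct (valley_involution u w n a Ha Hva) as (d1 & phi0 & Hd1 & Hd1a & Hphi0).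
  assert (Hcu : continuous u 0).
  { apply is_derive_continuous with (0 ^ n * w 0). apply (proj2 Hv). rewrite Rabs_R0; lra. }
  destruct (proj1 (continuous_eps u 0) Hcu (a / C)) as [d2 [Hd2 Hcu2]]; [apply Rdiv_lt_0_compat; auto|].
  pose proof (cond_pos dp) as Hdp.
  exists (Rmin dp (Rmin d1 d2)). split; [repeat apply Rmin_pos; auto|].
  intros x [Hx0 Hxd].
  assert (X1 : Rabs x < dp) by rmin.
  assert (X2 : Rabs x < d1) by rmin.
  assert (X3 : Rabs x < d2) by rmin.
  assert (Hxne : x <> 0) by (intros ->; rewrite Rabs_R0 in Hx0; lra).
  destruct (Hphi x) as (Hopp & T & g & HT & Hg0 & HgT & Hcurve & Hside).
  { unfold ball; simpl; unfold AbsRing_ball, abs, minus, plus, opp; simpl. rewrite Ropp_0, Rplus_0_r. exact X1. }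
  { exact Hxne. }
  split; [exact Hopp|].
  destruct (Hphi0 x (conj Hx0 X2)) as (P1 & P2 & P3 & _).
  assert (Hmin : forall X, Rabs X < s -> u 0 <= u X).
  { intros X HXs. apply Rabs_def2 in HXs. destruct (Rtotal_order X 0) as [K|[->|K]]; [|lra|].
    - apply Rlt_le, (valley_decreasing u w n s); auto; lra.
    - apply Rlt_le, (valley_increasing u w n s); auto; lra. }
  (* Within [- a, a] the sublevel set of u at u(x) is the interval between x and its partner
     [phi0 x], both strictly inside. *)
  assert (Hbetween : forall X, Rabs X <= a -> u X <= u x -> Rabs X < a).
  { intros X HXa HuX. apply Rabs_le_between in HXa. apply Rabs_def2 in P2.
    assert (Hxa : Rabs x < a) by lra. apply Rabs_def2 in Hxa.
    destruct (Rdichotomy _ _ Hxne) as [K|K].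
    - assert (N1 := neg_of_prod (- x) (- phi0 x) ltac:(lra) ltac:(lra)). apply Rabs_def1; apply Rnot_le_lt; intros K2.
      + assert (u (phi0 x) < u X) by (apply (valley_increasing u w n s); auto; lra). lra.
      + assert (u x < u X) by (apply (valley_decreasing u w n s); auto; lra). lra.
    - assert (N1 := neg_of_prod x (phi0 x) ltac:(lra) P1). apply Rabs_def1; apply Rnot_le_lt; intros K2.
      + assert (u x < u X) by (apply (valley_increasing u w n s); auto; lra). lra.
      + assert (u (phi0 x) < u X) by (apply (valley_decreasing u w n s); auto; lra). lra. }
  (* Bounds the height of the orbit: |Y| is at most C times the drop u(x) - u(X), and u is minimal
     at 0. *)
  assert (Hux : C * (u x - u 0) < a).
  { specialize (Hcu2 x ltac:(rewrite Rminus_0_r; auto)). apply Rabs_def2 in Hcu2.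
    assert (Hl : u x - u 0 < a / C) by lra. apply Rmult_lt_compat_l with (r := C) in Hl; auto.
    replace (C * (a / C)) with a in Hl by (field; lra). exact Hl. }
  set (X := fun t => fst (g (t * T))). set (Y := fun t => snd (g (t * T))).
  assert (HD := integral_curve_scaled W T g Hcurve).
  assert (HY : forall t, 0 <= t <= 1 -> 0 <= sg * Y t).
  { intros t Ht. unfold Y. destruct (Req_dec t 0) as [->|N0]; [rewrite Rmult_0_l, Hg0; simpl; lra|].
    destruct (Req_dec t 1) as [->|N1]; [rewrite Rmult_1_l, HgT; simpl; lra|].
    apply Rlt_le, Hside. apply scaled_strictly_between; [auto|lra]. }
  set (F := fun t => Rmax (Rabs (X t)) (Rabs (Y t))).
  assert (Hlevel : forall t, 0 <= t <= 1 -> (forall s, 0 <= s <= t -> F s <= a) -> H (X t) (Y t) = H x 0).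
  { intros t Ht HF.
    assert (HFs : forall s, 0 <= s <= t -> is_derive (fun s => H (X s) (Y s)) s 0).
    { intros t' Ht'. specialize (HF t' Ht'). destruct (HD t' ltac:(lra)) as [D1 D2].
      assert (F1 : Rabs (X t') < rho) by (apply Rle_lt_trans with (F t'); [apply Rmax_l|lra]).
      assert (F2 : Rabs (Y t') < r) by (apply Rle_lt_trans with (F t'); [apply Rmax_r|lra]).
      assert (F1' := Rabs_def2 _ _ F1).
      apply (Hconst X Y t' (vX W (X t') (Y t') * T)); [lra|auto|exact D1|].
      replace (slope W (X t') (Y t') * (vX W (X t') (Y t') * T)) with (vY W (X t') (Y t') * T); [exact D2|].
      unfold slope. field. apply HX; auto. }
    rewrite <- (constant_except nil (fun s => H (X s) (Y s)) 0 t).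
    - unfold X, Y. rewrite Rmult_0_l, Hg0. reflexivity.
    - lra.
    - intros t' Ht'. apply is_derive_continuous with 0. apply HFs; auto.
    - intros t' Ht' _. apply HFs; lra. }
  assert (HB : forall t, 0 <= t <= 1 -> F t < a).
  { apply barrier.
    - intros t Ht. destruct (HD t Ht) as [D1 D2].
      apply is_derive_continuous in D1. apply is_derive_continuous in D2.
      apply (continuous_ext (fun t => ((Rabs (X t) + Rabs (Y t)) + Rabs (Rabs (X t) - Rabs (Y t))) / 2)).
      { intros t'. unfold F. unfold Rmax, Rabs at 3. destruct (Rle_dec (Rabs (X t')) (Rabs (Y t')));
          destruct (Rcase_abs (Rabs (X t') - Rabs (Y t'))); lra. }
      assert (A1 : continuous (fun t => Rabs (X t)) t) by (apply (continuous_comp X Rabs); [exact D1|apply continuous_Rabs]).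
      assert (A2 : continuous (fun t => Rabs (Y t)) t) by (apply (continuous_comp Y Rabs); [exact D2|apply continuous_Rabs]).
      apply (continuous_mult (K := R_AbsRing) (fun t => Rabs (X t) + Rabs (Y t) + Rabs (Rabs (X t) - Rabs (Y t))) (fun _ => / 2));
        [|apply continuous_const].
      apply (continuous_plus (fun t => Rabs (X t) + Rabs (Y t)) (fun t => Rabs (Rabs (X t) - Rabs (Y t)))).
      + apply (continuous_plus (fun t => Rabs (X t)) (fun t => Rabs (Y t))); auto.
      + apply (continuous_comp (fun t => Rabs (X t) - Rabs (Y t)) Rabs); [|apply continuous_Rabs].
        apply (continuous_minus (fun t => Rabs (X t)) (fun t => Rabs (Y t))); auto.
    - unfold F, X, Y. rewrite Rmult_0_l, Hg0. simpl. rewrite Rabs_R0. apply Rmax_lub; lra.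
    - intros t Ht HF. assert (L := Hlevel t Ht HF). specialize (HF t ltac:(lra)). specialize (HY t Ht).
      assert (F1 : Rabs (X t) <= a) by (apply Rle_trans with (2 := HF), Rmax_l).
      assert (F1' := F1). apply Rabs_le_between in F1'.
      (* The level is conserved, and on the side sg * Y >= 0 leaving the axis raises sg times H. The
         point of the axis under the orbit therefore has a lower level. *)
      assert (Q : u (X t) <= u x /\ Rabs (Y t) <= C * (u x - u (X t))).
      { unfold u. destruct Hsg as [-> | ->].
        - destruct (Req_dec (Y t) 0) as [EY|NY].
          { rewrite EY in L. rewrite L, EY, Rabs_R0. split; [lra|]. right; ring. }
          specialize (Hinc (X t) 0 (Y t) ltac:(lra) ltac:(lra)). rewrite L in Hinc.
          rewrite Rabs_right by lra. split; [|lra].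
          assert (T1 := pos_of_mul C (H x 0 - H (X t) 0) HC ltac:(lra)). lra.
        - destruct (Req_dec (Y t) 0) as [EY|NY].
          { rewrite EY in L. rewrite L, EY, Rabs_R0. split; [lra|]. right; ring. }
          specialize (Hinc (X t) (Y t) 0 ltac:(lra) ltac:(lra)). rewrite L in Hinc.
          rewrite Rabs_left by lra. split; [|lra].
          assert (T1 := pos_of_mul C (H (X t) 0 - H x 0) HC ltac:(lra)). lra. }
      destruct Q as [Q1 Q2]. apply Rmax_lub_lt; [apply Hbetween; auto|].
      apply Rle_lt_trans with (1 := Q2). apply Rle_lt_trans with (2 := Hux).
      apply Rmult_le_compat_l; [lra|]. specialize (Hmin (X t) ltac:(apply Rabs_def1; lra)). lra. }
  assert (HB1 := HB 1 ltac:(lra)).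
  assert (L := Hlevel 1 ltac:(lra) (fun s Hs' => Rlt_le _ _ (HB s Hs'))).
  unfold F, X, Y in HB1. unfold X, Y in L. rewrite Rmult_1_l, HgT in HB1, L. simpl in HB1, L.
  split; [|rewrite L; reflexivity].
  apply Rle_lt_trans with (1 := Rmax_l _ _) in HB1. lra.
Qed.

(** Identifies coefficients of a convergent series with those of an asymptotic expansion with error
    o(x^2). That V_1 = 0 is not assumed but follows, as both maps start with - x. *)
Lemma second_coefficient (V : nat -> R) (f g : R -> R) (dl alp alm : R) :
  V 0%nat = 0 -> locally 0 (fun x => is_pseries V x (dl * (f x - g x))) ->
  (forall e, 0 < e -> exists d, 0 < d /\ forall x, 0 < Rabs x < d -> Rabs (f x + x - alp * x ^ 2) <= e * x ^ 2) ->
  (forall e, 0 < e -> exists d, 0 < d /\ forall x, 0 < Rabs x < d -> Rabs (g x + x - alm * x ^ 2) <= e * x ^ 2) ->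
  V 2%nat = dl * (alp - alm).
Proof.
  intros HV0 [d0 Hd0] Hf Hg. pose proof (cond_pos d0) as Hd0p.
  assert (Hps : forall x, Rabs x < d0 -> is_pseries V x (dl * (f x - g x))).
  { intros x Hx. apply Hd0. unfold ball; simpl; unfold AbsRing_ball, abs, minus, plus, opp; simpl.
    rewrite Ropp_0, Rplus_0_r. exact Hx. }
  assert (Hcv : Rbar_lt 0 (CV_radius V)).
  { apply Rbar_lt_le_trans with (d0 / 2); [simpl; lra|].
    apply Rbar_not_lt_le. intros K.
    apply (CV_disk_outside V (d0 / 2)).
    - rewrite Rabs_right by lra. exact K.
    - apply ex_series_lim_0. specialize (Hps (d0 / 2) ltac:(rewrite Rabs_right; lra)).
      apply is_pseries_R in Hps. eexists; exact Hps. }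
  set (t := PS_decr_n V 2).
  assert (Htail : forall x, Rabs x < d0 -> dl * (f x - g x) = V 1%nat * x + x ^ 2 * PSeries t x).
  { intros x Hx. assert (T := Hps x Hx). assert (Ex : ex_pseries V x) by (eexists; exact T).
    apply is_pseries_unique in T. rewrite <- T, (PSeries_decr_n V 1 x Ex). simpl. rewrite HV0. unfold t. ring. }
  assert (Hct : continuous (PSeries t) 0).
  { apply continuity_pt_filterlim, PSeries_continuity. rewrite Rabs_R0.
    change t with (PS_decr_1 (PS_decr_1 V)). rewrite !CV_radius_decr_1. exact Hcv. }
  assert (Ht0 : PSeries t 0 = V 2%nat) by (rewrite PSeries_0; reflexivity).
  set (A := dl * (alp - alm)).
  (* After division by x > 0 the two expansions differ by V_1 + x (V_2 - A), which is o(x): first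
     V_1 and then V_2 - A must vanish. *)
  assert (Hest : forall e, 0 < e -> exists d, 0 < d /\ forall x, 0 < x < d ->
      Rabs (V 1%nat + x * (V 2%nat - A)) <= e * x).
  { intros e He. set (K := 2 * Rabs dl + 1). pose proof (Rabs_pos dl).
    assert (He' : 0 < e / (2 * K)) by (apply Rdiv_lt_0_compat; unfold K; lra).
    destruct (Hf _ He') as [d1 [Hd1 F1]]. destruct (Hg _ He') as [d2 [Hd2 F2]].
    destruct (proj1 (continuous_eps _ _) Hct (e / 2) ltac:(lra)) as [d3 [Hd3 F3]].
    exists (Rmin (Rmin d1 d2) (Rmin d3 d0)). split; [repeat apply Rmin_pos; auto|].
    intros x [Hx0 Hx].
    assert (B1 : x < d1) by rmin.
    assert (B2 : x < d2) by rmin.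
    assert (B3 : x < d3) by rmin.
    assert (B0 : x < d0) by rmin.
    assert (Hax : Rabs x = x) by (apply Rabs_right; lra).
    specialize (F1 x ltac:(lra)). specialize (F2 x ltac:(lra)).
    specialize (F3 x ltac:(rewrite Rminus_0_r; lra)). rewrite Ht0 in F3.
    specialize (Htail x ltac:(lra)).
    set (p := f x + x - alp * x ^ 2) in *. set (q := g x + x - alm * x ^ 2) in *.
    set (v := PSeries t x - V 2%nat) in *.
    assert (E : x * (V 1%nat + x * (V 2%nat - A)) = dl * (p - q) - x ^ 2 * v).
    { unfold p, q, v, A. replace (dl * (f x + x - alp * x ^ 2 - (g x + x - alm * x ^ 2)))
        with (dl * (f x - g x) - x ^ 2 * (dl * (alp - alm))) by ring. rewrite Htail. ring. }
    assert (Hx2 : 0 < x ^ 2) by (apply pow_lt; auto).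
    apply Rmult_le_reg_l with x; auto. rewrite <- Hax at 1. rewrite <- Rabs_mult, E.
    apply Rle_trans with (1 := Rabs_triang _ _). rewrite Rabs_Ropp, !Rabs_mult.
    rewrite (Rabs_right (x ^ 2)) by lra.
    assert (S1 : Rabs (p - q) <= 2 * (e / (2 * K) * x ^ 2)).
    { apply Rle_trans with (1 := Rabs_triang _ _). rewrite Rabs_Ropp. lra. }
    assert (S2 : Rabs dl * Rabs (p - q) <= Rabs dl * (2 * (e / (2 * K) * x ^ 2))) by (apply Rmult_le_compat_l; auto).
    assert (S3 : x ^ 2 * Rabs v <= x ^ 2 * (e / 2)) by (apply Rmult_le_compat_l; lra).
    assert (S4 : Rabs dl * (2 * (e / (2 * K) * x ^ 2)) <= e / 2 * x ^ 2).
    { replace (Rabs dl * (2 * (e / (2 * K) * x ^ 2))) with ((2 * Rabs dl) / K * (e / 2 * x ^ 2)) by (field; unfold K; lra).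
      assert (2 * Rabs dl / K <= 1) by (apply (Rdiv_le_1 (2 * Rabs dl) K); unfold K; lra).
      assert (0 <= e / 2 * x ^ 2) by (apply Rmult_le_pos; lra).
      rewrite <- (Rmult_1_l (e / 2 * x ^ 2)) at 2. apply Rmult_le_compat_r; auto. }
    replace (x * (e * x)) with (e / 2 * x ^ 2 + x ^ 2 * (e / 2)) by field. lra. }
  assert (HV1 : V 1%nat = 0).
  { apply NNPP. intros N. assert (Hp := Rabs_pos_lt _ N).
    destruct (Hest 1 Rlt_0_1) as [d [Hd F]].
    set (B := Rabs (V 2%nat - A) + 1). pose proof (Rabs_pos (V 2%nat - A)).
    set (x := Rmin (d / 2) (Rabs (V 1%nat) / (2 * B))).
    assert (0 < x) by (apply Rmin_pos; [lra|apply Rdiv_lt_0_compat; unfold B; lra]).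
    assert (x <= d / 2) by apply Rmin_l.
    assert (Hx2 : x <= Rabs (V 1%nat) / (2 * B)) by apply Rmin_r.
    apply Rmult_le_compat_r with (r := 2 * B) in Hx2; [|unfold B; lra].
    replace (Rabs (V 1%nat) / (2 * B) * (2 * B)) with (Rabs (V 1%nat)) in Hx2 by (field; unfold B; lra).
    specialize (F x ltac:(lra)).
    assert (Tr := Rabs_triang (V 1%nat + x * (V 2%nat - A)) (- (x * (V 2%nat - A)))).
    replace (V 1%nat + x * (V 2%nat - A) + - (x * (V 2%nat - A))) with (V 1%nat) in Tr by ring.
    rewrite Rabs_Ropp, Rabs_mult, (Rabs_right x) in Tr by lra.
    replace (x * (2 * B)) with (2 * (x * Rabs (V 2%nat - A)) + 2 * x) in Hx2 by (unfold B; ring). lra. }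
  apply NNPP. intros N. assert (Hp : 0 < Rabs (V 2%nat - A)) by (apply Rabs_pos_lt; fold A in N; lra).
  destruct (Hest (Rabs (V 2%nat - A) / 2) ltac:(lra)) as [d [Hd F]].
  specialize (F (d / 2) ltac:(lra)). rewrite HV1, Rplus_0_l, Rabs_mult, (Rabs_right (d / 2)) in F by lra.
  rewrite Rmult_comm in F. apply Rmult_le_reg_r in F; lra.
Qed.

(** * Perturbed fields and their cycles *)

Lemma first_integral_mono (F H : R -> R -> R) (E : R -> R) (xl xr ry C xl' xr' C' : R) :
  first_integral F H E xl xr ry C -> xl <= xl' -> xr' <= xr -> C <= C' ->
  first_integral F H E xl' xr' ry C'.
Proof.
  intros (A1 & A2 & A3 & A4 & A5 & A6 & A7) H1 H2 HC.
  split; [lra|]. split; [auto|]. split; [|split; [|split; [|split]]].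
  - intros x x' y y' Hx Hx'. apply Rle_trans with (1 := A3 x x' y y' ltac:(lra) ltac:(lra)).
    apply Rmult_le_compat_r; auto. pose proof (Rabs_pos (x' - x)). pose proof (Rabs_pos (y' - y)). lra.
  - intros x y y' Hx Hy. apply Rle_trans with (1 := A4 x y y' ltac:(lra) Hy).
    apply Rmult_le_compat_r; auto.
    assert (T := pos_of_mul C (H x y' - H x y) A1). specialize (A4 x y y' ltac:(lra) Hy). lra.
  - intros g1 g2 t vx Hx. apply A5. lra.
  - intros x y Hx Hy. destruct (A6 x y ltac:(lra) Hy) as (eta & B1 & B2). exists eta. split; auto.
    intros s Hs. destruct (B2 s ltac:(lra)) as (D1 & D2 & D3). split; auto. split; auto.
    intros s'. apply Rle_trans with (1 := D2 s'). apply Rmult_le_compat_r; auto. apply Rabs_pos.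
  - intros x Hx. apply A7. lra.
Qed.

Lemma first_integral_shift (F H : R -> R -> R) (E : R -> R) (xl xr ry C b : R) :
  first_integral F H E xl xr ry C ->
  first_integral (fun x y => F (x - b) y) (fun x y => H (x - b) y) (fun x => E (x - b)) (xl + b) (xr + b) ry C.
Proof.
  intros (A1 & A2 & A3 & A4 & A5 & A6 & A7).
  assert (Hsh : forall (f : R -> R) x l, is_derive f (x - b) l -> is_derive (fun x => f (x - b)) x l).
  { intros f x l Hf. replace l with (1 * l) by ring.
    apply (is_derive_comp f (fun x => x - b)); [exact Hf|]. auto_derive; auto. }
  split; [lra|]. split; [auto|]. split; [|split; [|split; [|split]]].
  - intros x x' y y' Hx Hx'. replace (x' - x) with ((x' - b) - (x - b)) by ring. apply A3; lra.
  - intros x y y' Hx Hy. apply A4; lra.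
  - intros g1 g2 t vx Hx Hy D1 D2. apply (A5 (fun s => g1 s - b) g2 t vx); [lra|auto| |exact D2].
    replace vx with (vx - 0) by ring. apply (is_derive_minus g1 (fun _ => b) t vx 0); [exact D1|].
    exact (is_derive_const b t).
  - intros x y Hx Hy. destruct (A6 (x - b) y ltac:(lra) Hy) as (eta & B1 & B2).
    exists (fun s => eta (s - b)). split; auto.
    intros s Hs. destruct (B2 (s - b) ltac:(lra)) as (D1 & D2 & D3 & D4).
    split; [exact D1|]. split; [|split; [exact D3|apply (Hsh eta); exact D4]].
    intros s'. replace (s - s') with ((s - b) - (s' - b)) by ring. apply D2.
  - intros x Hx. destruct (A7 (x - b) ltac:(lra)) as [B1 B2]. split; auto. apply (Hsh (fun x => H x 0)). exact B2.
Qed.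

(** Small coefficients also make the polynomial bounded by 1 and 1-Lipschitz on [-1, 1]: the
    perturbed slope then satisfies the old estimates with constants increased by 1, independently of
    the polynomial. *)
Lemma poly_small (m : nat) (t : R) : 0 < t -> exists tau, 0 < tau /\ forall c, (forall j, Rabs (c j) <= tau) ->
  poly_norm m c < t /\
  forall x y, Rabs x <= 1 -> Rabs y <= 1 ->
    Rabs (poly_eval m c x) <= 1 /\ Rabs (poly_eval m c x - poly_eval m c y) <= Rabs (x - y).
Proof.
  intros Ht.
  assert (H : exists B, 0 < B /\ forall tau c, 0 < tau -> (forall j, Rabs (c j) <= tau) ->
    sum_f_R0 (fun j => c j ^ 2) m <= B * tau ^ 2 /\
    forall x y, Rabs x <= 1 -> Rabs y <= 1 ->
      Rabs (poly_eval m c x) <= B * tau /\ Rabs (poly_eval m c x - poly_eval m c y) <= B * tau * Rabs (x - y)).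
  { assert (Hp : forall x j, Rabs x <= 1 -> Rabs (x ^ j) <= 1).
    { intros x j Hx. rewrite <- (pow1 j). apply pow_abs_le; auto. }
    induction m as [|m [B [HB IH]]].
    - exists 1. split; [lra|]. intros tau c Htau Hc. specialize (Hc 0%nat). simpl. split.
      + replace (c 0%nat * (c 0%nat * 1)) with (c 0%nat ^ 2) by ring.
        rewrite <- pow2_abs. pose proof (Rabs_pos (c 0%nat)). nra.
      + intros x y _ _. unfold poly_eval. simpl. rewrite Rminus_diag, Rabs_R0, !Rmult_1_r, Rmult_1_l.
        split; auto. apply Rmult_le_pos; [lra|apply Rabs_pos].
    - pose proof (pos_INR (S m)). exists (B + (1 + INR (S m))). split; [lra|]. intros tau c Htau Hc.
      destruct (IH tau c Htau Hc) as [I1 I2]. specialize (Hc (S m)). pose proof (Rabs_pos (c (S m))).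
      assert (Hm : 0 <= INR (S m) * tau) by (apply Rmult_le_pos; lra). split.
      + cbn [sum_f_R0]. rewrite <- (pow2_abs (c (S m))).
        assert (Rabs (c (S m)) ^ 2 <= tau ^ 2) by (apply pow_incr; lra).
        assert (0 <= INR (S m) * tau ^ 2) by (apply Rmult_le_pos; [lra|apply pow2_ge_0]). lra.
      + intros x y Hx Hy. destruct (I2 x y Hx Hy) as [J1 J2]. rewrite !poly_eval_S. split.
        * apply Rle_trans with (1 := Rabs_triang _ _). rewrite Rabs_mult.
          assert (Rabs (c (S m)) * Rabs (x ^ S m) <= tau * 1) by (apply Rmult_le_compat; auto; apply Rabs_pos). lra.
        * replace (poly_eval m c x + c (S m) * x ^ S m - (poly_eval m c y + c (S m) * y ^ S m))
            with ((poly_eval m c x - poly_eval m c y) + c (S m) * (x ^ S m - y ^ S m)) by ring.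
          apply Rle_trans with (1 := Rabs_triang _ _). rewrite Rabs_mult.
          assert (Hpl := pow_lipschitz 1 x y (S m) Hx Hy). rewrite pow1, Rmult_1_r in Hpl.
          assert (Rabs (c (S m)) * Rabs (x ^ S m - y ^ S m) <= tau * (INR (S m) * Rabs (x - y)))
            by (apply Rmult_le_compat; auto; try apply Rabs_pos; lra).
          assert (0 <= tau * Rabs (x - y)) by (apply Rmult_le_pos; [lra|apply Rabs_pos]). lra. }
  destruct H as [B [HB H]].
  set (tau := Rmin (/ B) (Rmin 1 (t ^ 2 / (2 * B)))).
  assert (Ht2 : 0 < t ^ 2) by (apply pow_lt; auto).
  assert (HiB : 0 < / B) by (apply Rinv_0_lt_compat; auto).
  assert (Htau : 0 < tau) by (repeat apply Rmin_pos; try lra; apply Rdiv_lt_0_compat; lra).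
  assert (T1 : tau <= / B) by apply Rmin_l.
  assert (T2 : tau <= 1) by rmin.
  assert (T3 : tau <= t ^ 2 / (2 * B)) by rmin.
  assert (HBt : B * tau <= 1).
  { apply Rmult_le_compat_l with (r := B) in T1; [|lra]. rewrite Rinv_r in T1; lra. }
  exists tau. split; auto. intros c Hc. destruct (H tau c Htau Hc) as [I1 I2]. split.
  - unfold poly_norm. rewrite <- (sqrt_pow2 t) by lra. apply sqrt_lt_1_alt. split.
    + apply cond_pos_sum. intros j. apply pow2_ge_0.
    + apply Rle_lt_trans with (1 := I1).
      apply Rmult_le_compat_r with (r := 2 * B) in T3; [|lra].
      replace (t ^ 2 / (2 * B) * (2 * B)) with (t ^ 2) in T3 by (field; lra).
      assert (B * tau ^ 2 <= B * tau) by (apply Rmult_le_compat_l; [lra|]; nra). lra.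
  - intros x y Hx Hy. destruct (I2 x y Hx Hy) as [J1 J2]. split; [lra|].
    apply Rle_trans with (1 := J2). rewrite <- (Rmult_1_l (Rabs (x - y))) at 2.
    apply Rmult_le_compat_r; [apply Rabs_pos|auto].
Qed.

Lemma smooth_y_add_x (F F' Fy : R -> R -> R) (P : R -> R) (r K : R) :
  smooth_y F Fy r K -> (forall x y, box r x y -> F' x y = F x y + P x) ->
  (forall x y, Rabs x <= r -> Rabs y <= r -> Rabs (P x - P y) <= Rabs (x - y)) ->
  smooth_y F' Fy r (K + 1).
Proof.
  intros (H1 & H2 & H3) HF HP. split; [|split].
  - intros x y x' y' Hb Hb'. rewrite !HF by auto.
    replace (F x y + P x - (F x' y' + P x')) with ((F x y - F x' y') + (P x - P x')) by ring.
    apply Rle_trans with (1 := Rabs_triang _ _).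
    specialize (H1 _ _ _ _ Hb Hb'). specialize (HP x x' (proj1 Hb) (proj1 Hb')).
    pose proof (Rabs_pos (y - y')). lra.
  - intros x y x' y' Hb Hb'. specialize (H2 _ _ _ _ Hb Hb').
    pose proof (Rabs_pos (y - y')). pose proof (Rabs_pos (x - x')). lra.
  - intros x y y' Hb Hb'. rewrite !HF by auto.
    replace (F x y' + P x - (F x y + P x) - (y' - y) * Fy x y) with (F x y' - F x y - (y' - y) * Fy x y) by ring.
    specialize (H3 x y y' Hb Hb'). pose proof (pow2_ge_0 (y' - y)). lra.
Qed.

Lemma bound_shrink (a : nat -> R) (rho rho' M : R) :
  power_series_bound a rho M -> 0 <= rho' <= rho -> power_series_bound a rho' M.
Proof.
  intros H Hr n. apply Rle_trans with (2 := H n). apply Rmult_le_compat_l; [apply Rabs_pos|].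
  apply pow_incr; auto.
Qed.

Lemma sign_of_nonzero (x : R) : x <> 0 -> sign x = 1 \/ sign x = -1.
Proof.
  intros H. destruct (Rdichotomy _ _ H); [right; apply sign_eq_m1|left; apply sign_eq_1]; auto.
Qed.

(* A field with a tangency of order n at the origin: on the axis its components are
   the sum of [a] and x^n times the sum of [d]; sg is the side of the half-plane. *)
Record tangent_field (W : vector_field) (sg : R) (n : nat) (Fy : R -> R -> R) (r K m Mx M : R)
    (a d : nat -> R) (rho N : R) : Prop := {
  tf_r : 0 < r;
  tf_K : 0 <= K;
  tf_m : 0 < m;
  tf_dom : forall x y, box r x y -> vdom W (x, y);
  tf_X : forall x y, box r x y -> m <= vX W x y * sign (vX W 0 0) <= Mx;
  tf_lipX : lipschitz_box (vX W) r K;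
  tf_lipY : lipschitz_box (vY W) r K;
  tf_smooth : smooth_y (slope W) Fy r K;
  tf_bound : forall x y, box r x y -> Rabs (slope W x y) <= M;
  tf_rho : 0 < rho <= r;
  tf_a : power_series_bound a rho N;
  tf_d : power_series_bound d rho N;
  tf_axis : forall x, Rabs x < rho -> vX W x 0 = PSeries a x /\ vY W x 0 = x ^ n * PSeries d x;
  tf_X0 : vX W 0 0 <> 0;
  tf_sign : sg * (PSeries d 0 * PSeries a 0) < 0 }.

Arguments tf_K {W sg n Fy r K m Mx M a d rho N} _.
Arguments tf_X {W sg n Fy r K m Mx M a d rho N} _.
Arguments tf_X0 {W sg n Fy r K m Mx M a d rho N} _.
Arguments tf_dom {W sg n Fy r K m Mx M a d rho N} _.
Arguments tf_m {W sg n Fy r K m Mx M a d rho N} _.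
Arguments tf_r {W sg n Fy r K m Mx M a d rho N} _.
Arguments tf_sign {W sg n Fy r K m Mx M a d rho N} _.

Lemma tangent_field_exists (W : vector_field) (sg : R) (k : nat) :
  (1 <= k)%nat -> analytic_field W -> tangency_order W k ->
  sg * (vX W 0 0 * dxY W (2 * k - 1)) < 0 ->
  exists Fy r K m Mx M a d rho N, tangent_field W sg (2 * k - 1) Fy r K m Mx M a d rho N.
Proof.
  intros Hk HW (HX0 & HY0 & HYi & HYn) Hsg. set (n := (2 * k - 1)%nat) in *.
  destruct (analytic_field_regular W HW HX0) as
    (Fy & r & C & m & a & b & rho0 & M0 & (Hr & Hm & Hdom & HmX & HLX & HLY & HF) & Hrho0 & Ha & Hb & Hax).
  destruct (lipschitz_box_bounded _ r C (Rlt_le _ _ Hr) HLX) as [Mx [HMx HMx']].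
  destruct (lipschitz_box_bounded _ r C (Rlt_le _ _ Hr) (proj1 HF)) as [M [HM HM']].
  assert (HC : C <= Rmax 0 C) by apply Rmax_r.
  set (rho := Rmin r rho0). assert (Hrho : 0 < rho) by (apply Rmin_pos; auto).
  assert (Hrho1 : rho <= r) by apply Rmin_l. assert (Hrho2 : rho <= rho0) by apply Rmin_r.
  destruct (Hax 0 ltac:(rewrite Rabs_R0; auto)) as [Q1 Q2].
  apply is_pseries_unique in Q1. apply is_pseries_unique in Q2.
  (* The tangency conditions become vanishing of the coefficients below n = 2k - 1, so Y on the axis
     is x^n times a series with nonzero constant term. *)
  assert (Hdx : forall i, dxY W i = b i * INR (Factorial.fact i)).
  { intros i. unfold dxY. rewrite <- Derive_n_coef.
    - apply Derive_n_ext_loc. exists (mkposreal rho0 Hrho0). intros x Hx. symmetry.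
      apply is_pseries_unique. apply (Hax x). unfold ball in Hx; simpl in Hx; unfold AbsRing_ball, abs, minus, plus, opp in Hx; simpl in Hx.
      rewrite Ropp_0, Rplus_0_r in Hx. exact Hx.
    - replace 0 with (Rabs 0) by apply Rabs_R0. apply (bound_radius b rho0 M0); auto. rewrite Rabs_R0; auto. }
  assert (Hb0 : forall i, (i < n)%nat -> b i = 0).
  { intros i Hi. destruct i as [|i].
    - rewrite <- PSeries_0, Q2. exact HY0.
    - assert (T := HYi (S i) ltac:(unfold n in Hi; lia)). rewrite Hdx in T.
      apply Rmult_integral in T. destruct T as [T|T]; auto. exfalso. exact (INR_fact_neq_0 _ T). }
  set (d := PS_decr_n b n).
  assert (Hbd : power_series_bound d rho0 (M0 / rho0 ^ n)) by (apply bound_decr; auto).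
  assert (Hd0 : PSeries d 0 = b n) by (rewrite PSeries_0; unfold d, PS_decr_n; f_equal; lia).
  exists Fy, r, (Rmax 0 C), m, Mx, M, a, d, rho, (Rmax M0 (M0 / rho0 ^ n)). constructor; auto.
  - apply Rmax_l.
  - intros x y Hb'. split; auto. apply Rle_trans with (2 := HMx' x y Hb').
    apply Rle_trans with (1 := Rle_abs _). rewrite Rabs_mult.
    destruct (sign_of_nonzero _ HX0) as [-> | ->]; [rewrite Rabs_R1|rewrite (Rabs_left (-1)) by lra]; lra.
  - apply lipschitz_box_mono with r C; auto; lra.
  - apply lipschitz_box_mono with r C; auto; lra.
  - apply smooth_y_mono with r C; auto; lra.
  - apply bound_shrink with rho0; [|lra]. apply bound_mono with M0; auto. apply Rmax_l.
  - apply bound_shrink with rho0; [|lra]. apply bound_mono with (1 := Hbd). apply Rmax_r.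
  - intros x Hx. destruct (Hax x ltac:(lra)) as [P1 P2]. split.
    + symmetry. apply is_pseries_unique; auto.
    + apply is_pseries_unique in P2. rewrite <- P2. apply PSeries_decr_n_aux; auto.
  - rewrite Hd0, Q1. rewrite Hdx in Hsg.
    apply Rmult_lt_reg_r with (INR (Factorial.fact n)); [apply INR_fact_lt_0|]. lra.
Qed.

(* After the unfolding the zero (2i+1) e is simple; this is the product of the factors
   x - j e for the other zeros, in the coordinate centred at (2i+1) e. *)
Definition cofactor (k : nat) (e : R) (i : nat) (x : R) : R :=
  nodes e 1 (2 * i) (INR (2 * i + 1) * e + x) *
  nodes e (2 * i + 2) (2 * (k - 1 - i)) (INR (2 * i + 1) * e + x).

Lemma nodes_cofactor (k : nat) (e : R) (i : nat) (x : R) : (i < k)%nat ->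
  nodes e 1 (2 * k - 1) (INR (2 * i + 1) * e + x) = x * cofactor k e i x.
Proof.
  intros Hi. unfold cofactor.
  replace (2 * k - 1)%nat with (2 * i + (1 + 2 * (k - 1 - i)))%nat by lia.
  rewrite !nodes_cat. replace (1 + 2 * i + 1)%nat with (2 * i + 2)%nat by lia.
  cbn [nodes]. replace (1 + 2 * i + 0)%nat with (2 * i + 1)%nat by lia. ring.
Qed.

(** An odd multiple of e has an even number of other zeros on each side, so the tangency there
    inherits the sign of the original one and is invisible. *)
Lemma cofactor_pos (k : nat) (e : R) (i : nat) (x : R) :
  0 < e -> - (e / 2) < x < e / 2 -> 0 < cofactor k e i x.
Proof.
  intros He Hx. unfold cofactor. apply Rmult_lt_0_compat.
  - apply nodes_pos_right; [lra|]. replace (1 + 2 * i)%nat with (2 * i + 1)%nat by lia. lra.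
  - apply nodes_pos_left; [lra|]. replace (2 * i + 2)%nat with (S (2 * i + 1)) by lia. rewrite S_INR. lra.
Qed.

Lemma cofactor_ex_derive (k : nat) (e : R) (i : nat) (x : R) : ex_derive (cofactor k e i) x.
Proof.
  apply (ex_derive_mult (fun x => nodes e 1 (2 * i) (INR (2 * i + 1) * e + x))
           (fun x => nodes e (2 * i + 2) (2 * (k - 1 - i)) (INR (2 * i + 1) * e + x)));
    (apply (ex_derive_comp (nodes e _ _) (fun x => INR (2 * i + 1) * e + x)); [apply nodes_ex_derive|auto_derive; auto]).
Qed.

(* The logarithmic derivative at 0 of (Y / (x^n X)) E, up to the sign; the second
   Lyapunov coefficient compares its values for the two fields. *)
Definition bending (Fy : R -> R -> R) (a d : nat -> R) : R := log_derivative d 0 - log_derivative a 0 - Fy 0 0.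

Section TangentField.

Context {W : vector_field} {sg : R} {n : nat} {Fy : R -> R -> R} {r K m Mx M : R}
  {a d : nat -> R} {rho N : R}.
Hypothesis HT : tangent_field W sg n Fy r K m Mx M a d rho N.
Hypothesis sg_unit : sg = 1 \/ sg = -1.

Lemma tf_X_nonzero (x y : R) : box r x y -> m <= Rabs (vX W x y) /\ vX W x y <> 0.
Proof.
  intros Hb. assert (Hm := tf_m HT).
  assert (HX := proj1 (tf_X HT x y Hb)).
  assert (m <= Rabs (vX W x y)).
  { apply Rle_trans with (1 := HX). apply Rle_trans with (1 := Rle_abs _). rewrite Rabs_mult.
    destruct (sign_of_nonzero _ (tf_X0 HT)) as [-> | ->];
      [rewrite Rabs_R1|rewrite (Rabs_left (-1)) by lra]; lra. }
  split; auto. intros E. rewrite E, Rabs_R0 in *. lra.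
Qed.

Lemma tf_a0 : PSeries a 0 <> 0.
Proof. intros E. assert (T := tf_sign HT). rewrite E in T. lra. Qed.

Lemma tf_d0 : PSeries d 0 <> 0.
Proof. intros E. assert (T := tf_sign HT). rewrite E in T. lra. Qed.

Lemma quotient_sign (d' a' : R) : 0 < d' * PSeries d 0 -> 0 < a' * PSeries a 0 -> a' <> 0 /\ sg * (d' * / a') < 0.
Proof.
  intros H1 H2. assert (HS := tf_sign HT).
  assert (Ha' : a' <> 0) by (intros ->; lra). split; auto.
  set (d0 := PSeries d 0) in *. set (a0 := PSeries a 0) in *.
  assert (T : 0 < (- (sg * (d0 * a0))) * ((d' * d0) * (a' * a0))).
  { apply Rmult_lt_0_compat; [lra|]. apply Rmult_lt_0_compat; auto. }
  assert (Hq : 0 < (a' * (d0 * a0)) ^ 2).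
  { apply pow2_gt_0. apply Rmult_integral_contrapositive_currified; auto.
    apply Rmult_integral_contrapositive_currified; [apply tf_d0|apply tf_a0]. }
  apply Rmult_lt_reg_r with ((a' * (d0 * a0)) ^ 2); auto.
  replace (sg * (d' * / a') * (a' * (d0 * a0)) ^ 2) with (- ((- (sg * (d0 * a0))) * ((d' * d0) * (a' * a0)))) by (field; auto).
  lra.
Qed.

Lemma self_close (b : nat -> R) (t : R) : 0 < t -> power_series_bound (fun i => b i - b i) rho t.
Proof. intros Ht i. rewrite Rminus_diag, Rabs_R0. lra. Qed.

(** The unperturbed field is handled with p = 0 and no cofactor. The half-return map is a given one;
    [half_return_level] shows that it preserves the level, and the expansion of involutions
    applies. *)
Lemma half_return_expansion (phi : R -> R) : Nat.Odd n -> half_return_map W sg phi ->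
  forall e, 0 < e -> exists t, 0 < t /\ forall x, 0 < Rabs x < t ->
    Rabs (phi x + x - - (2 / (INR n + 2)) * bending Fy a d * x ^ 2) <= e * x ^ 2.
Proof.
  intros Hn Hphi. destruct HT as [Hr HK Hm Hdom HX HLX HLY HF HB Hrho Ha Hd Hax HX0 Hs].
  set (r' := Rmin r (/ (4 * (K + 1)))).
  assert (Hi : 0 < / (4 * (K + 1))) by (apply Rinv_0_lt_compat; lra).
  assert (Hr' : 0 < r') by (apply Rmin_pos; auto).
  assert (Hr'1 : r' <= r) by apply Rmin_l.
  assert (Hr'2 : 4 * (K * r') <= 1).
  { assert (T : r' <= / (4 * (K + 1))) by apply Rmin_r.
    apply Rmult_le_compat_l with (r := 4 * (K + 1)) in T; [|lra]. rewrite Rinv_r in T by lra. lra. }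
  assert (HM : 0 <= M) by (assert (T := HB 0 0 ltac:(split; rewrite Rabs_R0; lra)); pose proof (Rabs_pos (slope W 0 0)); lra).
  destruct (log_derivative_close d rho N ltac:(lra) Hd tf_d0 1 Rlt_0_1) as (t1 & Ht1 & C1).
  destruct (log_derivative_close a rho N ltac:(lra) Ha tf_a0 1 Rlt_0_1) as (t2 & Ht2 & C2).
  destruct (C1 d (self_close d t1 Ht1)) as [S1 _]. destruct (C2 a (self_close a t2 Ht2)) as [S2 _].
  set (rho' := Rmin rho (r' / (4 * (M + 1)))).
  assert (Hi2 : 0 < r' / (4 * (M + 1))) by (apply Rdiv_lt_0_compat; lra).
  assert (Hrho' : 0 < rho') by (apply Rmin_pos; lra).
  assert (R1 : rho' <= rho) by apply Rmin_l.
  assert (R2 : 4 * ((M + 1) * rho') <= r').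
  { assert (T : rho' <= r' / (4 * (M + 1))) by apply Rmin_r.
    apply Rmult_le_compat_l with (r := 4 * (M + 1)) in T; [|lra].
    replace (4 * (M + 1) * (r' / (4 * (M + 1)))) with r' in T by (field; lra). lra. }
  assert (HMrho : 0 <= M * rho') by (apply Rmult_le_pos; lra).
  destruct (first_integral_exists (slope W) Fy r' K M rho' Hr' HK) with (p := 0) as (H & E & C & HI & HE0 & HE1); try lra.
  { apply smooth_y_mono with r K; auto; lra. }
  { intros x y [Hx Hy]. apply HB. split; lra. }
  set (s := Rmin rho' (Rmin t1 t2)). assert (Hs0 : 0 < s) by (apply Rmin_pos; [exact Hrho'|apply Rmin_pos; auto]).
  assert (s1 : s <= rho') by apply Rmin_l.
  assert (s2 : s <= t1) by rmin.
  assert (s3 : s <= t2) by rmin.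
  destruct (tangency_valley (slope W) H E (fun _ => 1) a d sg 0 rho' N N r' C s (Fy 0 0) 0 n) as (w & w1 & Hv & Hw & Ew & _); auto; try lra.
  { apply bound_shrink with rho; auto; lra. }
  { apply bound_shrink with rho; auto; lra. }
  { exact (is_derive_const 1 0). }
  { intros x Hx. rewrite !Rplus_0_l. destruct (Hax x ltac:(lra)) as [X1 X2].
    assert (Q := quotient_sign _ _ (S1 x ltac:(lra)) (S2 x ltac:(lra))).
    split; [|split; [apply Q|split; [lra|apply Q]]].
    unfold slope. rewrite X1, X2. ring. }
  assert (Hv' : valley (fun x => sg * H x 0) w n s).
  { destruct Hv as [V1 V2]. split; auto. intros x Hx. destruct (V2 x Hx) as [V3 V4]. split; auto.
    apply is_derive_ext with (2 := V3). intros t. cbv beta. rewrite Rplus_0_l. reflexivity. }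
  assert (HL := half_return_level W sg rho' r' C s phi H E w n sg_unit HI).
  destruct HL as (t & Ht & HL); auto; try lra.
  { intros x y Hx Hy. apply tf_X_nonzero. split; lra. }
  intros e He.
  destruct (valley_expansion _ w phi n s w1 Hs0 Hv' Hw) with (e := e) as (t3 & Ht3 & HH); auto.
  { exists t. split; auto. }
  exists t3. split; auto. intros x Hx. specialize (HH x Hx). rewrite Ew in HH.
  unfold bending. replace (0 / 1 + (log_derivative d 0 - log_derivative a 0 - Fy 0 0)) with (log_derivative d 0 - log_derivative a 0 - Fy 0 0) in HH by field.
  exact HH.
Qed.

(** One polynomial serves all k tangencies, and [rho'] does not depend on the accuracy. The
    logarithmic derivative of the cofactor is kept exact, since it need not stay bounded as e tends
    to 0; it depends on k, e, i only and will cancel between the two fields. The constant K + 1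
    leaves room for the polynomial in the slope. *)
Lemma unfolding (k : nat) (r' : R) :
  (1 <= k)%nat -> n = (2 * k - 1)%nat -> 0 < r' -> r' <= r -> r' <= 1 -> 4 * ((K + 1) * r') <= 1 ->
  exists rho', 0 < rho' <= r' /\ forall eta, 0 < eta -> exists e0, 0 < e0 /\ forall e, 0 < e < e0 ->
    exists c, (forall j, Rabs (c j) <= eta) /\ forall i, (i < k)%nat ->
      let W' := perturb_field W (poly_eval (2 * k - 2) c) in
      let p := INR (2 * i + 1) * e in
      exists (H : R -> R -> R) (E w : R -> R) (w1 C : R),
        first_integral (slope W') H E (- rho') rho' r' C /\
        lipschitz_box (vX W') r' C /\ lipschitz_box (vY W') r' C /\
        valley (fun x => sg * H (p + x) 0) w 1 (e / 2) /\ is_derive w 0 w1 /\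
        Rabs (w1 / w 0 - (Derive (cofactor k e i) 0 / cofactor k e i 0 + bending Fy a d)) <= eta /\
        (forall x, Rabs x < e / 2 -> x * w x = sg * (- slope W' (p + x) 0 * E (p + x))) /\
        p + e <= rho'.
Proof.
  intros Hk Hnk Hr' Hr'r Hr'1 Hr'K. destruct HT as [Hr HK Hm Hdom HX HLX HLY HF HB Hrho Ha Hd Hax HX0 Hs].
  assert (HM : 0 <= M) by (assert (T := HB 0 0 ltac:(split; rewrite Rabs_R0; lra)); pose proof (Rabs_pos (slope W 0 0)); lra).
  destruct (lipschitz_box_bounded _ r K (Rlt_le _ _ Hr) HLX) as [A [HA HA']].
  set (rho' := Rmin rho (r' / (4 * (M + 1)))).
  assert (Hi2 : 0 < r' / (4 * (M + 1))) by (apply Rdiv_lt_0_compat; lra).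
  assert (Hrho' : 0 < rho') by (apply Rmin_pos; lra).
  assert (R1 : rho' <= rho) by apply Rmin_l.
  assert (R2 : 4 * ((M + 1) * rho') <= r').
  { assert (T : rho' <= r' / (4 * (M + 1))) by apply Rmin_r.
    apply Rmult_le_compat_l with (r := 4 * (M + 1)) in T; [|lra].
    replace (4 * (M + 1) * (r' / (4 * (M + 1)))) with r' in T by (field; lra). lra. }
  assert (HMrho : 0 <= M * rho') by (apply Rmult_le_pos; lra).
  exists rho'. split; [lra|]. intros eta Heta.
  destruct (poly_small (2 * k - 2) 1 Rlt_0_1) as (t0 & Ht0 & HP).
  destruct (log_derivative_close d rho N ltac:(lra) Hd tf_d0 (eta / 3) ltac:(lra)) as (t1 & Ht1 & C1).
  destruct (log_derivative_close a rho N ltac:(lra) Ha tf_a0 (eta / 3) ltac:(lra)) as (t2 & Ht2 & C2).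
  destruct (C2 a (self_close a t2 Ht2)) as [S2 L2].
  set (t := Rmin (Rmin t1 eta) t0).
  assert (Ht : 0 < t) by (unfold t; repeat apply Rmin_pos; auto).
  assert (T1 : t <= t1) by rmin.
  assert (T2 : t <= eta) by rmin.
  assert (T3 : t <= t0) by apply Rmin_r.
  destruct (unfold_zeros a d rho N m ltac:(lra) Ha Hd Hm) with (n := n) (eta := t) as (e1 & He1 & HU); auto.
  { intros x Hx. destruct (Hax x Hx) as [<- _]. apply tf_X_nonzero. split; [lra|rewrite Rabs_R0; lra]. }
  (* All zeros lie below 2k e, which is kept below z, where the two logarithmic derivatives and the
     y-derivative of the slope each differ by at most eta / 3 from their values at 0. *)
  set (z := Rmin (Rmin t1 t2) (Rmin rho' (eta / (3 * (K + 1))))).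
  assert (Hz0 : 0 < eta / (3 * (K + 1))) by (apply Rdiv_lt_0_compat; lra).
  assert (Hz : 0 < z) by (unfold z; apply Rmin_pos; apply Rmin_pos; auto).
  assert (Z1 : z <= t1) by rmin.
  assert (Z2 : z <= t2) by rmin.
  assert (Z3 : z <= rho') by rmin.
  assert (Z4 : K * z <= eta / 3).
  { assert (T : z <= eta / (3 * (K + 1))) by rmin.
    apply Rmult_le_compat_l with (r := K + 1) in T; [|lra].
    replace ((K + 1) * (eta / (3 * (K + 1)))) with (eta / 3) in T by (field; lra). lra. }
  set (k2 := INR (2 * k)). assert (Hk2 : 0 < k2) by (apply lt_0_INR; lia).
  exists (Rmin e1 (z / k2)). split; [apply Rmin_pos; auto; apply Rdiv_lt_0_compat; auto|].
  intros e [He0 He].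
  assert (He1' : e < e1) by rmin.
  assert (Hez : k2 * e < z).
  { assert (T : e < z / k2) by rmin.
    apply Rmult_lt_compat_l with (r := k2) in T; auto. replace (k2 * (z / k2)) with z in T by (field; lra). exact T. }
  destruct (HU e (conj He0 He1')) as (c & d' & Hc & Hcn & Hdd & Heq).
  assert (Hdd' : power_series_bound (fun i => d' i - d i) rho t1) by (apply bound_mono with t; auto).
  assert (Hd' : power_series_bound d' rho (N + t)).
  { intros i. assert (T := bound_plus _ _ _ _ _ (Rlt_le _ _ (proj1 Hrho)) Hd Hdd i). cbv beta in T.
    replace (d i + (d' i - d i)) with (d' i) in T by ring. exact T. }
  destruct (C1 d' Hdd') as [S1 L1].
  exists c. split; [intros j; specialize (Hc j); lra|]. intros i Hi W' p.
  set (P := poly_eval (2 * k - 2) c) in *.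
  destruct (HP c) as [_ HP']; [intros j; specialize (Hc j); lra|]. fold P in HP'.
  assert (HPc : forall x, poly_eval n c x = P x).
  { intros x. unfold P. replace n with (S (2 * k - 2)) by lia. rewrite poly_eval_S.
    rewrite (Hcn (S (2 * k - 2))) by lia. ring. }
  assert (Hslope : forall x y, box r' x y -> slope W' x y = slope W x y + P x).
  { intros x y [Hx Hy]. unfold slope, W'. simpl. field. apply tf_X_nonzero. split; lra. }
  assert (Hp : p + e <= k2 * e).
  { unfold p, k2. assert (Hle : INR (2 * i + 1) + 1 <= INR (2 * k)) by (rewrite <- S_INR; apply le_INR; lia).
    apply Rmult_le_compat_r with (r := e) in Hle; lra. }
  assert (Hp0 : 0 < p) by (apply Rmult_lt_0_compat; auto; apply lt_0_INR; lia).
  destruct (first_integral_exists (slope W') Fy r' (K + 1) (M + 1) rho' Hr' ltac:(lra)) with (p := p)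
    as (H & E & C & HI & HE0 & HE1); try lra.
  { apply smooth_y_add_x with (slope W) P; auto.
    - apply smooth_y_mono with r K; auto; lra.
    - intros x y Hx Hy. apply HP'; lra. }
  { intros x y Hb. rewrite Hslope by auto. apply Rle_trans with (1 := Rabs_triang _ _).
    apply Rplus_le_compat; [apply HB; split; destruct Hb; lra|]. destruct (HP' x x) as [HPb _]; auto; destruct Hb; lra. }
  destruct (tangency_valley (slope W') H E (cofactor k e i) a d' sg p rho' N (N + t) r' C (e / 2) (Fy p 0) (Derive (cofactor k e i) 0) 1)
    as (w & w1 & Hv & Hw & Ew & Exw); auto; try lra.
  { apply bound_shrink with rho; auto; lra. }
  { apply bound_shrink with rho; auto; lra. }
  { exists 0%nat. reflexivity. }
  { apply Derive_correct. apply cofactor_ex_derive. }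
  { intros x Hx. apply Rabs_def2 in Hx.
    assert (Hpx : Rabs (p + x) < z) by (apply Rabs_def1; lra).
    assert (Q := quotient_sign _ _ (S1 (p + x) ltac:(lra)) (S2 (p + x) ltac:(lra))).
    split; [|split; [apply Q|split; [apply cofactor_pos; auto; lra|apply Q]]].
    destruct (Hax (p + x) ltac:(lra)) as [X1 X2]. specialize (Heq (p + x) ltac:(lra)).
    unfold slope, W'. simpl. rewrite X1, X2, <- HPc, Heq.
    assert (Hnc := nodes_cofactor k e i x Hi). fold p in Hnc. rewrite Hnk, Hnc. ring. }
  (* One constant for the first integral and both components: on the box, Y + X P has Lipschitz
     constant K + (K + A), since P is bounded by 1 and 1-Lipschitz and X is bounded by A. *)
  set (D := Rmax C (K + (K + A))).
  assert (D1 : C <= D) by apply Rmax_l. assert (D2 : K + (K + A) <= D) by apply Rmax_r.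
  exists H, E, w, w1, D.
  split; [apply first_integral_mono with (1 := HI); lra|].
  split; [apply lipschitz_box_mono with r K; auto; lra|].
  split.
  { apply lipschitz_box_mono with r' (K + (K * 1 + A * 1)); [|lra|lra].
    apply (lipschitz_box_plus (vY W) (fun x y => vX W x y * P x)).
    - apply lipschitz_box_mono with r K; auto; lra.
    - apply (lipschitz_box_mult (vX W) (fun x y => P x)).
      + apply lipschitz_box_mono with r K; auto; lra.
      + intros x y x' y' [Hx _] [Hx' _]. destruct (HP' x x') as [_ HPl]; try lra.
        pose proof (Rabs_pos (y - y')). lra.
      + intros x y [Hx Hy]. apply HA'. split; lra.
      + intros x y [Hx _]. destruct (HP' x x) as [HPb _]; auto; lra. }
  split; [exact Hv|]. split; [exact Hw|]. split; [|split; [|lra]].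
  - rewrite Ew. unfold bending.
    assert (Hpz : Rabs p < z) by (apply Rabs_def1; lra).
    specialize (L1 p ltac:(lra)). specialize (L2 p ltac:(lra)).
    assert (L3 : Rabs (Fy p 0 - Fy 0 0) <= eta / 3).
    { destruct HF as (_ & HFl & _). specialize (HFl p 0 0 0).
      apply Rle_trans with (1 := HFl ltac:(split; rewrite ?Rabs_R0; lra) ltac:(split; rewrite ?Rabs_R0; lra)).
      rewrite !Rminus_0_r, Rabs_R0, Rplus_0_r. apply Rle_trans with (2 := Z4). apply Rmult_le_compat_l; lra. }
    apply Rabs_le_between in L1. apply Rabs_le_between in L2. apply Rabs_le_between in L3.
    apply Rabs_le. lra.
  - intros x Hx. rewrite <- (Exw x Hx). ring.
Qed.

End TangentField.

Record fold_side (W : vector_field) (b o : bool) (p e r rho m Mx C : R)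
    (H : R -> R -> R) (E w : R -> R) (w1 : R) : Prop := {
  fs_r : 0 < rho <= r;
  fs_e : 0 < e;
  fs_p : e <= p;
  fs_p' : p + e <= rho;
  fs_m : 0 < m;
  fs_field : forall x y, box r x y -> vdom W (x, y) /\ m <= sgn b * sgn o * vX W x y <= Mx;
  fs_fi : first_integral (slope W) H E (- rho) rho r C;
  fs_X : lipschitz_box (vX W) r C;
  fs_Y : lipschitz_box (vY W) r C;
  fs_valley : valley (fun x => sgn b * H (p + x) 0) w 1 (e / 2);
  fs_w : is_derive w 0 w1;
  fs_rate : forall x, Rabs x < e / 2 -> x * w x = sgn b * (- slope W (p + x) 0 * E (p + x)) }.

Arguments fs_rate {W b o p e r rho m Mx C H E w w1} _ x _.

Lemma fold_half_oval (W : vector_field) (b o : bool) (p e r rho m Mx C : R)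
    (H : R -> R -> R) (E w : R -> R) (w1 s x1 x2 m' Mx' C' : R) :
  fold_side W b o p e r rho m Mx C H E w w1 ->
  - (e / 4) < x1 -> x1 < s -> s < x2 -> x2 < e / 4 ->
  sgn b * H (p + (x1 - s)) 0 = sgn b * H (p + (x2 - s)) 0 ->
  0 < m' <= m -> Mx <= Mx' -> C <= C' -> C' * (x2 - x1) < r / 4 ->
  half_oval (shift_field W s) b o (p - e / 4) (p + x1) (p + s) (p + x2) (p + e / 4) r m' Mx' C'
    (fun x y => H (x - s) y) (fun x => E (x - s)).
Proof.
  intros [Hr He Hp Hp' Hm HF HI HX HY Hv Hw Hrate] X1 X1s Xs2 X2 HH Hm' HMx HC' HC'2.
  assert (Hbox : forall x y, p - e / 4 < x < p + e / 4 -> Rabs y < r -> box r (x - s) y).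
  { intros x y Hx Hy. split; [apply Rabs_le|]; lra. }
  assert (HC0 : 0 < C) by apply HI.
  (* The rate identity, divided by E and w, shows that the slope changes sign at p exactly as - x
     does. *)
  assert (Hsgn : forall x, Rabs x < e / 2 -> exists q, 0 < q /\ sgn b * slope W (p + x) 0 * q = - x).
  { intros x Hx. assert (Hx' := Rabs_def2 _ _ Hx). destruct (proj2 Hv x Hx) as [_ Hwx].
    destruct HI as (_ & _ & _ & _ & _ & _ & HE). destruct (HE (p + x) ltac:(lra)) as [Ep _].
    exists (E (p + x) / w x). split; [apply Rdiv_lt_0_compat; auto|].
    specialize (Hrate x Hx).
    replace (sgn b * slope W (p + x) 0 * (E (p + x) / w x)) with (- (sgn b * (- slope W (p + x) 0 * E (p + x))) / w x) by (field; lra).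
    rewrite <- Hrate. field. lra. }
  split; [lra|]. split; [lra|]. split; [lra|]. split; [lra|]. split; [lra|].
  split; [replace (p + x2 - (p + x1)) with (x2 - x1) by ring; exact HC'2|].
  split; [|split; [|split; [|split; [|split]]]].
  - intros x y Hx Hy. destruct (HF _ _ (Hbox x y Hx Hy)) as [F1 F2]. split; [exact F1|]. simpl. lra.
  - intros x y x' y' Hx Hx' Hy Hy'. simpl.
    specialize (HX _ _ _ _ (Hbox x y Hx Hy) (Hbox x' y' Hx' Hy')).
    specialize (HY _ _ _ _ (Hbox x y Hx Hy) (Hbox x' y' Hx' Hy')).
    replace (x - s - (x' - s)) with (x - x') in * by ring.
    pose proof (Rabs_pos (x - x')). pose proof (Rabs_pos (y - y')).
    assert (C * (Rabs (x - x') + Rabs (y - y')) <= C' * (Rabs (x - x') + Rabs (y - y'))) by (apply Rmult_le_compat_r; lra).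
    lra.
  - apply first_integral_mono with (1 := first_integral_shift (slope W) H E (- rho) rho r C s HI); lra.
  - intros x Hx. destruct (Hsgn (x - s - p)) as (q & Hq & Eq); [apply Rabs_def1; lra|].
    replace (p + (x - s - p)) with (x - s) in Eq by ring.
    change (slope (shift_field W s) x 0) with (slope W (x - s) 0).
    apply Rmult_lt_reg_r with q; auto. lra.
  - intros x Hx. destruct (Hsgn (x - s - p)) as (q & Hq & Eq); [apply Rabs_def1; lra|].
    replace (p + (x - s - p)) with (x - s) in Eq by ring.
    change (slope (shift_field W s) x 0) with (slope W (x - s) 0).
    apply Rmult_lt_reg_r with q; auto. lra.
  - replace (p + x1 - s) with (p + (x1 - s)) by ring. replace (p + x2 - s) with (p + (x2 - s)) by ring.
    apply Rmult_eq_reg_l with (sgn b); auto. unfold sgn. destruct b; lra.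
Qed.

Lemma fold_end_rate (W : vector_field) (b o : bool) (p e r rho m Mx C : R)
    (H : R -> R -> R) (E w : R -> R) (w1 s x : R) :
  fold_side W b o p e r rho m Mx C H E w w1 -> Rabs (x - s) < e / 2 ->
  Rabs (- slope (shift_field W s) (p + x) 0 * E (p + x - s)) = Rabs ((x - s) * w (x - s)).
Proof.
  intros HS Hx. rewrite (fs_rate HS _ Hx).
  change (slope (shift_field W s) (p + x) 0) with (slope W (p + x - s) 0).
  replace (p + x - s) with (p + (x - s)) by ring. rewrite (Rabs_mult (sgn b)).
  replace (Rabs (sgn b)) with 1; [ring|].
  unfold sgn. destruct b; [rewrite Rabs_R1|rewrite Rabs_left by lra]; lra.
Qed.

Lemma shift_field_0 (W : vector_field) : shift_field W 0 = W.
Proof.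
  destruct W as [dm X Y]. unfold shift_field. simpl. f_equal.
  - apply functional_extensionality. intros [x y]. simpl. rewrite Rminus_0_r. reflexivity.
  - apply functional_extensionality. intros x. rewrite Rminus_0_r. reflexivity.
  - apply functional_extensionality. intros x. rewrite Rminus_0_r. reflexivity.
Qed.

Lemma fold_cycle (W : bool -> vector_field) (o : bool) (p e r : R) (rho m Mx C : bool -> R)
    (H : bool -> R -> R -> R) (E w : bool -> R -> R) (w1 : bool -> R) :
  (forall b, fold_side (W b) b o p e r (rho b) (m b) (Mx b) (C b) (H b) (E b) (w b) (w1 b)) ->
  let A := - (2 / 3) * (w1 true / w true 0 - w1 false / w false 0) in
  exists s0, 0 < s0 /\ forall s, 0 < Rabs s < s0 -> s * A < 0 ->
    let S := FilippovSystem (shift_field (W true) s) (W false) in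
    exists G, (exists x, Rabs (x - p) < e / 2 /\ G (x, 0)) /\
      (forall q, G q -> Rabs (fst q - p) < e / 2 /\ Rabs (snd q) < r) /\
      limit_cycle S G /\ hyperbolic S G /\ surrounds_single_sliding_segment S G /\
      (sgn o * A < 0 -> asymptotically_stable S G) /\ (0 < sgn o * A -> repelling S G).
Proof.
  intros HS A.
  destruct (HS true) as [Hrt He _ _ Hmt _ HIt _ _ Hvt Hwt _]. destruct (HS false) as [_ _ _ _ Hmf _ HIf _ _ Hvf Hwf _].
  assert (HCt : 0 < C true) by apply HIt. assert (HCf : 0 < C false) by apply HIf.
  set (C' := Rmax (C true) (C false)). set (m' := Rmin (m true) (m false)). set (Mx' := Rmax (Mx true) (Mx false)).
  assert (Cb : forall b, C b <= C') by (intros []; [apply Rmax_l|apply Rmax_r]).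
  assert (mb : forall b, 0 < m' <= m b) by (intros b; split; [apply Rmin_pos; auto|destruct b; [apply Rmin_l|apply Rmin_r]]).
  assert (Mb : forall b, Mx b <= Mx') by (intros []; [apply Rmax_l|apply Rmax_r]).
  assert (HC' : 0 < C') by (apply Rlt_le_trans with (C true); auto).
  (* The first bound keeps the oval within a quarter of the spacing of the zeros, inside the
     valleys; the second makes it flat enough for the condition C' (x2 - x1) < r / 4. *)
  set (eps := Rmin (e / 4) (r / (8 * C'))).
  assert (Hr8 : 0 < r / (8 * C')) by (apply Rdiv_lt_0_compat; lra).
  assert (Heps : 0 < eps) by (apply Rmin_pos; lra).
  assert (Heps1 : eps <= e / 4) by apply Rmin_l.
  assert (Heps2 : C' * (2 * eps) <= r / 4).
  { assert (T : eps <= r / (8 * C')) by apply Rmin_r. apply Rmult_le_compat_l with (r := C' * 2) in T; [|lra].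
    replace (C' * 2 * (r / (8 * C'))) with (r / 4) in T by (field; lra). lra. }
  destruct (pseudo_hopf _ _ _ _ (e / 2) _ _ ltac:(lra) Hvt Hvf Hwt Hwf eps Heps) as (s0 & Hs0 & HP). fold A in HP.
  exists s0. split; auto. intros s Hs HsA S.
  destruct (HP s Hs HsA) as (x1 & x2 & X1 & X2 & Xs & Hu & Hv & HD).
  assert (HC2 : C' * (x2 - x1) < r / 4).
  { apply Rlt_le_trans with (2 := Heps2). apply Rmult_lt_compat_l; lra. }
  set (sh := fun b : bool => if b then s else 0).
  assert (Hhalf : forall b, half_field S b = shift_field (W b) (sh b)).
  { intros []; simpl; [reflexivity|symmetry; apply shift_field_0]. }
  assert (Hsh : forall b, x1 < sh b < x2) by (intros []; simpl; lra).
  set (H' := fun b x y => H b (x - sh b) y). set (E' := fun b x => E b (x - sh b)).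
  assert (HO : forall b, half_oval (half_field S b) b o (p - e / 4) (p + x1) (p + sh b) (p + x2) (p + e / 4) r m' Mx' C' (H' b) (E' b)).
  { intros b. rewrite Hhalf. specialize (Hsh b).
    apply (fold_half_oval (W b) b o p e r (rho b) (m b) (Mx b) (C b) (H b) (E b) (w b) (w1 b)); auto; try lra.
    destruct b; simpl; [exact Hu|rewrite !Rminus_0_r; exact Hv]. }
  assert (Hrate : forall b x, Rabs (x - sh b) < e / 2 -> end_rate S E' b (p + x) = Rabs ((x - sh b) * w b (x - sh b))).
  { intros b x Hx. unfold end_rate. rewrite Hhalf.
    apply (fold_end_rate (W b) b o p e r (rho b) (m b) (Mx b) (C b) (H b) (E b) (w b) (w1 b)); auto. }
  assert (Hpos : forall b x, sh b < x < e / 4 -> 0 < (x - sh b) * w b (x - sh b) /\ Rabs (x - sh b) < e / 2).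
  { intros b x Hx. specialize (Hsh b). assert (Ha : Rabs (x - sh b) < e / 2) by (apply Rabs_def1; lra). split; auto.
    destruct (HS b) as [_ _ _ _ _ _ _ _ _ HV _ _]. apply Rmult_lt_0_compat; [lra|apply (proj2 HV); auto]. }
  assert (Hneg : forall b x, - (e / 4) < x < sh b -> (x - sh b) * w b (x - sh b) < 0 /\ Rabs (x - sh b) < e / 2).
  { intros b x Hx. specialize (Hsh b). assert (Ha : Rabs (x - sh b) < e / 2) by (apply Rabs_def1; lra). split; auto.
    destruct (HS b) as [_ _ _ _ _ _ _ _ _ HV _ _]. apply Rmult_neg_pos; [lra|apply (proj2 HV); auto]. }
  assert (R2 : forall b, end_rate S E' b (p + x2) = (x2 - sh b) * w b (x2 - sh b)).
  { intros b. specialize (Hsh b). destruct (Hpos b x2) as [P1 P2]; [lra|]. rewrite Hrate by auto. apply Rabs_right; lra. }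
  assert (R1 : forall b, end_rate S E' b (p + x1) = - ((x1 - sh b) * w b (x1 - sh b))).
  { intros b. specialize (Hsh b). destruct (Hneg b x1) as [P1 P2]; [lra|]. rewrite Hrate by auto. apply Rabs_left; lra. }
  (* Up to the orientation sign, Q is the determinant D of end rates in [oval_cycle]. As A Q > 0,
     the sign of sgn o * A alone decides the stability. *)
  set (Q := (x2 - s) * w true (x2 - s) * (x1 * w false x1) - x2 * w false x2 * ((x1 - s) * w true (x1 - s))) in HD.
  assert (EQ : end_rate S E' (negb o) (p + x2) * end_rate S E' o (p + x1) -
    end_rate S E' o (p + x2) * end_rate S E' (negb o) (p + x1) = sgn o * Q).
  { unfold Q. rewrite !R1, !R2. destruct o; simpl; rewrite !Rminus_0_r; ring. }
  assert (Hso : sgn o * sgn o = 1) by (destruct o; simpl; ring).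
  assert (HDsgn : 0 < (sgn o * A) * (sgn o * Q)).
  { replace (sgn o * A * (sgn o * Q)) with ((sgn o * sgn o) * (A * Q)) by ring. rewrite Hso. lra. }
  destruct (oval_cycle S o (p - e / 4) (p + x1) (p + x2) (p + e / 4) r m' Mx' C' (fun b => p + sh b) H' E' HO)
    as (G & G1 & G2 & G3 & G4 & G5 & G6 & G7).
  { simpl. intros Eq. assert (s = 0) by lra. subst s. rewrite Rabs_R0 in Hs. lra. }
  { rewrite EQ. intros Eq. rewrite Eq in HDsgn. lra. }
  rewrite EQ in G6, G7.
  exists G. split; [exists (p + x1); split; auto; apply Rabs_def1; lra|].
  split; [|split; [auto|split; [auto|split; [auto|split]]]].
  - intros q Hq. destruct (G2 q Hq) as [Q1 Q2]. split; [apply Rabs_def1; lra|]. lra.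
  - intros K. apply G6. apply Rnot_le_lt. intros K2. assert (T := Rmult_le_compat_neg_l (sgn o * A) 0 (sgn o * Q) ltac:(lra) K2). lra.
  - intros K. apply G7. apply (pos_of_mul (sgn o * A)); auto.
Qed.

Lemma finite_small (n : nat) (P : nat -> R -> Prop) :
  (forall i, (i < n)%nat -> exists d, 0 < d /\ forall s, 0 < Rabs s < d -> P i s) ->
  exists d, 0 < d /\ forall i s, (i < n)%nat -> 0 < Rabs s < d -> P i s.
Proof.
  induction n as [|n IH]; intros H; [exists 1; split; [lra|intros; lia]|].
  destruct IH as [d1 [Hd1 H1]]; [intros i Hi; apply H; lia|].
  destruct (H n ltac:(lia)) as [d2 [Hd2 H2]].
  exists (Rmin d1 d2). split; [apply Rmin_pos; auto|]. intros i s Hi Hs.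
  assert (Rmin d1 d2 <= d1) by apply Rmin_l. assert (Rmin d1 d2 <= d2) by apply Rmin_r.
  destruct (Nat.eq_dec i n) as [->|E]; [apply H2|apply H1; [lia|]]; lra.
Qed.

Lemma locally_box (U : R * R -> Prop) : locally ((0, 0) : R * R) U ->
  exists t, 0 < t /\ forall q, Rabs (fst q) < t -> Rabs (snd q) < t -> U q.
Proof.
  intros [t Ht]. exists t. split; [apply cond_pos|]. intros [x y] Hx Hy. apply Ht.
  split; unfold ball; simpl; unfold AbsRing_ball, abs, minus, plus, opp; simpl; rewrite Ropp_0, Rplus_0_r; assumption.
Qed.

Lemma sign_sgn (x : R) : x <> 0 -> exists o, sign x = sgn o.
Proof.
  intros H. destruct (sign_of_nonzero x H) as [-> | ->]; [exists true|exists false]; reflexivity.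
Qed.

Lemma sign_opp_mult (b c : R) : c <> 0 -> sign b = - sign c -> 0 < Rabs b /\ b * c < 0.
Proof.
  intros Hc Hs. destruct (Rtotal_order b 0) as [K|[K|K]].
  - rewrite (sign_eq_m1 b K) in Hs. rewrite Rabs_left by auto. split; [lra|].
    destruct (Rdichotomy _ _ Hc) as [K2|K2]; [rewrite (sign_eq_m1 c K2) in Hs; lra|]. apply Rmult_neg_pos; auto.
  - subst b. rewrite sign_0 in Hs. destruct (sign_of_nonzero c Hc); lra.
  - rewrite (sign_eq_1 b K) in Hs. rewrite Rabs_right by lra. split; [lra|].
    destruct (Rdichotomy _ _ Hc) as [K2|K2]; [|rewrite (sign_eq_1 c K2) in Hs; lra]. apply Rmult_pos_neg; auto.
Qed.

Theorem theorem1 (k : nat) (hk : (1 <= k)%nat) (Z : filippov_system) (hZ : analytic_system Z)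
  (hmono : monodromic_tangential Z k k)
  (V : nat -> R) (hV : lyapunov_coefficients Z V) (hV2 : V 2%nat <> 0)
  (lambda : R) (hlambda : 0 < lambda)
  (U : R * R -> Prop) (hU : locally ((0, 0) : R * R) U) :
  exists (cp cm : nat -> R) (I : R -> Prop),
    poly_norm (2 * k - 2) cp < lambda /\
    poly_norm (2 * k - 2) cm < lambda /\
    locally 0 I /\
    forall b : R, I b -> sign b = - sign (delta_sign Z * V 2%nat) ->
      let Zb := perturbed_system Z (poly_eval (2 * k - 2) cp) (poly_eval (2 * k - 2) cm) b in
      exists G : nat -> R * R -> Prop,
        (forall i j : nat, (i < k)%nat -> (j < k)%nat -> i <> j -> ~ same_set (G i) (G j)) /\
        forall i : nat, (i < k)%nat ->
          limit_cycle Zb (G i) /\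
          hyperbolic Zb (G i) /\
          (forall p : R * R, G i p -> U p) /\
          surrounds_single_sliding_segment Zb (G i) /\
          (V 2%nat < 0 -> asymptotically_stable Zb (G i)) /\
          (0 < V 2%nat -> repelling Zb (G i)).
Proof.
  destruct hmono as (_ & _ & (Htp & Htm) & (Hsp & Hsm) & HXX). destruct hZ as [HZp HZm].
  set (Wb := half_field Z).
  assert (Hex : forall b : bool, exists T : (R -> R -> R) * (R * R * R * R * R) * ((nat -> R) * (nat -> R)) * (R * R),
     let '(Fy, (r, K, m, Mx, M), (a, d), (rho, N)) := T in
     tangent_field (Wb b) (sgn b) (2 * k - 1) Fy r K m Mx M a d rho N).
  { intros b. destruct (tangent_field_exists (Wb b) (sgn b) k hk) as (Fy & r & K & m & Mx & M & a & d & rho & N & HT).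
    - destruct b; auto.
    - destruct b; auto.
    - unfold Wb, half_field, sgn. destruct b; lra.
    - exists (Fy, (r, K, m, Mx, M), (a, d), (rho, N)). exact HT. }
  destruct (sign_sgn (vX (Zp Z) 0 0)) as [o Ho]; [apply Htp|].
  (* Condition (C3): the two fields travel in opposite directions, and [o] is the direction of the
     upper one. *)
  assert (Hob : forall b, sign (vX (Wb b) 0 0) = sgn b * sgn o).
  { intros []; simpl; [lra|]. destruct o; simpl in Ho |- *.
    - assert (0 < vX (Zp Z) 0 0).
      { destruct (Rtotal_order (vX (Zp Z) 0 0) 0) as [L|[L|L]]; auto.
        - rewrite (sign_eq_m1 _ L) in Ho; lra.
        - rewrite L, sign_0 in Ho; lra. }
      rewrite sign_eq_m1; [ring|]. apply neg_of_prod with (vX (Zp Z) 0 0); auto.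
    - assert (vX (Zp Z) 0 0 < 0).
      { destruct (Rtotal_order (vX (Zp Z) 0 0) 0) as [L|[L|L]]; auto.
        - rewrite L, sign_0 in Ho; lra.
        - rewrite (sign_eq_1 _ L) in Ho; lra. }
      rewrite sign_eq_1; [ring|]. apply (pos_of_mul (- vX (Zp Z) 0 0)); lra. }
  destruct (Hex true) as [[[[Fyp [[[[rp Kp] mp] Mxp] Mp]] [ap dp]] [rhop Np]] HTp].
  destruct (Hex false) as [[[[Fym [[[[rm Km] mm] Mxm] Mm]] [am dm]] [rhom Nm]] HTm].
  set (bp := bending Fyp ap dp). set (bm := bending Fym am dm).
  destruct hV as (phip & phim & Hphip & Hphim & HV0 & HVs).
  assert (Hodd : Nat.Odd (2 * k - 1)) by (exists (k - 1)%nat; lia).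
  assert (Xp := half_return_expansion HTp (sgn_cases true) phip Hodd Hphip).
  assert (Xm := half_return_expansion HTm (sgn_cases false) phim Hodd Hphim).
  fold bp in Xp. fold bm in Xm.
  assert (HV2 := second_coefficient V phip phim (delta_sign Z) _ _ HV0 HVs Xp Xm).
  unfold delta_sign in HV2 |- *. rewrite Ho in HV2 |- *.
  set (nu := 2 / (INR (2 * k - 1) + 2)) in *.
  assert (Hnu : 0 < nu) by (apply Rdiv_lt_0_compat; [lra|]; pose proof (pos_INR (2 * k - 1)); lra).
  (* For the exponent 2k - 1 the factor is nu = 2 / (2k + 1), for simple zeros it is 2 / 3. Only the
     difference of the bendings matters, up to a positive factor. *)
  assert (HdV : sgn o * V 2%nat = - nu * (bp - bm)).
  { rewrite HV2. replace (sgn o * (sgn o * (- nu * bp - - nu * bm))) with ((sgn o * sgn o) * (- nu * (bp - bm))) by ring.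
    rewrite sgn_sqr. ring. }
  assert (Hbb : bp - bm <> 0).
  { intros E. apply hV2. rewrite HV2. replace (- nu * bp - - nu * bm) with (- nu * (bp - bm)) by ring. rewrite E. ring. }
  destruct (locally_box U hU) as (R0 & HR0 & HU).
  set (rr := Rmin (Rmin (Rmin rp rm) (Rmin 1 R0)) (Rmin (/ (4 * (Kp + 1))) (/ (4 * (Km + 1))))).
  assert (HKp := tf_K HTp). assert (HKm := tf_K HTm).
  assert (Hrp := tf_r HTp). assert (Hrm := tf_r HTm).
  assert (Hrr : 0 < rr).
  { unfold rr. repeat apply Rmin_pos; try lra; apply Rinv_0_lt_compat; lra. }
  assert (r1 : rr <= rp) by rmin.
  assert (r2 : rr <= rm) by rmin.
  assert (r3 : rr <= 1) by rmin.
  assert (r4 : rr <= R0) by rmin.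
  assert (Hinv : forall K, 0 <= K -> rr <= / (4 * (K + 1)) -> 4 * ((K + 1) * rr) <= 1).
  { intros K HK T. apply Rmult_le_compat_l with (r := 4 * (K + 1)) in T; [|lra]. rewrite Rinv_r in T; lra. }
  assert (r5 := Hinv Kp HKp ltac:(unfold rr; apply Rle_trans with (1 := Rmin_r _ _), Rmin_l)).
  assert (r6 := Hinv Km HKm ltac:(unfold rr; apply Rle_trans with (1 := Rmin_r _ _), Rmin_r)).
  destruct (unfolding HTp k rr hk eq_refl Hrr r1 r3 r5) as (rhp & Hrhp & Up).
  destruct (unfolding HTm k rr hk eq_refl Hrr r2 r3 r6) as (rhm & Hrhm & Um).
  fold bp in Up. fold bm in Um.
  destruct (poly_small (2 * k - 2) lambda hlambda) as (tau & Htau & HP).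
  assert (Hab := Rabs_pos_lt _ Hbb).
  (* Each field is approximated up to a quarter of |bp - bm|, so their difference keeps at least
     half of it and hence its sign. *)
  set (eta := Rmin tau (Rabs (bp - bm) / 4)).
  assert (Heta : 0 < eta) by (apply Rmin_pos; lra).
  assert (eta1 : eta <= tau) by apply Rmin_l. assert (eta2 : eta <= Rabs (bp - bm) / 4) by apply Rmin_r.
  destruct (Up eta Heta) as (ep & Hep & Up'). destruct (Um eta Heta) as (em & Hem & Um').
  (* The same e for both fields: tangencies coincide before the shift, and the cofactor terms
     cancel. *)
  set (e := Rmin ep em / 2). assert (He0 : 0 < Rmin ep em) by (apply Rmin_pos; auto).
  assert (Hmp : Rmin ep em <= ep) by apply Rmin_l. assert (Hmm : Rmin ep em <= em) by apply Rmin_r.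
  destruct (Up' e ltac:(unfold e; lra)) as (cp & Hcp & Fp). destruct (Um' e ltac:(unfold e; lra)) as (cm & Hcm & Fm).
  assert (He : 0 < e) by (unfold e; lra).
  set (S := fun b => perturbed_system Z (poly_eval (2 * k - 2) cp) (poly_eval (2 * k - 2) cm) b).
  assert (Hcyc : forall i, (i < k)%nat -> exists s0, 0 < s0 /\ forall s, 0 < Rabs s < s0 -> s * (sgn o * V 2%nat) < 0 ->
    exists G, (exists x, Rabs (x - INR (2 * i + 1) * e) < e / 2 /\ G (x, 0)) /\
      (forall q, G q -> Rabs (fst q - INR (2 * i + 1) * e) < e / 2 /\ U q) /\
      limit_cycle (S s) G /\ hyperbolic (S s) G /\ surrounds_single_sliding_segment (S s) G /\
      (V 2%nat < 0 -> asymptotically_stable (S s) G) /\ (0 < V 2%nat -> repelling (S s) G)).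
  { intros i Hi. set (p := INR (2 * i + 1) * e).
    destruct (Fp i Hi) as (Hp & Ep & wp & w1p & Cp & IP & LXp & LYp & VP & Dp & Bp & Ratep & Posp).
    destruct (Fm i Hi) as (Hm & Em & wm & w1m & Cm & IM & LXm & LYm & VM & Dm & Bm & Ratem & Posm).
    assert (Hpe : e <= p).
    { unfold p. rewrite <- (Rmult_1_l e) at 1. apply Rmult_le_compat_r; [lra|].
      rewrite plus_INR. simpl (INR 1). pose proof (pos_INR (2 * i)). lra. }
    set (W := fun b : bool => if b then perturb_field (Zp Z) (poly_eval (2 * k - 2) cp) else perturb_field (Zm Z) (poly_eval (2 * k - 2) cm)).
    destruct (fold_cycle W o p e rr (fun b => if b then rhp else rhm) (fun b => if b then mp else mm)
      (fun b => if b then Mxp else Mxm) (fun b => if b then Cp else Cm) (fun b => if b then Hp else Hm)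
      (fun b => if b then Ep else Em) (fun b => if b then wp else wm) (fun b => if b then w1p else w1m)) as (s0 & Hs0 & HF).
    { intros []; constructor; auto.
      - apply (tf_m HTp).
      - intros x y [Hx Hy]. assert (Hb : box rp x y) by (split; lra).
        split; [apply (tf_dom HTp); auto|].
        assert (T := tf_X HTp x y Hb). rewrite (Hob true) in T.
        rewrite (Rmult_comm (sgn true * sgn o)). exact T.
      - apply (tf_m HTm).
      - intros x y [Hx Hy]. assert (Hb : box rm x y) by (split; lra).
        split; [apply (tf_dom HTm); auto|].
        assert (T := tf_X HTm x y Hb). rewrite (Hob false) in T.
        rewrite (Rmult_comm (sgn false * sgn o)). exact T. }
    set (A := - (2 / 3) * (w1p / wp 0 - w1m / wm 0)) in HF.
    (* The quadratic coefficient at the simple tangency has the sign of delta V_2, so the sign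
       prescribed for b is the one needed by [fold_cycle], and sgn o * A has the sign of V_2. *)
    assert (HA : 0 < A * (sgn o * V 2%nat)).
    { rewrite HdV. set (D := w1p / wp 0 - w1m / wm 0) in *.
      assert (HD : 0 < D * (bp - bm)).
      { apply Rabs_le_between in Bp. apply Rabs_le_between in Bm.
        destruct (Rdichotomy _ _ Hbb) as [L|L].
        - rewrite (Rabs_left _ L) in eta2, Hab. apply Rmult_neg_neg; unfold D; lra.
        - rewrite (Rabs_right (bp - bm)) in eta2, Hab by lra. apply Rmult_lt_0_compat; unfold D; lra. }
      unfold A. replace (- (2 / 3) * D * (- nu * (bp - bm))) with (2 / 3 * nu * (D * (bp - bm))) by ring.
      apply Rmult_lt_0_compat; [|auto]. lra. }
    exists s0. split; auto. intros s Hs HsV.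
    assert (HsA : s * A < 0).
    { apply Rnot_le_lt. intros L.
      assert (0 <= (s * A) * (sgn o * V 2%nat) * (sgn o * V 2%nat)).
      { replace (s * A * (sgn o * V 2%nat) * (sgn o * V 2%nat)) with (s * A * (sgn o * V 2%nat) ^ 2) by ring.
        apply Rmult_le_pos; auto. apply pow2_ge_0. }
      assert (T := Rmult_lt_0_compat _ _ HA (Ropp_0_gt_lt_contravar _ HsV)). lra. }
    destruct (HF s Hs HsA) as (G & G1 & G2 & G3 & G4 & G5 & G6 & G7).
    assert (HAV : 0 < (sgn o * A) * V 2%nat) by lra.
    exists G. split; [exact G1|]. split; [|split; [exact G3|split; [exact G4|split; [exact G5|split]]]].
    - intros q Hq. destruct (G2 q Hq) as [Q1 Q2]. split; [exact Q1|].
      apply HU; [|lra]. apply Rabs_def2 in Q1. apply Rabs_def1; fold p in Posp; lra.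
    - intros L. apply G6. apply neg_of_prod with (- V 2%nat); lra.
    - intros L. apply G7. apply (pos_of_mul (V 2%nat)); lra. }
  destruct (finite_small k _ Hcyc) as (s0 & Hs0 & HF).
  exists cp, cm, (fun b => Rabs b < s0).
  split; [apply HP; intros j; specialize (Hcp j); lra|]. split; [apply HP; intros j; specialize (Hcm j); lra|].
  split.
  { exists (mkposreal s0 Hs0). intros x Hx. unfold ball in Hx; simpl in Hx.
    unfold AbsRing_ball, abs, minus, plus, opp in Hx; simpl in Hx. rewrite Ropp_0, Rplus_0_r in Hx. exact Hx. }
  intros b Hb Hsb. fold (S b). set (Zb := S b) in *.
  assert (HdV0 : sgn o * V 2%nat <> 0) by (apply Rmult_integral_contrapositive_currified; auto; destruct o; simpl; lra).
  destruct (sign_opp_mult b _ HdV0 Hsb) as [Hb0 HbV].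
  destruct (functional_choice (fun (i : nat) (G : R * R -> Prop) => (i < k)%nat ->
      (exists x, Rabs (x - INR (2 * i + 1) * e) < e / 2 /\ G (x, 0)) /\
      (forall q, G q -> Rabs (fst q - INR (2 * i + 1) * e) < e / 2 /\ U q) /\
      limit_cycle Zb G /\ hyperbolic Zb G /\ surrounds_single_sliding_segment Zb G /\
      (V 2%nat < 0 -> asymptotically_stable Zb G) /\ (0 < V 2%nat -> repelling Zb G))) as [G HG].
  { intros i. destruct (classic (i < k)%nat) as [Hi|Hi].
    - destruct (HF i b Hi (conj Hb0 Hb) HbV) as [G HG]. exists G. intros _. exact HG.
    - exists (fun _ => False). intros C; contradiction. }
  exists G. split.
  (* The cycles are distinct because each meets the axis and stays within e / 2 of its own abscissa
     (2i + 1) e, and these abscissas are at least e apart. *)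
  - intros i j Hi Hj Hij Hsame. destruct (HG i Hi) as ((x & Hx & Gx) & _).
    apply (Hsame (x, 0)) in Gx. destruct (HG j Hj) as (_ & Hloc & _). destruct (Hloc _ Gx) as [Hx' _]. cbn [fst] in Hx'.
    apply Rabs_def2 in Hx. apply Rabs_def2 in Hx'.
    destruct (Nat.lt_total i j) as [L|[L|L]]; [|contradiction|].
    + assert (T : INR (2 * i + 1) + 1 <= INR (2 * j + 1)) by (rewrite <- S_INR; apply le_INR; lia).
      apply Rmult_le_compat_r with (r := e) in T; lra.
    + assert (T : INR (2 * j + 1) + 1 <= INR (2 * i + 1)) by (rewrite <- S_INR; apply le_INR; lia).
      apply Rmult_le_compat_r with (r := e) in T; lra.
  - intros i Hi. destruct (HG i Hi) as (_ & A2 & A3 & A4 & A5 & A6 & A7).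
    split; [exact A3|]. split; [exact A4|]. split; [intros q Hq; apply A2; auto|]. auto.
Qed.
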